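(* Let $Q\in\Gamma$ be a net of quadrics and let $$f(x,y,z)=(x,y,z,f_1(x,y,z),f_2(x,y,z),f_3(x,y,z))$$ be a parametrisation of $M^3_{\mathrm{reg}}\subset\mathbb{R}^6$ whose second fundamental form at the origin is $Q$. Then, for each possible $\mathcal{G}$-orbit of $Q$, the generic curvature locus of $M^3_{\mathrm{reg}}$ at the origin is given by the following table (an orbit appearing in two rows has both types of locus as generic curvature loci): - Roman Steiner surface: $A,\ B,\ C,\ D_a,\ D_a^{*},\ D_c^{*},\ E_a,\ E_a^{*},\ F_a$; - Cross-cap surface: $A,\ B_a,\ B_a^{*},\ D_a,\ D_a^{*},\ D_b,\ D_b^{*},\ D_c,\ D_c^{*},\ E_b,\ E_b^{*},\ F_a,\ F_b$; - Type 5 surface: $F_a^{*},\ F_b^{*},\ G,\ G^{*}$; - Type 6 surface: $H$; - Cone: $I$; - Ellipsoid: $I^{*}$.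
   Context: Nets and orbits. A net of quadrics is the linear system generated by three real quadratic forms $q_1,q_2,q_3$ in $x,y,z$; it is identified with the quadratic map $Q=(q_1,q_2,q_3):\mathbb{R}^3\to\mathbb{R}^3$, and $\Gamma$ is the set of all nets. $\mathcal{G}=GL(3)\times GL(3)$ acts by linear changes of coordinates in source and target. The orbits (those with moduli being families of orbits) have the following normal forms. Types $A,B,C$: $\langle 2xz+y^2,\ 2yz,\ -x^2-2gy^2+cz^2+2gxz\rangle$ with real parameters $g,c$, where $A_b$: $c<-9g^2$; $B_c$: $c=-9g^2,\ g>0$; $B_a$: $c=-9g^2,\ g<0$; $A_c$: $-9g^2<c<0,\ g>0$; $A_a$: $-9g^2<c<0,\ g<0$; $B_a^{*}$: $c=0,\ g>0$; $B_c^{*}$: $c=0,\ g<0$; $A_d$: $c>0$; $C$: $c=g=0$. ''$A$'' (resp. ''$B$'') without subscript refers to all the subcases $A_a,A_b,A_c,A_d$ (resp. $B_a,B_c,B_a^{*},B_c^{*}$). Other types (where two names are given, the upper sign is for the first and the lower sign for the second): $D_a$: $\langle x^2,y^2,z^2+2xy\rangle$; $D_b,D_c$: $\langle x^2-y^2,2xy,x^2\pm z^2\rangle$; $D_a^{*}$: $\langle 2xz,2yz,z^2+2xy\rangle$; $D_b^{*},D_c^{*}$: $\langle 2xz,2yz,x^2+y^2\mp z^2\rangle$; $E_a,E_b$: $\langle x^2\pm y^2,2xy,z^2\rangle$; $E_a^{*},E_b^{*}$: $\langle x^2\mp y^2,2xz,2yz\rangle$; $F_a,F_b$: $\langle x^2\pm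 y^2,2xy,2yz\rangle$; $F_a^{*},F_b^{*}$: $\langle x^2\mp y^2,2xz,z^2\rangle$; $G$: $\langle x^2,y^2,2yz\rangle$; $G^{*}$: $\langle 2xy,2xz,z^2\rangle$; $H$: $\langle x^2,2xy,y^2+2xz\rangle$; $I$: $\langle x^2,2xy,y^2\rangle$; $I^{*}$: $\langle 2xz,2yz,z^2\rangle$. Curvature locus. For $f$ in Monge form ($f_i$ with zero constant and linear parts) with second fundamental form $Q$ at the origin, the curvature locus at the origin is the image of the unit sphere $\mathbb{S}^2\subset\mathbb{R}^3$ under $u\mapsto II(u,u)=Q(u)$. Generic curvature locus. The topological type of the curvature locus is not constant on a $\mathcal{G}$-orbit, since $\mathcal{G}$ does not preserve the sphere. Composing with a linear change of coordinates in the source amounts to replacing $x^2+y^2+z^2$ by another positive definite quadratic form $p$, i.e. to considering $Q$ restricted to $\{p=1\}$. A type of locus is a generic curvature locus of an orbit (or family of orbits) if it is the type obtained for a generic choice in it, i.e. if it occurs for all members of a non-empty open subset of the orbit (or family); equivalently, for an open set of forms $p$ (and of parameters, when the normal form has any). Types of surfaces (determined by the singularities of the parametrisation; germs up to smooth changes of coordinates in source and target; antipodal points of $\mathbb{S}^2$ have the same image and are counted once). A cross-cap has normal form $(x,y)\mapsto(x,y^2,xy)$. Roman Steiner surface: 6 cross-caps joined in pairs by 3 transversal double point curves which meet at a triple point. Cross-cap surface: 2 cross-caps joined by a transversal double point curve. Type 5 surface: 2 cross-caps joined by a transversal double point curve, one of them lying on a tangent double point curve with non-degenerate tangency (the tangent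 sheets have different curvature) whose two end points are non-finitely determined singularities. Type 6 surface: no cross-caps, and a tangent double point curve with degenerate tangency (the tangent sheets have the same curvature) whose two end points are non-finitely determined singularities. Cone: a truncated (compact) cone, with a curve of singular points corresponding to the base and a singular point corresponding to the vertex. Ellipsoid: an ellipsoid, with a curve of non-finitely determined singular points of the parametrisation.
   Formalization: The table is proved exhaustive among the six types except for the cross-cap surface with B_c, B_c^* and C: by the stated definition it is also generic there (for C, e.g. p=10x²+y²+z²+2xy+2xz), so these three pairs are excepted from the converse. *)

(* Defs.v *)
From mathcomp Require Import all_boot all_order all_algebra.
From mathcomp Require Import all_classical all_reals topology normedtype derive.

Set Implicit Arguments.
Unset Strict Implicit.
Unset Printing Implicit Defensive.

Import Order.TTheory GRing.Theory Num.Theory.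
Import numFieldNormedType.Exports.

Local Open Scope classical_set_scope.
Local Open Scope ring_scope.

Definition row3 (R : realType) (a b c : R) : 'rV[R]_3 :=
  \row_(i < 3) [:: a; b; c]`_i.

Definition dot (R : realType) n (u v : 'rV[R]_n) : R := \sum_i u 0 i * v 0 i.

Definition sphere (R : realType) : set 'rV[R]_3 := [set u | dot u u = 1].

Section SmoothGerms.
Context {R : realType}.

Definition iterD m n (vs : seq 'rV[R]_m.+1) (f : 'rV[R]_m.+1 -> 'rV[R]_n.+1) :
    'rV[R]_m.+1 -> 'rV[R]_n.+1 :=
  foldr (fun v h => 'D_v h) f vs.

(* f is of class C^infinity on some neighbourhood of x *)
Definition smooth_near m n (f : 'rV[R]_m.+1 -> 'rV[R]_n.+1) (x : 'rV[R]_m.+1) :=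
  \forall y \near x, forall vs : seq 'rV[R]_m.+1,
    {for y, continuous (iterD vs f)} /\ forall v, derivable (iterD vs f) y v.

(* by the inverse function theorem, a germ of diffeomorphism at x *)
Definition local_diffeo n (f : 'rV[R]_n.+1 -> 'rV[R]_n.+1) (x : 'rV[R]_n.+1) :=
  smooth_near f x /\ forall v, v != 0 -> 'D_v f x != 0.

(* smooth changes of coordinates in source and target, for germs at 0 *)
Definition A_equivalent (g h : 'rV[R]_2 -> 'rV[R]_3) :=
  exists (phi : 'rV[R]_2 -> 'rV[R]_2) (psi : 'rV[R]_3 -> 'rV[R]_3),
    [/\ local_diffeo phi 0, phi 0 = 0, local_diffeo psi (g 0) &
        \forall x \near (0 : 'rV[R]_2), psi (g x) = h (phi x)].

Definition same_jet (k : nat) (g h : 'rV[R]_2 -> 'rV[R]_3) :=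
  forall vs : seq 'rV[R]_2, (size vs <= k)%N -> iterD vs g 0 = iterD vs h 0.

Definition finitely_determined (g : 'rV[R]_2 -> 'rV[R]_3) :=
  exists k : nat, forall h, smooth_near h 0 -> same_jet k g h -> A_equivalent g h.

Definition cross_cap_normal_form (u : 'rV[R]_2) : 'rV[R]_3 :=
  let x := u 0 0 in let y := u 0 1 in row3 x (y ^+ 2) (x * y).

End SmoothGerms.

(* F is defined on the whole of R^3, but only its restriction to the sphere
   matters; in the application F is even and factors through u ~ - u. *)

Section SphereMaps.
Context {R : realType}.
Variable F : 'rV[R]_3 -> 'rV[R]_3.

Definition pm (s : seq 'rV[R]_3) : set 'rV[R]_3 :=
  [set u | (u \in s) || (- u \in s)].

Definition non_antipodal (u v : 'rV[R]_3) := (u != v) && (u != - v).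

Definition locus : set 'rV[R]_3 := F @` @sphere R.

Definition preim (y : 'rV[R]_3) : set 'rV[R]_3 := [set u | sphere u /\ F u = y].

Definition tangent (u : 'rV[R]_3) : set 'rV[R]_3 := [set w | dot u w = 0].

(* image of the tangent plane of the sphere at u *)
Definition tangent_image (u : 'rV[R]_3) : set 'rV[R]_3 :=
  [set 'D_w F u | w in tangent u].

Definition immersive_at (u : 'rV[R]_3) :=
  forall w, tangent u w -> w != 0 -> 'D_w F u != 0.

Definition singular_at (u : 'rV[R]_3) := ~ immersive_at u.

Definition sphere_chart (phi : 'rV[R]_2 -> 'rV[R]_3) (u : 'rV[R]_3) :=
  [/\ smooth_near phi 0, phi 0 = u, \forall x \near (0 : 'rV[R]_2), sphere (phi x) &
      forall v, v != 0 -> 'D_v phi 0 != 0].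

Definition cross_cap_at (u : 'rV[R]_3) :=
  exists2 phi, sphere_chart phi u &
    A_equivalent (F \o phi) cross_cap_normal_form.

Definition finitely_determined_at (u : 'rV[R]_3) :=
  exists2 phi, sphere_chart phi u & finitely_determined (F \o phi).

Definition non_fd_singularity (u : 'rV[R]_3) :=
  singular_at u /\ ~ finitely_determined_at u.

Definition regular_point (y : 'rV[R]_3) :=
  exists2 u, preim y = pm [:: u] & immersive_at u.

Definition cross_cap_point (y : 'rV[R]_3) :=
  exists2 u, preim y = pm [:: u] & cross_cap_at u.

Definition non_fd_point (y : 'rV[R]_3) :=
  exists2 u, preim y = pm [:: u] & non_fd_singularity u.

Definition transversal_double_point (y : 'rV[R]_3) :=
  exists u v, [/\ preim y = pm [:: u; v], non_antipodal u v,
    immersive_at u, immersive_at v &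
    forall a, exists b c, [/\ tangent_image u b, tangent_image v c & a = b + c]].

Definition transversal_triple_point (y : 'rV[R]_3) :=
  exists u v w, [/\ preim y = pm [:: u; v; w],
    [&& non_antipodal u v, non_antipodal u w & non_antipodal v w],
    [/\ immersive_at u, immersive_at v & immersive_at w] &
    tangent_image u `&` tangent_image v `&` tangent_image w = [set 0]].

(* Acceleration at t = 0 of the image under F of the great circle
   t |-> cos (|w| t) u + sin (|w| t) w / |w|: that circle has velocity w and
   acceleration - |w|^2 u at u.  The component of [acceleration u w] normal to
   the sheet is the second fundamental form of the sheet on 'D_w F u. *)
Definition acceleration (u w : 'rV[R]_3) : 'rV[R]_3 :=
  'D_w ('D_w F) u - dot w w *: 'D_u F u.

(* For sheets at u and v with the same tangent plane: the second fundamental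
   forms agree. *)
Definition same_curvature (u v : 'rV[R]_3) :=
  forall w1 w2, tangent u w1 -> tangent v w2 -> 'D_w1 F u = 'D_w2 F v ->
    tangent_image u (acceleration u w1 - acceleration v w2).

Definition tangent_double_point (degenerate : Prop) (y : 'rV[R]_3) :=
  exists u v, [/\ preim y = pm [:: u; v], non_antipodal u v,
    immersive_at u /\ immersive_at v,
    tangent_image u = tangent_image v &
    degenerate <-> same_curvature u v].

(* a cross-cap lying on another, immersed, sheet *)
Definition cross_cap_on_sheet (y : 'rV[R]_3) :=
  exists u v, [/\ preim y = pm [:: u; v], non_antipodal u v,
    cross_cap_at u & immersive_at v].

Definition arc (gamma : R -> 'rV[R]_3) :=
  {within `[0, 1]%classic, continuous gamma} /\ {in `[0, 1]%R &, injective gamma}.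

Definition arc_pts (gamma : R -> 'rV[R]_3) : set 'rV[R]_3 := gamma @` `[0, 1].
Definition arc_int (gamma : R -> 'rV[R]_3) : set 'rV[R]_3 := gamma @` `]0, 1[.

(* a simple closed curve in the quotient of the sphere by u ~ - u *)
Definition closed_curve (gamma : R -> 'rV[R]_3) :=
  [/\ {within `[0, 1]%classic, continuous gamma},
      forall t, t \in `[0, 1]%R -> sphere (gamma t),
      pm [:: gamma 0] (gamma 1) &
      forall s t, s \in `[0, 1[%R -> t \in `[0, 1[%R ->
        pm [:: gamma s] (gamma t) -> s = t].

Definition closed_curve_pts (gamma : R -> 'rV[R]_3) : set 'rV[R]_3 :=
  [set u | exists2 t, t \in `[0, 1]%R & pm [:: gamma t] u].

(* The three arcs meet only at y0, so their six end points are distinct. *)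
Definition roman_steiner_surface :=
  exists (gamma : 'I_3 -> R -> 'rV[R]_3) (y0 : 'rV[R]_3),
  [/\ [/\ forall i, arc (gamma i),
          forall i, arc_int (gamma i) y0 &
          forall i j, i != j ->
            arc_pts (gamma i) `&` arc_pts (gamma j) = [set y0]],
      transversal_triple_point y0,
      forall i, cross_cap_point (gamma i 0) /\ cross_cap_point (gamma i 1),
      forall i y, arc_int (gamma i) y -> y != y0 -> transversal_double_point y &
      forall y, locus y -> (forall i, ~ arc_pts (gamma i) y) -> regular_point y].

Definition cross_cap_surface :=
  exists gamma : R -> 'rV[R]_3,
  [/\ arc gamma,
      cross_cap_point (gamma 0), cross_cap_point (gamma 1),
      forall y, arc_int gamma y -> transversal_double_point y &
      forall y, locus y -> ~ arc_pts gamma y -> regular_point y].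

(* tau is the transversal double point curve, kappa the tangent one *)
Definition type5_surface :=
  exists tau kappa : R -> 'rV[R]_3,
  [/\ [/\ arc tau, arc kappa, arc_int kappa (tau 0) &
          arc_pts tau `&` arc_pts kappa = [set tau 0]],
      cross_cap_on_sheet (tau 0) /\ cross_cap_point (tau 1),
      forall y, arc_int tau y -> transversal_double_point y,
      [/\ non_fd_point (kappa 0), non_fd_point (kappa 1) &
          forall y, arc_int kappa y -> y != tau 0 ->
            tangent_double_point False y] &
      forall y, locus y -> ~ arc_pts tau y -> ~ arc_pts kappa y ->
        regular_point y].

Definition type6_surface :=
  exists kappa : R -> 'rV[R]_3,
  [/\ arc kappa,
      forall u, sphere u -> ~ cross_cap_at u,
      non_fd_point (kappa 0) /\ non_fd_point (kappa 1),
      forall y, arc_int kappa y -> tangent_double_point True y &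
      forall y, locus y -> ~ arc_pts kappa y -> regular_point y].

(* Up to an affine change of coordinates in the target, the image is
   a^2 + b^2 = c^2, 0 <= c <= 1, with base c = 1 and vertex 0. *)
Definition cone_surface :=
  exists (A : 'M[R]_3) (y0 : 'rV[R]_3),
  let aff (y : 'rV[R]_3) := y *m A + y0 in
  let base := [set aff y | y in [set y : 'rV[R]_3 |
    y 0 0 ^+ 2 + y 0 1 ^+ 2 = 1 /\ y 0 2 = 1]] in
  [/\ A \in unitmx,
      locus = [set aff y | y in [set y : 'rV[R]_3 |
        y 0 0 ^+ 2 + y 0 1 ^+ 2 = y 0 2 ^+ 2 /\ 0 <= y 0 2 <= 1]],
      exists2 gamma, closed_curve gamma &
        [set u | sphere u /\ base (F u)] = closed_curve_pts gamma,
      exists v, preim y0 = pm [:: v] &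
      forall u, sphere u -> (singular_at u <-> base (F u) \/ F u = y0)].

Definition ellipsoid_surface :=
  exists (A : 'M[R]_3) (y0 : 'rV[R]_3) (gamma : R -> 'rV[R]_3),
  [/\ A \in unitmx,
      locus = [set y *m A + y0 | y in @sphere R],
      closed_curve gamma,
      [set u | sphere u /\ singular_at u] = closed_curve_pts gamma &
      forall u, closed_curve_pts gamma u -> non_fd_singularity u].

End SphereMaps.

Inductive surface_type :=
  RomanSteiner | CrossCapSurface | Type5 | Type6 | Cone | Ellipsoid.

Definition of_surface_type (R : realType) (s : surface_type)
    (F : 'rV[R]_3 -> 'rV[R]_3) : Prop :=
  match s with
  | RomanSteiner => roman_steiner_surface F
  | CrossCapSurface => cross_cap_surface F
  | Type5 => type5_surface F
  | Type6 => type6_surface F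
  | Cone => cone_surface F
  | Ellipsoid => ellipsoid_surface F
  end.

Section Nets.
Context {R : realType}.

(* The triple (q1, q2, q3) is encoded by its 3 x 6 matrix of coefficients in
   the monomials x^2, y^2, z^2, yz, xz, xy. *)
Definition net := 'M[R]_(3, 6).

Definition net_map (Q : net) (u : 'rV[R]_3) : 'rV[R]_3 :=
  let x := u 0 0 in let y := u 0 1 in let z := u 0 2 in
  (\row_(j < 6) [:: x ^+ 2; y ^+ 2; z ^+ 2; y * z; x * z; x * y]`_j) *m Q^T.

End Nets.

(* the suffix s stands for a star *)
Inductive orbit_type :=
  | oAa | oAb | oAc | oAd
  | oBa | oBc | oBas | oBcs
  | oC
  | oDa | oDb | oDc | oDas | oDbs | oDcs
  | oEa | oEb | oEas | oEbs
  | oFa | oFb | oFas | oFbs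
  | oG | oGs | oH | oI | oIs.

(* the values of the parameters for the families A, B, C; no constraint (and no
   dependence on the parameters) for the other types *)
Definition parameters (R : realType) (o : orbit_type) (g c : R) : Prop :=
  match o with
  | oAb => c < - 9 * g ^+ 2
  | oBc => c = - 9 * g ^+ 2 /\ 0 < g
  | oBa => c = - 9 * g ^+ 2 /\ g < 0
  | oAc => - 9 * g ^+ 2 < c < 0 /\ 0 < g
  | oAa => - 9 * g ^+ 2 < c < 0 /\ g < 0
  | oBas => c = 0 /\ 0 < g
  | oBcs => c = 0 /\ g < 0
  | oAd => 0 < c
  | oC => c = 0 /\ g = 0
  | _ => True
  end.

Definition normal_form (R : realType) (o : orbit_type) (g c : R)
    (u : 'rV[R]_3) : 'rV[R]_3 :=
  let x := u 0 0 in let y := u 0 1 in let z := u 0 2 in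
  match o with
  | oAa | oAb | oAc | oAd | oBa | oBc | oBas | oBcs | oC =>
      row3 (2 * x * z + y ^+ 2) (2 * y * z)
        (- x ^+ 2 - 2 * g * y ^+ 2 + c * z ^+ 2 + 2 * g * x * z)
  | oDa => row3 (x ^+ 2) (y ^+ 2) (z ^+ 2 + 2 * x * y)
  | oDb => row3 (x ^+ 2 - y ^+ 2) (2 * x * y) (x ^+ 2 + z ^+ 2)
  | oDc => row3 (x ^+ 2 - y ^+ 2) (2 * x * y) (x ^+ 2 - z ^+ 2)
  | oDas => row3 (2 * x * z) (2 * y * z) (z ^+ 2 + 2 * x * y)
  | oDbs => row3 (2 * x * z) (2 * y * z) (x ^+ 2 + y ^+ 2 - z ^+ 2)
  | oDcs => row3 (2 * x * z) (2 * y * z) (x ^+ 2 + y ^+ 2 + z ^+ 2)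
  | oEa => row3 (x ^+ 2 + y ^+ 2) (2 * x * y) (z ^+ 2)
  | oEb => row3 (x ^+ 2 - y ^+ 2) (2 * x * y) (z ^+ 2)
  | oEas => row3 (x ^+ 2 - y ^+ 2) (2 * x * z) (2 * y * z)
  | oEbs => row3 (x ^+ 2 + y ^+ 2) (2 * x * z) (2 * y * z)
  | oFa => row3 (x ^+ 2 + y ^+ 2) (2 * x * y) (2 * y * z)
  | oFb => row3 (x ^+ 2 - y ^+ 2) (2 * x * y) (2 * y * z)
  | oFas => row3 (x ^+ 2 - y ^+ 2) (2 * x * z) (z ^+ 2)
  | oFbs => row3 (x ^+ 2 + y ^+ 2) (2 * x * z) (z ^+ 2)
  | oG => row3 (x ^+ 2) (y ^+ 2) (2 * y * z)
  | oGs => row3 (2 * x * y) (2 * x * z) (z ^+ 2)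
  | oH => row3 (x ^+ 2) (2 * x * y) (y ^+ 2 + 2 * x * z)
  | oI => row3 (x ^+ 2) (2 * x * y) (y ^+ 2)
  | oIs => row3 (2 * x * z) (2 * y * z) (z ^+ 2)
  end.

(* the orbit, or family of orbits, under GL(3) x GL(3) *)
Definition orbit (R : realType) (o : orbit_type) : set (@net R) :=
  [set Q | exists (g c : R) (S T : 'M[R]_3),
    [/\ parameters o g c, S \in unitmx, T \in unitmx &
        forall u, net_map Q u = normal_form o g c (u *m S) *m T]].

(* parametrisation (x, y, z, f1, f2, f3) of a germ at the origin of a
   3-manifold in R^6, f1, f2, f3 having zero constant and linear parts *)
Definition monge_form (R : realType) (f : 'rV[R]_3 -> 'rV[R]_(3 + 3)) :=
  [/\ smooth_near f 0,
      \forall u \near (0 : 'rV[R]_3), lsubmx (f u) = u,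
      rsubmx (f 0) = 0 &
      forall v, rsubmx ('D_v f 0) = 0].

(* u |-> II(u, u) at the origin, the normal space being {0} x R^3 *)
Definition second_fundamental_form (R : realType)
    (f : 'rV[R]_3 -> 'rV[R]_(3 + 3)) (u : 'rV[R]_3) : 'rV[R]_3 :=
  rsubmx ('D_u ('D_u f) 0).

Definition generic_curvature_locus (R : realType)
    (o : orbit_type) (s : surface_type) : Prop :=
  exists U : set (@net R),
  [/\ open U, U `&` orbit o !=set0 &
      forall Q f, U Q -> orbit o Q -> monge_form f ->
        (forall u, second_fundamental_form f u = net_map Q u) ->
        of_surface_type s (second_fundamental_form f)].

Definition table (s : surface_type) (o : orbit_type) : bool :=
  match s with
  | RomanSteiner =>
      match o with
      | oAa | oAb | oAc | oAd | oBa | oBc | oBas | oBcs | oC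
      | oDa | oDas | oDcs | oEa | oEas | oFa => true
      | _ => false
      end
  | CrossCapSurface =>
      match o with
      | oAa | oAb | oAc | oAd | oBa | oBas | oDa | oDas | oDb | oDbs
      | oDc | oDcs | oEb | oEbs | oFa | oFb => true
      | _ => false
      end
  | Type5 => match o with oFas | oFbs | oG | oGs => true | _ => false end
  | Type6 => match o with oH => true | _ => false end
  | Cone => match o with oI => true | _ => false end
  | Ellipsoid => match o with oIs => true | _ => false end
  end.

(* Main.v *)
(* Adjoining the form x^2 + y^2 + z^2 to the net turns the locus into a linear
   projection of the Veronese surface from the pencil of symmetric matrices
   orthogonal to these four forms. On the pencil the determinant is a binary cubic.
   A root of it is a matrix of rank 2 and trace 0, that is, a pair of conjugate
   vectors, and adapting a basis to it gives normal forms of the four forms: the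
   locus is a Roman Steiner surface or a cross-cap surface according to the sign of
   the discriminant; if this vanishes, it is of type 5 or 6 according as the Hessian
   covariant is nonzero or zero. For each orbit the sign of the discriminant
   is read off the annihilator of the normal form, and the examples spread to open
   sets, respectively to dense ones, since the pencil depends polynomially on
   the frame. Only for I and I* does the cubic vanish identically.
   A germ is not finitely determined if arbitrarily near 0 it has two points with
   the same image and a common conormal, while a perturbation of any given flatness
   does not: this property is invariant under changes of coordinates. *)
From HB Require Import structures.
Require Import Defs.
From mathcomp Require Import all_boot all_order all_algebra.
From mathcomp Require Import all_classical all_reals topology normedtype derive.
From mathcomp Require Import realfun sequences interval_inference landau.
From mathcomp Require Import ring lra.

Set Implicit Arguments.
Unset Strict Implicit.
Unset Printing Implicit Defensive.

Import Order.TTheory GRing.Theory Num.Theory.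
Import numFieldNormedType.Exports.

Local Open Scope classical_set_scope.
Local Open Scope ring_scope.

(** * Mean value estimates in several variables *)

Section Calculus.
Context {R : realType}.

(** On the sphere the last coordinate of [hat Q] is 1. So the locus is the projective image of four
    quadratic forms, and bases of the source adapted to these forms can replace orthonormal ones.
    The trace condition keeps the construction real: a nonzero symmetric matrix of determinant 0 and
    trace 0 is indefinite of rank 2, hence a symmetric product of two real vectors.

    The two directions of the table meet different obstacles. To obtain open sets, the pencil must
    vary continuously with the net; it is read off an adjugate matrix. For type 5 the discriminant
    vanishes on the whole orbit, and only the nonvanishing of the Hessian is an open condition. For
    the converse, the given open set may meet the orbit anywhere, so a good net is needed
    arbitrarily near any net of the orbit: along the line that joins a given matrix to a good one,
    the covariants are polynomials in one variable with finitely many zeros. Finally, the types of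
    surfaces must exclude each other; this is done by counting preimages, with singular and immersed
    points told apart. *)

Lemma near_eq_differentiable (V W : normedModType R) (f g : V -> W) (x : V) :
  (\forall y \near x, f y = g y) -> differentiable f x -> differentiable g x.
Proof.
move=> fg /diff_locallyP[dfc dfx].
have gE : g \o shift x = cst (g x) + 'd f x +o_ 0 id.
  apply/eqaddoP => e e0.
  have /eqaddoP/(_ e e0) := dfx.
  have fg0 : \forall h \near (0 : V), f (h + x) = g (h + x).
    by have := fg; rewrite (@near_shift _ _ 0 x) /=; apply: filterS => h; rewrite /= subr0.
  apply: filterS2 fg0 => h E.
  rewrite /= !fctE /= /cst E.
  by rewrite (nbhs_singleton fg).
have dE : 'd g x = 'd f x :> (V -> W) by exact: diff_unique.
by apply/diff_locallyP; rewrite dE.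
Qed.

Lemma is_derive_line (V W : normedModType R) (g : V -> W) (p v : V) (t : R) :
  derivable g (p + t *: v) v ->
  is_derive t 1 (fun s : R => g (p + s *: v)) ('D_v g (p + t *: v)).
Proof.
have E : (fun h : R => h^-1 *: (((fun s : R => g (p + s *: v)) \o shift t) (h *: 1)
      - g (p + t *: v))) =
    (fun h => h^-1 *: ((g \o shift (p + t *: v)) (h *: v) - g (p + t *: v))).
  apply/funext => h /=; congr (_ *: (g _ - _)).
  by rewrite [h *: 1]mulr1 scalerDl addrCA addrA addrC addrA.
by move=> dg; split; rewrite /derivable /derive E.
Qed.

Lemma MVT_bound (f df : R -> R) (a b e : R) :
  (forall x, Num.min a b <= x <= Num.max a b -> is_derive x 1 f (df x)) ->
  (forall x, Num.min a b <= x <= Num.max a b -> `|df x| <= e) ->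
  `|f a - f b| <= e * `|a - b|.
Proof.
wlog ab : a b / a <= b => [hw|] Hd He.
  case: (leP a b) => [|/ltW] ab; first exact: hw.
  by rewrite distrC [X in _ * X]distrC; apply: hw => // x; rewrite minC maxC; [exact: Hd|exact: He].
move: Hd He; rewrite min_l // max_r // => Hd He.
have [||c cab E] := @MVT_segment R f df a b ab.
- by move=> x; rewrite in_itv /= => /andP[/ltW ax /ltW xb]; apply: Hd; rewrite ax xb.
- apply: continuous_in_subspaceT => x; rewrite inE /= in_itv /= => xab.
  apply: differentiable_continuous; apply/derivable1_diffP.
  by have [] := Hd _ xab.
rewrite distrC E normrM [X in _ * X]distrC ler_wpM2r //.
by apply: He; move: cab; rewrite in_itv.
Qed.

Lemma mxnorm_coord n (z : 'rV[R]_n.+1) i : `|z 0 i| <= `|z|.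
Proof.
rewrite [leRHS]/Num.Def.normr /= mx_normrE.
by have := @le_bigmax _ R _ 0 (fun i : 'I_1 * 'I_n.+1 => `|z i.1 i.2|) (0, i); exact.
Qed.

Lemma mxnorm_le n (z : 'rV[R]_n.+1) (r : R) : 0 <= r ->
  (forall i, `|z 0 i| <= r) -> `|z| <= r.
Proof.
move=> r0 H; rewrite [leLHS]/Num.Def.normr /= mx_normrE bigmax_le //= => -[i j] _ /=.
by rewrite ord1.
Qed.

(** The coordinates of [z] are replaced by those of [z'] one at a time, and the mean value theorem
    is applied on each segment. The norm is the sup norm, so the intermediate points stay in the
    ball: each coordinate lies between those of [z] and [z']. *)
Lemma partials_bound n (g : 'rV[R]_n.+1 -> R) (y : 'rV[R]_n.+1) (r e : R) :
  (forall z, `|z - y| <= r -> forall i, derivable g z (delta_mx 0 i)) ->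
  (forall z, `|z - y| <= r -> forall i, `|'D_(delta_mx 0 i) g z| <= e) ->
  forall z z', `|z - y| <= r -> `|z' - y| <= r ->
    `|g z - g z'| <= n.+1%:R * e * `|z - z'|.
Proof.
move=> Hd He z z' zr zr'.
have r0 : 0 <= r by exact: le_trans zr.
pose p (k : nat) : 'rV[R]_n.+1 := \row_j (if (j < k)%N then z' 0 j else z 0 j).
have e0 : 0 <= e by exact: le_trans (He z zr 0).
have step (k : nat) : (k <= n.+1)%N -> `|g z - g (p k)| <= k%:R * e * `|z - z'|.
  elim: k => [|k IH] kn.
    have -> : p 0%N = z by apply/rowP => j; rewrite mxE.
    by rewrite subrr normr0 !mul0r.
  rewrite -(subrKA (g (p k))) (le_trans (ler_normD _ _)) //.
  rewrite -natr1 [_ + 1]addrC 2!mulrDl addrC mul1r.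
  apply: lerD; last by apply: IH; exact: ltnW.
  pose i : 'I_n.+1 := Ordinal kn.
  pose q : 'rV[R]_n.+1 := \row_j (if j == i then 0 else p k 0 j).
  have pq t : (q + t *: delta_mx 0 i) = \row_j (if j == i then t else p k 0 j).
    apply/rowP => j; rewrite !mxE eqxx /=.
    by case: (j == i); rewrite ?mulr1 ?add0r // mulr0 addr0.
  have pk : p k = q + (z 0 i) *: delta_mx 0 i.
    rewrite pq; apply/rowP => j; rewrite !mxE.
    by case: eqP => [->|//]; rewrite ltnn.
  have pk1 : p k.+1 = q + (z' 0 i) *: delta_mx 0 i.
    rewrite pq; apply/rowP => j; rewrite !mxE.
    case: eqP => [->|/eqP ji]; first by rewrite ltnSn.
    by rewrite ltnS leq_eqVlt; move: ji; rewrite -val_eqE /= => /negbTE ->.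
  have inball t : Num.min (z 0 i) (z' 0 i) <= t <= Num.max (z 0 i) (z' 0 i) ->
      `|q + t *: delta_mx 0 i - y| <= r.
    move=> /andP[t1 t2]; rewrite pq; apply: mxnorm_le => // j; rewrite !mxE.
    have A := le_trans (mxnorm_coord _ j) zr; have B := le_trans (mxnorm_coord _ j) zr'.
    move: A B; rewrite !mxE => A B.
    case: eqP => [ji|_]; last by case: ifP.
    rewrite ji in A B *; move: A B t1 t2; rewrite !ler_norml => /andP[A1 A2] /andP[B1 B2].
    rewrite ge_min le_max => /orP[] t1 /orP[] t2; clear - A1 A2 B1 B2 t1 t2; apply/andP; split; lra.
  have := @MVT_bound (fun t => g (q + t *: delta_mx 0 i))
    (fun t => 'D_(delta_mx 0 i) g (q + t *: delta_mx 0 i)) (z 0 i) (z' 0 i) e.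
  rewrite -pk -pk1 => /(_ _ _)/le_trans; apply.
  - by move=> t /inball tb; apply: is_derive_line; exact: Hd.
  - by move=> t /inball tb; exact: He.
  - rewrite ler_wpM2l //; have := mxnorm_coord (z - z') i.
    by rewrite !mxE.
have := step n.+1 (leqnn _).
suff -> : p n.+1 = z' by [].
by apply/rowP => j; rewrite mxE ltn_ord.
Qed.

End Calculus.

(** * Differentiability from partial derivatives, and finite orders of smoothness *)

Section PartialDerivatives.
Context {R : realType}.

Lemma sum_coord_linear n (c : 'I_n.+1 -> R) :
  {L : {linear 'rV[R]_n.+1 -> R} | (forall h, L h = \sum_i h 0 i * c i) & continuous L}.
Proof.
pose l (h : 'rV[R]_n.+1) : R := \sum_i h 0 i * c i.
have lin : linear l.
  move=> a u v; rewrite /l scaler_sumr -big_split /=; apply: eq_bigr => i _.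
  by rewrite !mxE mulrDl -mulrA.
pose L : {linear 'rV[R]_n.+1 -> R} := HB.pack l (GRing.isLinear.Build _ _ _ _ l lin).
exists L => //= x; apply: differentiable_continuous.
have -> : l = \sum_i (fun h : 'rV[R]_n.+1 => h 0 i * c i).
  by apply/funext => h; rewrite fct_sumE.
apply: differentiable_sum => i; apply: differentiableM; last exact: differentiable_cst.
exact: differentiable_coord.
Qed.

Lemma derive_linear (V W : normedModType R) (L : {linear V -> W}) x v :
  continuous L -> 'D_v L x = L v.
Proof. by move=> Lc; rewrite deriveE ?diff_lin //; exact: linear_differentiable. Qed.

Lemma differentiable_of_bound (V W : normedModType R) (f : V -> W) (x : V)
    (L : {linear V -> W}) : continuous L ->
  (forall e, 0 < e -> \forall h \near 0, `|f (h + x) - (f x + L h)| <= e * `|h|) ->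
  differentiable f x.
Proof.
move=> Lc H.
have fE : f \o shift x = cst (f x) + L +o_ 0 id by apply/eqaddoP => e e0; exact: H.
have dE : 'd f x = L :> (V -> W) by exact: diff_unique.
by apply/diff_locallyP; rewrite dE.
Qed.

(** The candidate differential [L] is subtracted: the partial derivatives of [g \- L] vanish at [y],
    hence are small nearby by continuity, and [partials_bound] turns this into a small remainder. *)
Lemma partials_differentiable n (g : 'rV[R]_n.+1 -> R) (y : 'rV[R]_n.+1) :
  (\forall z \near y, forall i, derivable g z (delta_mx 0 i)) ->
  (forall i, {for y, continuous ('D_(delta_mx 0 i) g)}) ->
  differentiable g y.
Proof.
move=> Hd Hc.
have [L LE Lc] := sum_coord_linear (fun i => 'D_(delta_mx 0 i) g y).
have Li i : L (delta_mx 0 i) = 'D_(delta_mx 0 i) g y.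
  rewrite LE (bigD1 i) //= mxE !eqxx mul1r big1 ?addr0 // => j ji.
  by rewrite mxE eqxx (negbTE ji) mul0r.
apply: (differentiable_of_bound Lc) => e e0.
  pose e' := e / n.+1%:R.
  have e'0 : 0 < e' by rewrite divr_gt0.
  have Hi (i : 'I_n.+1) :
      \forall z \near y, `|'D_(delta_mx 0 i) g y - 'D_(delta_mx 0 i) g z| <= e'.
    by have /cvgrPdist_le/(_ _ e'0) := Hc i.
  have Hb := filter_forall (nbhs_filter y) Hi.
  have [r /= r0 Hr] := (nbhs_ballP _ _).1 (filterI Hd Hb).
  apply/nbhs_ballP; exists (r / 2) => /=; first by rewrite divr_gt0.
  move=> h; rewrite -ball_normE /= sub0r normrN => hr.
  have inb z : `|z - y| <= r / 2 -> ball y r z.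
    rewrite -ball_normE /= distrC => /le_lt_trans; apply.
    by rewrite ltr_pdivrMr // ltr_pMr // ltr1n.
  have dL z v : derivable L z v.
    by apply: diff_derivable; apply: linear_differentiable.
  have := @partials_bound R n (g \- L) y (r / 2) e'.
  have DE z i : `|z - y| <= r / 2 ->
     is_derive z (delta_mx 0 i) (g \- L)
       ('D_(delta_mx 0 i) g z - 'D_(delta_mx 0 i) g y).
    move=> /inb/Hr[/(_ i) d1 _].
    split; first exact: derivableB d1 (dL _ _).
    by rewrite (deriveB d1 (dL _ _)) (derive_linear _ _ Lc) Li.
  move=> /(_ _ _ (h + y) y) /=; rewrite addrK subrr normr0.
  have -> : g (h + y) - L (h + y) - (g y - L y) = g (h + y) - (g y + L h).
    by rewrite linearD; ring.
  have -> : n.+1%:R * e' = e by rewrite /e' mulrC divfK.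
  apply; last 1 first.
  - by rewrite divr_ge0 // ltW.
  - by move=> z zr i; have [] := DE z i zr.
  - move=> z zr i; rewrite (@derive_val _ _ _ _ _ _ _ (DE z i zr)) distrC.
    by have [_] := Hr _ (inb _ zr); exact.
  - exact: ltW.
Qed.

Lemma differentiable_rowP (V : normedModType R) n (f : V -> 'rV[R]_n.+1) x :
  differentiable f x <-> forall j, differentiable (fun y => f y 0 j) x.
Proof.
split => [df j|df].
  apply: (@differentiable_comp _ _ _ _ f (fun v : 'rV[R]_n.+1 => v 0 j)) => //.
  exact: differentiable_coord.
have -> : f = \sum_j (fun y => f y 0 j *: (delta_mx 0 j : 'rV[R]_n.+1)).
  apply/funext => y; rewrite fct_sumE [LHS]row_sum_delta //.
apply: differentiable_sum => j; exact: differentiableZl.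
Qed.

Lemma derive_coord (V : normedModType R) n (f : V -> 'rV[R]_n.+1) x v j :
  derivable f x v -> ('D_v f x) 0 j = 'D_v (fun y => f y 0 j) x.
Proof. by move=> df; rewrite derive_mx // mxE. Qed.

Lemma derive_compE (U V W : normedModType R) (f : U -> V) (g : V -> W) x v :
  differentiable f x -> differentiable g (f x) ->
  'D_v (g \o f) x = 'D_('D_v f x) g (f x).
Proof.
move=> df dg; rewrite !deriveE //; last exact: differentiable_comp.
by rewrite diff_comp.
Qed.

(** Order 0 already asks for differentiability, so [Ck k] stands for [k.+1] differentiations. Each
    order thus supplies the differentiability that the product and chain rules require for the next
    one. *)
Fixpoint Ck (V W : normedModType R) (k : nat) (O : set V) (f : V -> W) : Prop :=
  if k is k'.+1 then
    (forall x, O x -> differentiable f x) /\ forall v, Ck k' O ('D_v f)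
  else forall x, O x -> differentiable f x.

Lemma Ck_diff (V W : normedModType R) k (O : set V) (f : V -> W) x :
  Ck k O f -> O x -> differentiable f x.
Proof. by case: k => [|k] /=; [move=> df; exact: df|move=> [df _]; exact: df]. Qed.

Lemma CkW (V W : normedModType R) k (O : set V) (f : V -> W) :
  Ck k.+1 O f -> Ck k O f.
Proof. by elim: k f => [|k IH] f [df Df] //; split => // v; exact: IH. Qed.

Lemma Ck_ext (V W : normedModType R) k (O : set V) (f g : V -> W) :
  open O -> (forall x, O x -> f x = g x) -> Ck k O f -> Ck k O g.
Proof.
move=> Oo; elim: k f g => [|k IH] f g fg.
  move=> df x Ox; apply: (near_eq_differentiable _ (df x Ox)).
  by apply: filterS (open_nbhs_nbhs (conj Oo Ox)) => y /fg.
move=> [df Df]; split=> [x Ox|v].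
  apply: (near_eq_differentiable _ (df x Ox)).
  by apply: filterS (open_nbhs_nbhs (conj Oo Ox)) => y /fg.
apply: IH (Df v) => x Ox; apply: near_eq_derive.
by apply: filterS (open_nbhs_nbhs (conj Oo Ox)) => y /fg.
Qed.

Lemma CkSub (V W : normedModType R) k (O O' : set V) (f : V -> W) :
  O' `<=` O -> Ck k O f -> Ck k O' f.
Proof.
move=> OO; elim: k f => [|k IH] f; first by move=> df x /OO Ox; exact: df.
by move=> [df Df]; split=> [x /OO Ox|v]; [exact: df|exact: IH (Df v)].
Qed.

Lemma Ck_cst (V W : normedModType R) k (O : set V) (c : W) : Ck k O (cst c : V -> W).
Proof.
elim: k c => [|k IH] c; first by move=> x _; exact: differentiable_cst.
split=> [x _|v]; first exact: differentiable_cst.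
have -> : 'D_v (cst c : V -> W) = cst 0 by apply/funext => x; rewrite derive_cst.
exact: IH.
Qed.

Lemma Ck_linear (V W : normedModType R) k (O : set V) (L : {linear V -> W}) :
  continuous L -> Ck k O L.
Proof.
move=> Lc; case: k => [|k]; first by move=> x _; exact: linear_differentiable.
split=> [x _|v]; first exact: linear_differentiable.
have -> : 'D_v L = cst (L v) by apply/funext => x; rewrite derive_linear.
exact: Ck_cst.
Qed.

Lemma Ck_coord n k (O : set 'rV[R]_n.+1) j : Ck k O (fun v : 'rV[R]_n.+1 => v 0 j).
Proof.
have [L LE Lc] := sum_coord_linear (fun i : 'I_n.+1 => (i == j)%:R).
have -> : (fun v : 'rV[R]_n.+1 => v 0 j) = L.
  apply/funext => v; rewrite LE (bigD1 j) //= eqxx mulr1 big1 ?addr0 // => i /negbTE ->.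
  by rewrite mulr0.
exact: Ck_linear.
Qed.

Lemma CkD (V W : normedModType R) k (O : set V) (f g : V -> W) : open O ->
  Ck k O f -> Ck k O g -> Ck k O (fun x => f x + g x).
Proof.
move=> Oo; elim: k f g => [|k IH] f g.
  by move=> df dg x Ox; apply: differentiableD; [exact: df|exact: dg].
move=> [df Df] [dg Dg]; split=> [x Ox|v].
  by apply: differentiableD; [exact: df|exact: dg].
apply: Ck_ext (IH _ _ (Df v) (Dg v)) => // x Ox.
by rewrite deriveD //; apply: diff_derivable; auto.
Qed.

Lemma CkM (V : normedModType R) k (O : set V) (f g : V -> R) : open O ->
  Ck k O f -> Ck k O g -> Ck k O (fun x => f x * g x).
Proof.
move=> Oo; elim: k f g => [|k IH] f g.
  by move=> df dg x Ox; apply: differentiableM; [exact: df|exact: dg].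
move=> Cf Cg; have [df Df] := Cf; have [dg Dg] := Cg; split=> [x Ox|v].
  by apply: differentiableM; [exact: df|exact: dg].
have C := CkD Oo (IH _ _ (CkW Cf) (Dg v)) (IH _ _ (CkW Cg) (Df v)).
apply: Ck_ext C => // x Ox.
by rewrite deriveM //; apply: diff_derivable; auto.
Qed.

Lemma CkN (V : normedModType R) k (O : set V) (f : V -> R) : open O ->
  Ck k O f -> Ck k O (fun x => - f x).
Proof.
move=> Oo Cf; have := CkM Oo (Ck_cst k O (-1 : R)) Cf.
by apply: Ck_ext => // x _; rewrite /= mulN1r.
Qed.

Lemma CkX (V : normedModType R) k (O : set V) (f : V -> R) n : open O ->
  Ck k O f -> Ck k O (fun x => f x ^+ n).
Proof.
move=> Oo Cf; elim: n => [|n IH].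
  by apply: Ck_ext (Ck_cst k O (1 : R)) => // x _; rewrite expr0.
by apply: Ck_ext (CkM Oo Cf IH) => // x _; rewrite exprS.
Qed.

Lemma Ck_sum (V : normedModType R) k (O : set V) n (f : 'I_n -> V -> R) : open O ->
  (forall i, Ck k O (f i)) -> Ck k O (fun x => \sum_i f i x).
Proof.
move=> Oo; elim: n f => [|n IH] f Cf.
  by apply: Ck_ext (Ck_cst k O (0 : R)) => // x _; rewrite big_ord0.
apply: Ck_ext (CkD Oo (IH _ (fun i => Cf (widen_ord (leqnSn n) i))) (Cf ord_max)) => // x _.
by rewrite big_ord_recr.
Qed.

(** The derivative of the inverse is expressed through the inverse itself, needed one order lower;
    this closes the induction. [Ck_sqrt] follows the same scheme. *)
Lemma CkV (V : normedModType R) k (O : set V) (f : V -> R) : open O ->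
  (forall x, O x -> f x != 0) -> Ck k O f -> Ck k O (fun x => (f x)^-1).
Proof.
move=> Oo f0; elim: k => [|k IH].
  by move=> df x Ox; apply: differentiableV; auto.
move=> Cf; have [df Df] := Cf; split=> [x Ox|v]; first by apply: differentiableV; auto.
have C := IH (CkW Cf).
apply: Ck_ext (CkN Oo (CkM Oo (CkX 2 Oo C) (Df v))) => // x Ox.
by rewrite deriveV ?f0 //; [rewrite exprVn -mulNr |apply: diff_derivable; auto].
Qed.

Lemma Ck_sqrt (V : normedModType R) k (O : set V) (f : V -> R) : open O ->
  (forall x, O x -> 0 < f x) -> Ck k O f -> Ck k O (fun x => Num.sqrt (f x)).
Proof.
move=> Oo f0.
have ds x : O x -> differentiable f x -> differentiable (Num.sqrt \o f) x.
  move=> Ox df; apply: differentiable_comp => //; apply/derivable1_diffP.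
  by have [] := is_derive1_sqrt (f0 _ Ox).
elim: k => [|k IH]; first by move=> df x Ox; apply: ds; auto.
move=> Cf; have [df Df] := Cf; split=> [x Ox|v]; first by apply: ds; auto.
have C := IH (CkW Cf).
have C2 : Ck k O (fun x => (2 * Num.sqrt (f x))^-1).
  apply: CkV => // [x Ox|]; last exact: CkM (Ck_cst _ _ _) C.
  by rewrite mulf_neq0 // ?pnatr_eq0 // gt_eqF // sqrtr_gt0 f0.
apply: Ck_ext (CkM Oo (Df v) C2) => // x Ox.
rewrite (@derive_compE _ _ _ f Num.sqrt) //; first last.
- apply/derivable1_diffP; by have [] := is_derive1_sqrt (f0 _ Ox).
- exact: df.
have dsq : differentiable Num.sqrt (f x).
  by apply/derivable1_diffP; have [] := is_derive1_sqrt (f0 _ Ox).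
set d := 'D_v f x.
transitivity ('d Num.sqrt (f x) (d *: (1 : R))).
  by rewrite linearZ /= -deriveE // derive_sqrt ?f0.
have -> : d *: (1 : R) = d by exact: mulr1.
by rewrite deriveE.
Qed.

Lemma Ck_rowP (V : normedModType R) k (O : set V) n (f : V -> 'rV[R]_n.+1) : open O ->
  Ck k O f <-> forall j, Ck k O (fun x => f x 0 j).
Proof.
move=> Oo; elim: k f => [|k IH] f.
  split=> [df j x Ox|df x Ox].
    by have /differentiable_rowP := df x Ox; exact.
  by apply/differentiable_rowP => j; exact: df.
split=> [[df Df] j|Cf].
  split=> [x Ox|v]; first by have /differentiable_rowP := df x Ox; exact.
  have /IH/(_ j) := Df v; apply: Ck_ext => // x Ox.
  by rewrite derive_coord //; apply: diff_derivable; exact: df.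
have df x : O x -> differentiable f x.
  by move=> Ox; apply/differentiable_rowP => j; have [+ _] := Cf j; exact.
split=> // v; apply/IH => j; have [_ /(_ v)] := Cf j.
by apply: Ck_ext => // x Ox; rewrite derive_coord //; apply: diff_derivable; exact: df.
Qed.

Lemma derive_row_sum (W : normedModType R) n (h : 'rV[R]_n.+1 -> W) x w :
  differentiable h x -> 'D_w h x = \sum_j w 0 j *: 'D_(delta_mx 0 j) h x.
Proof.
move=> dh; rewrite deriveE // {1}(row_sum_delta w) linear_sum; apply: eq_bigr => j _.
by rewrite linearZ /= deriveE.
Qed.

(** By the chain rule in coordinates, the derivative of the composite is a sum of products of
    coordinates of ['D_v f] with partial derivatives of [h] composed with [f], to which the
    induction hypothesis applies. *)
Lemma Ck_comp (V : normedModType R) k (O : set V) n (O' : set 'rV[R]_n.+1)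
    (f : V -> 'rV[R]_n.+1) (h : 'rV[R]_n.+1 -> R) :
  open O -> (forall x, O x -> O' (f x)) -> Ck k O f -> Ck k O' h -> Ck k O (h \o f).
Proof.
move=> Oo fO; elim: k h => [|k IH] h.
  by move=> df dh x Ox; apply: differentiable_comp; auto.
move=> Cf [dh Dh]; have [df Df] := Cf.
split=> [x Ox|v]; first by apply: differentiable_comp; auto.
have C j : Ck k O (fun x => ('D_v f x) 0 j * ('D_(delta_mx 0 j) h \o f) x).
  by apply: CkM => //; [have /Ck_rowP := Df v; exact|apply: IH (Dh _) => //; exact: CkW].
apply: Ck_ext (Ck_sum Oo C) => // x Ox.
have dhf := dh _ (fO _ Ox).
by rewrite (@derive_compE _ _ _ f h) ?[RHS]derive_row_sum //; exact: df.
Qed.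

End PartialDerivatives.

(** * Smooth functions near a point *)

Section Smoothness.
Context {R : realType}.

Lemma near_eq_continuous (T U : topologicalType) (f g : T -> U) x :
  (\forall y \near x, f y = g y) -> {for x, continuous f} -> {for x, continuous g}.
Proof.
move=> fg; rewrite /prop_for /continuous_at -(nbhs_singleton fg) => fx.
by apply: cvg_trans fx; apply: near_eq_cvg; exact: fg.
Qed.

Lemma deriveD_pt (V : normedModType R) (f g : V -> R) x v :
  differentiable f x -> differentiable g x ->
  'D_v (fun y => f y + g y) x = 'D_v f x + 'D_v g x.
Proof.
move=> /(@diff_derivable _ _ _ f x v) df /(@diff_derivable _ _ _ g x v) dg.
exact: (deriveD df dg).
Qed.

Lemma deriveM_pt (V : normedModType R) (f g : V -> R) x v :
  differentiable f x -> differentiable g x ->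
  'D_v (fun y => f y * g y) x = f x * 'D_v g x + g x * 'D_v f x.
Proof.
move=> /(@diff_derivable _ _ _ f x v) df /(@diff_derivable _ _ _ g x v) dg.
exact: (deriveM df dg).
Qed.

Lemma differentiableX_pt (V : normedModType R) (f : V -> R) x n :
  differentiable f x -> differentiable (fun y => f y ^+ n) x.
Proof.
move=> df; elim: n => [|n IH].
  have -> : (fun y => f y ^+ 0) = cst 1 by apply/funext => y; rewrite expr0.
  exact: differentiable_cst.
have -> : (fun y => f y ^+ n.+1) = (fun y => f y * f y ^+ n).
  by apply/funext => y; rewrite exprS.
exact: (differentiableM df IH).
Qed.

Lemma deriveX_pt (V : normedModType R) (f : V -> R) x v n :
  differentiable f x -> 'D_v (fun y => f y ^+ n.+1) x = n.+1%:R * f x ^+ n * 'D_v f x.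
Proof.
move=> df; elim: n => [|n IH].
  have -> : (fun y => f y ^+ 1) = f by apply/funext => y; rewrite expr1.
  by rewrite expr0 mulr1 mul1r.
have -> : (fun y => f y ^+ n.+2) = (fun y => f y * f y ^+ n.+1).
  by apply/funext => y; rewrite exprS.
rewrite deriveM_pt //; last exact: differentiableX_pt.
by rewrite IH !exprS -[in RHS]natr1; ring.
Qed.

Definition smooth_on (V W : normedModType R) (O : set V) (f : V -> W) :=
  forall k, Ck k O f.

Definition smooth_at (V W : normedModType R) (f : V -> W) (x : V) :=
  exists O : set V, [/\ open O, O x & smooth_on O f].

Definition itD (V W : normedModType R) (vs : seq V) (f : V -> W) : V -> W :=
  foldr (fun v h => 'D_v h) f vs.

Lemma smooth_on_itD (V W : normedModType R) (O : set V) (f : V -> W) vs :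
  smooth_on O f -> smooth_on O (itD vs f).
Proof. by move=> sf; elim: vs => [|v vs IH] //= k; have [_] := IH k.+1; exact. Qed.

Lemma itD_ext (V W : normedModType R) (O : set V) (f g : V -> W) vs :
  open O -> (forall x, O x -> f x = g x) -> forall x, O x -> itD vs f x = itD vs g x.
Proof.
move=> Oo fg; elim: vs => [|v vs IH] //= x Ox; apply: near_eq_derive.
exact: filterS (open_nbhs_nbhs (conj Oo Ox)).
Qed.

Lemma itD_coord (V : normedModType R) (O : set V) n (f : V -> 'rV[R]_n.+1) vs j :
  open O -> smooth_on O f ->
  forall x, O x -> (itD vs f x) 0 j = itD vs (fun y => f y 0 j) x.
Proof.
move=> Oo sf; elim: vs => [|v vs IH] //= x Ox.
rewrite derive_coord; last first.
  by apply: diff_derivable; apply: (Ck_diff (smooth_on_itD vs sf 0) Ox).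
by apply: near_eq_derive; apply: filterS (open_nbhs_nbhs (conj Oo Ox)).
Qed.

(** Each derivation lowers the exponent of [b] by one. The induction therefore carries the remainder
    in the form [b ^+ (K - size vs) * rho'] on all of [O]; since [size vs < K], a positive power of
    [b] is left, and it vanishes at [x]. *)
Lemma itD_addM_flat (V : normedModType R) (O : set V) (g b rho : V -> R) K x vs :
  open O -> O x -> smooth_on O g -> smooth_on O b -> smooth_on O rho -> b x = 0 ->
  (size vs < K)%N ->
  itD vs (fun y => g y + b y ^+ K * rho y) x = itD vs g x.
Proof.
move=> Oo Ox sg sb sr bx sK.
have [rho' sr' E] : exists2 rho', smooth_on O rho' & forall y, O y ->
    itD vs (fun y => g y + b y ^+ K * rho y) y =
    itD vs g y + b y ^+ (K - size vs) * rho' y.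
  elim: vs sK => [|v vs IH] /= sK; first by exists rho; rewrite ?subn0.
  have [rho' sr' E] := IH (ltnW sK).
  have [m mE] : exists m, (K - size vs)%N = m.+1.
    by exists (K - size vs).-1; rewrite prednK // subn_gt0 ltnW.
  have dD (h : V -> R) y : smooth_on O h -> O y -> differentiable h y.
    by move=> sh Oy; apply: (Ck_diff (sh 0) Oy).
  have sDb : smooth_on O ('D_v b) by move=> k; have [_] := sb k.+1; exact.
  have sDr : smooth_on O ('D_v rho') by move=> k; have [_] := sr' k.+1; exact.
  exists (fun y => m.+1%:R * ('D_v b y * rho' y) + b y * 'D_v rho' y).
    move=> k; apply: (CkD Oo); last exact: CkM.
    by apply: (CkM Oo (Ck_cst k O (m.+1%:R : R))); exact: CkM.
  move=> y Oy; rewrite subnS mE /=.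
  have -> : 'D_v (itD vs (fun y => g y + b y ^+ K * rho y)) y =
    'D_v (fun z => itD vs g z + b z ^+ m.+1 * rho' z) y.
    apply: near_eq_derive; apply: filterS (open_nbhs_nbhs (conj Oo Oy)) => z Oz.
    by rewrite E // mE.
  have dg := dD _ _ (smooth_on_itD vs sg) Oy.
  have db := dD _ _ sb Oy.
  have dr := dD _ _ sr' Oy.
  have dbm := differentiableX_pt m.+1 db.
  rewrite deriveD_pt //; last exact: (differentiableM dbm dr).
  by rewrite deriveM_pt // deriveX_pt // exprS; ring.
by rewrite E // bx expr0n subn_eq0 leqNgt sK /= mul0r addr0.
Qed.

(** The definition in the statement asks only for continuity and directional derivability of the
    iterated derivatives. On an open set, continuity of the next partial derivatives upgrades this
    to differentiability at every order. *)
Lemma smooth_nearP m n (f : 'rV[R]_m.+1 -> 'rV[R]_n.+1) x :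
  smooth_near f x <-> smooth_at f x.
Proof.
split=> [| [ O [Oo Ox sf]]]; last first.
  apply: filterS (open_nbhs_nbhs (conj Oo Ox)) => y Oy vs.
  have d := Ck_diff (smooth_on_itD vs sf 0) Oy.
  by split=> [|v]; [exact: differentiable_continuous|exact: diff_derivable].
rewrite /smooth_near -nbhs_nearE nbhsE => -[ O [Oo Ox] H]; exists O; split=> //.
have dO vs y : O y -> differentiable (Defs.iterD vs f) y.
  move=> Oy; apply/differentiable_rowP => j; apply: partials_differentiable.
    apply: filterS (open_nbhs_nbhs (conj Oo Oy)) => z Oz i.
    have [_ /(_ (delta_mx 0 i))] := H z Oz vs.
    by move=> /derivable_mxP; exact.
  move=> i; have [+ _] := H y Oy (delta_mx 0 i :: vs).
  rewrite /= => C.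
  have C2 : {for y, continuous (fun z => ('D_(delta_mx 0 i) (Defs.iterD vs f) z) 0 j)}.
    apply: (@continuous_comp _ _ _ _ (fun v : 'rV[R]_n.+1 => v 0 j)) => //.
    exact: coord_continuous.
  have E z : O z -> ('D_(delta_mx 0 i) (Defs.iterD vs f) z) 0 j =
     'D_(delta_mx 0 i) (fun z => Defs.iterD vs f z 0 j) z.
    by move=> Oz; have [_ Hd] := H z Oz vs; exact: (derive_coord j (Hd _)).
  apply: near_eq_continuous C2.
  by apply: filterS (open_nbhs_nbhs (conj Oo Oy)) => z /E.
suff C k vs : Ck k O (Defs.iterD vs f) by move=> k; exact: (C k [::]).
elim: k vs => [|k IH] vs; first by move=> y; exact: dO.
by split=> [y|v]; [exact: dO|exact: (IH (v :: vs))].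
Qed.

Lemma smooth_on_near (V W : normedModType R) (O : set V) (f : V -> W) x :
  open O -> O x -> smooth_on O f -> smooth_at f x.
Proof. by move=> Oo Ox sf; exists O. Qed.

Lemma smooth_at_near (V W : normedModType R) (f : V -> W) (x : V) :
  smooth_at f x -> \forall y \near x, smooth_at f y.
Proof.
move=> [ O [Oo Ox sf]]; apply: filterS (open_nbhs_nbhs (conj Oo Ox)) => y Oy.
by exists O.
Qed.

Lemma smooth_at_differentiable (V W : normedModType R) (f : V -> W) (x : V) :
  smooth_at f x -> differentiable f x.
Proof. by move=> [ O [Oo Ox sf]]; exact: (Ck_diff (sf 0) Ox). Qed.

Lemma smooth_at_continuous (V W : normedModType R) (f : V -> W) (x : V) :
  smooth_at f x -> {for x, continuous f}.
Proof. by move=> /smooth_at_differentiable/differentiable_continuous. Qed.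

Lemma smooth_at_derive (V W : normedModType R) (f : V -> W) (x v : V) :
  smooth_at f x -> smooth_at ('D_v f) x.
Proof.
by move=> [ O [Oo Ox sf]]; exists O; split => // k; have [_] := sf k.+1; exact.
Qed.

Lemma smooth_at_ext (V W : normedModType R) (f g : V -> W) (x : V) :
  (\forall y \near x, f y = g y) -> smooth_at f x -> smooth_at g x.
Proof.
rewrite -nbhs_nearE nbhsE => -[U [Uo Ux] fg] [ O [Oo Ox sf]].
exists (O `&` U); split => //; first exact: openI.
move=> k; apply: (@Ck_ext _ _ _ _ _ f); first exact: openI.
  by move=> y [_ /fg].
by apply: CkSub (sf k) => y [].
Qed.

Lemma smooth_at2 (V W W' W'' : normedModType R) (op : (V -> W) -> (V -> W') -> (V -> W''))
    (f : V -> W) (g : V -> W') (x : V) :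
  (forall k O, open O -> Ck k O f -> Ck k O g -> Ck k O (op f g)) ->
  smooth_at f x -> smooth_at g x -> smooth_at (op f g) x.
Proof.
move=> H [ O [Oo Ox sf]] [U [Uo Ux sg]].
exists (O `&` U); split => //; first exact: openI.
move=> k; apply: H; first exact: openI.
  by apply: CkSub (sf k) => y [].
by apply: CkSub (sg k) => y [].
Qed.

Lemma smooth_cst (V W : normedModType R) (c : W) (x : V) : smooth_at (fun=> c) x.
Proof. by exists setT; split => //; [exact: openT|move=> k; exact: Ck_cst]. Qed.

Lemma smooth_coord n j (x : 'rV[R]_n.+1) : smooth_at (fun v : 'rV[R]_n.+1 => v 0 j) x.
Proof. by exists setT; split => //; [exact: openT|move=> k; exact: Ck_coord]. Qed.

Lemma smoothD (V : normedModType R) (f g : V -> R) x :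
  smooth_at f x -> smooth_at g x -> smooth_at (fun y => f y + g y) x.
Proof.
exact: (@smooth_at2 _ _ _ _ (fun (f g : V -> R) y => f y + g y) f g x
  (fun k O Oo => @CkD _ _ _ k O f g Oo)).
Qed.

Lemma smoothM (V : normedModType R) (f g : V -> R) x :
  smooth_at f x -> smooth_at g x -> smooth_at (fun y => f y * g y) x.
Proof.
exact: (@smooth_at2 _ _ _ _ (fun (f g : V -> R) y => f y * g y) f g x
  (fun k O Oo => @CkM _ _ k O f g Oo)).
Qed.

Lemma smoothN (V : normedModType R) (f : V -> R) x :
  smooth_at f x -> smooth_at (fun y => - f y) x.
Proof.
by move=> [ O [Oo Ox sf]]; exists O; split => // k; exact: CkN.
Qed.

Lemma smoothB (V : normedModType R) (f g : V -> R) x :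
  smooth_at f x -> smooth_at g x -> smooth_at (fun y => f y - g y) x.
Proof. by move=> sf sg; apply: smoothD => //; exact: smoothN. Qed.

Lemma smoothX (V : normedModType R) (f : V -> R) n x :
  smooth_at f x -> smooth_at (fun y => f y ^+ n) x.
Proof.
by move=> [ O [Oo Ox sf]]; exists O; split => // k; exact: CkX.
Qed.

Lemma smooth_open1 (V : normedModType R) (P : R -> Prop) (f : V -> R) x :
  open [set y | P y] -> smooth_at f x -> P (f x) ->
  exists O : set V, [/\ open O, O x, smooth_on O f & forall y, O y -> P (f y)].
Proof.
move=> Po [ O [Oo Ox sf]] Pfx.
have : \forall y \near x, P (f y).
  have := smooth_at_continuous (smooth_on_near Oo Ox sf).
  by apply; exact: (open_nbhs_nbhs (conj Po Pfx)).
rewrite -nbhs_nearE nbhsE => -[U [Uo Ux] HU].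
exists (O `&` U); split => //; first exact: openI.
  by move=> k; apply: CkSub (sf k) => y [].
by move=> y [_ /HU].
Qed.

Lemma smoothV (V : normedModType R) (f : V -> R) x :
  smooth_at f x -> f x != 0 -> smooth_at (fun y => (f y)^-1) x.
Proof.
move=> sf f0; have [|O [Oo Ox sO HO]] := @smooth_open1 _ (fun y => y != 0) f x _ sf f0.
  exact: open_neq.
by exists O; split => // k; exact: CkV.
Qed.

Lemma smooth_sqrt (V : normedModType R) (f : V -> R) x :
  smooth_at f x -> 0 < f x -> smooth_at (fun y => Num.sqrt (f y)) x.
Proof.
move=> sf f0; have [|O [Oo Ox sO HO]] := @smooth_open1 _ (fun y => 0 < y) f x _ sf f0.
  exact: open_gt.
by exists O; split => // k; exact: Ck_sqrt.
Qed.

Lemma smooth_row (V : normedModType R) n (f : V -> 'rV[R]_n.+1) x :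
  (forall j, smooth_at (fun y => f y 0 j) x) <-> smooth_at f x.
Proof.
split=> [H| [ O [Oo Ox sf]] j]; last first.
  by exists O; split=> // k; apply/(Ck_rowP k f Oo): j.
pose C j (O : set V) := [/\ open O, O x & smooth_on O (fun y => f y 0 j)].
have /choice[g Hg] : forall j, exists O, C j O by move=> j; have [ O ?] := H j; exists O.
have gx j : nbhs x (g j) by have [go gx _] := Hg j; exact: open_nbhs_nbhs.
have := filter_forall (nbhs_filter x) gx; rewrite nbhsE => -[U [Uo Ux] HU].
exists U; split=> // k; apply/Ck_rowP => // j.
by have [_ _ /(_ k)] := Hg j; apply: CkSub => y /HU; exact.
Qed.

Lemma smooth_comp (V : normedModType R) n (f : V -> 'rV[R]_n.+1)
    (h : 'rV[R]_n.+1 -> R) x :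
  smooth_at f x -> smooth_at h (f x) -> smooth_at (h \o f) x.
Proof.
move=> sf [Q [ Qo Qx sh]]; have [ O [Oo Ox sfO]] := sf.
have : \forall y \near x, Q (f y).
  by apply: (smooth_at_continuous sf); exact: open_nbhs_nbhs.
rewrite -nbhs_nearE nbhsE => -[U [Uo Ux] HU].
exists (O `&` U); split => //; first exact: openI.
move=> k; apply: (@Ck_comp _ _ _ _ _ Q); first exact: openI.
- by move=> y [_ /HU].
- by apply: CkSub (sfO k) => y [].
- exact: sh.
Qed.

Lemma smooth_comp_row (V : normedModType R) n p (f : V -> 'rV[R]_n.+1)
    (h : 'rV[R]_n.+1 -> 'rV[R]_p.+1) x :
  smooth_at f x -> smooth_at h (f x) -> smooth_at (h \o f) x.
Proof.
move=> sf /smooth_row sh; apply/smooth_row => j.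
exact: (smooth_comp sf (sh j)).
Qed.

Lemma smooth_linear n (L : {linear 'rV[R]_n.+1 -> R}) x : smooth_at L x.
Proof.
have [L' LE Lc] := sum_coord_linear (fun i => L (delta_mx 0 i)).
have -> : (L : _ -> _) = L'.
  apply/funext => h; rewrite LE {1}(row_sum_delta h) linear_sum.
  by apply: eq_bigr => i _; rewrite linearZ.
by exists setT; split => //; [exact: openT|move=> k; exact: Ck_linear].
Qed.

End Smoothness.

HB.instance Definition _ (R : realType) m n := NormedModule.on 'M[R]_(m.+1, n.+1).

(** * Inverse function theorem *)

Section LocalDiffeo.
Context {R : realType}.

Lemma smooth_at_eq (V W : normedModType R) (f g : V -> W) (x : V) :
  f =1 g -> smooth_at f x -> smooth_at g x.
Proof. by move=> /funext ->. Qed.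

Lemma mulmx_inj_unitmx n (A : 'M[R]_n) :
  (forall v : 'rV[R]_n, v != 0 -> v *m A != 0) -> A \in unitmx.
Proof.
move=> H; rewrite -row_free_unit -kermx_eq0.
apply/eqP/row_matrixP => i; rewrite row0; apply/eqP; apply: contraT => /H.
by rewrite -row_mul mulmx_ker row0 eqxx.
Qed.

Lemma linear_row_smooth n p (L : {linear 'rV[R]_n.+1 -> 'rV[R]_p.+1}) x : smooth_at L x.
Proof.
apply/smooth_row => j.
have lin : linear (fun y => L y 0 j) by move=> a u v; rewrite linearP !mxE.
pose l : {linear 'rV[R]_n.+1 -> R} :=
  HB.pack (fun y => L y 0 j) (GRing.isLinear.Build _ _ _ _ (fun y => L y 0 j) lin).
exact: (smooth_linear l x).
Qed.

Lemma derive_linear_comp (V : normedModType R) n p (L : {linear 'rV[R]_n.+1 -> 'rV[R]_p.+1})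
    (f : V -> 'rV[R]_n.+1) x v :
  differentiable f x -> 'D_v (L \o f) x = L ('D_v f x).
Proof.
move=> df; have dL y := smooth_at_differentiable (linear_row_smooth L y).
rewrite derive_compE // derive_linear // => y.
exact: differentiable_continuous.
Qed.

(** With [A] the inverse Jacobian at [x], the map [z |-> f z *m A - z] has zero derivative at [x],
    hence is Lipschitz with constant 1/2 on a small ball. Injectivity, surjectivity and
    nonsingularity of nearby derivatives are drawn from this one estimate. *)
Lemma local_diffeo_estimate n (f : 'rV[R]_n.+1 -> 'rV[R]_n.+1) x :
  local_diffeo f x -> exists (A : 'M[R]_n.+1) (r : R), [/\ 0 < r,
    forall z, `|z - x| <= r -> smooth_at f z,
    forall z, `|z - x| <= r -> forall v, `|'D_v f z *m A - v| <= 2^-1 * `|v| &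
    A \in unitmx /\ forall z z', `|z - x| <= r -> `|z' - x| <= r ->
      `|(f z *m A - z) - (f z' *m A - z')| <= 2^-1 * `|z - z'|].
Proof.
move=> [/smooth_nearP sf Df].
have df := smooth_at_differentiable sf.
have uJ : jacobian f x \in unitmx.
  by apply: mulmx_inj_unitmx => v /Df; rewrite deriveEjacobian.
set A := invmx (jacobian f x); have uA : A \in unitmx by rewrite unitmx_inv.
pose G z := f z *m A - z.
have sG z : smooth_at f z -> smooth_at G z.
  move=> sfz; apply/smooth_row => j.
  have s1 : smooth_at (mulmxr A \o f) z.
    exact: (smooth_comp_row sfz (linear_row_smooth _ _)).
  have /smooth_row/(_ j) s2 := s1.
  by apply: smooth_at_eq (smoothB s2 (smooth_coord j z)) => y; rewrite !mxE.
have DG z v : smooth_at f z -> 'D_v G z = 'D_v f z *m A - v.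
  move=> sfz; have dfz := smooth_at_differentiable sfz.
  have dLf : differentiable (mulmxr A \o f) z.
    apply: smooth_at_differentiable.
    exact: (smooth_comp_row sfz (linear_row_smooth _ _)).
  have -> : G = (mulmxr A \o f) - id by [].
  rewrite deriveB ?derive_id; [|exact: diff_derivable|exact: derivable_id].
  by rewrite derive_linear_comp.
(* [partials_bound] costs a factor [n.+1]; this choice leaves the constant 1/2. *)
pose e : R := (2 * n.+1%:R)^-1.
have e0 : 0 < e by rewrite invr_gt0 mulr_gt0.
have near_small (i : 'I_n.+1) : \forall z \near x, `|'D_(delta_mx 0 i) G z| <= e.
  have sDG := smooth_at_derive (delta_mx 0 i) (sG _ sf).
  have /cvgrPdist_le/(_ _ e0) := smooth_at_continuous sDG.
  have -> : 'D_(delta_mx 0 i) G x = 0.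
    by rewrite DG // deriveEjacobian // -mulmxA mulmxV // mulmx1 subrr.
  by apply: filterS => z; rewrite sub0r normrN.
have near_all := filterI (smooth_at_near sf) (filter_forall (nbhs_filter x) near_small).
have [r /= r0 Hr] := (nbhs_ballP _ _).1 (near_all (nbhs_filter x)).
have inb z : `|z - x| <= r / 2 -> smooth_at f z /\ forall i, `|'D_(delta_mx 0 i) G z| <= e.
  move=> zx; apply: Hr; rewrite -ball_normE /= distrC (le_lt_trans zx) //.
  by rewrite ltr_pdivrMr // ltr_pMr // ltr1n.
have en : n.+1%:R * e = 2^-1 by rewrite /e invfM mulrCA divff ?mulr1 // pnatr_eq0.
exists A, (r / 2); split.
- by rewrite divr_gt0.
- by move=> z /inb[].
- move=> z /inb[sfz He] v; rewrite -DG // derive_row_sum; last first.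
    exact/smooth_at_differentiable/sG.
  apply: le_trans (ler_norm_sum _ _ _) _.
  have -> : 2^-1 * `|v| = \sum_(j < n.+1) (`|v| * e).
    by rewrite sumr_const card_ord -[RHS]mulr_natl -(congr1 ( *%R^~ `|v|) en); ring.
  apply: ler_sum => j _; rewrite normrZ ler_pM //; exact: mxnorm_coord.
- split=> // z z' zr zr'; apply: mxnorm_le => [|j]; first by rewrite mulr_ge0.
  rewrite [_ 0 j]mxE [X in _ + X]mxE.
  rewrite -en; apply: (@partials_bound R n (fun z => G z 0 j) x (r / 2) e) => // w wr i.
    have [sw _] := inb w wr.
    have /smooth_row/(_ j)/smooth_at_differentiable := sG _ sw.
    exact: diff_derivable.
  have [sw /(_ i) Hw] := inb w wr.
  rewrite -derive_coord; first exact: le_trans (mxnorm_coord _ _) Hw.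
  exact/diff_derivable/smooth_at_differentiable/sG.
Qed.

Lemma local_diffeo_inj n (f : 'rV[R]_n.+1 -> 'rV[R]_n.+1) x :
  local_diffeo f x -> exists2 r : R, 0 < r &
    forall z z', `|z - x| <= r -> `|z' - x| <= r -> f z = f z' -> z = z'.
Proof.
move=> /local_diffeo_estimate[A [r [r0 _ _ [_ H]]]]; exists r => // z z' zr zr' E.
have := H z z' zr zr'; rewrite E opprB addrC addrA subrK.
rewrite distrC => Hle; apply/eqP; rewrite -subr_eq0 -normr_le0.
have := normr_ge0 (z - z'); lra.
Qed.

Lemma local_diffeo_near n (f : 'rV[R]_n.+1 -> 'rV[R]_n.+1) x :
  local_diffeo f x -> \forall z \near x, local_diffeo f z.
Proof.
move=> /local_diffeo_estimate[A [r [r0 sf H _]]].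
apply/nbhs_ballP; exists r => //= z; rewrite -ball_normE /= distrC => /ltW zr.
split=> [|v v0]; first exact/smooth_nearP/sf.
apply: contra v0 => /eqP E; have := H z zr v.
rewrite E mul0mx sub0r normrN -normr_le0; have := normr_ge0 v; lra.
Qed.

(** Solving [f z = y] amounts to finding a fixed point of [T], a contraction by 1/2. The ball of
    radius [d] is stable: one half of [d] pays for the distance from [y *m A] to [f x *m A], the
    other for the contraction. *)
Lemma local_diffeo_surj n (f : 'rV[R]_n.+1 -> 'rV[R]_n.+1) x (V : set 'rV[R]_n.+1) :
  local_diffeo f x -> nbhs x V -> \forall y \near f x, exists2 z, V z & f z = y.
Proof.
move=> /local_diffeo_estimate[A [r [r0 sf _ [uA H]]]] /nbhs_ballP[e /= e0 eV].
pose d := Num.min r (e / 2).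
have d0 : 0 < d by rewrite lt_min r0 divr_gt0.
have dr : d <= r by rewrite ge_min lexx.
have de : d < e.
  by rewrite gt_min [X in _ || X]ltr_pdivrMr // ltr_pMr // ltr1n orbT.
have Ac : {for f x, continuous (mulmxr A)}.
  exact: smooth_at_continuous (linear_row_smooth _ _).
have d2 : 0 < d / 2 by rewrite divr_gt0.
have /cvgrPdist_le/(_ _ d2) := Ac; apply: filterS => y; rewrite /= => Hy.
pose U := [set z | `|z - x| <= d].
pose T z := y *m A - (f z *m A - z).
have TU z : U z -> U (T z).
  move=> /= Uz; rewrite /U /=.
  have -> : T z - x = (y *m A - f x *m A) - ((f z *m A - z) - (f x *m A - x)).
    by rewrite /T; apply/rowP => j; rewrite !mxE; ring.
  rewrite (le_trans (ler_normB _ _)) // [leRHS](splitr d) lerD //.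
    by rewrite distrC.
  rewrite (le_trans (H _ _ _ _)) ?subrr ?normr0 //.
  - exact: le_trans Uz dr.
  - exact: ltW.
  - by rewrite [leRHS]mulrC ler_wpM2l.
pose T' : {fun U >-> U} := HB.pack T (isFun.Build _ _ U U T TU).
have Tc : is_contraction T'.
  exists (2^-1)%:nng; split=> /=; first by rewrite invf_lt1 // ltr1n.
  move=> [z z'] /= [Uz Uz'].
  have -> : T z - T z' = - ((f z *m A - z) - (f z' *m A - z')).
    by rewrite /T; apply/rowP => j; rewrite !mxE; ring.
  by rewrite normrN H // ?(le_trans Uz) ?(le_trans Uz').
have Uc : closed U.
  have -> : U = closed_ball x d.
    rewrite closed_ballE //; apply/seteqP; split=> z /=; rewrite /closed_ball_ /=.
      by rewrite distrC.
    by rewrite distrC.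
  exact: closed_ball_closed.
have [|z Uz zE] := @banach_fixed_point R 'rV[R]_n.+1 U T' Tc Uc.
  by exists x; rewrite /U /= subrr normr0 ltW.
exists z.
  by apply: eV; rewrite -ball_normE /= distrC (le_lt_trans Uz).
have : f z *m A = y *m A.
  by move: zE; rewrite /T' /= /T => /rowP zE; apply/rowP => j; have := zE j; rewrite !mxE; lra.
by move=> /(congr1 (mulmx^~ (invmx A))); rewrite !mulmxK.
Qed.

Lemma local_diffeo_deriv_surj n (f : 'rV[R]_n.+1 -> 'rV[R]_n.+1) x w :
  local_diffeo f x -> exists v, 'D_v f x = w.
Proof.
move=> [/smooth_nearP/smooth_at_differentiable df Df].
have uJ : jacobian f x \in unitmx.
  by apply: mulmx_inj_unitmx => v /Df; rewrite deriveEjacobian.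
by exists (w *m invmx (jacobian f x)); rewrite deriveEjacobian // mulmxKV.
Qed.

(** Recognises a local diffeomorphism by an explicit smooth left inverse, in place of a Jacobian
    determinant. *)
Lemma left_inverse_deriv_neq0 (V W : normedModType R) (f : V -> W) (g : W -> V) x v :
  differentiable f x -> differentiable g (f x) -> (\forall y \near x, g (f y) = y) ->
  v != 0 -> 'D_v f x != 0.
Proof.
move=> df dg gf; apply: contra => /eqP E.
have : 'D_v (g \o f) x = v.
  by rewrite (near_eq_derive (g := id)) // derive_id.
by rewrite derive_compE // E derive0 => <-.
Qed.

End LocalDiffeo.

(** * Non-transversal pairs of points, an invariant of germs *)

Section Nontransversality.
Context {R : realType}.

Lemma near_comp (T U : topologicalType) (f : T -> U) (x : T) (P : U -> Prop) :
  {for x, continuous f} -> (\forall y \near f x, P y) -> \forall z \near x, P (f z).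
Proof. by move=> fx; exact: fx. Qed.

Lemma near_all_pts (T : topologicalType) (x : T) (P : T -> Prop) :
  (forall y, P y) -> \forall y \near x, P y.
Proof. by move=> H; exact: nearW. Qed.

Lemma nbhsI2 (T : topologicalType) (x : T) (A B : set T) :
  nbhs x A -> nbhs x B -> nbhs x (A `&` B).
Proof. by move=> xA xB; apply: filterI. Qed.

Definition conormal (p : nat) (g : 'rV[R]_2 -> 'rV[R]_p.+1) (x : 'rV[R]_2) (n : 'cV[R]_p.+1) :=
  forall w, 'D_w g x *m n = 0.

(** A common nonzero conormal means that both tangent images lie in one plane; this covers tangent
    sheets as well as pairs that involve singular points. Only distinct points are paired, so that a
    cross-cap does not have the property. *)
Definition nontransversal_near (g : 'rV[R]_2 -> 'rV[R]_3) :=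
  forall V, nbhs (0 : 'rV[R]_2) V -> exists x y n,
    [/\ V x, V y, x != y & g x = g y] /\ [/\ n != 0, conormal g x n & conormal g y n].

(** The points are moved by [phi], the conormal by the inverse Jacobian of [psi]. As both points
    have the same image, one Jacobian serves for both and the conormal stays common. *)
Lemma nontransversal_equiv (g h : 'rV[R]_2 -> 'rV[R]_3) :
  smooth_near g 0 -> smooth_near h 0 -> A_equivalent g h ->
  nontransversal_near g -> nontransversal_near h.
Proof.
move=> /smooth_nearP sg /smooth_nearP sh [phi [psi [dphi phi0 dpsi E]]] NTg V V0.
have sphi : smooth_at phi 0 by apply/smooth_nearP; case: dphi.
have cphi := smooth_at_continuous sphi.
have [r r0 inj] := local_diffeo_inj dphi.
have N1 : \forall x \near (0 : 'rV[R]_2), V (phi x) by apply: (near_comp cphi); rewrite phi0.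
have N2 := local_diffeo_near dphi.
have N3 := smooth_at_near sg.
have N4 : \forall x \near (0 : 'rV[R]_2), smooth_at h (phi x).
  by apply: (near_comp cphi); rewrite phi0; exact: smooth_at_near.
have N5 : \forall x \near (0 : 'rV[R]_2), local_diffeo psi (g x).
  by apply: (near_comp (smooth_at_continuous sg)); exact: local_diffeo_near.
have N6 : \forall x \near (0 : 'rV[R]_2), `|x - 0| <= r.
  apply/nbhs_ballP; exists r => //= x; rewrite -ball_normE /= distrC; exact: ltW.
have N7 := near_join E.
have NN := nbhsI2 N1 (nbhsI2 N2 (nbhsI2 N3 (nbhsI2 N4 (nbhsI2 N5 (nbhsI2 N6 N7))))).
have [x [y [n [[[Vx [px [gx [hx [psx [rx Ex]]]]]] [Vy [py [gy [hy [psy [ry Ey]]]]]] xy gxy] [n0 nx ny]]]]]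
  := NTg _ NN.
have spsi : differentiable psi (g x).
  by apply: smooth_at_differentiable; apply/smooth_nearP; case: psx.
have uJ : jacobian psi (g x) \in unitmx.
  by apply: mulmx_inj_unitmx => v; case: psx => _ /(_ v) H /H; rewrite deriveEjacobian.
have key z : local_diffeo phi z -> smooth_at g z -> smooth_at h (phi z) ->
    (\near z, psi (g z) = h (phi z)) -> differentiable psi (g z) ->
    conormal g z n ->
    jacobian psi (g z) \in unitmx -> conormal h (phi z) (invmx (jacobian psi (g z)) *m n).
  move=> pz /smooth_at_differentiable dg /smooth_at_differentiable dh Ez dpz nz uz w.
  have [v <-] := local_diffeo_deriv_surj w pz.
  have dpz' : differentiable phi z by case: pz => /smooth_nearP/smooth_at_differentiable.
  rewrite -(@derive_compE _ _ _ _ phi h) //.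
  rewrite -(near_eq_derive (f := psi \o g)) //.
  rewrite (@derive_compE _ _ _ _ g psi) // deriveEjacobian //.
  by rewrite mulmxA mulmxK.
exists (phi x), (phi y), (invmx (jacobian psi (g x)) *m n); split; split => //.
- by apply: contra xy => /eqP/inj ->.
- by rewrite -(nbhs_singleton Ex) -(nbhs_singleton Ey) gxy.
- apply: contra n0 => /eqP/(congr1 (mulmx (jacobian psi (g x)))).
  by rewrite mulKVmx // mulmx0 => ->.
- exact: (key x px gx hx Ex spsi nx uJ).
- by rewrite gxy in spsi uJ *; exact: (key y py gy hy Ey spsi ny uJ).
Qed.

Lemma local_diffeo_id n (x : 'rV[R]_n.+1) : local_diffeo id x.
Proof.
split; first by apply/smooth_nearP; apply/smooth_row => j; exact: smooth_coord.
by move=> v v0; rewrite derive_id.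
Qed.

(** [theta] is onto a neighbourhood of 0, so a bad pair for [g0] lifts to a pair for [g]; by the
    chain rule the derivatives of [g] are among those of [g0], and the conormal is kept. *)
Lemma nontransversal_pull (g0 g : 'rV[R]_2 -> 'rV[R]_3) (theta : 'rV[R]_2 -> 'rV[R]_2) :
  smooth_at g0 0 -> local_diffeo theta 0 -> theta 0 = 0 ->
  (\forall x \near (0 : 'rV[R]_2), g x = g0 (theta x)) ->
  nontransversal_near g0 -> nontransversal_near g.
Proof.
move=> sg0 dth th0 E NT V V0.
have sth : smooth_at theta 0 by apply/smooth_nearP; case: dth.
have N1 : \forall x \near (0 : 'rV[R]_2), smooth_at g0 (theta x).
  by apply: (near_comp (smooth_at_continuous sth)); rewrite th0; exact: smooth_at_near.
have NN := nbhsI2 V0 (nbhsI2 N1 (nbhsI2 (smooth_at_near sth) (near_join E))).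
have := local_diffeo_surj dth NN; rewrite th0 => /NT.
move=> [_ [_ [n [[[x [Vx [gx [sx Ex]]] <-] [y [Vy [gy [sy Ey]]] <-] xy gxy] [n0 nx ny]]]]].
exists x, y, n; split; split; [exact: Vx|exact: Vy| | |exact: n0| |].
- by apply: contra xy => /eqP ->.
- by rewrite (nbhs_singleton Ex) (nbhs_singleton Ey).
- move=> w; rewrite (near_eq_derive (g := g0 \o theta)) //.
  by rewrite derive_compE //; exact: smooth_at_differentiable.
- move=> w; rewrite (near_eq_derive (g := g0 \o theta)) //.
  by rewrite derive_compE //; exact: smooth_at_differentiable.
Qed.

(* [h0] has the same k-jet as [g0], but cannot be A-equivalent to it. *)
Lemma not_finitely_determined (g0 g : 'rV[R]_2 -> 'rV[R]_3) (theta : 'rV[R]_2 -> 'rV[R]_2) :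
  smooth_at g0 0 -> local_diffeo theta 0 -> theta 0 = 0 ->
  (\forall x \near (0 : 'rV[R]_2), g x = g0 (theta x)) ->
  nontransversal_near g0 ->
  (forall k, exists (h0 : 'rV[R]_2 -> 'rV[R]_3) (b : 'rV[R]_2 -> R) (rho : 'rV[R]_2 -> 'rV[R]_3),
    [/\ smooth_at b 0, smooth_at rho 0, b 0 = 0,
      \forall y \near (0 : 'rV[R]_2), h0 y = g0 y + b y ^+ k.+1 *: rho y &
      ~ nontransversal_near h0]) ->
  ~ finitely_determined g.
Proof.
move=> sg0 dth th0 E NT0 H [k Hk].
have NTg := nontransversal_pull sg0 dth th0 E NT0.
have [h0 [b [rho [sb sr b0 hE NTh]]]] := H k.
apply: NTh.
have sth : smooth_at theta 0 by apply/smooth_nearP; case: dth.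
have sg : smooth_at g 0.
  apply: (smooth_at_ext (f := g0 \o theta)); first by apply: filterS E => x ->.
  by apply: smooth_comp_row => //; rewrite th0.
have sh0 : smooth_at h0 0.
  apply: (smooth_at_ext (f := fun y => g0 y + b y ^+ k.+1 *: rho y)).
    by apply: filterS hE => x ->.
  apply/smooth_row => j; move/smooth_row: sg0 => /(_ j) sg0; move/smooth_row: sr => /(_ j) sr.
  apply: smooth_at_eq (smoothD sg0 (smoothM (smoothX k.+1 sb) sr)) => y.
  by rewrite !mxE.
(* Finite determinacy concerns perturbations of [g], so [h0] is read in the coordinates of [g];
   [b \o theta] still vanishes at 0, which preserves the jet. *)
pose h := h0 \o theta.
have sh : smooth_at h 0 by apply: smooth_comp_row => //; rewrite th0.
have hEth : \forall x \near (0 : 'rV[R]_2), h x = g x + b (theta x) ^+ k.+1 *: rho (theta x).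
  have : \forall x \near (0 : 'rV[R]_2),
      h0 (theta x) = g0 (theta x) + b (theta x) ^+ k.+1 *: rho (theta x).
    by apply: (near_comp (P := fun y => h0 y = g0 y + b y ^+ k.+1 *: rho y) (smooth_at_continuous sth)); rewrite th0.
  by apply: filterS2 E => x ->.
have jet : same_jet k g h.
  move=> vs vsk; apply/rowP => j.
  have [ W1 [w1 z1 s1]] := sg; have [ W2 [w2 z2 s2]] := sh.
  rewrite (itD_coord vs j w1 s1) // (itD_coord vs j w2 s2) //.
  have [ W3 [w3 z3 s3]] : smooth_at (b \o theta) 0 by apply: smooth_comp => //; rewrite th0.
  have [ W4 [w4 z4 s4]] : smooth_at (fun x => (rho (theta x)) 0 j) 0.
    by move/smooth_row: sr => /(_ j) sr; apply: (smooth_comp (h := fun v => rho v 0 j)) => //; rewrite th0.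
  have := hEth; rewrite -nbhs_nearE nbhsE => -[ W5 [w5 z5] e5].
  pose U := (W1 `&` (W3 `&` (W4 `&` W5))).
  have oU : open U by do 3 (apply: openI => //).
  have gU : smooth_on U (fun y => g y 0 j).
    move=> m; have Cg : Ck m U g by apply: CkSub (s1 m) => y [].
    exact: (proj1 (Ck_rowP m g oU) Cg j).
  have bU : smooth_on U (b \o theta) by move=> m; apply: CkSub (s3 m) => y [_ []].
  have rU : smooth_on U (fun x => (rho (theta x)) 0 j).
    by move=> m; apply: CkSub (s4 m) => y [_ [_ []]].
  have := itD_ext vs oU (f := fun y => h y 0 j)
    (g := fun y => g y 0 j + (b \o theta) y ^+ k.+1 * rho (theta y) 0 j).
  move=> -> //; last by move=> x [_ [_ [_ /e5 ->]]]; rewrite !mxE.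
  by rewrite (itD_addM_flat oU _ gU bU rU) //= th0.
have NTh : nontransversal_near h.
  apply: nontransversal_equiv NTg; [exact/smooth_nearP|exact/smooth_nearP|].
  by apply: Hk => //; exact/smooth_nearP.
apply: nontransversal_equiv NTh; [exact/smooth_nearP|exact/smooth_nearP|].
exists theta, id; split => //; first exact: local_diffeo_id.
exact: near_all_pts.
Qed.

End Nontransversality.

(** * Rules for directional derivatives of real functions *)

Section Derivations.
Context {R : realType} {V : normedModType R}.

Definition has_derivative (f : V -> R) (x w : V) (d : R) :=
  differentiable f x /\ 'D_w f x = d.

Lemma has_derivative_cst c x w : has_derivative (fun=> c) x w 0.
Proof. by split; [exact: differentiable_cst|exact: derive_cst]. Qed.

Lemma has_derivativeD f g x w a b : has_derivative f x w a -> has_derivative g x w b ->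
  has_derivative (fun y => f y + g y) x w (a + b).
Proof.
move=> [df <-] [dg <-]; split; last exact: deriveD_pt.
exact: (differentiableD df dg).
Qed.

Lemma has_derivativeM f g x w a b : has_derivative f x w a -> has_derivative g x w b ->
  has_derivative (fun y => f y * g y) x w (f x * b + g x * a).
Proof.
move=> [df <-] [dg <-]; split; last exact: deriveM_pt.
exact: (differentiableM df dg).
Qed.

Lemma has_derivativeN f x w a : has_derivative f x w a ->
  has_derivative (fun y => - f y) x w (- a).
Proof.
move=> df; have [d E] := has_derivativeM (has_derivative_cst (-1) x w) df.
have -> : (fun y => - f y) = (fun y => -1 * f y) by apply/funext => y; rewrite mulN1r.
by split; [exact: d|rewrite E; ring].
Qed.

Lemma has_derivativeX f x w a n : has_derivative f x w a ->
  has_derivative (fun y => f y ^+ n.+1) x w (n.+1%:R * f x ^+ n * a).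
Proof.
by move=> [df <-]; split; [exact: differentiableX_pt|exact: deriveX_pt].
Qed.

End Derivations.

Lemma has_derivative_coord (R : realType) n (x w : 'rV[R]_n.+1) j :
  has_derivative (fun v : 'rV[R]_n.+1 => v 0 j) x w (w 0 j).
Proof.
split; first exact: differentiable_coord.
have di : derivable (@id 'rV[R]_n.+1) x w by exact: derivable_id.
by have := derive_coord j di; rewrite derive_id => ->.
Qed.

(** * The Veronese map and the system of four forms *)

Section Hat.
Context {R : realType}.

Definition row2 (a b : R) : 'rV[R]_2 := \row_(i < 2) [:: a; b]`_i.
Definition row4 (a b c d : R) : 'rV[R]_4 := \row_(i < 4) [:: a; b; c; d]`_i.

Definition ver (u : 'rV[R]_3) : 'rV[R]_6 :=
  let x := u 0 0 in let y := u 0 1 in let z := u 0 2 in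
  \row_(j < 6) [:: x ^+ 2; y ^+ 2; z ^+ 2; y * z; x * z; x * y]`_j.

(** Polarization of the Veronese map [ver] without the factor 1/2, so that [pver u u = 2 *: ver u].
    [phat] inherits this, and [phat Q u w = 0] says that [u] and [w] are conjugate for all four
    forms. *)
Definition pver (u w : 'rV[R]_3) : 'rV[R]_6 :=
  \row_(j < 6) [:: 2 * (u 0 0 * w 0 0); 2 * (u 0 1 * w 0 1); 2 * (u 0 2 * w 0 2);
    u 0 1 * w 0 2 + u 0 2 * w 0 1; u 0 0 * w 0 2 + u 0 2 * w 0 0;
    u 0 0 * w 0 1 + u 0 1 * w 0 0]`_j.

Lemma ord3E (P : 'I_3 -> Prop) : P 0 -> P 1 -> P 2 -> forall j, P j.
Proof.
move=> P0 P1 P2 [[|[|[|//]]] i].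
- by have -> : Ordinal i = 0 by exact: val_inj.
- by have -> : Ordinal i = 1 by exact: val_inj.
- by have -> : Ordinal i = 2 by exact: val_inj.
Qed.

Lemma ord4E (P : 'I_4 -> Prop) : P 0 -> P 1 -> P 2 -> P 3 -> forall j, P j.
Proof.
move=> P0 P1 P2 P3 [[|[|[|[|//]]]] i].
- by have -> : Ordinal i = 0 by exact: val_inj.
- by have -> : Ordinal i = 1 by exact: val_inj.
- by have -> : Ordinal i = 2 by exact: val_inj.
- by have -> : Ordinal i = 3 by exact: val_inj.
Qed.

Lemma ord2E (P : 'I_2 -> Prop) : P 0 -> P 1 -> forall j, P j.
Proof.
move=> P0 P1 [[|[|//]] i].
- by have -> : Ordinal i = 0 by exact: val_inj.
- by have -> : Ordinal i = 1 by exact: val_inj.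
Qed.

Lemma sum3E (V : nmodType) (f : 'I_3 -> V) : \sum_i f i = f 0 + f 1 + f 2.
Proof.
rewrite !big_ord_recr big_ord0 /= add0r; congr (f _ + f _ + f _); exact: val_inj.
Qed.

Lemma sum4E (V : nmodType) (f : 'I_4 -> V) : \sum_i f i = f 0 + f 1 + f 2 + f 3.
Proof.
rewrite !big_ord_recr big_ord0 /= add0r; congr (f _ + f _ + f _ + f _); exact: val_inj.
Qed.

Lemma sum2E (V : nmodType) (f : 'I_2 -> V) : \sum_i f i = f 0 + f 1.
Proof.
rewrite !big_ord_recr big_ord0 /= add0r; congr (f _ + f _); exact: val_inj.
Qed.

Lemma row3P (u v : 'rV[R]_3) : u 0 0 = v 0 0 -> u 0 1 = v 0 1 -> u 0 2 = v 0 2 -> u = v.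
Proof. by move=> *; apply/rowP; apply: ord3E. Qed.

Lemma row2P (u v : 'rV[R]_2) : u 0 0 = v 0 0 -> u 0 1 = v 0 1 -> u = v.
Proof. by move=> *; apply/rowP; apply: ord2E. Qed.

Lemma row4P (u v : 'rV[R]_4) :
  u 0 0 = v 0 0 -> u 0 1 = v 0 1 -> u 0 2 = v 0 2 -> u 0 3 = v 0 3 -> u = v.
Proof. by move=> *; apply/rowP; apply: ord4E. Qed.

Lemma row3_eta (u : 'rV[R]_3) : u = row3 (u 0 0) (u 0 1) (u 0 2).
Proof. by apply: row3P; rewrite mxE. Qed.

Lemma row3_mul (n : nat) (x y z : R) (K : 'M[R]_(3, n)) :
  row3 x y z *m K = x *: row 0 K + y *: row 1 K + z *: row 2 K.
Proof. by rewrite mulmx_sum_row sum3E !mxE. Qed.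

Lemma row4_mul (n : nat) (x y z t : R) (K : 'M[R]_(4, n)) :
  row4 x y z t *m K = x *: row 0 K + y *: row 1 K + z *: row 2 K + t *: row 3 K.
Proof. by rewrite mulmx_sum_row sum4E !mxE. Qed.

Lemma dotE (u w : 'rV[R]_3) : dot u w = u 0 0 * w 0 0 + u 0 1 * w 0 1 + u 0 2 * w 0 2.
Proof. by rewrite /dot sum3E. Qed.

Lemma verD u w : ver (u + w) = ver u + pver u w + ver w.
Proof.
by apply/rowP => -[[|[|[|[|[|[|//]]]]]] i]; rewrite !mxE /=; ring.
Qed.

Lemma verZ (a : R) u : ver (a *: u) = a ^+ 2 *: ver u.
Proof.
by apply/rowP => -[[|[|[|[|[|[|//]]]]]] i]; rewrite !mxE /=; ring.
Qed.

Lemma pverC u w : pver u w = pver w u.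
Proof.
by apply/rowP => -[[|[|[|[|[|[|//]]]]]] i]; rewrite !mxE /=; ring.
Qed.

Lemma pverDr u w w' : pver u (w + w') = pver u w + pver u w'.
Proof.
by apply/rowP => -[[|[|[|[|[|[|//]]]]]] i]; rewrite !mxE /=; ring.
Qed.

Lemma pverZr (a : R) u w : pver u (a *: w) = a *: pver u w.
Proof.
by apply/rowP => -[[|[|[|[|[|[|//]]]]]] i]; rewrite !mxE /=; ring.
Qed.

Lemma pver_diag u : pver u u = 2 *: ver u.
Proof.
by apply/rowP => -[[|[|[|[|[|[|//]]]]]] i]; rewrite !mxE /=; ring.
Qed.

Lemma smooth_ver u : smooth_at ver u.
Proof.
apply/smooth_row => -[[|[|[|[|[|[|//]]]]]] i];
  (apply: smooth_at_eq; first (by move=> y; rewrite mxE /=; reflexivity));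
  by repeat first [exact: smooth_coord|apply: smoothX|apply: smoothM].
Qed.

Lemma derive_ver u w : 'D_w ver u = pver u w.
Proof.
have d := smooth_at_differentiable (smooth_ver u).
apply/rowP => j; rewrite derive_coord; last exact: diff_derivable.
have H : has_derivative (fun v => ver v 0 j) u w (pver u w 0 j).
  have c k := has_derivative_coord u w k.
  have E (f g : 'rV[R]_3 -> R) a b : f =1 g -> a = b ->
    has_derivative f u w a -> has_derivative g u w b by move=> /funext -> ->.
  move: j => [[|[|[|[|[|[|//]]]]]] i].
  - by apply: E (has_derivativeX 1 (c 0)) => [y|]; rewrite !mxE /=; ring.
  - by apply: E (has_derivativeX 1 (c 1)) => [y|]; rewrite !mxE /=; ring.
  - by apply: E (has_derivativeX 1 (c 2)) => [y|]; rewrite !mxE /=; ring.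
  - by apply: E (has_derivativeM (c 1) (c 2)) => [y|]; rewrite !mxE /=; ring.
  - by apply: E (has_derivativeM (c 0) (c 2)) => [y|]; rewrite !mxE /=; ring.
  - by apply: E (has_derivativeM (c 0) (c 1)) => [y|]; rewrite !mxE /=; ring.
by case: H.
Qed.

Lemma derive_ver_mul p (B : 'M[R]_(6, p.+1)) u w :
  'D_w (fun v => ver v *m B) u = pver u w *m B.
Proof.
have := derive_linear_comp (mulmxr B) w (smooth_at_differentiable (smooth_ver u)).
by rewrite derive_ver.
Qed.

Lemma smooth_mulmx (V : normedModType R) n p (f : V -> 'rV[R]_n.+1) (B : 'M[R]_(n.+1, p.+1)) x :
  smooth_at f x -> smooth_at (fun y => f y *m B) x.
Proof. by move=> sf; exact: (smooth_comp_row sf (linear_row_smooth (mulmxr B) _)). Qed.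

Variable Q : @net R.
Local Notation F := (net_map Q).

Definition pnet (u w : 'rV[R]_3) : 'rV[R]_3 := pver u w *m Q^T.

(* the columns are the three forms of the net and x^2 + y^2 + z^2 *)
Definition hatm : 'M[R]_(6, 4) := \matrix_(i < 6, j < 4)
  if unlift ord_max j is Some k then Q k i else (i < 3)%:R.

Definition hat (u : 'rV[R]_3) : 'rV[R]_4 := ver u *m hatm.
Definition phat (u w : 'rV[R]_3) : 'rV[R]_4 := pver u w *m hatm.

Lemma net_mapE u : F u = ver u *m Q^T. Proof. by []. Qed.

Lemma hatm_lift i k : hatm i (lift ord_max k) = Q k i.
Proof. by rewrite mxE liftK. Qed.

Lemma hatm_max i : hatm i ord_max = (i < 3)%:R.
Proof. by rewrite mxE unlift_none. Qed.

Lemma mul_hatm_lift (v : 'rV[R]_6) k : (v *m hatm) 0 (lift ord_max k) = (v *m Q^T) 0 k.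
Proof. by rewrite !mxE; apply: eq_bigr => i _; rewrite hatm_lift mxE. Qed.

Lemma mul_hatm_max (v : 'rV[R]_6) :
  (v *m hatm) 0 ord_max = v 0 0 + v 0 1 + v 0 2.
Proof.
rewrite mxE (eq_bigr (fun i : 'I_6 => v 0 i * (i < 3)%:R)); last first.
  by move=> i _; rewrite hatm_max.
rewrite !big_ord_recr big_ord0 /= !mulr0 !mulr1 !addr0 add0r.
by congr (v _ _ + v _ _ + v _ _); exact: val_inj.
Qed.

Lemma hat_lift u k : hat u 0 (lift ord_max k) = F u 0 k.
Proof. exact: mul_hatm_lift. Qed.

Lemma hat_max u : hat u 0 ord_max = dot u u.
Proof. by rewrite mul_hatm_max !mxE /= dotE !expr2. Qed.

Lemma phat_lift u w k : phat u w 0 (lift ord_max k) = pnet u w 0 k.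
Proof. exact: mul_hatm_lift. Qed.

Lemma phat_max u w : phat u w 0 ord_max = 2 * dot u w.
Proof. by rewrite mul_hatm_max !mxE /= dotE !mulrDr. Qed.

Lemma rowmaxP (a b : 'rV[R]_4) :
  (forall k, a 0 (lift ord_max k) = b 0 (lift ord_max k)) ->
  a 0 ord_max = b 0 ord_max -> a = b.
Proof.
by move=> H E; apply/rowP => j; case: (unliftP ord_max j) => [k ->|->].
Qed.

Lemma hatD u w : hat (u + w) = hat u + phat u w + hat w.
Proof. by rewrite /hat verD !mulmxDl. Qed.
Lemma hatZ a u : hat (a *: u) = a ^+ 2 *: hat u.
Proof. by rewrite /hat verZ scalemxAl. Qed.
Lemma phatC u w : phat u w = phat w u. Proof. by rewrite /phat pverC. Qed.
Lemma phatDr u w w' : phat u (w + w') = phat u w + phat u w'.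
Proof. by rewrite /phat pverDr mulmxDl. Qed.
Lemma phatDl u w w' : phat (w + w') u = phat w u + phat w' u.
Proof. by rewrite ![phat _ u]phatC phatDr. Qed.
Lemma phatZr a u w : phat u (a *: w) = a *: phat u w.
Proof. by rewrite /phat pverZr scalemxAl. Qed.
Lemma phatZl a u w : phat (a *: w) u = a *: phat w u.
Proof. by rewrite ![phat _ u]phatC phatZr. Qed.
Lemma phat_diag u : phat u u = 2 *: hat u.
Proof. by rewrite /phat pver_diag scalemxAl. Qed.

Lemma net_mapN u : F (- u) = F u.
Proof. by rewrite !net_mapE -scaleN1r verZ sqrrN expr1n scale1r. Qed.

Lemma net_mapZ a u : F (a *: u) = a ^+ 2 *: F u.
Proof. by rewrite !net_mapE verZ scalemxAl. Qed.

Lemma derive_net u w : 'D_w F u = pnet u w.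
Proof. exact: derive_ver_mul. Qed.

Lemma smooth_net u : smooth_at F u.
Proof. exact: (@smooth_mulmx _ 5 2 ver Q^T u (smooth_ver u)). Qed.

Lemma smooth_hat u : smooth_at hat u.
Proof. exact: (@smooth_mulmx _ 5 3 ver hatm u (smooth_ver u)). Qed.

Lemma derive_hat u w : 'D_w hat u = phat u w.
Proof. exact: derive_ver_mul. Qed.

Lemma pnetDr u w w' : pnet u (w + w') = pnet u w + pnet u w'.
Proof. by rewrite /pnet pverDr mulmxDl. Qed.
Lemma pnetZr a u w : pnet u (a *: w) = a *: pnet u w.
Proof. by rewrite /pnet pverZr scalemxAl. Qed.

Lemma hat_eq u v : sphere u -> sphere v -> (F u = F v <-> hat u = hat v).
Proof.
move=> su sv; split=> E; last by apply/rowP => k; rewrite -!hat_lift E.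
by apply: rowmaxP => [k|]; rewrite ?hat_lift ?E // !hat_max su sv.
Qed.

Lemma phat_eq0 u w : tangent u w -> (pnet u w = 0 <-> phat u w = 0).
Proof.
move=> tw; split=> E.
  by apply: rowmaxP => [k|]; rewrite ?phat_lift ?phat_max ?E ?mxE // tw mulr0.
by apply/rowP => k; rewrite -phat_lift E !mxE.
Qed.

Lemma immersive_hat u : (forall w, phat u w = 0 -> w = 0) -> immersive_at F u.
Proof.
move=> H w tw; apply: contra => /eqP; rewrite derive_net => /(phat_eq0 tw)/H ->.
exact: eqxx.
Qed.

Lemma singular_hat u w : w != 0 -> phat u w = 0 -> singular_at F u.
Proof.
move=> w0 E; have tw : tangent u w.
  have := phat_max u w; rewrite E mxE => /esym/eqP.
  by rewrite mulf_eq0 pnatr_eq0 /= => /eqP.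
by move=> /(_ w tw w0); rewrite derive_net (proj2 (phat_eq0 tw) E) eqxx.
Qed.

(** The last coordinate of [phat u w] is [2 * dot u w], so its vanishing is tangency of [w] to the
    sphere. *)
Lemma tangent_imageP u (a : 'rV[R]_3) :
  tangent_image F u a <->
  exists w, phat u w = \row_j (if unlift ord_max j is Some k then a 0 k else 0).
Proof.
split=> [[w tw <-]|[w E]].
  exists w; apply: rowmaxP => [k|]; rewrite mxE ?liftK ?unlift_none.
    by rewrite phat_lift derive_net.
  by rewrite phat_max tw mulr0.
have Ek k : phat u w 0 (lift ord_max k) = a 0 k by rewrite E mxE liftK.
exists w.
  have := phat_max u w; rewrite E mxE unlift_none => /esym/eqP.
  by rewrite mulf_eq0 pnatr_eq0 /= => /eqP.
by apply/rowP => k; rewrite derive_net -phat_lift.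
Qed.

Lemma dotC (u v : 'rV[R]_3) : dot u v = dot v u.
Proof. by rewrite !dotE; ring. Qed.
Lemma dotDr (u v w : 'rV[R]_3) : dot u (v + w) = dot u v + dot u w.
Proof. by rewrite !dotE !mxE; ring. Qed.
Lemma dotZr (u v : 'rV[R]_3) a : dot u (a *: v) = a * dot u v.
Proof. by rewrite !dotE !mxE; ring. Qed.
Lemma dotZl (u v : 'rV[R]_3) a : dot (a *: u) v = a * dot u v.
Proof. by rewrite !dotE !mxE; ring. Qed.
Lemma dot_ge0 (u : 'rV[R]_3) : 0 <= dot u u.
Proof. by rewrite dotE -!expr2 !addr_ge0 ?sqr_ge0. Qed.
Lemma dot_eq0 (u : 'rV[R]_3) : dot u u = 0 -> u = 0.
Proof.
rewrite dotE -!expr2 => H.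
have := sqr_ge0 (u 0 0); have := sqr_ge0 (u 0 1); have := sqr_ge0 (u 0 2) => h2 h1 h0.
apply: row3P; rewrite mxE; apply/eqP; rewrite -sqrf_eq0; apply/eqP; lra.
Qed.
Lemma dot_gt0 (u : 'rV[R]_3) : u != 0 -> 0 < dot u u.
Proof.
by move=> u0; rewrite lt_neqAle dot_ge0 andbT eq_sym; apply: contra u0 => /eqP/dot_eq0 ->.
Qed.

(** The images of [phat u] and [phat v] share the line of [hat u = hat v], because
    [phat u u = 2 *: hat u]. The radial parts of [w] and [w'] are opposite; removing them makes both
    vectors tangent without changing the sum. *)
Lemma transversal_hat u v : sphere u -> sphere v -> F u = F v ->
  (forall A, exists w w', A = phat u w + phat v w') ->
  forall a, exists b c, [/\ tangent_image F u b, tangent_image F v c & a = b + c].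
Proof.
move=> su sv Fuv H a.
have [w [w' E]] := H (\row_j (if unlift ord_max j is Some k then a 0 k else 0)).
have Em : dot u w + dot v w' = 0.
  have := congr1 (fun A : 'rV[R]_4 => A 0 ord_max) E.
  rewrite mxE unlift_none [RHS]mxE !phat_max -mulrDr => /esym/eqP.
  by rewrite mulf_eq0 pnatr_eq0 /= => /eqP.
pose l := dot u w.
exists (pnet u (w - l *: u)), (pnet v (w' + l *: v)); split.
- exists (w - l *: u); last by rewrite derive_net.
  by rewrite /tangent /= -scaleNr dotDr dotZr su mulr1 subrr.
- exists (w' + l *: v); last by rewrite derive_net.
  by rewrite /tangent /= dotDr dotZr sv mulr1 addrC.
- apply/rowP => k.
  have := congr1 (fun A : 'rV[R]_4 => A 0 (lift ord_max k)) E.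
  rewrite mxE liftK [X in _ = X]mxE !phat_lift => ->.
  rewrite -scaleNr !pnetDr !pnetZr /pnet !pver_diag -!scalemxAl -!net_mapE Fuv !mxE.
  by ring.
Qed.

Lemma tangent_image_eq u v :
  (forall w, exists w', phat u w = phat v w') -> (forall w, exists w', phat v w = phat u w') ->
  tangent_image F u = tangent_image F v.
Proof.
move=> uv vu; apply/seteqP; split=> a /tangent_imageP[w E]; apply/tangent_imageP.
  by have [w' E'] := uv w; exists w'; rewrite -E'.
by have [w' E'] := vu w; exists w'; rewrite -E'.
Qed.

Lemma accelerationE u w : acceleration F u w = 2 *: (F w - dot w w *: F u).
Proof.
rewrite /acceleration derive_net.
have -> : 'D_w F = fun v => pnet v w by apply/funext => v; rewrite derive_net.
have -> : 'D_w (fun v => pnet v w) u = pnet w w.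
  have lin : linear (fun v => pnet v w).
    by move=> a x y; rewrite /pnet ![pver _ w]pverC pverDr pverZr mulmxDl scalemxAl.
  pose L : {linear 'rV[R]_3 -> 'rV[R]_3} :=
    HB.pack (fun v => pnet v w) (GRing.isLinear.Build _ _ _ _ (fun v => pnet v w) lin).
  apply: (derive_linear (L := L)) => x.
  by apply: smooth_at_continuous; exact: linear_row_smooth.
by rewrite /pnet !pver_diag -!scalemxAl -!net_mapE scalerBr !scalerA mulrC.
Qed.

Lemma same_curvatureP u v : sphere u -> sphere v -> F u = F v ->
  (same_curvature F u v <->
   forall w w', phat u w = phat v w' -> exists w'', hat w - hat w' = phat u w'').
Proof.
move=> su sv Fuv.
have hE := proj1 (hat_eq su sv) Fuv.
have key w w' : phat u w = phat v w' -> tangent u w ->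
   tangent_image F u (acceleration F u w - acceleration F v w') <->
   exists w'', hat w - hat w' = phat u w''.
  move=> E tw; rewrite tangent_imageP.
  set d := dot w w - dot w' w'.
  have accE : (\row_j (if unlift ord_max j is Some k
        then (acceleration F u w - acceleration F v w') 0 k else 0)) =
      2 *: (hat w - hat w') - (2 * d) *: hat u.
    apply: rowmaxP => [k|]; rewrite mxE ?liftK ?unlift_none.
      rewrite !accelerationE -Fuv /d.
      move: (hat_lift w k) (hat_lift w' k) (hat_lift u k).
      move: (hat w) (hat w') (hat u) (F w) (F w') (F u) => h1 h2 h3 f1 f2 f3.
      by rewrite !mxE => -> -> ->; ring.
    move: (hat_max w) (hat_max w') (hat_max u); rewrite su /d.
    move: (hat w) (hat w') (hat u) => h1 h2 h3 E1 E2 E3.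
    by rewrite !mxE E1 E2 E3; ring.
  rewrite accE.
  have hu : hat u = phat u (2^-1 *: u).
    by rewrite phatZr phat_diag scalerA mulVf ?scale1r // pnatr_eq0.
  split=> -[w'' Ew].
    exists (2^-1 *: (w'' + (2 * d * 2^-1) *: u)).
    rewrite phatZr phatDr Ew phatZr phat_diag.
    by move: (hat w) (hat w') (hat u) => h1 h2 h3; apply/rowP => j; rewrite !mxE; field.
  exists (2 *: w'' - (2 * d * 2^-1) *: u).
  rewrite -scaleNr phatDr !phatZr phat_diag -Ew.
  by move: (hat w) (hat w') (hat u) => h1 h2 h3; apply/rowP => j; rewrite !mxE; field.
split=> H w w'.
  move=> E; pose l := dot u w.
  have E1 : phat u (w - l *: u) = phat v (w' - l *: v).
    by rewrite -!scaleNr !phatDr !phatZr !phat_diag E hE.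
  have dE : dot u w = dot v w'.
    have := congr1 (fun A : 'rV[R]_4 => A 0 ord_max) E; rewrite !phat_max.
    by move/mulfI; apply; rewrite pnatr_eq0.
  have t1 : tangent u (w - l *: u).
    by rewrite /tangent /= -scaleNr dotDr dotZr su mulr1 subrr.
  have t2 : tangent v (w' - l *: v).
    by rewrite /tangent /= -scaleNr dotDr dotZr sv mulr1 -dE subrr.
  have [|w'' Ew] := proj1 (key _ _ E1 t1).
    apply: (H _ _ t1 t2); rewrite !derive_net; apply/rowP => k.
    by rewrite -!phat_lift E1.
  exists w''; rewrite -Ew -!scaleNr !hatD !hatZ !phatZr hE.
  by rewrite [phat w u]phatC [phat w' v]phatC E; apply/rowP => j; rewrite !mxE; ring.
rewrite !derive_net => tw tw' E.
have Eh : phat u w = phat v w'.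
  by apply: rowmaxP => [k|]; [rewrite !phat_lift E|rewrite !phat_max tw tw'].
exact: (proj2 (key _ _ Eh tw) (H _ _ Eh)).
Qed.

End Hat.

(** * Projective formulation in four homogeneous coordinates *)

Section Projection.
Context {R : realType}.

Lemma near_smooth_neq0 (V : normedModType R) (f : V -> R) x :
  smooth_at f x -> f x != 0 -> \forall y \near x, f y != 0.
Proof.
move=> sf f0; have [|W [Wo Wx _ HW]] := @smooth_open1 _ _ (fun a => a != 0) f x _ sf f0.
  exact: open_neq.
exact: filterS (open_nbhs_nbhs (conj Wo Wx)).
Qed.

Lemma near_smooth_gt0 (V : normedModType R) (f : V -> R) x :
  smooth_at f x -> 0 < f x -> \forall y \near x, 0 < f y.
Proof.
move=> sf f0; have [|W [Wo Wx _ HW]] := @smooth_open1 _ _ (fun a => 0 < a) f x _ sf f0.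
  exact: open_gt.
exact: filterS (open_nbhs_nbhs (conj Wo Wx)).
Qed.

(** An affine chart of projective 3-space. [pr \o hat Q] is invariant under scaling of the source,
    so the sphere can be replaced by affine planes, on which the coordinates are polynomial. *)
Definition pr (A : 'rV[R]_4) : 'rV[R]_3 :=
  \row_k (A 0 (lift ord_max k) / A 0 ord_max).

Lemma sum_lift (V : nmodType) (f : 'I_4 -> V) :
  \sum_i f i = \sum_k f (lift ord_max k) + f ord_max.
Proof.
rewrite big_ord_recr; congr (_ + _); apply: eq_bigr => k _; congr f.
by apply: val_inj; rewrite /= /bump leqNgt ltn_ord.
Qed.

Lemma pr_scale (mu : R) A : mu != 0 -> pr (mu *: A) = pr A.
Proof. by move=> mu0; apply/rowP => k; rewrite !mxE -mulf_div divff // mul1r. Qed.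

Lemma pr_eq (A B : 'rV[R]_4) : A 0 ord_max != 0 -> B 0 ord_max != 0 -> pr A = pr B ->
  A = (A 0 ord_max / B 0 ord_max) *: B.
Proof.
move=> A0 B0 E; apply: rowmaxP => [k|]; rewrite mxE; last by rewrite divfK.
have /rowP/(_ k) := E; rewrite !mxE => /(congr1 ( *%R^~ (A 0 ord_max))).
by rewrite divfK // => ->; rewrite mulrAC; ring.
Qed.

Lemma smooth_pr (V : normedModType R) (A : V -> 'rV[R]_4) x :
  smooth_at A x -> A x 0 ord_max != 0 -> smooth_at (pr \o A) x.
Proof.
move=> /smooth_row sA A0; apply/smooth_row => k.
apply: smooth_at_eq (smoothM (sA (lift ord_max k)) (smoothV (sA ord_max) A0)) => y.
by rewrite !mxE.
Qed.

Definition ncov (l : 'cV[R]_4) : 'cV[R]_3 := \col_k l (lift ord_max k) 0.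

(** For a plane through [A x], the last coefficient is fixed by [A x *m l = 0]. Differentiating the
    identity that [A] is its last coordinate times [pr \o A] then shows that [l] kills the
    derivatives of [A] exactly when [ncov l] kills those of the projection. *)
Lemma pr_conormal (A : 'rV[R]_2 -> 'rV[R]_4) x (l : 'cV[R]_4) :
  smooth_at A x -> A x 0 ord_max != 0 -> A x *m l = 0 ->
  (conormal A x l <-> conormal (pr \o A) x (ncov l)).
Proof.
move=> sA A0 Al.
have sP := smooth_pr sA A0.
have dA := smooth_at_differentiable sA; have dP := smooth_at_differentiable sP.
have sAj j : smooth_at (fun y => A y 0 j) x by move/smooth_row: sA; exact.
have sPj k : smooth_at (fun y => pr (A y) 0 k) x by move/smooth_row: sP; exact.
have DA w k : ('D_w A x) 0 (lift ord_max k) =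
    A x 0 ord_max * ('D_w (pr \o A) x) 0 k + pr (A x) 0 k * ('D_w A x) 0 ord_max.
  rewrite !derive_coord; [|exact: diff_derivable..].
  rewrite -(deriveM_pt (f := fun y => A y 0 ord_max) (g := fun y => pr (A y) 0 k));
    [|exact: smooth_at_differentiable (sAj _)|exact: smooth_at_differentiable (sPj _)].
  apply: near_eq_derive.
  have := near_smooth_neq0 (sAj ord_max) A0.
  by apply: filterS => y y0; rewrite mxE mulrC divfK.
have E0 : \sum_k pr (A x) 0 k * l (lift ord_max k) 0 + l ord_max 0 = 0.
  have : (A x *m l) 0 0 = 0 by rewrite Al mxE.
  rewrite mxE sum_lift => E; apply: (mulfI A0); rewrite mulr0 mulrDr mulr_sumr.
  apply: etrans E; congr (_ + _); apply: eq_bigr => k _.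
  by rewrite mxE mulrA [A x 0 ord_max * _]mulrC divfK.
have key w : ('D_w A x *m l) 0 0 = A x 0 ord_max * ('D_w (pr \o A) x *m ncov l) 0 0.
  rewrite mxE sum_lift (eq_bigr _ (fun k _ => congr1 ( *%R^~ _) (DA w k))).
  have -> : l ord_max 0 = - \sum_k pr (A x) 0 k * l (lift ord_max k) 0.
    by apply/eqP; rewrite -addr_eq0 addrC E0.
  rewrite [in RHS]mxE mulr_sumr mulrN mulr_sumr -sumrB; apply: eq_bigr => k _.
  by rewrite [ncov l k 0]mxE; ring.
split=> H w; apply/matrixP => i j; rewrite !ord1 [RHS]mxE.
  by have := key w; rewrite H mxE => /esym/eqP; rewrite mulf_eq0 (negbTE A0) => /eqP.
by rewrite key H mxE mulr0.
Qed.

Lemma conormal_mulmx (B : 'rV[R]_2 -> 'rV[R]_4) (M : 'M[R]_4) x l :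
  differentiable B x -> conormal B x (M *m l) <-> conormal (fun y => B y *m M) x l.
Proof.
move=> dB.
have E w : 'D_w (fun y => B y *m M) x = 'D_w B x *m M.
  exact: (derive_linear_comp (mulmxr M) w dB).
by split=> H w; have := H w; rewrite E mulmxA.
Qed.

Lemma nontransversal_hat (A : 'rV[R]_2 -> 'rV[R]_4) :
  (forall x, smooth_at A x) -> A 0 0 ord_max != 0 ->
  (forall V, nbhs (0 : 'rV[R]_2) V -> exists x y mu l,
    [/\ V x, V y, x != y & A x = mu *: A y] /\
    [/\ l != 0, A x *m l = 0, A y *m l = 0, conormal A x l & conormal A y l]) ->
  nontransversal_near (pr \o A).
Proof.
move=> sA A0 H V V0.
have sAm : smooth_at (fun y => A y 0 ord_max) 0 by have /smooth_row := sA 0; exact.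
have N : \forall y \near (0 : 'rV[R]_2), A y 0 ord_max != 0.
    exact: near_smooth_neq0 sAm A0.
have [x [y [mu [l [[[Vx x0] [Vy y0] xy E] [l0 Axl Ayl cx cy]]]]]] := H _ (nbhsI2 V0 N).
have mu0 : mu != 0.
  by apply: contra x0 => /eqP mu0; rewrite E mu0 scale0r mxE.
exists x, y, (ncov l); split; split => //=.
- by rewrite E pr_scale.
- apply: contra l0 => /eqP n0.
  have lk k : l (lift ord_max k) 0 = 0.
    by have /matrixP/(_ k 0) := n0; rewrite !mxE.
  have : (A x *m l) 0 0 = 0 by rewrite Axl mxE.
  rewrite mxE sum_lift big1 ?add0r => [/eqP|k _]; last by rewrite lk mulr0.
  rewrite mulf_eq0 (negbTE x0) /= => /eqP lm.
  apply/eqP/matrixP => i j; rewrite [j]ord1 [RHS]mxE.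
  by case: (unliftP ord_max i) => [k ->|->].
- exact/pr_conormal.
- exact/pr_conormal.
Qed.

Lemma not_nontransversal_hat (A : 'rV[R]_2 -> 'rV[R]_4) :
  smooth_at A 0 -> 0 < A 0 0 ord_max ->
  (\forall x \near (0 : 'rV[R]_2), True) ->
  (exists2 V, nbhs (0 : 'rV[R]_2) V & forall x y mu l, V x -> V y -> x != y -> 0 < mu ->
    A x = mu *: A y -> A x *m l = 0 -> A y *m l = 0 -> conormal A x l -> conormal A y l ->
    l = 0) ->
  ~ nontransversal_near (pr \o A).
Proof.
move=> sA A0 _ [V V0 H] NT.
have sAm : smooth_at (fun y => A y 0 ord_max) 0 by have /smooth_row := sA; exact.
have N : \forall y \near (0 : 'rV[R]_2), 0 < A y 0 ord_max.
    exact: near_smooth_gt0 sAm A0.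
have [x [y [n [[[Vx [x0 sx]] [Vy [y0 sy]] xy E] [n0 cx cy]]]]] :=
  NT _ (nbhsI2 V0 (nbhsI2 N (smooth_at_near sA))).
pose s := \sum_k pr (A x) 0 k * n k 0.
pose l : 'cV[R]_4 := \col_j (if unlift ord_max j is Some k then n k 0 else - s).
have nl : ncov l = n.
  by apply/matrixP => i j; rewrite [j]ord1 !mxE liftK.
have Al z : pr (A z) = pr (A x) -> 0 < A z 0 ord_max -> A z *m l = 0.
  move=> Ez z0; apply/matrixP => i j; rewrite !ord1 [RHS]mxE mxE sum_lift.
  rewrite [l ord_max 0]mxE unlift_none mulrN /s mulr_sumr -sumrB big1 // => k _.
  by rewrite mxE liftK -Ez mxE mulrA [A z 0 ord_max * _]mulrC divfK ?gt_eqF // subrr.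
have x0' : A x 0 ord_max != 0 by rewrite gt_eqF.
have y0' : A y 0 ord_max != 0 by rewrite gt_eqF.
move/eqP: n0; apply; rewrite -nl.
suff -> : l = 0 by apply/matrixP => i j; rewrite !mxE.
apply: (H x y (A x 0 ord_max / A y 0 ord_max)) => //.
- by rewrite divr_gt0.
- exact: pr_eq.
- exact: Al.
- by apply: Al => //; rewrite -E.
- by apply/pr_conormal => //; [exact: Al|rewrite nl].
- by apply/pr_conormal => //; [apply: Al => //; rewrite -E|rewrite nl].
Qed.

Definition nontransversal_model (B : 'rV[R]_2 -> 'rV[R]_4) :=
  forall V, nbhs (0 : 'rV[R]_2) V -> exists x y mu (l : 'cV[R]_4),
    [/\ V x, V y, x != y & B x = mu *: B y] /\
    [/\ l != 0, B x *m l = 0, B y *m l = 0, conormal B x l & conormal B y l].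

(** Equality of projective images is equality up to a factor [mu]. Near 0 the last coordinates are
    positive after the change of basis, whence [0 < mu]; [model6y_perturbation] uses this sign. *)
Definition transversal_model (B : 'rV[R]_2 -> 'rV[R]_4) :=
  exists2 V, nbhs (0 : 'rV[R]_2) V & forall x y mu (l : 'cV[R]_4),
    V x -> V y -> x != y -> 0 < mu -> B x = mu *: B y ->
    B x *m l = 0 -> B y *m l = 0 -> conormal B x l -> conormal B y l -> l = 0.

Lemma nontransversal_of_model B (M : 'M[R]_4) :
  M \in unitmx -> (forall x, smooth_at B x) -> (B 0 *m M) 0 ord_max != 0 ->
  nontransversal_model B -> nontransversal_near (fun x => pr (B x *m M)).
Proof.
move=> uM sB B0 H; apply: (@nontransversal_hat (fun x => B x *m M)) => // [x|V V0].
  exact: smooth_mulmx.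
have [x [y [mu [l [[Vx Vy xy E] [l0 Bx By cx cy]]]]]] := H V V0.
have Ml : M *m (invmx M *m l) = l by rewrite mulKVmx.
exists x, y, mu, (invmx M *m l); split; split => //.
- by rewrite E scalemxAl.
- by apply: contra l0 => /eqP E0; rewrite -Ml E0 mulmx0.
- by rewrite -mulmxA Ml.
- by rewrite -mulmxA Ml.
- by rewrite -Ml in cx; exact: (proj1 (conormal_mulmx M _ (smooth_at_differentiable (sB x))) cx).
- by rewrite -Ml in cy; exact: (proj1 (conormal_mulmx M _ (smooth_at_differentiable (sB y))) cy).
Qed.

Lemma not_nontransversal_of_model B (M : 'M[R]_4) :
  M \in unitmx -> (forall x, smooth_at B x) -> 0 < (B 0 *m M) 0 ord_max ->
  transversal_model B -> ~ nontransversal_near (fun x => pr (B x *m M)).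
Proof.
move=> uM sB B0 [V V0 H].
apply: (@not_nontransversal_hat (fun x => B x *m M)) => //.
- exact: smooth_mulmx.
- exact: near_all_pts.
exists V => // x y mu l Vx Vy xy mu0 E Bx By cx cy.
have : M *m l = 0.
  apply: (H x y mu) => //.
  - by have := congr1 (mulmx^~ (invmx M)) E; rewrite -scalemxAl !mulmxK.
  - by rewrite mulmxA.
  - by rewrite mulmxA.
  - exact: (proj2 (conormal_mulmx M l (smooth_at_differentiable (sB x))) cx).
  - exact: (proj2 (conormal_mulmx M l (smooth_at_differentiable (sB y))) cy).
by move=> /(congr1 (mulmx (invmx M))); rewrite mulKmx // mulmx0.
Qed.

(** The perturbation is made on the homogeneous coordinates, where the models are polynomial, and
    then carried through the change of basis [M] and the projection. *)
Lemma not_finitely_determined_model (B : 'rV[R]_2 -> 'rV[R]_4) (M : 'M[R]_4)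
    (g : 'rV[R]_2 -> 'rV[R]_3) (theta : 'rV[R]_2 -> 'rV[R]_2) :
  M \in unitmx -> (forall x, smooth_at B x) -> 0 < (B 0 *m M) 0 ord_max ->
  local_diffeo theta 0 -> theta 0 = 0 ->
  (\forall x \near (0 : 'rV[R]_2), g x = pr (B (theta x) *m M)) ->
  nontransversal_model B ->
  (forall k, exists (b : 'rV[R]_2 -> R) (rho : 'rV[R]_2 -> 'rV[R]_4),
    [/\ forall x, smooth_at b x, forall x, smooth_at rho x, b 0 = 0 &
      transversal_model (fun x => B x + b x ^+ k.+1 *: rho x)]) ->
  ~ finitely_determined g.
Proof.
move=> uM sB B0 dth th0 E NT H.
have sA x : smooth_at (fun x => B x *m M) x by exact: smooth_mulmx.
have A0 : (B 0 *m M) 0 ord_max != 0 by rewrite gt_eqF.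
apply: (@not_finitely_determined R (fun x => pr (B x *m M)) g theta) => //.
- exact: smooth_pr (sA 0) A0.
- exact: nontransversal_of_model.
move=> k; have [b [rho [sb sr b0 T]]] := H k.
pose B' x := B x + b x ^+ k.+1 *: rho x.
have B'0 : B' 0 = B 0 by rewrite /B' b0 expr0n /= scale0r addr0.
have sB' x : smooth_at B' x.
  apply/smooth_row => j; have /smooth_row/(_ j) s1 := sB x; have /smooth_row/(_ j) s2 := sr x.
  by apply: smooth_at_eq (smoothD s1 (smoothM (smoothX k.+1 (sb x)) s2)) => y; rewrite !mxE.
pose A x := B x *m M; pose r x := rho x *m M.
have sr' x : smooth_at r x by exact: smooth_mulmx.
have B'm0 : (B' 0 *m M) 0 ord_max != 0 by rewrite B'0.
(* The difference of the two quotients, put over a common denominator, has the factor [b x ^+ k.+1];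
   the cofactor is this row, smooth at 0 because both denominators are nonzero there. *)
exists (fun x => pr (B' x *m M)), b, (fun x => \row_k
  ((r x 0 (lift ord_max k) * A x 0 ord_max - A x 0 (lift ord_max k) * r x 0 ord_max)
   / ((B' x *m M) 0 ord_max * A x 0 ord_max))); split => //.
- apply/smooth_row => j.
  have sAj i : smooth_at (fun x => A x 0 i) 0 by have /smooth_row := sA 0; exact.
  have srj i : smooth_at (fun x => r x 0 i) 0 by have /smooth_row := sr' 0; exact.
  have sB'j : smooth_at (fun x => (B' x *m M) 0 ord_max) 0.
    by have /smooth_row := @smooth_mulmx R _ 3 3 B' M 0 (sB' 0); exact.
  apply: smooth_at_eq (smoothM (smoothB (smoothM (srj (lift ord_max j)) (sAj ord_max))
    (smoothM (sAj (lift ord_max j)) (srj ord_max)))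
    (smoothV (smoothM sB'j (sAj ord_max)) _)); last by rewrite mulf_neq0.
  by move=> y; rewrite [RHS]mxE.
- have sAm : smooth_at (fun y => A y 0 ord_max) 0 by have /smooth_row := sA 0; exact.
  have N1 : \forall y \near (0 : 'rV[R]_2), A y 0 ord_max != 0.
    exact: near_smooth_neq0 sAm A0.
  have sBm : smooth_at (fun y => (B' y *m M) 0 ord_max) 0.
    by have /smooth_row := @smooth_mulmx R _ 3 3 B' M 0 (sB' 0); exact.
  have N2 : \forall y \near (0 : 'rV[R]_2), (B' y *m M) 0 ord_max != 0.
    exact: near_smooth_neq0 sBm B'm0.
  apply: filterS (nbhsI2 N1 N2) => y [y1 y2]; apply/rowP => j.
  move: y2; have -> : B' y *m M = A y + b y ^+ k.+1 *: r y.
    by rewrite /B' mulmxDl scalemxAl.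
  rewrite /A in y1 *; move: y1; move: (B y *m M) (r y) (b y ^+ k.+1) => a c d.
  rewrite !mxE => y1 y2; field; by rewrite y1 y2.
- by apply: not_nontransversal_of_model => //; rewrite B'0.
Qed.

Lemma derive_row4 (f0 f1 f2 f3 : 'rV[R]_2 -> R) x w d0 d1 d2 d3 :
  has_derivative f0 x w d0 -> has_derivative f1 x w d1 ->
  has_derivative f2 x w d2 -> has_derivative f3 x w d3 ->
  'D_w (fun y => row4 (f0 y) (f1 y) (f2 y) (f3 y)) x = row4 d0 d1 d2 d3.
Proof.
move=> [D0 <-] [D1 <-] [D2 <-] [D3 <-].
set f := fun y => _.
have E j : (fun y => f y 0 j) = [eta [:: f0; f1; f2; f3]`_j].
  by apply/funext => y; rewrite mxE; move: j; apply: ord4E.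
have df : differentiable f x.
  by apply/differentiable_rowP => j; rewrite E; move: j; apply: ord4E.
apply/rowP => j; rewrite derive_coord ?E; last exact: diff_derivable.
by rewrite mxE; move: j; apply: ord4E.
Qed.

Lemma smooth_row4 (V : normedModType R) (f0 f1 f2 f3 : V -> R) x :
  smooth_at f0 x -> smooth_at f1 x -> smooth_at f2 x -> smooth_at f3 x ->
  smooth_at (fun y => row4 (f0 y) (f1 y) (f2 y) (f3 y)) x.
Proof.
move=> s0 s1 s2 s3; apply/smooth_row.
by apply: ord4E; [apply: smooth_at_eq s0|apply: smooth_at_eq s1|apply: smooth_at_eq s2|
  apply: smooth_at_eq s3] => y; rewrite mxE.
Qed.

Lemma smooth_row3 (V : normedModType R) (f0 f1 f2 : V -> R) x :
  smooth_at f0 x -> smooth_at f1 x -> smooth_at f2 x ->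
  smooth_at (fun y => row3 (f0 y) (f1 y) (f2 y)) x.
Proof.
move=> s0 s1 s2; apply/smooth_row.
by apply: ord3E; [apply: smooth_at_eq s0|apply: smooth_at_eq s1|apply: smooth_at_eq s2]
  => y; rewrite mxE.
Qed.

Lemma smooth_row2 (V : normedModType R) (f0 f1 : V -> R) x :
  smooth_at f0 x -> smooth_at f1 x -> smooth_at (fun y => row2 (f0 y) (f1 y)) x.
Proof.
move=> s0 s1; apply/smooth_row.
by apply: ord2E; [apply: smooth_at_eq s0|apply: smooth_at_eq s1] => y; rewrite mxE.
Qed.

Lemma nbhs0_ball2 (V : set 'rV[R]_2) : nbhs (0 : 'rV[R]_2) V ->
  exists2 r : R, 0 < r & forall a b, `|a| < r -> `|b| < r -> V (row2 a b).
Proof.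
move=> /nbhs_ballP[r /= r0 H]; exists (r / 2); first by rewrite divr_gt0.
move=> a b ar br; apply: H; rewrite -ball_normE /= sub0r normrN.
apply: (@le_lt_trans _ _ (r / 2)); last by rewrite ltr_pdivrMr // ltr_pMr // ltr1n.
apply: mxnorm_le; first by rewrite divr_ge0 // ltW.
by apply: ord2E; rewrite mxE /= ltW.
Qed.

Lemma ball2_nbhs0 (r : R) : 0 < r ->
  nbhs (0 : 'rV[R]_2) [set x : 'rV[R]_2 | `|x 0 0| < r /\ `|x 0 1| < r].
Proof.
move=> r0; apply/nbhs_ballP; exists r => //= x.
rewrite -ball_normE /= sub0r normrN => xr.
by split; apply: le_lt_trans xr; exact: mxnorm_coord.
Qed.

End Projection.

Ltac smooth_tac := repeat first [exact: smooth_cst|exact: smooth_coord|apply: smoothX|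
  apply: smoothN|apply: smoothM|apply: smoothD].

(** * Models of germs that are not finitely determined *)

Section Models.
Context {R : realType}.

(* y^(2 n + 1), written so that its sign is visible *)
Definition oddpow (n : nat) (y : R) : R := y * (y ^+ n) ^+ 2.

Lemma oddpowN n y : oddpow n (- y) = - oddpow n y.
Proof.
by rewrite /oddpow -!exprM !(mulnC _ 2) !exprM sqrrN mulNr.
Qed.

Lemma oddpow_mono n y z : y != z -> 0 < (oddpow n y - oddpow n z) * (y - z).
Proof.
wlog yz : y z / y < z => [H|_].
  rewrite neq_lt => /orP[] yz; first by apply: H => //; rewrite lt_eqF.
  by rewrite -mulrNN !opprB; apply: H => //; rewrite lt_eqF.
rewrite -mulrNN !opprB mulr_gt0 ?subr_gt0 //.
have pos a b : 0 <= a -> a < b -> oddpow n a < oddpow n b.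
  move=> a0 ab; rewrite /oddpow; apply: (@le_lt_trans _ _ (a * (b ^+ n) ^+ 2)).
    rewrite ler_wpM2l // lerXn2r ?nnegrE ?exprn_ge0 // ?(le_trans a0 (ltW ab)) //.
    by rewrite lerXn2r ?nnegrE ?(le_trans a0 (ltW ab)) // ltW.
  by rewrite ltr_pM2r // !exprn_gt0 // (le_lt_trans a0 ab).
have [y0|y0] := leP 0 y; first exact: pos.
have [z0|z0] := leP z 0.
  by have := pos (- z) (- y); rewrite !oddpowN oppr_ge0 !ltrN2; apply.
apply: (@lt_trans _ _ 0).
  by rewrite /oddpow pmulr_llt0 // exprn_even_gt0 //= expf_eq0 lt_eqF ?andbF.
by rewrite /oddpow mulr_gt0 // !exprn_gt0.
Qed.

Lemma oddpow_derivative (V : normedModType R) n (f : V -> R) x w a : has_derivative f x w a ->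
  has_derivative (fun y => oddpow n.+1 (f y)) x w ((2 * n.+1 + 1)%:R * (f x ^+ n.+1) ^+ 2 * a).
Proof.
move=> df; have := has_derivativeM df (has_derivativeX 1 (has_derivativeX n df)).
rewrite /oddpow => -[d e]; split => //.
by rewrite e natrD natrM !exprS; ring.
Qed.

Lemma conormal_row4 (f : 'rV[R]_2 -> 'rV[R]_4) x w d0 d1 d2 d3 (l : 'cV[R]_4) :
  conormal f x l -> 'D_w f x = row4 d0 d1 d2 d3 ->
  d0 * l 0 0 + d1 * l 1 0 + d2 * l 2 0 + d3 * l 3 0 = 0.
Proof.
move=> cx E; have /matrixP/(_ 0 0) := cx w.
by rewrite E mxE sum4E !mxE.
Qed.

Lemma mul_row4_col a b c d (l : 'cV[R]_4) :
  (row4 a b c d *m l) 0 0 = a * l 0 0 + b * l 1 0 + c * l 2 0 + d * l 3 0.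
Proof. by rewrite mxE sum4E !mxE. Qed.

Lemma col4P (l : 'cV[R]_4) : l 0 0 = 0 -> l 1 0 = 0 -> l 2 0 = 0 -> l 3 0 = 0 -> l = 0.
Proof.
move=> *; apply/matrixP => i j; rewrite [j]ord1 [RHS]mxE.
by move: i; apply: ord4E.
Qed.

Lemma mulmx_delta_col n (A : 'rV[R]_n) j : A *m (delta_mx j 0 : 'cV[R]_n) = (A 0 j)%:M.
Proof.
apply/matrixP => i k; rewrite !ord1 [RHS]mxE eqxx mulr1n mxE (bigD1 j) //= mxE !eqxx mulr1.
by rewrite big1 ?addr0 // => m /negbTE mj; rewrite mxE mj /= mulr0.
Qed.

Lemma delta_col_neq0 j : (delta_mx j 0 : 'cV[R]_4) != 0.
Proof. by apply/eqP => /matrixP/(_ j 0)/eqP; rewrite !mxE !eqxx oner_eq0. Qed.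

Lemma row4_eq a b c d a' b' c' d' (mu : R) :
  row4 a b c d = mu *: row4 a' b' c' d' ->
  [/\ a = mu * a', b = mu * b', c = mu * c' & d = mu * d'].
Proof.
by move=> /rowP E; split; [have := E 0|have := E 1|have := E 2|have := E 3]; rewrite !mxE.
Qed.

Lemma two_points (V : set 'rV[R]_2) : nbhs (0 : 'rV[R]_2) V ->
  exists t : R, [/\ t != 0, V (row2 t 0), V (row2 (- t) 0), V (row2 0 t) & V (row2 0 (- t))].
Proof.
move=> /nbhs0_ball2[r r0 H]; exists (r / 2).
have r2 : `|r / 2| < r.
  by rewrite ger0_norm ?divr_ge0 ?ltW // ltr_pdivrMr // ltr_pMr // ltr1n.
split; first by rewrite gt_eqF // divr_gt0.
all: by apply: H; rewrite ?normrN ?normr0.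
Qed.

Lemma row2_neq (a b c d : R) : (a != c) || (b != d) -> row2 a b != row2 c d.
Proof.
move=> H; apply/eqP => E; have /rowP/(_ 0) := E; have /rowP/(_ 1) := E.
by rewrite !mxE /= => e1 e0; move: H; rewrite e0 e1 !eqxx.
Qed.

Lemma neq_opp (t : R) : t != 0 -> t != - t.
Proof. by move=> t0; rewrite -subr_eq0 opprK -mulr2n mulrn_eq0. Qed.

(** The normal form [G5] of type 5 on the affine plane where the first coordinate is 1, at an end of
    the tangent double point curve; that curve is [p 0 1 = 0]. *)
Definition model5 (p : 'rV[R]_2) : 'rV[R]_4 :=
  row4 1 (p 0 0 ^+ 2) (p 0 1 ^+ 2) (p 0 1 * (1 - p 0 0)).

Lemma smooth_model5 x : smooth_at model5 x.
Proof. by apply: smooth_row4; smooth_tac. Qed.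

Lemma model5_nontransversal : nontransversal_model model5.
Proof.
have D (p w : 'rV[R]_2) := derive_row4 (has_derivative_cst 1 p w)
  (has_derivativeX 1 (has_derivative_coord p w 0)) (has_derivativeX 1 (has_derivative_coord p w 1))
  (has_derivativeM (has_derivative_coord p w 1)
    (has_derivativeD (has_derivative_cst 1 p w) (has_derivativeN (has_derivative_coord p w 0)))).
move=> V /two_points[t [t0 V1 V2 _ _]].
exists (row2 t 0), (row2 (- t) 0), 1, (delta_mx 2 0); split; split => //.
- by apply: row2_neq; rewrite neq_opp.
- by rewrite scale1r /model5 !mxE /=; congr row4; ring.
- exact: delta_col_neq0.
- by rewrite mulmx_delta_col !mxE /= expr0n /= raddf0.
- by rewrite mulmx_delta_col !mxE /= expr0n /= raddf0.
- by move=> w; rewrite mulmx_delta_col /model5 D !mxE /= ?(mulr0, mul0r) raddf0.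
- by move=> w; rewrite mulmx_delta_col /model5 D !mxE /= ?(mulr0, mul0r) raddf0.
Qed.

(** The third coordinate gains a term of degree [2 * k + 3], odd for every [k], which tells [t] from
    [- t]. For points [(t, a)] and [(- t, b)] with the same image, eliminating [b] gives [t * (4 * a
    ^+ 2 + 2 * q * (1 + t) ^+ 2) = 0] with [q] positive unless [t = 0]. So no double point is left
    nearby, and the condition on conormals holds vacuously. *)
Lemma model5_perturbation k : exists (b : 'rV[R]_2 -> R) (rho : 'rV[R]_2 -> 'rV[R]_4),
  [/\ forall x, smooth_at b x, forall x, smooth_at rho x, b 0 = 0 &
    transversal_model (fun x => model5 x + b x ^+ k.+1 *: rho x)].
Proof.
exists (fun p => p 0 0), (fun p => row4 0 0 (p 0 0 ^+ k.+1 * p 0 0) 0); split.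
- by move=> x; exact: smooth_coord.
- by move=> x; apply: smooth_row4; smooth_tac.
- by rewrite mxE.
exists [set x : 'rV[R]_2 | `|x 0 0| < 1 /\ `|x 0 1| < 1]; first exact: ball2_nbhs0.
have E (p : 'rV[R]_2) : model5 p + p 0 0 ^+ k.+1 *: row4 0 0 (p 0 0 ^+ k.+1 * p 0 0) 0 =
  row4 1 (p 0 0 ^+ 2) (p 0 1 ^+ 2 + oddpow k.+1 (p 0 0)) (p 0 1 * (1 - p 0 0)).
  by apply: row4P; rewrite !mxE /= /oddpow; ring.
move=> x y mu l [x0 _] [y0 _] xy _; rewrite !E => /row4_eq[].
rewrite mulr1 => <-; rewrite !mul1r => E1 E2 E3 _ _ _ _; exfalso.
move/eqP: xy; apply; move: E1 E2 E3 x0 y0.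
move: (x 0 0) (x 0 1) (y 0 0) (y 0 1) (@row2P R x y) => t a s b P E1 E2 E3.
rewrite !ltr_norml => /andP[t1 t2] /andP[s1 s2].
have : (t - s) * (t + s) = 0 by rewrite mulrDr mulrBl mulrBl -!expr2 E1; ring.
move/eqP; rewrite mulf_eq0 => /orP[/eqP ts|/eqP ts].
  have ts' : t = s by lra.
  apply: P => //; rewrite ts' in E3.
  have s1' : 1 - s != 0 by apply/eqP; lra.
  exact: (mulIf s1').
have {}ts : s = - t by lra.
have [t0|t0] := eqVneq t 0.
  by apply: P; [|move: E3]; rewrite ts t0 !oppr0 // addr0 !mulr1.
exfalso; move: E2 E3; rewrite ts oddpowN opprK /oddpow.
have : 0 < (t ^+ k.+1) ^+ 2 by rewrite exprn_even_gt0 //= expf_neq0.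
move: ((t ^+ k.+1) ^+ 2) => q q0 E2 E3.
have E3' : a ^+ 2 * (1 - t) ^+ 2 = b ^+ 2 * (1 + t) ^+ 2 by rewrite -!exprMn E3.
have bE : b ^+ 2 = a ^+ 2 + 2 * (t * q) by lra.
have : t * (4 * a ^+ 2 + 2 * q * (1 + t) ^+ 2) = 0 by rewrite bE in E3'; lra.
move/eqP; rewrite mulf_eq0 (negbTE t0) /= gt_eqF // ltr_wpDl //.
  by rewrite mulr_ge0 ?sqr_ge0.
by rewrite !mulr_gt0 //; lra.
Qed.

(** The normal form [G6] on the plane where the second coordinate is 1. The two ends of the tangent
    curve of type 6 need different models; the other one is [model6z], with third coordinate 1. *)
Definition model6y (p : 'rV[R]_2) : 'rV[R]_4 :=
  row4 (p 0 0 ^+ 2) (p 0 1 ^+ 2) (p 0 0) (p 0 0 * p 0 1 - 1).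

Lemma smooth_model6y x : smooth_at model6y x.
Proof. by apply: smooth_row4; smooth_tac. Qed.

Lemma model6y_nontransversal : nontransversal_model model6y.
Proof.
have D (p w : 'rV[R]_2) := derive_row4
  (has_derivativeX 1 (has_derivative_coord p w 0)) (has_derivativeX 1 (has_derivative_coord p w 1))
  (has_derivative_coord p w 0)
  (has_derivativeD (has_derivativeM (has_derivative_coord p w 0) (has_derivative_coord p w 1))
     (has_derivative_cst (-1) p w)).
move=> V /two_points[t [t0 _ _ V1 V2]].
exists (row2 0 t), (row2 0 (- t)), 1, (delta_mx 0 0); split; split => //.
- by apply: row2_neq; rewrite neq_opp ?orbT.
- by rewrite scale1r /model6y !mxE /=; congr row4; ring.
- exact: delta_col_neq0.
- by rewrite mulmx_delta_col !mxE /= expr0n /= raddf0.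
- by rewrite mulmx_delta_col !mxE /= expr0n /= raddf0.
- by move=> w; rewrite mulmx_delta_col /model6y D !mxE /= ?(mulr0, mul0r) raddf0.
- by move=> w; rewrite mulmx_delta_col /model6y D !mxE /= ?(mulr0, mul0r) raddf0.
Qed.

(** With [x = p 0 0] and [z = p 0 1], the pairs [(0, z)], [(0, - z)] survive, but the added term
    makes their sheets transversal. For [x != 0], a coincidence gives [mu * (oddpow k.+1 z - oddpow
    k.+1 z') = x ^+ 2 * (z' - z)], against monotonicity of odd powers. *)
Lemma model6y_perturbation k : exists (b : 'rV[R]_2 -> R) (rho : 'rV[R]_2 -> 'rV[R]_4),
  [/\ forall x, smooth_at b x, forall x, smooth_at rho x, b 0 = 0 &
    transversal_model (fun x => model6y x + b x ^+ k.+1 *: rho x)].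
Proof.
exists (fun p => p 0 1), (fun p => row4 (- (p 0 0 * (p 0 1 ^+ k.+1 * p 0 1))) 0 0 0); split.
- by move=> x; exact: smooth_coord.
- by move=> x; apply: smooth_row4; smooth_tac.
- by rewrite mxE.
have E : (fun p : 'rV[R]_2 => model6y p + p 0 1 ^+ k.+1 *:
    row4 (- (p 0 0 * (p 0 1 ^+ k.+1 * p 0 1))) 0 0 0) =
  (fun p => row4 (p 0 0 ^+ 2 + - (p 0 0 * oddpow k.+1 (p 0 1))) (p 0 1 ^+ 2) (p 0 0)
    (p 0 0 * p 0 1 - 1)).
  by apply/funext => p; apply: row4P; rewrite !mxE /= /oddpow; ring.
rewrite E; exists setT; first exact: filterT.
move=> x y mu l _ _ xy mu0 /row4_eq[E0 E1 E2 E3] Bx _ cx cy.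
have [x0|x0] := eqVneq (x 0 0) 0; last first.
  exfalso; move/eqP: xy; apply.
  move: x0 E0 E1 E2 E3; move: (x 0 0) (x 0 1) (y 0 0) (y 0 1) (@row2P R x y).
  move=> a z a' z' P a0 E0 E1 E2 E3.
  have H : a - oddpow k.+1 z = a' - oddpow k.+1 z'.
    apply: (mulfI a0).
    have E0' : a * (a - oddpow k.+1 z) = mu * a' * (a' - oddpow k.+1 z') by lra.
    by rewrite E0' -E2.
  have M : mu - 1 = a * (z' - z) by have := congr1 ( *%R^~ z') E2; rewrite /= => e; lra.
  have D : mu * (oddpow k.+1 z - oddpow k.+1 z') = a ^+ 2 * (z' - z).
    have -> : oddpow k.+1 z - oddpow k.+1 z' = a - a' by lra.
    by rewrite mulrBr -E2 expr2 -mulrA -M; ring.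
  have [zz|zz] := eqVneq z z'.
    have m1 : mu = 1 by move: M; rewrite zz subrr mulr0; lra.
    by apply: P => //; rewrite E2 m1 mul1r.
  have := mulr_gt0 mu0 (oddpow_mono k.+1 zz); rewrite mulrA D.
  have := mulr_ge0 (sqr_ge0 a) (sqr_ge0 (z - z')).
  rewrite !expr2 => h1 h2; suff : (0 : R) < 0 by rewrite ltxx.
  lra.
have y0 : y 0 0 = 0.
  by apply/eqP; move/esym/eqP: E2; rewrite x0 mulf_eq0 (gt_eqF mu0).
have mu1 : mu = 1 by move: E3; rewrite x0 y0 !mul0r; lra.
have y1 : y 0 1 = - x 0 1.
  move: E1; rewrite mu1 mul1r => /eqP; rewrite eqf_sqr => /orP[/eqP e|/eqP ->]; last by rewrite opprK.
  by move/eqP: xy; case; apply: row2P; rewrite // x0 y0.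
have z0 : x 0 1 != 0.
  by apply/eqP => e; move/eqP: xy; apply; apply: row2P; rewrite ?x0 ?y0 // y1 e oppr0.
have D (p w : 'rV[R]_2) := derive_row4
  (has_derivativeD (has_derivativeX 1 (has_derivative_coord p w 0))
    (has_derivativeN (has_derivativeM (has_derivative_coord p w 0)
      (oddpow_derivative k (has_derivative_coord p w 1)))))
  (has_derivativeX 1 (has_derivative_coord p w 1)) (has_derivative_coord p w 0)
  (has_derivativeD (has_derivativeM (has_derivative_coord p w 0) (has_derivative_coord p w 1))
     (has_derivative_cst (-1) p w)).
have c1 := conormal_row4 cx (D x (row2 0 1)).
have c2 := conormal_row4 cx (D x (row2 1 0)).
have c3 := conormal_row4 cy (D y (row2 1 0)).
have Bl := congr1 (fun m : 'M_1 => m 0 0) Bx; rewrite /= mul_row4_col mxE in Bl.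
move: c1 c2 c3 Bl; rewrite !mxE /= x0 y0 y1 oddpowN !(mul0r, mulr0, mulr1, add0r, addr0, oppr0, expr0n, expr1) /=.
move=> c1 c2 c3 Bl.
have h0 : oddpow k.+1 (x 0 1) != 0 by rewrite /oddpow mulf_neq0 // !expf_neq0.
have l1 : l 1 0 = 0.
  by apply/eqP; move/eqP: c1; rewrite !mulf_eq0 pnatr_eq0 (negbTE z0).
have l3 : l 3 0 = 0 by rewrite l1 in Bl; lra.
have l2 : l 2 0 = 0 by rewrite l3 in c2 c3; lra.
apply: col4P => //; apply: (mulfI h0); rewrite l3 l2 in c2; lra.
Qed.

Definition model6z (p : 'rV[R]_2) : 'rV[R]_4 :=
  row4 (p 0 0 ^+ 2) 1 (p 0 0 * p 0 1) (p 0 0 - p 0 1 ^+ 2).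

Lemma smooth_model6z x : smooth_at model6z x.
Proof. by apply: smooth_row4; smooth_tac. Qed.

Lemma model6z_nontransversal : nontransversal_model model6z.
Proof.
have D (p w : 'rV[R]_2) := derive_row4
  (has_derivativeX 1 (has_derivative_coord p w 0)) (has_derivative_cst 1 p w)
  (has_derivativeM (has_derivative_coord p w 0) (has_derivative_coord p w 1))
  (has_derivativeD (has_derivative_coord p w 0)
     (has_derivativeN (has_derivativeX 1 (has_derivative_coord p w 1)))).
move=> V /two_points[t [t0 _ _ V1 V2]].
exists (row2 0 t), (row2 0 (- t)), 1, (delta_mx 0 0); split; split => //.
- by apply: row2_neq; rewrite neq_opp ?orbT.
- by rewrite scale1r /model6z !mxE /=; congr row4; ring.
- exact: delta_col_neq0.
- by rewrite mulmx_delta_col !mxE /= expr0n /= raddf0.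
- by rewrite mulmx_delta_col !mxE /= expr0n /= raddf0.
- by move=> w; rewrite mulmx_delta_col /model6z D !mxE /= ?(mulr0, mul0r) raddf0.
- by move=> w; rewrite mulmx_delta_col /model6z D !mxE /= ?(mulr0, mul0r) raddf0.
Qed.

(** With [x = p 0 0] and [y = p 0 1], the surviving pairs are [y], [- y] over
    [x = - (y ^+ k.+1) ^+ 2], and there the conormal equations force [l = 0]. A pair with opposite
    nonzero [x] is excluded by the monotonicity of [oddpow]. *)
Lemma model6z_perturbation k : exists (b : 'rV[R]_2 -> R) (rho : 'rV[R]_2 -> 'rV[R]_4),
  [/\ forall x, smooth_at b x, forall x, smooth_at rho x, b 0 = 0 &
    transversal_model (fun x => model6z x + b x ^+ k.+1 *: rho x)].
Proof.
exists (fun p => p 0 1), (fun p => row4 0 0 (p 0 1 ^+ k.+1 * p 0 1) 0); split.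
- by move=> x; exact: smooth_coord.
- by move=> x; apply: smooth_row4; smooth_tac.
- by rewrite mxE.
have E : (fun p : 'rV[R]_2 => model6z p + p 0 1 ^+ k.+1 *: row4 0 0 (p 0 1 ^+ k.+1 * p 0 1) 0) =
  (fun p => row4 (p 0 0 ^+ 2) 1 (p 0 0 * p 0 1 + oddpow k.+1 (p 0 1)) (p 0 0 + - p 0 1 ^+ 2)).
  by apply/funext => p; apply: row4P; rewrite !mxE /= /oddpow; ring.
rewrite E; exists setT; first exact: filterT.
move=> x y mu l _ _ xy mu0 /row4_eq[E0 E1 E2 E3] Bx _ cx cy.
move: E0 E2 E3; have -> : mu = 1 by lra.
rewrite !mul1r => E0 E2 E3.
have [xy0|xy0] := eqVneq (x 0 0) (y 0 0); last first.
  exfalso.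
  have y0 : y 0 0 = - x 0 0.
    move/eqP: E0; rewrite eqf_sqr => /orP[/eqP e|/eqP ->]; last by rewrite opprK.
    by rewrite e eqxx in xy0.
  have x0 : x 0 0 != 0 by apply: contra xy0 => /eqP e; rewrite y0 e oppr0.
  move: x0 E2 E3; rewrite y0; move: (x 0 0) (x 0 1) (y 0 1) => a b c a0 E2 E3.
  have Q : 2 * a = b ^+ 2 - c ^+ 2 by lra.
  have S : a * (b + c) = oddpow k.+1 c - oddpow k.+1 b by lra.
  have bc : b != c by apply: contra a0 => /eqP e; rewrite e subrr in Q; apply/eqP; lra.
  have := oddpow_mono k.+1 bc.
  have -> : oddpow k.+1 b - oddpow k.+1 c = - (2^-1 * (b ^+ 2 - c ^+ 2) * (b + c)).
    by rewrite -Q mulrA mulVf ?pnatr_eq0 // mul1r S opprB.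
  have := mulr_ge0 (sqr_ge0 (b - c)) (sqr_ge0 (b + c)); rewrite !expr2 => h1 h2; suff : (0 : R) < 0 by rewrite ltxx.
  lra.
rewrite -xy0 in E2 E3.
have y1 : y 0 1 = - x 0 1.
  have /eqP : x 0 1 ^+ 2 = y 0 1 ^+ 2 by lra.
  rewrite eqf_sqr => /orP[/eqP e|/eqP ->]; last by rewrite opprK.
  by move/eqP: xy; case; apply: row2P.
have z0 : x 0 1 != 0.
  by apply/eqP => e; move/eqP: xy; apply; apply: row2P; rewrite // y1 e oppr0.
pose q := (x 0 1 ^+ k.+1) ^+ 2.
have q0 : q != 0 by rewrite /q !expf_neq0.
have x0 : x 0 0 = - q.
  apply: (mulfI z0); move: E2; rewrite y1 oddpowN /oddpow -/q => e; lra.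
have qN : (y 0 1 ^+ k.+1) ^+ 2 = q.
  by rewrite /q y1 -!exprM !(mulnC _ 2) !exprM sqrrN.
have D (p w : 'rV[R]_2) := derive_row4
  (has_derivativeX 1 (has_derivative_coord p w 0)) (has_derivative_cst 1 p w)
  (has_derivativeD (has_derivativeM (has_derivative_coord p w 0) (has_derivative_coord p w 1))
     (oddpow_derivative k (has_derivative_coord p w 1)))
  (has_derivativeD (has_derivative_coord p w 0)
     (has_derivativeN (has_derivativeX 1 (has_derivative_coord p w 1)))).
have c1 := conormal_row4 cx (D x (row2 0 1)).
have c2 := conormal_row4 cy (D y (row2 0 1)).
have c3 := conormal_row4 cx (D x (row2 1 0)).
have Bl := congr1 (fun m : 'M_1 => m 0 0) Bx; rewrite /= mul_row4_col mxE in Bl.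
move: c1 c2 c3 Bl; rewrite !mxE /= -xy0 qN -/q y1 x0.
have kE : (2 * k.+1 + 1)%:R = 2 * k.+1%:R + 1 :> R by rewrite natrD natrM.
rewrite kE; move: (ltr0Sn R k); move: (k.+1%:R : R) => kk kk0.
rewrite !(mul0r, mulr0, mulr1, add0r, addr0, oppr0, expr1) => c1 c2 c3 Bl.
have l3 : l 3 0 = 0 by apply: (mulfI z0); lra.
rewrite l3 in c1 c3 Bl.
have l2 : l 2 0 = 0.
  have kq : 2 * kk * q != 0 by rewrite mulf_neq0 // mulf_neq0 ?pnatr_eq0 // gt_eqF.
  by apply: (mulfI kq); lra.
rewrite l2 in c3 Bl.
have l0 : l 0 0 = 0 by apply: (mulfI q0); lra.
by apply: col4P => //; rewrite l0 in Bl; lra.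
Qed.

(** The ellipsoid near a point of its singular curve [p 0 1 = 0], which is collapsed to one
    projective point; the last coordinate is the squared norm. *)
Definition modelI (p : 'rV[R]_2) : 'rV[R]_4 :=
  row4 (p 0 1) (p 0 0 * p 0 1) (p 0 1 ^+ 2) (1 + p 0 0 ^+ 2 + p 0 1 ^+ 2).

Lemma smooth_modelI x : smooth_at modelI x.
Proof. by apply: smooth_row4; smooth_tac. Qed.

Lemma modelI_nontransversal : nontransversal_model modelI.
Proof.
have D (p w : 'rV[R]_2) := derive_row4
  (has_derivative_coord p w 1) (has_derivativeM (has_derivative_coord p w 0) (has_derivative_coord p w 1))
  (has_derivativeX 1 (has_derivative_coord p w 1))
  (has_derivativeD (has_derivativeD (has_derivative_cst 1 p w)
    (has_derivativeX 1 (has_derivative_coord p w 0))) (has_derivativeX 1 (has_derivative_coord p w 1))).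
move=> V /two_points[t [t0 V1 V2 _ _]].
exists (row2 t 0), (row2 (- t) 0), 1, (delta_mx 2 0); split; split => //.
- by apply: row2_neq; rewrite neq_opp.
- by rewrite scale1r /modelI !mxE /=; congr row4; ring.
- exact: delta_col_neq0.
- by rewrite mulmx_delta_col !mxE /= expr0n /= raddf0.
- by rewrite mulmx_delta_col !mxE /= expr0n /= raddf0.
- by move=> w; rewrite mulmx_delta_col /modelI D !mxE /= ?(mulr0, mul0r) raddf0.
- by move=> w; rewrite mulmx_delta_col /modelI D !mxE /= ?(mulr0, mul0r) raddf0.
Qed.

Lemma modelI_perturbation k : exists (b : 'rV[R]_2 -> R) (rho : 'rV[R]_2 -> 'rV[R]_4),
  [/\ forall x, smooth_at b x, forall x, smooth_at rho x, b 0 = 0 &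
    transversal_model (fun x => modelI x + b x ^+ k.+1 *: rho x)].
Proof.
(* The extra factor is the last coordinate of the model: after division by it, the perturbation is
   [oddpow k.+1 (p 0 0)], injective along the collapsed curve. *)
exists (fun p => p 0 0), (fun p => row4 0 0
  (p 0 0 ^+ k.+1 * p 0 0 * (1 + p 0 0 ^+ 2 + p 0 1 ^+ 2)) 0); split.
- by move=> x; exact: smooth_coord.
- by move=> x; apply: smooth_row4; smooth_tac.
- by rewrite mxE.
have E : (fun p : 'rV[R]_2 => modelI p + p 0 0 ^+ k.+1 *: row4 0 0
     (p 0 0 ^+ k.+1 * p 0 0 * (1 + p 0 0 ^+ 2 + p 0 1 ^+ 2)) 0) =
  (fun p => row4 (p 0 1) (p 0 0 * p 0 1)
     (p 0 1 ^+ 2 + oddpow k.+1 (p 0 0) * (1 + p 0 0 ^+ 2 + p 0 1 ^+ 2))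
     (1 + p 0 0 ^+ 2 + p 0 1 ^+ 2)).
  by apply/funext => p; apply: row4P; rewrite !mxE /= /oddpow; ring.
rewrite E; exists setT; first exact: filterT.
move=> x y mu l _ _ xy mu0 /row4_eq[E0 E1 E2 E3] _ _ _ _; exfalso.
move/eqP: xy; apply; move: E0 E1 E2 E3.
have : 0 < 1 + y 0 0 ^+ 2 + y 0 1 ^+ 2.
  by have := sqr_ge0 (y 0 0); have := sqr_ge0 (y 0 1); lra.
move: (x 0 0) (x 0 1) (y 0 0) (y 0 1) (@row2P R x y) => a z a' z' P.
move: (1 + a' ^+ 2 + z' ^+ 2) => p' p'0 E0 E1 E2 E3; rewrite E3 in E2.
have [z0|z0] := eqVneq z' 0.
  rewrite z0 mulr0 in E0; apply: P; last by rewrite z0.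
  move: E2; rewrite E0 z0 expr0n /= !add0r.
  rewrite mulrCA => /(mulfI (lt0r_neq0 mu0)) /(mulIf (lt0r_neq0 p'0)) H.
  apply/eqP; apply: contraT => aa; have := oddpow_mono k.+1 aa.
  by rewrite H subrr mul0r ltxx.
have aa : a = a'.
  have z1 : mu * z' != 0 by rewrite mulf_neq0 // gt_eqF.
  by apply: (mulIf z1); rewrite -{1}E0 E1; ring.
apply: P => //; rewrite E0.
have -> : mu = 1; last by rewrite mul1r.
have z2 : mu * z' ^+ 2 != 0 by rewrite mulf_neq0 ?expf_neq0 // gt_eqF.
by apply: (mulIf z2); rewrite aa E0 in E2; rewrite exprMn in E2; lra.
Qed.

(** The double points are the pairs [(0, y)], [(0, - y)], where the two sheets are transversal. This
    is how a cross-cap is excluded at the ends of the tangent curve of type 6. *)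
Lemma cross_cap_transversal : ~ nontransversal_near (@cross_cap_normal_form R).
Proof.
move=> /(_ setT filterT)[x [y [n [[_ _ xy E] [n0 cx cy]]]]].
have D (p w : 'rV[R]_2) : 'D_w (@cross_cap_normal_form R) p =
    row3 (w 0 0) (2 * p 0 1 * w 0 1) (p 0 0 * w 0 1 + p 0 1 * w 0 0).
  have c0 := has_derivative_coord p w 0; have c1 := has_derivative_coord p w 1.
  have [d1 e1] := has_derivativeX 1 c1; have [d2 e2] := has_derivativeM c0 c1.
  have [d0 e0] := c0.
  have E0 : (fun q => (@cross_cap_normal_form R) q 0 0) = (fun q => q 0 0).
    by apply/funext => q; rewrite mxE.
  have E1 : (fun q => (@cross_cap_normal_form R) q 0 1) = (fun q => q 0 1 ^+ 2).
    by apply/funext => q; rewrite mxE.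
  have E2 : (fun q => (@cross_cap_normal_form R) q 0 2) = (fun q => q 0 0 * q 0 1).
    by apply/funext => q; rewrite mxE.
  have df : differentiable (@cross_cap_normal_form R) p.
    by apply/differentiable_rowP; apply: ord3E; rewrite ?E0 ?E1 ?E2.
  by apply: row3P; rewrite derive_coord ?E0 ?E1 ?E2 ?e0 ?e1 ?e2 ?mxE //=; apply: diff_derivable.
have C (p w : 'rV[R]_2) : conormal (@cross_cap_normal_form R) p n ->
    w 0 0 * n 0 0 + 2 * p 0 1 * w 0 1 * n 1 0 + (p 0 0 * w 0 1 + p 0 1 * w 0 0) * n 2 0 = 0.
  by move=> /(_ w)/matrixP/(_ 0 0); rewrite D mxE sum3E !mxE.
have c1 := C _ (row2 1 0) cx; have c2 := C _ (row2 0 1) cx.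
have c3 := C _ (row2 1 0) cy; have c4 := C _ (row2 0 1) cy.
have /rowP e := E; have e0 := e 0; have e1 := e 1; have e2 := e 2.
rewrite !mxE /= in c1 c2 c3 c4 e0 e1 e2.
have y1 : y 0 1 = - x 0 1.
  move/eqP: e1; rewrite eqf_sqr => /orP[/eqP h|/eqP ->]; last by rewrite opprK.
  by move/eqP: xy; case; apply: row2P.
have z0 : x 0 1 != 0.
  by apply/eqP => h; move/eqP: xy; apply; apply: row2P; rewrite // y1 h oppr0.
rewrite y1 -e0 in c3 c4 e2.
have x0 : x 0 0 = 0 by apply: (mulIf z0); lra.
rewrite x0 in c2 c4.
have n2 : n 2 0 = 0 by apply: (mulfI z0); lra.
have n1 : n 1 0 = 0 by apply: (mulfI z0); lra.
have n00 : n 0 0 = 0 by rewrite n2 in c1; lra.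
move/eqP: n0; apply; apply/matrixP => i j; rewrite [j]ord1 [RHS]mxE.
by move: i; apply: ord3E.
Qed.

End Models.

(** * Charts of the sphere *)

Section Charts.
Context {R : realType}.

Definition aff (K : 'M[R]_3) (x : 'rV[R]_2) : 'rV[R]_3 := row3 1 (x 0 0) (x 0 1) *m K.
Definition normalize (w : 'rV[R]_3) : 'rV[R]_3 := (Num.sqrt (dot w w))^-1 *: w.
Definition std_chart (K : 'M[R]_3) (x : 'rV[R]_2) : 'rV[R]_3 := normalize (aff K x).
Definition aff_inv (K : 'M[R]_3) (u : 'rV[R]_3) : 'rV[R]_2 :=
  row2 ((u *m invmx K) 0 1 / (u *m invmx K) 0 0) ((u *m invmx K) 0 2 / (u *m invmx K) 0 0).

Lemma normalize_sphere w : w != 0 -> sphere (normalize w).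
Proof.
move=> w0; rewrite /sphere /= dotZl dotZr mulrA -expr2 exprVn sqr_sqrtr ?dot_ge0 //.
by rewrite mulVf // gt_eqF // dot_gt0.
Qed.

Lemma sphere_neq0 (u : 'rV[R]_3) : sphere u -> u != 0.
Proof.
rewrite /sphere /= => su; apply/eqP => u0; move/eqP: su.
by rewrite u0 dotE !mxE !mul0r !addr0 eq_sym oner_eq0.
Qed.

Lemma sphereN (u : 'rV[R]_3) : sphere u -> sphere (- u).
Proof. by rewrite /sphere /= => <-; rewrite !dotE !mxE; ring. Qed.

Lemma pr_hat Q (u : 'rV[R]_3) : sphere u -> pr (hat Q u) = net_map Q u.
Proof. by move=> su; apply/rowP => k; rewrite mxE hat_lift hat_max su divr1. Qed.

Lemma pr_hatZ Q c (u : 'rV[R]_3) : c != 0 -> pr (hat Q (c *: u)) = pr (hat Q u).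
Proof. by move=> c0; rewrite hatZ pr_scale // expf_neq0. Qed.

Lemma invsqrt_neq0 (w : 'rV[R]_3) : w != 0 -> (Num.sqrt (dot w w))^-1 != 0.
Proof. by move=> w0; rewrite invr_neq0 // gt_eqF // sqrtr_gt0 dot_gt0. Qed.

Lemma net_normalize Q (w : 'rV[R]_3) : w != 0 -> net_map Q (normalize w) = pr (hat Q w).
Proof.
move=> w0; rewrite -(pr_hat Q (normalize_sphere w0)) /normalize pr_hatZ //.
exact: invsqrt_neq0.
Qed.

Lemma aff_neq0 K x : K \in unitmx -> aff K x != 0.
Proof.
move=> uK; apply/eqP => /(congr1 (mulmx^~ (invmx K))); rewrite mulmxK // mul0mx.
by move/rowP/(_ 0)/eqP; rewrite !mxE oner_eq0.
Qed.

Lemma smooth_aff K x : smooth_at (aff K) x.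
Proof.
have s : smooth_at (fun y : 'rV[R]_2 => row3 1 (y 0 0) (y 0 1)) x.
  by apply: smooth_row3; smooth_tac.
exact: (@smooth_mulmx R _ 2 2 _ K x s).
Qed.

Lemma smooth_dot (V : normedModType R) (f g : V -> 'rV[R]_3) x :
  smooth_at f x -> smooth_at g x -> smooth_at (fun y => dot (f y) (g y)) x.
Proof.
move=> /smooth_row sf /smooth_row sg.
apply: smooth_at_eq (smoothD (smoothD (smoothM (sf 0) (sg 0)) (smoothM (sf 1) (sg 1)))
  (smoothM (sf 2) (sg 2))) => y.
by rewrite dotE.
Qed.

Lemma smooth_std_chart K x : K \in unitmx -> smooth_at (std_chart K) x.
Proof.
move=> uK; have sA := smooth_aff K x; have /smooth_row sAj := sA.
have d0 := dot_gt0 (aff_neq0 x uK).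
apply/smooth_row => j.
apply: smooth_at_eq (smoothM (smoothV (smooth_sqrt (smooth_dot sA sA) d0) _) (sAj j)).
  by move=> y; rewrite /std_chart /normalize [RHS]mxE.
by rewrite gt_eqF // sqrtr_gt0.
Qed.

Lemma smooth_aff_inv K u : (u *m invmx K) 0 0 != 0 -> smooth_at (aff_inv K) u.
Proof.
move=> u0.
have sc j : smooth_at (fun u : 'rV[R]_3 => (u *m invmx K) 0 j) u.
  have s : smooth_at (fun u : 'rV[R]_3 => u *m invmx K) u.
    exact: (linear_row_smooth (mulmxr (invmx K))).
  by move/smooth_row: s; exact.
by apply: smooth_row2; apply: smoothM => //; exact: smoothV.
Qed.

Lemma aff_invZ K c x : K \in unitmx -> c != 0 -> aff_inv K (c *: aff K x) = x.
Proof.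
move=> uK c0; rewrite /aff_inv /aff -scalemxAl mulmxK //.
by apply: row2P; rewrite !mxE /= mulr1 mulrAC divff // mul1r.
Qed.

Lemma std_chart_inv K x : K \in unitmx -> aff_inv K (std_chart K x) = x.
Proof. by move=> uK; apply: aff_invZ => //; exact: invsqrt_neq0 (aff_neq0 _ _). Qed.

Lemma std_chartP K : K \in unitmx -> sphere_chart (std_chart K) (std_chart K 0).
Proof.
move=> uK; split=> //.
- exact/smooth_nearP/smooth_std_chart.
- by apply: near_all_pts => x; exact/normalize_sphere/aff_neq0.
move=> v; apply: (@left_inverse_deriv_neq0 R _ _ _ (aff_inv K)).
- exact/smooth_at_differentiable/smooth_std_chart.
- apply/smooth_at_differentiable/smooth_aff_inv.
  have := invsqrt_neq0 (aff_neq0 0 uK); rewrite /std_chart /normalize.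
  move: (Num.sqrt _)^-1 => c c0.
  by rewrite /aff -scalemxAl mulmxK // !mxE /= mulr1.
- by apply: near_all_pts => x; exact: std_chart_inv.
Qed.

Lemma sphere_chart_tangent (phi : 'rV[R]_2 -> 'rV[R]_3) u w :
  sphere_chart phi u -> dot u ('D_w phi 0) = 0.
Proof.
move=> [/smooth_nearP sphi phi0 sph _].
have dphi := smooth_at_differentiable sphi.
pose Q : @net R := 0.
have dh : differentiable (hat Q) (phi 0) by exact/smooth_at_differentiable/smooth_hat.
have E : ('D_w (hat Q \o phi) 0) 0 ord_max = 2 * dot u ('D_w phi 0).
  by rewrite derive_compE // derive_hat phat_max phi0.
have E2 : ('D_w (hat Q \o phi) 0) 0 ord_max = 0.
  rewrite derive_coord; last exact/diff_derivable/differentiable_comp.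
  rewrite (near_eq_derive (g := (fun=> 1 : R))) ?[LHS]derive_cst //.
  by apply: filterS sph => x sx; rewrite /= hat_max.
by move: E; rewrite E2 => /esym/eqP; rewrite mulf_eq0 pnatr_eq0 /= => /eqP.
Qed.

(** To deny finite determinacy or a cross-cap, every chart at [u] must be treated; this compares an
    arbitrary one with an affine plane. If the derivative of [theta] killed [w], that of [phi] along
    [w] would be radial; being tangent to the sphere as well, it would vanish. *)
Lemma chart_affine Q K (phi : 'rV[R]_2 -> 'rV[R]_3) u c :
  K \in unitmx -> c != 0 -> u = c *: row 0 K -> sphere_chart phi u ->
  let theta := aff_inv K \o phi in
  [/\ local_diffeo theta 0, theta 0 = 0 &
    \forall x \near (0 : 'rV[R]_2), net_map Q (phi x) = pr (hat Q (aff K (theta x)))].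
Proof.
move=> uK c0 uE chart theta; have [/smooth_nearP sphi phi0 sph dphi0] := chart.
have dphi := smooth_at_differentiable sphi.
have uv : u *m invmx K = row3 c 0 0.
  rewrite uE -scalemxAl; have -> : row 0 K = row3 1 0 0 *m K.
    by rewrite row3_mul scale1r !scale0r !addr0.
  by rewrite mulmxK //; apply: row3P; rewrite !mxE /= ?mulr1 ?mulr0.
pose v x := phi x *m invmx K.
have sv : smooth_at v 0 by exact: smooth_mulmx.
have svj j : smooth_at (fun x => v x 0 j) 0 by move/smooth_row: sv; exact.
have v0 : v 0 0 0 = c by rewrite /v phi0 uv mxE.
have v00 : v 0 0 0 != 0 by rewrite v0.
have nv := near_smooth_neq0 (svj 0) v00.
have sth : smooth_at theta 0.
  apply: smooth_comp_row => //; apply: smooth_aff_inv.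
  by rewrite phi0 uv mxE.
have th0 : theta 0 = 0.
  by rewrite /theta /= phi0 /aff_inv uv; apply: row2P; rewrite !mxE /= mul0r.
have phiE : \forall x \near (0 : 'rV[R]_2), phi x = v x 0 0 *: aff K (theta x).
  apply: filterS nv => x vx; rewrite -[LHS](mulmxKV uK) -/(v x) /aff scalemxAl.
  congr (_ *m K); rewrite /theta /= /aff_inv -/(v x).
  move: (v x) vx => w w0.
  by apply: row3P; rewrite !mxE /= ?mulr1 // mulrC divfK.
split=> //; last first.
  apply: filterS2 (nbhsI2 phiE nv) sph => x [Ex vx] sx.
  by rewrite -(pr_hat Q sx) {1}Ex pr_hatZ.
split; first exact/smooth_nearP.
move=> w w0; apply: contra w0 => /eqP Dth.
have thj j : smooth_at (fun x => theta x 0 j) 0 by move/smooth_row: sth; exact.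
have dth := smooth_at_differentiable sth; have dv := smooth_at_differentiable sv.
have Dv0 (i : 'I_3) (j : 'I_2) : (\forall x \near (0 : 'rV[R]_2), v x 0 i = theta x 0 j * v x 0 0) ->
    ('D_w v 0) 0 i = 0.
  move=> E; rewrite derive_coord; last exact: diff_derivable.
  rewrite (near_eq_derive (g := fun x => theta x 0 j * v x 0 0)) //.
  rewrite deriveM_pt; [|exact: smooth_at_differentiable (thj j)|exact: smooth_at_differentiable (svj 0)].
  rewrite -(derive_coord (f := theta)); last exact: diff_derivable.
  by rewrite Dth th0 !mxE mul0r mulr0 addr0.
have D1 : ('D_w v 0) 0 1 = 0.
  apply: (Dv0 1 0); apply: filterS nv => x vx.
  have -> : theta x 0 0 = v x 0 1 / v x 0 0 by rewrite /theta /= /aff_inv mxE.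
  by rewrite divfK.
have D2 : ('D_w v 0) 0 2 = 0.
  apply: (Dv0 2 1); apply: filterS nv => x vx.
  have -> : theta x 0 1 = v x 0 2 / v x 0 0 by rewrite /theta /= /aff_inv mxE.
  by rewrite divfK.
have Dv : 'D_w v 0 = 'D_w phi 0 *m invmx K.
  exact: (derive_linear_comp (mulmxr (invmx K)) w dphi).
have Dphi : 'D_w phi 0 = ('D_w v 0) 0 0 *: row 0 K.
  rewrite -[LHS](mulmxKV uK) -Dv {1}(row3_eta ('D_w v 0)) D1 D2 row3_mul.
  by rewrite !scale0r !addr0.
have su : sphere u by rewrite -phi0; exact: nbhs_singleton sph.
have k0 : row 0 K != 0.
  by apply: contra c0 => /eqP k0; have := sphere_neq0 su; rewrite uE k0 scaler0 eqxx.
have := sphere_chart_tangent w chart; rewrite Dphi uE dotZl dotZr => /eqP.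
rewrite !mulf_eq0 (negbTE c0) (gt_eqF (dot_gt0 k0)) orbF /= => /eqP d0.
move: Dphi; rewrite d0 scale0r => Dphi.
by apply: contraT => /dphi0; rewrite Dphi eqxx.
Qed.

Lemma nontransversal_not_cross_cap (F : 'rV[R]_3 -> 'rV[R]_3) u :
  (forall u, smooth_at F u) ->
  (forall phi, sphere_chart phi u -> nontransversal_near (F \o phi)) -> ~ cross_cap_at F u.
Proof.
move=> sF H [phi chart E]; have NT := H _ chart; have [/smooth_nearP sphi _ _ _] := chart.
apply: cross_cap_transversal; apply: nontransversal_equiv E NT.
  by apply/smooth_nearP; exact: smooth_comp_row.
apply/smooth_nearP; rewrite /cross_cap_normal_form.
by apply: smooth_row3; smooth_tac.
Qed.

(** The derivative of the normal form vanishes in the direction [(0, 1)]; the coordinate changes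
    turn this direction into a nonzero tangent vector of the sphere killed by the derivative of
    [F]. *)
Lemma cross_cap_singular (F : 'rV[R]_3 -> 'rV[R]_3) u :
  (forall u, smooth_at F u) -> cross_cap_at F u -> singular_at F u.
Proof.
move=> sF [phi chart [f [psi [df f0 dpsi E]]]] imm.
have [/smooth_nearP sphi phi0 _ dphi0] := chart.
have dphi := smooth_at_differentiable sphi.
have dF v := smooth_at_differentiable (sF v).
have scc : smooth_at (@cross_cap_normal_form R) 0.
  by apply: smooth_row3; smooth_tac.
have [w wE] := local_diffeo_deriv_surj (row2 0 1) df.
have w0 : w != 0.
  apply/eqP => w0; move: wE; rewrite w0 derive0 => /rowP/(_ 1)/eqP.
  by rewrite !mxE eq_sym oner_eq0.
have dff : differentiable f 0 by case: df => /smooth_nearP/smooth_at_differentiable.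
have dpsi' : differentiable psi ((F \o phi) 0) by case: dpsi => /smooth_nearP/smooth_at_differentiable.
have D0 : 'D_w (cross_cap_normal_form \o f) 0 = 0.
  rewrite derive_compE //; last by rewrite f0; exact: smooth_at_differentiable.
  rewrite wE f0; have dcc := smooth_at_differentiable scc.
  have c0 := has_derivative_coord (0 : 'rV[R]_2) (row2 0 1) 0.
  have c1 := has_derivative_coord (0 : 'rV[R]_2) (row2 0 1) 1.
  have [d1 e1] := has_derivativeX 1 c1; have [d2 e2] := has_derivativeM c0 c1.
  have [d0 e0] := c0.
  have E0 : (fun q => (@cross_cap_normal_form R) q 0 0) = (fun q => q 0 0).
    by apply/funext => q; rewrite mxE.
  have E1 : (fun q => (@cross_cap_normal_form R) q 0 1) = (fun q => q 0 1 ^+ 2).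
    by apply/funext => q; rewrite mxE.
  have E2 : (fun q => (@cross_cap_normal_form R) q 0 2) = (fun q => q 0 0 * q 0 1).
    by apply/funext => q; rewrite mxE.
  apply: row3P; rewrite derive_coord ?E0 ?E1 ?E2 ?e0 ?e1 ?e2 ?mxE //=; try exact: diff_derivable.
  - by rewrite mulr0 mul0r.
  - by rewrite mul0r mulr0 addr0.
have := dphi0 _ w0 => Dphi.
have tw : tangent u ('D_w phi 0) := sphere_chart_tangent w chart.
have := imm _ tw Dphi; rewrite -phi0 -(@derive_compE _ _ _ _ phi F) //.
apply/negP; rewrite negbK; apply: contraT => n0.
have [_ /(_ _ n0)] := dpsi.
rewrite -(@derive_compE _ _ _ _ (F \o phi) psi) //; last exact: differentiable_comp.
by rewrite (near_eq_derive (g := cross_cap_normal_form \o f)) // D0 eqxx.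
Qed.

(** The non-transversal pairs alone exclude a cross-cap; together with perturbations of every
    flatness that have no such pairs, they exclude finite determinacy. *)
Lemma not_finitely_determined_at_model Q K (M : 'M[R]_4) u c (B : 'rV[R]_2 -> 'rV[R]_4) :
  K \in unitmx -> M \in unitmx -> c != 0 -> u = c *: row 0 K ->
  (forall x, hat Q (aff K x) = B x *m M) -> (forall x, smooth_at B x) ->
  nontransversal_model B ->
  (forall k, exists (b : 'rV[R]_2 -> R) (rho : 'rV[R]_2 -> 'rV[R]_4),
    [/\ forall x, smooth_at b x, forall x, smooth_at rho x, b 0 = 0 &
      transversal_model (fun x => B x + b x ^+ k.+1 *: rho x)]) ->
  ~ finitely_determined_at (net_map Q) u /\ ~ cross_cap_at (net_map Q) u.
Proof.
move=> uK uM c0 uE hE sB NT PT.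
have B0 : 0 < (B 0 *m M) 0 ord_max by rewrite -hE hat_max dot_gt0 // aff_neq0.
split.
  move=> [phi chart]; have [dth th0 E] := chart_affine Q uK c0 uE chart.
  apply: (@not_finitely_determined_model R B M _ (aff_inv K \o phi)) => //.
  by apply: filterS E => x; rewrite -hE.
apply: nontransversal_not_cross_cap; first exact: smooth_net.
move=> phi chart; have [dth th0 E] := chart_affine Q uK c0 uE chart.
apply: (@nontransversal_pull R (fun x => pr (B x *m M)) _ (aff_inv K \o phi)) => //.
- apply: (smooth_pr (A := fun x => B x *m M)); last by rewrite gt_eqF.
  exact: smooth_mulmx.
- by apply: filterS E => x; rewrite -hE.
- by apply: nontransversal_of_model => //; rewrite gt_eqF.
Qed.

End Charts.

(** * Adapted bases and the cross-cap normal form *)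

Section Bases.
Context {R : realType}.

Definition hat_free (Q : @net R) := forall l : 'cV[R]_4, hatm Q *m l = 0 -> l = 0.

Definition rows4 (n : nat) (a b c d : 'rV[R]_n) : 'M[R]_(4, n) :=
  \matrix_(i < 4) ([:: a; b; c; d]`_i).

Definition rows3 (a b c : 'rV[R]_3) : 'M[R]_3 := \matrix_(i < 3) ([:: a; b; c]`_i).

Lemma rows4_mul n (x y z t : R) (a b c d : 'rV[R]_n) :
  row4 x y z t *m rows4 a b c d = x *: a + y *: b + z *: c + t *: d.
Proof. by rewrite row4_mul !rowK. Qed.

Lemma ver_span (c : 'cV[R]_6) : (forall u, ver u *m c = 0) -> c = 0.
Proof.
move=> H.
have E x y z : x ^+ 2 * c 0 0 + y ^+ 2 * c 1 0 + z ^+ 2 * c 2 0 + y * z * c 3 0 +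
    x * z * c 4 0 + x * y * c 5 0 = 0.
  have /matrixP/(_ 0 0) := H (row3 x y z).
  rewrite mxE !big_ord_recr big_ord0 /= add0r [X in _ = X]mxE !mxE /= => <-.
  by congr (_ * c _ _ + _ * c _ _ + _ * c _ _ + _ * c _ _ + _ * c _ _ + _ * c _ _); exact: val_inj.
move: (E 1 0 0) (E 0 1 0) (E 0 0 1) (E 0 1 1) (E 1 0 1) (E 1 1 0).
rewrite !(expr1n, expr0n, mul0r, mulr0, mul1r, addr0, add0r) /= => c0 c1 c2.
rewrite c0 c1 c2 !(mul0r, addr0, add0r) => c3 c4 c5.
apply/matrixP => i j; rewrite [j]ord1 [RHS]mxE.
move: i => [[|[|[|[|[|[|//]]]]]] i].
- by rewrite -[RHS]c0; congr (c _ _); exact: val_inj.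
- by rewrite -[RHS]c1; congr (c _ _); exact: val_inj.
- by rewrite -[RHS]c2; congr (c _ _); exact: val_inj.
- by rewrite -[RHS]c3; congr (c _ _); exact: val_inj.
- by rewrite -[RHS]c4; congr (c _ _); exact: val_inj.
- by rewrite -[RHS]c5; congr (c _ _); exact: val_inj.
Qed.

(** A vector killed by [M] would be a linear relation among the coordinates of [hat Q], that is,
    among the four forms. In this way each normal form [G] gets an invertible matrix without a
    determinant being computed. *)
Lemma unit_of_hat_free Q (K : 'M[R]_3) (M : 'M[R]_4) (G : 'rV[R]_3 -> 'rV[R]_4) :
  K \in unitmx -> hat_free Q -> (forall v, hat Q (v *m K) = G v *m M) -> M \in unitmx.
Proof.
move=> uK Qf hE; rewrite -unitmx_tr; apply: mulmx_inj_unitmx => v; apply: contra => /eqP vM.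
have Mv : M *m v^T = 0 by rewrite -[LHS]trmxK trmx_mul trmxK vM trmx0.
rewrite -[v]trmxK (Qf v^T) ?trmx0 //; apply: ver_span => u.
by rewrite mulmxA -/(hat Q u) -[u](mulmxKV uK) hE -mulmxA Mv mulmx0.
Qed.

Lemma hat_row3 Q (K : 'M[R]_3) x y z : hat Q (row3 x y z *m K) =
  x ^+ 2 *: hat Q (row 0 K) + y ^+ 2 *: hat Q (row 1 K) + z ^+ 2 *: hat Q (row 2 K) +
  (x * y) *: phat Q (row 0 K) (row 1 K) + (x * z) *: phat Q (row 0 K) (row 2 K) +
  (y * z) *: phat Q (row 1 K) (row 2 K).
Proof.
rewrite row3_mul !hatD !hatZ phatDl !phatZl !phatZr !scalerA.
by apply/rowP => j; rewrite ![in LHS]mxE ![in RHS]mxE; ring.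
Qed.

(** This normal form belongs to a simple root of the cubic; the signs of [al] and [be] will decide
    the type of the surface. *)
Lemma hat_alpha_beta Q (K : 'M[R]_3) (al be : R) :
  phat Q (row 0 K) (row 1 K) = 0 ->
  hat Q (row 2 K) = - al *: hat Q (row 0 K) - be *: hat Q (row 1 K) ->
  forall x y z, hat Q (row3 x y z *m K) =
    row4 (x ^+ 2 - al * z ^+ 2) (y ^+ 2 - be * z ^+ 2) (x * z) (y * z) *m
    rows4 (hat Q (row 0 K)) (hat Q (row 1 K))
      (phat Q (row 0 K) (row 2 K)) (phat Q (row 1 K) (row 2 K)).
Proof.
move=> p01 h2 x y z; rewrite hat_row3 p01 h2 rows4_mul scaler0 addr0.
move: (hat Q (row 0 K)) (hat Q (row 1 K)) (phat Q (row 0 K) (row 2 K)) (phat Q _ _) => a b c d.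
by apply/rowP => j; rewrite !mxE; ring.
Qed.

Lemma hat_alpha_betaK Q (K : 'M[R]_3) (al be : R) (v : 'rV[R]_3) :
  phat Q (row 0 K) (row 1 K) = 0 ->
  hat Q (row 2 K) = - al *: hat Q (row 0 K) - be *: hat Q (row 1 K) ->
  hat Q (v *m K) =
    row4 (v 0 0 ^+ 2 - al * v 0 2 ^+ 2) (v 0 1 ^+ 2 - be * v 0 2 ^+ 2)
         (v 0 0 * v 0 2) (v 0 1 * v 0 2) *m
    rows4 (hat Q (row 0 K)) (hat Q (row 1 K))
      (phat Q (row 0 K) (row 2 K)) (phat Q (row 1 K) (row 2 K)).
Proof. by move=> p01 h2; rewrite {1}[v]row3_eta (hat_alpha_beta p01 h2). Qed.

Definition Zinv (al X : R) : R := 2 * X / (1 + Num.sqrt (1 + 4 * al * X ^+ 2)).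

(* X = z / (1 - al z^2) is the quadratic equation al X z^2 + z - X = 0 *)
Lemma ZinvK al z : 0 < 1 - al * z ^+ 2 -> 0 < 1 + al * z ^+ 2 ->
  Zinv al (z / (1 - al * z ^+ 2)) = z.
Proof.
move=> h1 h2; have h1' := lt0r_neq0 h1.
have E : Num.sqrt (1 + 4 * al * (z / (1 - al * z ^+ 2)) ^+ 2) =
    (1 + al * z ^+ 2) / (1 - al * z ^+ 2).
  have -> : 1 + 4 * al * (z / (1 - al * z ^+ 2)) ^+ 2 =
     ((1 + al * z ^+ 2) / (1 - al * z ^+ 2)) ^+ 2 by field.
  by rewrite sqrtr_sqr ger0_norm // divr_ge0 // ltW.
rewrite /Zinv E.
have -> : 1 + (1 + al * z ^+ 2) / (1 - al * z ^+ 2) = 2 / (1 - al * z ^+ 2) by field.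
by field.
Qed.

Lemma smooth_Zinv (V : normedModType R) al (f : V -> R) x : smooth_at f x -> f x = 0 ->
  smooth_at (fun y => Zinv al (f y)) x.
Proof.
move=> sf f0; have e : 0 < 1 + 4 * al * f x ^+ 2 by rewrite f0 expr0n mulr0 addr0 ltr01.
apply: smoothM; first by apply: smoothM => //; exact: smooth_cst.
apply: smoothV; last by rewrite gt_eqF // ltr_pwDl // sqrtr_ge0.
apply: smoothD; first exact: smooth_cst.
apply: smooth_sqrt => //; apply: smoothD; first exact: smooth_cst.
by apply: smoothM; [exact: smooth_cst|exact: smoothX].
Qed.

Definition homog (y : 'rV[R]_3) : 'rV[R]_4 :=
  \row_j (if unlift ord_max j is Some k then y 0 k else 1).

Lemma homog_pr (A : 'rV[R]_4) : A 0 ord_max != 0 -> homog (pr A) = (A 0 ord_max)^-1 *: A.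
Proof.
by move=> A0; apply: rowmaxP => [k|]; rewrite !mxE ?liftK ?unlift_none ?mxE ?mulVf // mulrC.
Qed.

Lemma pr_homog y : pr (homog y) = y.
Proof. by apply/rowP => k; rewrite !mxE liftK unlift_none divr1. Qed.

Lemma smooth_homog (x : 'rV[R]_3) : smooth_at homog x.
Proof.
apply/smooth_row => j; case: (unliftP ord_max j) => [k ->|->].
  have E : (fun y : 'rV[R]_3 => y 0 k) =1 (fun y => homog y 0 (lift ord_max k)).
    by move=> y; rewrite mxE liftK.
  exact: smooth_at_eq E (smooth_coord k x).
have E : (fun=> 1) =1 (fun y => homog y 0 ord_max) by move=> y; rewrite mxE unlift_none.
exact: smooth_at_eq E (smooth_cst _ x).
Qed.

(** With [y = p 0 0] and [z = p 0 1], division by the first coordinate gives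
    [X = z / (1 - al * z ^+ 2)], [Y = y * X] and [W = (y ^+ 2 - be * z ^+ 2) / (1 - al * z ^+ 2)].
    As [z = Zinv al X] is smooth in [X], the target change [psi] recovers [y ^+ 2] from [W], and in
    the source coordinates [(X, y)] the germ is [(X, y ^+ 2, X * y)]. Explicit left inverses show
    that both changes are local diffeomorphisms. *)
Theorem cross_cap_of_basis Q (K : 'M[R]_3) (al be : R) : K \in unitmx -> hat_free Q ->
  phat Q (row 0 K) (row 1 K) = 0 ->
  hat Q (row 2 K) = - al *: hat Q (row 0 K) - be *: hat Q (row 1 K) ->
  cross_cap_at (net_map Q) (normalize (row 0 K)).
Proof.
move=> uK Qf p01 h2.
set M := rows4 (hat Q (row 0 K)) (hat Q (row 1 K))
      (phat Q (row 0 K) (row 2 K)) (phat Q (row 1 K) (row 2 K)).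
have uM : M \in unitmx.
  exact: (unit_of_hat_free uK Qf (fun v => hat_alpha_betaK v p01 h2)).
have a0 : aff K 0 = row 0 K.
  by rewrite /aff row3_mul !mxE scale1r !scale0r !addr0.
have k0 : row 0 K != 0 by rewrite -a0 aff_neq0.
exists (std_chart K); first by rewrite -a0; exact: std_chartP.
pose B (p : 'rV[R]_2) := row4 (1 - al * p 0 1 ^+ 2) (p 0 0 ^+ 2 - be * p 0 1 ^+ 2)
  (p 0 1) (p 0 0 * p 0 1).
have gE p : net_map Q (std_chart K p) = pr (B p *m M).
  by rewrite /std_chart net_normalize ?aff_neq0 // /aff (hat_alpha_beta p01 h2) /B expr1n !mul1r.
have Bm p : (B p *m M) 0 ord_max != 0.
  have -> : B p *m M = hat Q (aff K p).
    by rewrite /aff (hat_alpha_beta p01 h2) /B expr1n !mul1r.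
  by rewrite hat_max gt_eqF // dot_gt0 // aff_neq0.
pose S y := homog y *m invmx M.
have SE p : S (net_map Q (std_chart K p)) = ((B p *m M) 0 ord_max)^-1 *: B p.
  by rewrite /S gE homog_pr // -scalemxAl mulmxK.
pose W y := S y 0 1 / S y 0 0; pose X y := S y 0 2 / S y 0 0; pose Y y := S y 0 3 / S y 0 0.
pose psi y := row3 (X y) (W y * (1 - al * Zinv al (X y) ^+ 2) + be * Zinv al (X y) ^+ 2) (Y y).
pose phi (p : 'rV[R]_2) := row2 (p 0 1 / (1 - al * p 0 1 ^+ 2)) (p 0 0).
have B0 : B 0 = row4 1 0 0 0.
  by apply: row4P; rewrite /B !mxE /= ?expr0n /= ?mulr0 ?subr0 ?mul0r.
have S0 : S ((net_map Q \o std_chart K) 0) 0 0 != 0.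
  have := Bm 0; rewrite /= SE; move: ((B 0 *m M) 0 ord_max) => m m0.
  by rewrite B0 !mxE /= mulr1 invr_neq0.
have X0 : X ((net_map Q \o std_chart K) 0) = 0.
  rewrite /X /= SE; move: ((B 0 *m M) 0 ord_max) => m.
  by rewrite B0 !mxE /= mulr0 mul0r.
set g0 := (net_map Q \o std_chart K) 0 in S0 X0 *.
have sS j : smooth_at (fun y => S y 0 j) g0.
  by have /smooth_row := @smooth_mulmx R _ 3 3 homog (invmx M) g0 (smooth_homog g0); exact.
have sX : smooth_at X g0 by apply: smoothM => //; exact: smoothV.
have sW : smooth_at W g0 by apply: smoothM => //; exact: smoothV.
have sY : smooth_at Y g0 by apply: smoothM => //; exact: smoothV.
have sZ : smooth_at (fun y => Zinv al (X y)) g0 by exact: smooth_Zinv.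
have spsi : smooth_at psi g0.
  apply: smooth_row3 => //; apply: smoothD; apply: smoothM => //.
  - apply: smoothB; first exact: smooth_cst.
    by apply: smoothM; [exact: smooth_cst|exact: smoothX].
  - exact: smooth_cst.
  - exact: smoothX.
have sc : smooth_at (fun p : 'rV[R]_2 => 1 - al * p 0 1 ^+ 2) 0 by smooth_tac.
have sc' : smooth_at (fun p : 'rV[R]_2 => 1 + al * p 0 1 ^+ 2) 0 by smooth_tac.
have c0 : 0 < 1 - al * (0 : 'rV[R]_2) 0 1 ^+ 2 by rewrite mxE expr0n mulr0 subr0 ltr01.
have c0' : 0 < 1 + al * (0 : 'rV[R]_2) 0 1 ^+ 2 by rewrite mxE expr0n mulr0 addr0 ltr01.
have sphi : smooth_at phi 0.
  apply: smooth_row2; last exact: smooth_coord.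
  by apply: smoothM; [exact: smooth_coord|apply: smoothV => //; exact: lt0r_neq0].
have near_c := nbhsI2 (near_smooth_gt0 sc c0) (near_smooth_gt0 sc' c0').
have phi0 : phi 0 = 0.
  by apply: row2P; rewrite !mxE /= ?mul0r.
have dphi : local_diffeo phi 0.
  split=> [|v]; first exact/smooth_nearP.
  apply: (@left_inverse_deriv_neq0 R _ _ phi (fun q => row2 (q 0 1) (Zinv al (q 0 0)))).
  - exact: smooth_at_differentiable.
  - apply: smooth_at_differentiable; apply: smooth_row2; first exact: smooth_coord.
    by apply: smooth_Zinv; [exact: smooth_coord|rewrite phi0 mxE].
  - by apply: filterS near_c => p [h1 h2']; apply: row2P; rewrite !mxE //= ZinvK.
have Zg0 : Zinv al (X g0) = 0 by rewrite X0 /Zinv mulr0 mul0r.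
have sU : smooth_at (fun y => 1 - al * Zinv al (X y) ^+ 2) g0.
  apply: smoothB; first exact: smooth_cst.
  by apply: smoothM; [exact: smooth_cst|exact: smoothX].
have U0 : 1 - al * Zinv al (X g0) ^+ 2 != 0.
  by rewrite Zg0 expr0n mulr0 subr0 oner_eq0.
have dpsi : local_diffeo psi g0.
  split=> [|v]; first exact/smooth_nearP.
  apply: (@left_inverse_deriv_neq0 R _ _ psi (fun q => pr (row4 1
    ((q 0 1 - be * Zinv al (q 0 0) ^+ 2) / (1 - al * Zinv al (q 0 0) ^+ 2)) (q 0 0) (q 0 2) *m M))).
  - exact: smooth_at_differentiable.
  - apply: smooth_at_differentiable.
    have q0 : psi g0 0 0 = 0 by rewrite mxE.
    have sz : smooth_at (fun q : 'rV[R]_3 => Zinv al (q 0 0)) (psi g0).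
      by apply: smooth_Zinv => //; exact: smooth_coord.
    have sden : smooth_at (fun q : 'rV[R]_3 => 1 - al * Zinv al (q 0 0) ^+ 2) (psi g0).
      apply: smoothB; first exact: smooth_cst.
      by apply: smoothM; [exact: smooth_cst|exact: smoothX].
    apply: (smooth_pr (A := fun q : 'rV[R]_3 => row4 1
      ((q 0 1 - be * Zinv al (q 0 0) ^+ 2) / (1 - al * Zinv al (q 0 0) ^+ 2))
      (q 0 0) (q 0 2) *m M)).
      apply: smooth_mulmx; apply: smooth_row4; [exact: smooth_cst| |exact: smooth_coord..].
      apply: smoothM; last first.
        by apply: smoothV => //; rewrite q0 /Zinv mulr0 mul0r expr0n mulr0 subr0 oner_eq0.
      apply: smoothB; first exact: smooth_coord.
      by apply: smoothM; [exact: smooth_cst|exact: smoothX].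
    have -> : row4 1 ((psi g0 0 1 - be * Zinv al (psi g0 0 0) ^+ 2) /
       (1 - al * Zinv al (psi g0 0 0) ^+ 2)) (psi g0 0 0) (psi g0 0 2) = B 0.
      rewrite B0 !mxE /= Zg0 expr0n !mulr0 !subr0 divr1 mulr1 addr0 X0.
      by congr row4; rewrite /W /Y /g0 /= SE; move: ((B 0 *m M) 0 ord_max) => m;
        rewrite B0 !mxE /= mulr0 mul0r.
    exact: Bm.
  - apply: filterS (nbhsI2 (near_smooth_neq0 (sS 0) S0) (near_smooth_neq0 sU U0)) => y [y0 yU].
    rewrite !mxE /=.
    have -> : (W y * (1 - al * Zinv al (X y) ^+ 2) + be * Zinv al (X y) ^+ 2 -
        be * Zinv al (X y) ^+ 2) / (1 - al * Zinv al (X y) ^+ 2) = W y by rewrite addrK mulfK.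
    have -> : row4 1 (W y) (X y) (Y y) = (S y 0 0)^-1 *: S y.
      by apply: row4P; rewrite [LHS]mxE [RHS]mxE /= ?mulVf // mulrC.
    by rewrite -scalemxAl /S mulmxKV // pr_scale ?pr_homog // invr_neq0.
exists phi, psi; split => //.
apply: filterS near_c => p [h1 h2'] /=.
have h1' := lt0r_neq0 h1.
have A0 := Bm p.
have XE : X (net_map Q (std_chart K p)) = p 0 1 / (1 - al * p 0 1 ^+ 2).
  by rewrite /X SE; move: ((B p *m M) 0 ord_max) A0 => m m0; rewrite !mxE /=; field; rewrite m0 h1'.
rewrite /psi /cross_cap_normal_form XE ZinvK // /W /Y SE.
move: ((B p *m M) 0 ord_max) A0 => m m0.
by apply: row3P; rewrite !mxE //=; field; rewrite m0 h1'.
Qed.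

End Bases.

(** * Geometry of the locus read in a normal form *)

Section Systems.
Context {R : realType}.
Variables (Q : @net R) (K : 'M[R]_3) (M : 'M[R]_4) (G : 'rV[R]_3 -> 'rV[R]_4).
Hypotheses (uK : K \in unitmx) (uM : M \in unitmx).
Hypothesis hE : forall v, hat Q (v *m K) = G v *m M.
Local Notation F := (net_map Q).

(** For the quadratic maps [G] used below this is the polarization, and [M] turns it into [phat]:
    immersion, tangency and curvature become algebra on [G]. *)
Definition polar (v w : 'rV[R]_3) : 'rV[R]_4 := G (v + w) - G v - G w.

Lemma mulK_inj (v w : 'rV[R]_3) : v *m K = w *m K -> v = w.
Proof. by move=> /(congr1 (mulmx^~ (invmx K))); rewrite !mulmxK. Qed.

Lemma mulM_inj (v w : 'rV[R]_4) : v *m M = w *m M -> v = w.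
Proof. by move=> /(congr1 (mulmx^~ (invmx M))); rewrite !mulmxK. Qed.

Lemma coordsP (u : 'rV[R]_3) : exists v, u = v *m K.
Proof. by exists (u *m invmx K); rewrite mulmxKV. Qed.

Lemma sys_phat v w : phat Q (v *m K) (w *m K) = polar v w *m M.
Proof.
have := hatD Q (v *m K) (w *m K); rewrite -mulmxDl !hE /polar => E.
rewrite !mulmxBl E; move: (G v *m M) (phat _ _ _) (G w *m M) => x y z.
by apply/rowP => j; rewrite !mxE; ring.
Qed.

Lemma sys_hat v w : hat Q (v *m K) = hat Q (w *m K) <-> G v = G w.
Proof. by rewrite !hE; split=> [/mulM_inj|->]. Qed.

Lemma sys_sphere v w : G v = G w -> sphere (v *m K) -> sphere (w *m K).
Proof.
move=> /sys_hat/(congr1 (fun A : 'rV[R]_4 => A 0 ord_max)); rewrite !hat_max.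
by rewrite /sphere /= => ->.
Qed.

Lemma sys_eq v w : sphere (v *m K) -> sphere (w *m K) ->
  (F (v *m K) = F (w *m K) <-> G v = G w).
Proof. by move=> sv sw; rewrite hat_eq // sys_hat. Qed.

Lemma sys_immersive v : (forall w, polar v w = 0 -> w = 0) -> immersive_at F (v *m K).
Proof.
move=> H; apply: immersive_hat => w; have [w' ->] := coordsP w.
by rewrite sys_phat => E; rewrite (H w') ?mul0mx //; apply: mulM_inj; rewrite E mul0mx.
Qed.

Lemma sys_singular v w : w != 0 -> polar v w = 0 -> singular_at F (v *m K).
Proof.
move=> w0 E; apply: (@singular_hat _ _ _ (w *m K)); last by rewrite sys_phat E mul0mx.
by apply: contra w0 => /eqP w0; apply/eqP/mulK_inj; rewrite w0 mul0mx.
Qed.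

Lemma sys_transversal v w : sphere (v *m K) -> G v = G w ->
  (forall A, exists w1 w2, A = polar v w1 + polar w w2) ->
  forall a, exists b c, [/\ tangent_image F (v *m K) b, tangent_image F (w *m K) c & a = b + c].
Proof.
move=> sv vw H; have sw := sys_sphere vw sv.
apply: transversal_hat => //; first exact/sys_eq.
move=> A; have [w1 [w2 E]] := H (A *m invmx M).
exists (w1 *m K), (w2 *m K); rewrite !sys_phat -mulmxDl -E.
by rewrite mulmxKV.
Qed.

Lemma pmP (s : seq 'rV[R]_3) u : pm s u <-> (u \in s) \/ (- u \in s).
Proof. by split=> [/orP|H]; last apply/orP. Qed.

Lemma sys_preim1 v : sphere (v *m K) -> (forall w, G w = G v -> w = v \/ w = - v) ->
  Defs.preim F (F (v *m K)) = pm [:: v *m K].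
Proof.
move=> sv H; apply/seteqP; split=> u.
  move=> [su E]; have [w uE] := coordsP u; subst u; move/(sys_eq su sv): E => /H[->|->].
    by apply/pmP; left; rewrite inE.
  by apply/pmP; right; rewrite inE mulNmx opprK.
move=> /pmP[]; rewrite inE => /eqP; first by move=> ->.
move=> /(congr1 -%R); rewrite opprK => ->.
by split; [exact: sphereN|rewrite net_mapN].
Qed.

Lemma sys_preim2 v v2 : sphere (v *m K) -> G v2 = G v ->
  (forall w, G w = G v -> [\/ w = v, w = - v, w = v2 | w = - v2]) ->
  Defs.preim F (F (v *m K)) = pm [:: v *m K; v2 *m K].
Proof.
move=> sv E2 H; have sv2 := sys_sphere (esym E2) sv.
have F2 : F (v2 *m K) = F (v *m K) by apply/sys_eq.
apply/seteqP; split=> u.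
  move=> [su E]; have [w uE] := coordsP u; subst u; move/(sys_eq su sv): E => /H[->|->|->|->].
  - by apply/pmP; left; rewrite !inE eqxx.
  - by apply/pmP; right; rewrite !inE mulNmx opprK eqxx.
  - by apply/pmP; left; rewrite !inE eqxx orbT.
  - by apply/pmP; right; rewrite !inE mulNmx opprK eqxx orbT.
move=> /pmP[]; rewrite !inE => /orP[] /eqP; first by move=> ->.
- by move=> ->; split => //.
- move=> /(congr1 -%R); rewrite opprK => ->.
  by split; [exact: sphereN|rewrite net_mapN].
- move=> /(congr1 -%R); rewrite opprK => ->.
  by split; [exact: sphereN|rewrite net_mapN].
Qed.

Lemma sys_preim3 v v2 v3 : sphere (v *m K) -> G v2 = G v -> G v3 = G v ->
  (forall w, G w = G v -> (w = v \/ w = - v) \/ [\/ w = v2, w = - v2, w = v3 | w = - v3]) ->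
  Defs.preim F (F (v *m K)) = pm [:: v *m K; v2 *m K; v3 *m K].
Proof.
move=> sv E2 E3 H; have sv2 := sys_sphere (esym E2) sv; have sv3 := sys_sphere (esym E3) sv.
have F2 : F (v2 *m K) = F (v *m K) by apply/sys_eq.
have F3 : F (v3 *m K) = F (v *m K) by apply/sys_eq.
apply/seteqP; split=> u.
  move=> [su E]; have [w uE] := coordsP u; subst u.
  move/(sys_eq su sv): E => /H[[->|->]|[->|->|->|->]].
  - by apply/pmP; left; rewrite !inE eqxx.
  - by apply/pmP; right; rewrite !inE mulNmx opprK eqxx.
  - by apply/pmP; left; rewrite !inE eqxx orbT.
  - by apply/pmP; right; rewrite !inE mulNmx opprK eqxx orbT.
  - by apply/pmP; left; rewrite !inE eqxx !orbT.
  - by apply/pmP; right; rewrite !inE mulNmx opprK eqxx !orbT.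
move=> /pmP[]; rewrite !inE => /or3P[] /eqP; try by move=> ->.
- move=> /(congr1 -%R); rewrite opprK => ->.
  by split; [exact: sphereN|rewrite net_mapN].
- move=> /(congr1 -%R); rewrite opprK => ->.
  by split; [exact: sphereN|rewrite net_mapN].
- move=> /(congr1 -%R); rewrite opprK => ->.
  by split; [exact: sphereN|rewrite net_mapN].
Qed.

Lemma sys_non_antipodal v w : v != w -> v != - w -> non_antipodal (v *m K) (w *m K).
Proof.
move=> vw vNw; rewrite /non_antipodal -mulNmx; apply/andP; split.
  by apply: contra vw => /eqP/mulK_inj ->.
by apply: contra vNw => /eqP/mulK_inj ->.
Qed.

Lemma sys_tangent_image_eq v w :
  (forall w1, exists w2, polar v w1 = polar w w2) ->
  (forall w1, exists w2, polar w w1 = polar v w2) ->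
  tangent_image F (v *m K) = tangent_image F (w *m K).
Proof.
move=> H1 H2; apply: tangent_image_eq => x; have [w1 ->] := coordsP x.
  by have [w2 E] := H1 w1; exists (w2 *m K); rewrite !sys_phat E.
by have [w2 E] := H2 w1; exists (w2 *m K); rewrite !sys_phat E.
Qed.

Lemma sys_same_curvature v w : sphere (v *m K) -> G v = G w ->
  (same_curvature F (v *m K) (w *m K) <->
   forall w1 w2, polar v w1 = polar w w2 -> exists w3, G w1 - G w2 = polar v w3).
Proof.
move=> sv vw; have sw := sys_sphere vw sv.
rewrite same_curvatureP //; last exact/sys_eq.
split=> H w1 w2.
  move=> E; have [|w3] := H (w1 *m K) (w2 *m K); first by rewrite !sys_phat E.
  have [w3' ->] := coordsP w3; rewrite !hE sys_phat -mulmxBl => /mulM_inj E3.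
  by exists w3'.
have [w1' ->] := coordsP w1; have [w2' ->] := coordsP w2.
rewrite !sys_phat => /mulM_inj/H[w3 E]; exists (w3 *m K).
by rewrite !hE sys_phat -mulmxBl E.
Qed.

End Systems.

(** * Double point curves as segments *)

Section Segments.
Context {R : realType}.
Variables (Q : @net R) (a b : 'rV[R]_3).
Hypotheses (a0 : a != 0) (b0 : b != 0) (ab : phat Q a b = 0).
Local Notation F := (net_map Q).

(** For conjugate [a] and [b] the mixed term of [hat Q (x *: a + y *: b)] disappears and only
    squares remain, so the great circle through [a] and [b] is folded onto this straight segment.
    All double point curves below arise in this way. *)
Definition seg (t : R) : 'rV[R]_3 := (1 - t) *: F (normalize a) + t *: F (normalize b).

Lemma seg0 : seg 0 = F (normalize a).
Proof. by rewrite /seg subr0 scale1r scale0r addr0. Qed.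

Lemma seg1 : seg 1 = F (normalize b).
Proof. by rewrite /seg subrr scale1r scale0r add0r. Qed.

Lemma F_normalize w : w != 0 -> F w = dot w w *: F (normalize w).
Proof.
move=> w0; rewrite /normalize net_mapZ scalerA exprVn sqr_sqrtr ?dot_ge0 // mulfV ?scale1r //.
by rewrite gt_eqF // dot_gt0.
Qed.

Lemma hat_ab x y : hat Q (x *: a + y *: b) = x ^+ 2 *: hat Q a + y ^+ 2 *: hat Q b.
Proof. by rewrite hatD !hatZ phatZl phatZr ab !scaler0 addr0. Qed.

Lemma dot_ab x y : dot (x *: a + y *: b) (x *: a + y *: b) =
  x ^+ 2 * dot a a + y ^+ 2 * dot b b.
Proof. by rewrite -!(hat_max Q) hat_ab !mxE. Qed.

Lemma F_ab x y : F (x *: a + y *: b) = x ^+ 2 *: F a + y ^+ 2 *: F b.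
Proof.
apply/rowP => k; rewrite -hat_lift hat_ab [LHS]mxE [X in X + _]mxE [X in _ + X]mxE.
by rewrite !hat_lift [RHS]mxE [X in _ = X + _]mxE [X in _ = _ + X]mxE.
Qed.

Lemma seg_ab x y : sphere (x *: a + y *: b) -> F (x *: a + y *: b) = seg (y ^+ 2 * dot b b).
Proof.
move=> sxy; have E : 1 - y ^+ 2 * dot b b = x ^+ 2 * dot a a.
  by rewrite -sxy dot_ab addrK.
by rewrite /seg E F_ab !(F_normalize a0) !(F_normalize b0) !scalerA.
Qed.

Lemma seg_param t : 0 <= t <= 1 -> exists x y, [/\ sphere (x *: a + y *: b),
  seg t = F (x *: a + y *: b), 0 <= x, 0 <= y & x ^+ 2 * dot a a = 1 - t /\ y ^+ 2 * dot b b = t].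
Proof.
move=> /andP[t0 t1]; have A := dot_gt0 a0; have B := dot_gt0 b0.
pose x := Num.sqrt ((1 - t) / dot a a); pose y := Num.sqrt (t / dot b b).
have xE : x ^+ 2 * dot a a = 1 - t.
  by rewrite sqr_sqrtr ?divfK ?gt_eqF // divr_ge0 ?subr_ge0 // ltW.
have yE : y ^+ 2 * dot b b = t.
  by rewrite sqr_sqrtr ?divfK ?gt_eqF // divr_ge0 // ltW.
have s : sphere (x *: a + y *: b) by rewrite /sphere /= dot_ab xE yE subrK.
by exists x, y; split; rewrite ?sqrtr_ge0 // seg_ab // yE.
Qed.

Lemma seg_arc : F (normalize a) != F (normalize b) -> Defs.arc seg.
Proof.
move=> Fab; split.
  apply: continuous_subspaceT => t; apply: cvgD; apply: cvgZr_tmp.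
    by apply: cvgB; [exact: cvg_cst|exact: cvg_id].
  exact: cvg_id.
move=> s t _ _ E; have : (s - t) *: (F (normalize b) - F (normalize a)) = 0.
  move: E; rewrite /seg => /rowP E; apply/rowP => j; have := E j.
  move: (F (normalize a)) (F (normalize b)) => p q.
  by rewrite !mxE => e; lra.
move/eqP; rewrite scaler_eq0 subr_eq0 => /orP[/eqP //|].
by rewrite subr_eq0 eq_sym (negbTE Fab).
Qed.

Lemma arc_pts_seg x y : sphere (x *: a + y *: b) -> arc_pts seg (F (x *: a + y *: b)).
Proof.
move=> s; exists (y ^+ 2 * dot b b); last by rewrite seg_ab.
have := s; rewrite /sphere /= dot_ab in_itv /= => E.
by rewrite mulr_ge0 ?sqr_ge0 ?dot_ge0 //= -E lerDr mulr_ge0 ?sqr_ge0 ?dot_ge0.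
Qed.

Lemma arc_int_seg x y : sphere (x *: a + y *: b) -> x != 0 -> y != 0 ->
  arc_int seg (F (x *: a + y *: b)).
Proof.
move=> s x0 y0; exists (y ^+ 2 * dot b b); last by rewrite seg_ab.
have := s; rewrite /sphere /= dot_ab in_itv /= => E.
have p (z : R) (w : 'rV[R]_3) : z != 0 -> w != 0 -> 0 < z ^+ 2 * dot w w.
  by move=> z0 w0; apply: mulr_gt0; [rewrite exprn_even_gt0|exact: dot_gt0].
by rewrite p //= -E ltrDr p.
Qed.

Lemma arc_pts_segP y : arc_pts seg y ->
  exists s t, sphere (s *: a + t *: b) /\ y = F (s *: a + t *: b).
Proof.
move=> [t]; rewrite /= in_itv /= => /seg_param[x [z [s E _ _ _]]] <-.
by exists x, z.
Qed.

Lemma arc_int_segP y : arc_int seg y ->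
  exists s t, [/\ sphere (s *: a + t *: b), y = F (s *: a + t *: b), 0 < s & 0 < t].
Proof.
move=> [t]; rewrite /= in_itv /= => /andP[t0 t1] <-.
have [|x [z [s E x0 z0 [xE zE]]]] := @seg_param t; first by rewrite !ltW.
exists x, z; split => //; rewrite lt_neqAle ?x0 ?z0 andbT eq_sym; apply/eqP => h.
  by move: xE t1; rewrite h expr0n mul0r => /esym/eqP; rewrite subr_eq0 => /eqP <-; rewrite ltxx.
by move: zE t0; rewrite h expr0n mul0r => <-; rewrite ltxx.
Qed.

End Segments.

(** * Cross-cap surfaces and surfaces of type 5 *)

Section Types.
Context {R : realType}.

Lemma sqr_cases (a b : R) : a ^+ 2 = b ^+ 2 -> a = b \/ a = - b.
Proof. by move/eqP; rewrite eqf_sqr => /orP[/eqP|/eqP]; [left|right]. Qed.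

Lemma same_signs (x y p q : R) : p = x \/ p = - x -> q = y \/ q = - y ->
  p - q = x - y -> x != y -> p = x /\ q = y.
Proof.
move=> [] -> [] -> E st.
- by [].
- have y0 : y = 0 by lra.
  by rewrite y0 oppr0.
- have x0 : x = 0 by lra.
  by rewrite x0 oppr0.
- by move/eqP: st; case; lra.
Qed.

Lemma normalizeE (w : 'rV[R]_3) : w != 0 -> exists2 c : R, c != 0 & normalize w = c *: w.
Proof. by move=> w0; exists (Num.sqrt (dot w w))^-1 => //; exact: invsqrt_neq0. Qed.

Lemma F_sphere_scale Q (w : 'rV[R]_3) (s : R) : w != 0 -> sphere (s *: w) ->
  net_map Q (s *: w) = net_map Q (normalize w).
Proof.
move=> w0; rewrite /sphere /= dotZl dotZr mulrA -expr2 => s1.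
rewrite net_mapZ (F_normalize Q w0) scalerA s1 scale1r //.
Qed.

Lemma row3_neq0 (x y z : R) : [|| x != 0, y != 0 | z != 0] -> row3 x y z != 0.
Proof.
move=> H; apply/eqP => /rowP E; have := E 0; have := E 1; have := E 2.
by rewrite !mxE /= => z0 y0 x0; move: H; rewrite x0 y0 z0 !eqxx.
Qed.

Lemma mulK_neq0 (K : 'M[R]_3) (v : 'rV[R]_3) : K \in unitmx -> v != 0 -> v *m K != 0.
Proof.
by move=> uK; apply: contra => /eqP E; apply/eqP/(mulK_inj uK); rewrite E mul0mx.
Qed.

Lemma row3_mulZ (c x y z : R) (K : 'M[R]_3) :
  c *: (row3 x y z *m K) = row3 (c * x) (c * y) (c * z) *m K.
Proof. by rewrite scalemxAl; congr (_ *m K); apply: row3P; rewrite !mxE. Qed.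

Lemma row_rows3 (a b c : 'rV[R]_3) :
  [/\ row 0 (rows3 a b c) = a, row 1 (rows3 a b c) = b & row 2 (rows3 a b c) = c].
Proof. by split; rewrite rowK. Qed.

Lemma rowsK (K : 'M[R]_3) : [/\ row 0 K = row3 1 0 0 *m K, row 1 K = row3 0 1 0 *m K
  & row 2 K = row3 0 0 1 *m K].
Proof. by split; rewrite row3_mul ?scale1r ?scale0r ?add0r ?addr0. Qed.

Lemma rows3_unit (K P : 'M[R]_3) (a b c : 'rV[R]_3) : K \in unitmx -> P \in unitmx ->
  [/\ a = row 0 P *m K, b = row 1 P *m K & c = row 2 P *m K] -> rows3 a b c \in unitmx.
Proof.
move=> uK uP [-> -> ->]; have -> : rows3 (row 0 P *m K) (row 1 P *m K) (row 2 P *m K) = P *m K.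
  by apply/row_matrixP; apply: ord3E; rewrite rowK /= row_mul.
by rewrite unitmx_mul uP.
Qed.

Lemma unitmx_row3 (x0 x1 x2 y0 y1 y2 z0 z1 z2 : R) :
  x0 * (y1 * z2 - y2 * z1) - x1 * (y0 * z2 - y2 * z0) + x2 * (y0 * z1 - y1 * z0) != 0 ->
  rows3 (row3 x0 x1 x2) (row3 y0 y1 y2) (row3 z0 z1 z2) \in unitmx.
Proof.
move=> D; apply: mulmx_inj_unitmx => v; apply: contra => /eqP.
rewrite [v]row3_eta row3_mul !rowK /= => /rowP E.
have := E 0; have := E 1; have := E 2; rewrite !mxE /=.
move: (v 0 0) (v 0 1) (v 0 2) => a b c e2 e1 e0.
have S k0 k1 k2 : k0 * (a * x0 + b * y0 + c * z0) + k1 * (a * x1 + b * y1 + c * z1) +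
    k2 * (a * x2 + b * y2 + c * z2) = 0 by rewrite e0 e1 e2 !mulr0 !addr0.
apply/eqP; apply: row3P; rewrite !mxE /=; apply: (mulfI D); rewrite mulr0.
- by rewrite -(S (y1 * z2 - y2 * z1) (- (y0 * z2 - y2 * z0)) (y0 * z1 - y1 * z0)); ring.
- by rewrite -(S (- (x1 * z2 - x2 * z1)) (x0 * z2 - x2 * z0) (- (x0 * z1 - x1 * z0))); ring.
- by rewrite -(S (x1 * y2 - x2 * y1) (- (x0 * y2 - x2 * y0)) (x0 * y1 - x1 * y0)); ring.
Qed.

Section CrossCap.
Variables (Q : @net R) (K : 'M[R]_3) (al be : R).
Hypotheses (uK : K \in unitmx) (Qf : hat_free Q).
Hypothesis p01 : phat Q (row 0 K) (row 1 K) = 0.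
Hypothesis h2 : hat Q (row 2 K) = - al *: hat Q (row 0 K) - be *: hat Q (row 1 K).
Local Notation F := (net_map Q).

Definition Gab (v : 'rV[R]_3) : 'rV[R]_4 :=
  row4 (v 0 0 ^+ 2 - al * v 0 2 ^+ 2) (v 0 1 ^+ 2 - be * v 0 2 ^+ 2)
       (v 0 0 * v 0 2) (v 0 1 * v 0 2).

Lemma polar_Gab v w : polar Gab v w = row4 (2 * (v 0 0 * w 0 0 - al * (v 0 2 * w 0 2)))
  (2 * (v 0 1 * w 0 1 - be * (v 0 2 * w 0 2))) (v 0 0 * w 0 2 + v 0 2 * w 0 0)
  (v 0 1 * w 0 2 + v 0 2 * w 0 1).
Proof. by apply: row4P; rewrite !mxE /=; ring. Qed.

Lemma Gab_eq (v w : 'rV[R]_3) : Gab w = Gab v -> [/\ w 0 0 ^+ 2 - al * w 0 2 ^+ 2 = v 0 0 ^+ 2 - al * v 0 2 ^+ 2,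
  w 0 1 ^+ 2 - be * w 0 2 ^+ 2 = v 0 1 ^+ 2 - be * v 0 2 ^+ 2,
  w 0 0 * w 0 2 = v 0 0 * v 0 2 & w 0 1 * w 0 2 = v 0 1 * v 0 2].
Proof. by move=> /rowP E; split; [have := E 0|have := E 1|have := E 2|have := E 3]; rewrite !mxE. Qed.

Hypotheses (al0 : al < 0) (be0 : 0 < be).

(** If [w 0 2] is nonzero, squaring the last equation and inserting the second leaves
    [v 0 2 ^+ 2 - w 0 2 ^+ 2] times a quantity that [0 < be] makes positive. If it is zero, the
    second equation has the wrong sign. *)
Lemma Gab_fib1 (v w : 'rV[R]_3) : v 0 2 != 0 -> Gab w = Gab v -> w = v \/ w = - v.
Proof.
move=> z0 /Gab_eq[E0 E1 E2 E3].
have z2 : w 0 2 ^+ 2 = v 0 2 ^+ 2.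
  have [w2|w2] := eqVneq (w 0 2) 0.
    exfalso; have y0 : v 0 1 = 0 by apply: (mulIf z0); rewrite mul0r -E3 w2 mulr0.
    move: E1; rewrite w2 y0 expr0n /= mulr0 subr0 add0r => E1.
    have : 0 < be * v 0 2 ^+ 2 by apply: mulr_gt0 => //; rewrite exprn_even_gt0.
    have := sqr_ge0 (w 0 1); rewrite E1; lra.
  have E3' : w 0 1 ^+ 2 * w 0 2 ^+ 2 = v 0 1 ^+ 2 * v 0 2 ^+ 2 by rewrite -!exprMn E3.
  have pos : 0 < v 0 1 ^+ 2 * v 0 2 ^+ 2 + be * (w 0 2 ^+ 2 * v 0 2 ^+ 2).
    apply: ltr_wpDl; first by rewrite mulr_ge0 ?sqr_ge0.
    by apply: mulr_gt0 => //; apply: mulr_gt0; rewrite exprn_even_gt0.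
  have : (v 0 2 ^+ 2 - w 0 2 ^+ 2) * (v 0 1 ^+ 2 * v 0 2 ^+ 2 + be * (w 0 2 ^+ 2 * v 0 2 ^+ 2)) = 0.
    have e : w 0 1 ^+ 2 = v 0 1 ^+ 2 - be * v 0 2 ^+ 2 + be * w 0 2 ^+ 2 by lra.
    have := congr1 ( *%R (v 0 2 ^+ 2)) E3'; rewrite e.
    move: (v 0 1 ^+ 2) (v 0 2 ^+ 2) (w 0 2 ^+ 2) => p q r h; lra.
  by move/eqP; rewrite mulf_eq0 (gt_eqF pos) orbF subr_eq0 => /eqP ->.
have [e|e] := sqr_cases z2; [left|right]; move: E2 E3; rewrite e.
  by move=> /(mulIf z0) e0 /(mulIf z0) e1; apply: row3P.
rewrite !mulrN -!mulNr => /(mulIf z0) e0 /(mulIf z0) e1.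
by apply: row3P; rewrite [RHS]mxE ?e // -?e0 -?e1 opprK.
Qed.

Lemma Gab_fib2 (v w : 'rV[R]_3) : v 0 2 = 0 -> Gab w = Gab v ->
  w 0 2 = 0 /\ (w 0 0 ^+ 2 = v 0 0 ^+ 2 /\ w 0 1 ^+ 2 = v 0 1 ^+ 2).
Proof.
move=> z0 /Gab_eq[E0 E1 E2 E3].
suff w0 : w 0 2 = 0.
  by move: E0 E1; rewrite w0 z0 expr0n /= !mulr0 !subr0.
apply/eqP; apply: contraT => w0; exfalso.
have x0 : w 0 0 = 0 by apply: (mulIf w0); rewrite mul0r E2 z0 mulr0.
have y0 : w 0 1 = 0 by apply: (mulIf w0); rewrite mul0r E3 z0 mulr0.
move: E1; rewrite y0 z0 expr0n /= mulr0 subr0 add0r => E1.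
have : 0 < be * w 0 2 ^+ 2 by apply: mulr_gt0 => //; rewrite exprn_even_gt0.
have := sqr_ge0 (v 0 1); rewrite -E1; lra.
Qed.

Lemma Gab_imm1 (v : 'rV[R]_3) : v 0 2 != 0 -> forall w, polar Gab v w = 0 -> w = 0.
Proof.
move=> z0 w; rewrite polar_Gab => /rowP E.
have := E 0; have := E 1; have := E 2; have := E 3; rewrite !mxE /=.
move: z0 (@row3P R w 0); rewrite !mxE.
move: (v 0 0) (v 0 1) (v 0 2) (w 0 0) (w 0 1) (w 0 2) => x y z a b c z0 P E3 E2 E1 _.
have H : c * (y ^+ 2 + be * z ^+ 2) = 0.
  have e : z * b = - (y * c) by lra.
  have e2 : z * (y * b - be * (z * c)) = 0 by rewrite (_ : y * b - be * (z * c) = 0) ?mulr0 //; lra.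
  have : y * (z * b) - be * z * (z * c) = 0 by lra.
  rewrite e; lra.
have pos : 0 < y ^+ 2 + be * z ^+ 2.
  by apply: ltr_wpDl; [exact: sqr_ge0|apply: mulr_gt0 => //; rewrite exprn_even_gt0].
have c0 : c = 0 by apply/eqP; move/eqP: H; rewrite mulf_eq0 (gt_eqF pos) orbF.
apply: P => //; apply: (mulfI z0); rewrite c0 in E2 E3; lra.
Qed.

Lemma Gab_imm2 (v : 'rV[R]_3) : v 0 2 = 0 -> v 0 0 != 0 -> v 0 1 != 0 ->
  forall w, polar Gab v w = 0 -> w = 0.
Proof.
move=> z0 x0 y0 w; rewrite polar_Gab z0 => /rowP E.
have := E 0; have := E 1; have := E 2; have := E 3; rewrite !mxE /= => E3 E2 E1 E0.
have c0 : w 0 2 = 0 by apply: (mulfI x0); lra.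
rewrite c0 in E1 E0.
by apply: row3P; rewrite [RHS]mxE //; [apply: (mulfI x0)|apply: (mulfI y0)]; lra.
Qed.

(** The double points come from the plane of rows 0 and 1, where only the squares of the two
    coordinates matter. Both ends of the segment are cross-caps by [cross_cap_of_basis], used at the
    second end with rows 0 and 1 exchanged, and [al] with [be]. *)
Theorem cross_cap_surface_of_basis : cross_cap_surface F.
Proof.
have hE v : hat Q (v *m K) = Gab v *m _ := hat_alpha_betaK v p01 h2.
have uM := unit_of_hat_free uK Qf hE.
have [r0 r1 r2] := rowsK K.
have k00 : row 0 K != 0 by rewrite r0 mulK_neq0 // row3_neq0 // oner_eq0.
have k10 : row 1 K != 0 by rewrite r1 mulK_neq0 // row3_neq0 // oner_eq0 orbT.
have kE s t : s *: row 0 K + t *: row 1 K = row3 s t 0 *m K.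
  by rewrite row3_mul scale0r addr0.
have [c c0 nc] := normalizeE k00; have [d d0 nd] := normalizeE k10.
have ncE : normalize (row 0 K) = row3 c 0 0 *m K.
  by rewrite nc r0 row3_mulZ mulr1 !mulr0.
have ndE : normalize (row 1 K) = row3 0 d 0 *m K.
  by rewrite nd r1 row3_mulZ mulr1 !mulr0.
have sc := normalize_sphere k00; have sd := normalize_sphere k10.
exists (seg Q (row 0 K) (row 1 K)); rewrite seg0 seg1; split.
- apply: seg_arc; apply/eqP; rewrite ncE ndE in sc sd *.
  move/(sys_eq uM hE sc sd)/rowP/(_ 1); rewrite !mxE /= expr0n /= mulr0 !subr0.
  by move/esym/eqP; rewrite sqrf_eq0 (negbTE d0).
- exists (normalize (row 0 K)); last exact: (cross_cap_of_basis uK Qf p01 h2).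
  rewrite ncE in sc *; apply: (sys_preim1 uK uM hE) => // w /(Gab_fib2 _).
  rewrite !mxE /= => /(_ erefl)[w2 [/sqr_cases w0 /eqP]]; rewrite expr0n sqrf_eq0 => /eqP w1.
  by case: w0 => w0; [left|right]; apply: row3P; rewrite ?w0 ?w1 ?w2 !mxE //= oppr0.
- exists (normalize (row 1 K)).
    rewrite ndE in sd *; apply: (sys_preim1 uK uM hE) => // w /(Gab_fib2 _).
    rewrite !mxE /= => /(_ erefl)[w2 [/eqP]]; rewrite expr0n sqrf_eq0 => /eqP w0 /sqr_cases w1.
    by case: w1 => w1; [left|right]; apply: row3P; rewrite ?w0 ?w1 ?w2 !mxE //= oppr0.
  have [q0 q1 q2] := row_rows3 (row 1 K) (row 0 K) (row 2 K).
  rewrite -q0; apply: (@cross_cap_of_basis _ _ (rows3 (row 1 K) (row 0 K) (row 2 K)) be al) => //.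
  + apply: (rows3_unit uK (P := rows3 (row3 0 1 0) (row3 1 0 0) (row3 0 0 1))).
      by apply: unitmx_row3; rewrite !(mul0r, mulr0, mul1r, subr0, sub0r, addr0) oppr_eq0 oner_eq0.
    by split; rewrite [in RHS]rowK /=; [exact: r1|exact: r0|exact: r2].
  + by rewrite q0 q1 phatC.
  + by rewrite q0 q1 q2 h2 !scaleNr addrC.
- move=> y /(arc_int_segP k00 k10 p01)[s [t [ss -> s0 t0]]].
  rewrite kE in ss *.
  have s0' := lt0r_neq0 s0; have t0' := lt0r_neq0 t0.
  exists (row3 s t 0 *m K), (row3 s (- t) 0 *m K); split.
  + apply: (sys_preim2 uK uM hE) => //.
      by apply: row4P; rewrite !mxE /= ?sqrrN ?mulrN ?mulr0.
    move=> w /(Gab_fib2 _); rewrite !mxE /= => /(_ erefl)[w2 [/sqr_cases w0 /sqr_cases w1]].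
    by case: w0 w1 => w0 [] w1; [apply: Or41|apply: Or43|apply: Or44|apply: Or42];
      apply: row3P; rewrite ?w0 ?w1 ?w2 !mxE //= ?oppr0 ?opprK.
  + apply: (sys_non_antipodal uK).
      by apply/eqP => /rowP/(_ 1)/eqP; rewrite !mxE /= (negbTE (neq_opp t0')).
    by apply/eqP => /rowP/(_ 0)/eqP; rewrite !mxE /= (negbTE (neq_opp s0')).
  + by apply: (sys_immersive uK uM hE); apply: Gab_imm2; rewrite !mxE.
  + by apply: (sys_immersive uK uM hE); apply: Gab_imm2; rewrite !mxE //= oppr_eq0.
  + apply: (sys_transversal uM hE) => //.
      by apply: row4P; rewrite !mxE /= ?sqrrN ?mulrN ?mulr0.
    (* The third components of the two vectors are added in the third coordinate and subtracted in
       the fourth; the half sum and half difference of [A 0 2 / s] and [A 0 3 / t] separate them. *)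
    move=> A; exists (row3 (A 0 0 / (2 * s)) (A 0 1 / (2 * t)) ((A 0 2 / s + A 0 3 / t) / 2)).
    exists (row3 0 0 ((A 0 2 / s - A 0 3 / t) / 2)).
    by rewrite !polar_Gab; apply: row4P; rewrite !mxE /=; field; rewrite s0' t0'.
- move=> _ [u su <-]; have [v uE] := coordsP uK u; subst u => Narc.
  have [z0|z0] := eqVneq (v 0 2) 0.
    exfalso; apply: Narc; move: su; rewrite [v]row3_eta z0 -kE.
    exact: arc_pts_seg.
  exists (v *m K).
    by apply: (sys_preim1 uK uM hE) => // w; exact: Gab_fib1.
  by apply: (sys_immersive uK uM hE); exact: Gab_imm1.
Qed.

End CrossCap.

Section Type5.
Variables (Q : @net R) (K : 'M[R]_3).
Hypotheses (uK : K \in unitmx) (Qf : hat_free Q).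
Hypothesis p01 : phat Q (row 0 K) (row 1 K) = 0.
Hypothesis p02 : phat Q (row 0 K) (row 2 K) + phat Q (row 1 K) (row 2 K) = 0.
Local Notation F := (net_map Q).

(** The cubic of this system has a double root, the pair of rows 0 and 1, and a simple one, the pair
    of [row 0 K + row 1 K] and [row 2 K]. They give the tangent and the transversal double point
    curve respectively. *)
Definition G5 (v : 'rV[R]_3) : 'rV[R]_4 :=
  row4 (v 0 0 ^+ 2) (v 0 1 ^+ 2) (v 0 2 ^+ 2) (v 0 2 * (v 0 0 - v 0 1)).

Lemma polar_G5 v w : polar G5 v w = row4 (2 * (v 0 0 * w 0 0)) (2 * (v 0 1 * w 0 1))
  (2 * (v 0 2 * w 0 2)) (v 0 2 * (w 0 0 - w 0 1) + w 0 2 * (v 0 0 - v 0 1)).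
Proof. by apply: row4P; rewrite !mxE /=; ring. Qed.

Lemma hat_G5 v : hat Q (v *m K) = G5 v *m rows4 (hat Q (row 0 K)) (hat Q (row 1 K))
  (hat Q (row 2 K)) (phat Q (row 0 K) (row 2 K)).
Proof.
have e : phat Q (row 1 K) (row 2 K) = - phat Q (row 0 K) (row 2 K).
  by apply/eqP; rewrite -addr_eq0 addrC p02.
rewrite {1}[v]row3_eta hat_row3 p01 e rows4_mul scaler0 addr0.
move: (hat Q (row 0 K)) (hat Q (row 1 K)) (hat Q (row 2 K)) (phat Q _ _) => p q r s.
by apply/rowP => j; rewrite !mxE; ring.
Qed.

Lemma G5_eq (v w : 'rV[R]_3) : G5 w = G5 v -> [/\ w 0 0 = v 0 0 \/ w 0 0 = - v 0 0,
  w 0 1 = v 0 1 \/ w 0 1 = - v 0 1, w 0 2 = v 0 2 \/ w 0 2 = - v 0 2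
  & w 0 2 * (w 0 0 - w 0 1) = v 0 2 * (v 0 0 - v 0 1)].
Proof.
move=> /rowP E; have := E 0; have := E 1; have := E 2; have := E 3; rewrite !mxE /=.
by move=> e3 /sqr_cases e2 /sqr_cases e1 /sqr_cases e0.
Qed.

Lemma type5_end : non_fd_point F (F (normalize (row 0 K))).
Proof.
have uM := unit_of_hat_free uK Qf hat_G5.
have [r0 r1 r2] := rowsK K.
have k00 : row 0 K != 0 by rewrite r0 mulK_neq0 // row3_neq0 // oner_eq0.
have [c c0 nc] := normalizeE k00; have sc := normalize_sphere k00.
have ncE : normalize (row 0 K) = row3 c 0 0 *m K.
  by rewrite nc r0 row3_mulZ mulr1 !mulr0.
exists (normalize (row 0 K)).
  rewrite ncE in sc *; apply: (sys_preim1 uK uM hat_G5) => // w /G5_eq.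
  rewrite !mxE /= !oppr0 => -[[] e0 [] e1 [] e2 _];
  by first [left; apply: row3P; rewrite ?e0 ?e1 ?e2 !mxE //=; fail |
            right; apply: row3P; rewrite ?e0 ?e1 ?e2 !mxE //= oppr0].
split.
  rewrite ncE; apply: (sys_singular uK hat_G5 (w := row3 0 1 0)).
    by rewrite row3_neq0 // oner_eq0 orbT.
  by rewrite polar_G5; apply: row4P; rewrite !mxE /=; ring.
have hA x : hat Q (aff K x) = model5 x *m rows4 (hat Q (row 0 K)) (hat Q (row 1 K))
    (hat Q (row 2 K)) (phat Q (row 0 K) (row 2 K)).
  by rewrite /aff hat_G5 /G5 /model5; congr (_ *m _); apply: row4P; rewrite !mxE //= expr1n.
by have [] := not_finitely_determined_at_model uK uM c0 nc hA smooth_model5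
  model5_nontransversal model5_perturbation.
Qed.

End Type5.

(** The planes of the two conjugate pairs meet in the direction of [a], which is an end of [tau] but
    an interior point of [kappa]. There the cross-cap lies on another sheet, the one at the
    direction of [row 0 K - row 1 K]. *)
Theorem type5_surface_of_basis (Q : @net R) (K : 'M[R]_3) :
  K \in unitmx -> hat_free Q -> phat Q (row 0 K) (row 1 K) = 0 ->
  phat Q (row 0 K) (row 2 K) + phat Q (row 1 K) (row 2 K) = 0 ->
  type5_surface (net_map Q).
Proof.
move=> uK Qf p01 p02.
have hE := hat_G5 p01 p02.
have uM := unit_of_hat_free uK Qf hE.
have [r0 r1 r2] := rowsK K.
pose a := row 0 K + row 1 K; pose b := row 2 K.
have aE : a = row3 1 1 0 *m K by rewrite row3_mul !scale1r scale0r addr0.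
have bE : b = row3 0 0 1 *m K by [].
have e0 : row 0 K != 0 by rewrite r0 mulK_neq0 // row3_neq0 // oner_eq0.
have f0 : row 1 K != 0 by rewrite r1 mulK_neq0 // row3_neq0 // oner_eq0 orbT.
have a0 : a != 0 by rewrite aE mulK_neq0 // row3_neq0 // oner_eq0.
have b0 : b != 0 by rewrite bE mulK_neq0 // row3_neq0 // oner_eq0 !orbT.
have ab : phat Q a b = 0 by rewrite /a phatDl.
have ha : hat Q a = hat Q (row 0 K) + hat Q (row 1 K) by rewrite hatD p01 addr0.
have hneg : hat Q (row 0 K - row 1 K) = hat Q (row 0 K) + hat Q (row 1 K).
  by rewrite -scaleN1r hatD hatZ phatZr p01 scaler0 addr0 sqrrN expr1n scale1r.
have kE s t : s *: row 0 K + t *: row 1 K = row3 s t 0 *m K.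
  by rewrite row3_mul scale0r addr0.
have tE s t : s *: a + t *: b = row3 s s t *m K.
  by rewrite row3_mul /a scalerDr.
have [c c0 nc] := normalizeE a0; have [d d0 nd] := normalizeE b0.
have [c1 c10 nc1] := normalizeE e0; have [d1 d10 nd1] := normalizeE f0.
have ncE : normalize a = row3 c c 0 *m K by rewrite nc aE row3_mulZ mulr1 !mulr0.
have ndE : normalize b = row3 0 0 d *m K by rewrite nd bE row3_mulZ mulr1 !mulr0.
have nc1E : normalize (row 0 K) = row3 c1 0 0 *m K by rewrite nc1 r0 row3_mulZ mulr1 !mulr0.
have nd1E : normalize (row 1 K) = row3 0 d1 0 *m K by rewrite nd1 r1 row3_mulZ mulr1 !mulr0.
have sa := normalize_sphere a0; have sb := normalize_sphere b0.
have se := normalize_sphere e0; have sf := normalize_sphere f0.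
have diagE s t : s != 0 -> t != 0 -> sphere (row3 s t 0 *m K) ->
    [/\ row3 s t 0 *m K \in [:: row3 s t 0 *m K] ,
     Defs.preim (net_map Q) (net_map Q (row3 s t 0 *m K)) =
       pm [:: row3 s t 0 *m K; row3 s (- t) 0 *m K] &
     non_antipodal (row3 s t 0 *m K) (row3 s (- t) 0 *m K)].
  move=> s0 t0 ss; split; first exact: mem_head.
    apply: (sys_preim2 uK uM hE) => //.
      by apply: row4P; rewrite !mxE /= ?sqrrN ?mul0r.
    move=> w /G5_eq; rewrite !mxE /= oppr0.
    have w20 : (w 0 2 = 0 \/ w 0 2 = 0) -> w 0 2 = 0 by case.
    move=> [w0 w1 /w20 w2 _].
    by case: w0 w1 => w0 [] w1; [apply: Or41|apply: Or43|apply: Or44|apply: Or42];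
      apply: row3P; rewrite ?w0 ?w1 ?w2 !mxE //= ?oppr0 ?opprK.
  apply: (sys_non_antipodal uK).
    by apply/eqP => /rowP/(_ 1)/eqP; rewrite !mxE /= (negbTE (neq_opp t0)).
  by apply/eqP => /rowP/(_ 0)/eqP; rewrite !mxE /= (negbTE (neq_opp s0)).
have imm0 s t : s != 0 -> t != 0 -> s != t -> immersive_at (net_map Q) (row3 s t 0 *m K).
  move=> s0 t0 st; apply: (sys_immersive uK uM hE) => w; rewrite polar_G5 => /rowP E.
  have := E 0; have := E 1; have := E 3; rewrite !mxE /= => E3 E1 E0.
  have st0 : s - t != 0 by rewrite subr_eq0.
  by apply: row3P; rewrite [RHS]mxE; [apply: (mulfI s0)|apply: (mulfI t0)|apply: (mulIf st0)]; lra.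
have imm1 s t z : z != 0 -> s != 0 \/ t != 0 ->
    immersive_at (net_map Q) (row3 s t z *m K).
  move=> z0 st; apply: (sys_immersive uK uM hE) => w; rewrite polar_G5 => /rowP E.
  have := E 0; have := E 1; have := E 2; have := E 3; rewrite !mxE /= => E3 E2 E1 E0.
  have w2 : w 0 2 = 0 by apply: (mulfI z0); lra.
  have w01 : w 0 0 = w 0 1 by rewrite w2 in E3; apply: (mulfI z0); lra.
  have w0 : w 0 0 = 0.
    by case: st => h; apply: (mulfI h); rewrite -?w01 in E1; lra.
  by apply: row3P; rewrite [RHS]mxE // -w01.
exists (seg Q a b), (seg Q (row 0 K) (row 1 K)); rewrite !seg0 !seg1.
have aF s : sphere (s *: a) -> net_map Q (s *: a) = net_map Q (normalize a) by exact: F_sphere_scale.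
split.
- split.
  + apply: seg_arc; apply/eqP; rewrite ncE ndE in sa sb *.
    move/(sys_eq uM hE sa sb)/rowP/(_ 2); rewrite !mxE /= expr0n /=.
    by move/esym/eqP; rewrite sqrf_eq0 (negbTE d0).
  + apply: seg_arc; apply/eqP; rewrite nc1E nd1E in se sf *.
    move/(sys_eq uM hE se sf)/rowP/(_ 1); rewrite !mxE /= expr0n /=.
    by move/esym/eqP; rewrite sqrf_eq0 (negbTE d10).
  + by rewrite ncE -kE; apply: arc_int_seg => //; rewrite kE -ncE.
  + apply/seteqP; split=> y; last first.
      move=> ->; split.
        have -> : normalize a = c *: a + 0 *: b by rewrite scale0r addr0.
        by apply: arc_pts_seg => //; rewrite scale0r addr0 -nc.
      by rewrite ncE -kE; apply: arc_pts_seg => //; rewrite kE -ncE.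
    move=> [/(arc_pts_segP a0 b0 ab)[s [t [ss yE]]] /(arc_pts_segP e0 f0 p01)[s' [t' [ss' yE']]]].
    rewrite tE in ss yE; rewrite kE in ss' yE'; rewrite yE in yE' *.
    move/(sys_eq uM hE ss ss'): yE' => /rowP/(_ 2); rewrite !mxE /= expr0n /= => /eqP.
    rewrite sqrf_eq0 => /eqP t0; rewrite /= t0.
    have sE : row3 s s 0 *m K = s *: a by rewrite aE row3_mulZ mulr1 mulr0.
    by rewrite sE; apply: aF; rewrite -sE -t0.
- split.
    exists (normalize a), (row3 c (- c) 0 *m K).
    have [_ pr na] := diagE c c c0 c0 (eq_ind _ (fun u => sphere u) sa _ ncE).
    rewrite ncE; split => //; last by apply: imm0; rewrite ?oppr_eq0 ?neq_opp.
    rewrite -ncE; have [q0 q1 q2] := row_rows3 a b (row 0 K - row 1 K).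
    (* [row 0 K - row 1 K] has the same [hat] as [a], so the relation holds with parameters -1 and
       0. *)
    rewrite -q0; apply: (@cross_cap_of_basis _ _ (rows3 a b (row 0 K - row 1 K)) (-1) 0) => //.
    + apply: (rows3_unit uK (P := rows3 (row3 1 1 0) (row3 0 0 1) (row3 1 (- 1) 0))).
        apply: unitmx_row3.
        have -> : 1 * (0 * 0 - 1 * -1) - 1 * (0 * 0 - 1 * 1) + 0 * (0 * -1 - 0 * 1) = 2 :> R by ring.
        by rewrite pnatr_eq0.
      split; rewrite [in RHS]rowK //=.
      by rewrite row3_mul scale1r scale0r addr0 scaleN1r.
    + by rewrite q0 q1.
    + by rewrite q0 q1 q2 hneg ha opprK scale1r scale0r subr0.
  exists (normalize b).
    rewrite ndE in sb *; apply: (sys_preim1 uK uM hE) => // w /G5_eq.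
    rewrite !mxE /= !oppr0 => -[[] w0 [] w1 [] w2 _];
    by first [left; apply: row3P; rewrite ?w0 ?w1 ?w2 !mxE //=; fail |
            right; apply: row3P; rewrite ?w0 ?w1 ?w2 !mxE //= oppr0].
  have [q0 q1 q2] := row_rows3 b a (row 0 K - row 1 K).
  rewrite -q0; apply: (@cross_cap_of_basis _ _ (rows3 b a (row 0 K - row 1 K)) 0 (-1)) => //.
  + apply: (rows3_unit uK (P := rows3 (row3 0 0 1) (row3 1 1 0) (row3 1 (- 1) 0))).
      apply: unitmx_row3.
      have -> : 0 * (1 * 0 - 0 * -1) - 0 * (1 * 0 - 0 * 1) + 1 * (1 * -1 - 1 * 1) = - 2 :> R by ring.
      by rewrite oppr_eq0 pnatr_eq0.
    split; rewrite [in RHS]rowK //=.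
    by rewrite row3_mul scale1r scale0r addr0 scaleN1r.
  + by rewrite q0 q1 phatC.
  + by rewrite q0 q1 q2 hneg ha oppr0 scale0r sub0r scaleN1r opprK.
- move=> y /(arc_int_segP a0 b0 ab)[s [t [ss -> s0 t0]]].
  rewrite tE in ss *.
  have s0' := lt0r_neq0 s0; have t0' := lt0r_neq0 t0.
  have GG : G5 (row3 s s (- t)) = G5 (row3 s s t).
    by apply: row4P; rewrite !mxE /= ?sqrrN ?subrr ?mulr0.
  exists (row3 s s t *m K), (row3 s s (- t) *m K); split.
  + apply: (sys_preim2 uK uM hE) => //.
    move=> w /G5_eq; rewrite !mxE /= subrr mulr0 => -[w0 w1 w2 /eqP].
    have w20 : w 0 2 != 0 by case: w2 => ->; rewrite ?oppr_eq0.
    rewrite mulf_eq0 (negbTE w20) subr_eq0 => /eqP w01.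
    rewrite -w01 in w1.
    by case: w0 w2 => w0 [] w2; [apply: Or41|apply: Or43|apply: Or44|apply: Or42];
      apply: row3P; rewrite -?w01 ?w0 ?w2 !mxE //= ?opprK.
  + apply: (sys_non_antipodal uK).
      by apply/eqP => /rowP/(_ 2)/eqP; rewrite !mxE /= (negbTE (neq_opp t0')).
    by apply/eqP => /rowP/(_ 0)/eqP; rewrite !mxE /= (negbTE (neq_opp s0')).
  + by apply: imm1 => //; left.
  + by apply: imm1; rewrite ?oppr_eq0 //; left.
  + apply: (sys_transversal uM hE) => // A.
    exists (row3 (A 0 0 / (2 * s) - (A 0 0 / (2 * s) - A 0 3 / t) / 2)
      (A 0 1 / (4 * s)) (A 0 2 / (2 * t))).
    exists (row3 ((A 0 0 / (2 * s) - A 0 3 / t) / 2) (A 0 1 / (4 * s)) 0).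
    by rewrite !polar_G5; apply: row4P; rewrite !mxE /=; field; rewrite ?s0' ?t0'.
- split; first exact: type5_end.
    have [q0 q1 q2] := row_rows3 (row 1 K) (row 0 K) (row 2 K).
    rewrite -q0; apply: type5_end; rewrite ?q0 ?q1 ?q2 //.
    + apply: (rows3_unit uK (P := rows3 (row3 0 1 0) (row3 1 0 0) (row3 0 0 1))).
        by apply: unitmx_row3; rewrite !(mul0r, mulr0, mul1r, subr0, sub0r, addr0) oppr_eq0 oner_eq0.
      by split; rewrite [in RHS]rowK /=; [exact: r1|exact: r0|exact: r2].
    + by rewrite phatC.
    + by rewrite addrC.
  move=> y /(arc_int_segP e0 f0 p01)[s [t [ss -> s0 t0]]] yt.
  rewrite kE in ss yt *.
  have s0' := lt0r_neq0 s0; have t0' := lt0r_neq0 t0.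
  have st : s != t.
    apply: contra yt => /eqP st; rewrite -st in ss *.
    have sE : row3 s s 0 *m K = s *: a by rewrite aE row3_mulZ mulr1 mulr0.
    by rewrite sE in ss *; rewrite aF.
  have [_ pr na] := diagE s t s0' t0' ss.
  have sNt : s != - t by rewrite gt_eqF // (lt_trans _ s0) // oppr_lt0.
  have dm : s - t != 0 by rewrite subr_eq0.
  have dp : s + t != 0 by rewrite gt_eqF // addr_gt0.
  exists (row3 s t 0 *m K), (row3 s (- t) 0 *m K).
  split; [exact: pr|exact: na| | |].
  + by split; apply: imm0; rewrite ?oppr_eq0.
  + apply: (sys_tangent_image_eq uK hE) => w; rewrite polar_G5.
      exists (row3 (w 0 0) (- w 0 1) (w 0 2 * (s - t) / (s + t))).
      by rewrite polar_G5; apply: row4P; rewrite !mxE /=; field.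
    exists (row3 (w 0 0) (- w 0 1) (w 0 2 * (s + t) / (s - t))).
    by rewrite polar_G5; apply: row4P; rewrite !mxE /=; field.
  + split=> [[]|/(sys_same_curvature uK uM hE)].
    have GG : G5 (row3 s t 0) = G5 (row3 s (- t) 0).
      by apply: row4P; rewrite !mxE /= ?sqrrN ?mul0r.
    (* These vectors have the same image under the two derivatives, but their values under [G5]
       differ by [(s + t) ^+ 2 - (s - t) ^+ 2 = 4 * (s * t)] in the third coordinate, which vanishes
       on the tangent image. *)
    move=> /(_ ss GG (row3 0 0 (s + t)) (row3 0 0 (s - t))).
    case; first by rewrite !polar_G5; apply: row4P; rewrite !mxE /=; ring.
    move=> w; rewrite polar_G5 => /rowP/(_ 2); rewrite !mxE /= mul0r mulr0 => E.
    have : 4 * (s * t) = 0 by move: E; clear; lra.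
    by move/eqP; rewrite !mulf_eq0 pnatr_eq0 (negbTE s0') (negbTE t0').
- move=> _ [u su <-]; have [v uE] := coordsP uK u; subst u => Ntau Nkappa.
  have z0 : v 0 2 != 0.
    apply/eqP => z0; apply: Nkappa; move: su; rewrite [v]row3_eta z0 -kE.
    exact: arc_pts_seg.
  have st : v 0 0 != v 0 1.
    apply/eqP => st; apply: Ntau; move: su; rewrite [v]row3_eta -st -tE.
    exact: arc_pts_seg.
  exists (v *m K).
    apply: (sys_preim1 uK uM hE) => // w /G5_eq[w0 w1 w2 E].
    case: w2 => w2; rewrite w2 in E; [left|right].
      have [e0' e1'] := same_signs w0 w1 (mulfI z0 E) st.
      exact: row3P.
    have E' : - w 0 0 - - w 0 1 = v 0 0 - v 0 1.
      by apply: (mulfI z0); rewrite -E; ring.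
    have [||e0' e1'] := same_signs _ _ E' st.
    - by case: w0 => ->; rewrite ?opprK; [right|left].
    - by case: w1 => ->; rewrite ?opprK; [right|left].
    by apply: row3P; rewrite [RHS]mxE // -?e0' -?e1' opprK.
  rewrite [v]row3_eta; apply: imm1 => //.
  have [h|h] := eqVneq (v 0 0) 0; last by left.
  by right; apply: contra st => /eqP ->; rewrite h.
Qed.

End Types.

(** * Surfaces of type 6 *)

Section Type6.
Context {R : realType}.
Variables (Q : @net R) (K : 'M[R]_3).
Hypotheses (uK : K \in unitmx) (Qf : hat_free Q).
Hypothesis p12 : phat Q (row 1 K) (row 2 K) = 0.
Hypothesis p02 : phat Q (row 0 K) (row 2 K) = - hat Q (row 1 K).
Local Notation F := (net_map Q).

(** The normal form of a triple root, represented by the conjugate pair of rows 1 and 2. The first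
    coordinate is known up to sign, and where it is nonzero it determines the other two; all double
    points therefore lie in the plane of rows 1 and 2. *)
Definition G6 (v : 'rV[R]_3) : 'rV[R]_4 :=
  row4 (v 0 0 ^+ 2) (v 0 2 ^+ 2) (v 0 0 * v 0 1) (v 0 0 * v 0 2 - v 0 1 ^+ 2).

Lemma polar_G6 v w : polar G6 v w = row4 (2 * (v 0 0 * w 0 0)) (2 * (v 0 2 * w 0 2))
  (v 0 0 * w 0 1 + v 0 1 * w 0 0)
  (v 0 0 * w 0 2 + v 0 2 * w 0 0 - 2 * (v 0 1 * w 0 1)).
Proof. by apply: row4P; rewrite !mxE /=; ring. Qed.

Lemma hat_G6 v : hat Q (v *m K) = G6 v *m rows4 (hat Q (row 0 K)) (hat Q (row 2 K))
  (phat Q (row 0 K) (row 1 K)) (phat Q (row 0 K) (row 2 K)).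
Proof.
have e : hat Q (row 1 K) = - phat Q (row 0 K) (row 2 K) by rewrite p02 opprK.
rewrite {1}[v]row3_eta hat_row3 p12 e rows4_mul scaler0 addr0.
move: (hat Q (row 0 K)) (hat Q (row 2 K)) (phat Q (row 0 K) (row 1 K)) (phat Q _ _) => p q r s.
by apply/rowP => j; rewrite !mxE; ring.
Qed.

Lemma G6_eq (v w : 'rV[R]_3) : G6 w = G6 v -> [/\ w 0 0 = v 0 0 \/ w 0 0 = - v 0 0,
  w 0 2 = v 0 2 \/ w 0 2 = - v 0 2, w 0 0 * w 0 1 = v 0 0 * v 0 1
  & w 0 0 * w 0 2 - w 0 1 ^+ 2 = v 0 0 * v 0 2 - v 0 1 ^+ 2].
Proof.
move=> /rowP E; have := E 0; have := E 1; have := E 2; have := E 3; rewrite !mxE /=.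
by move=> e3 e2 /sqr_cases e1 /sqr_cases e0.
Qed.

Lemma G6_fib1 (v w : 'rV[R]_3) : v 0 0 != 0 -> G6 w = G6 v -> w = v \/ w = - v.
Proof.
move=> v0 /G6_eq[[] e0 _ e1 e2]; rewrite e0 in e1 e2; [left|right].
  have w1 := mulfI v0 e1; rewrite w1 in e2.
  by apply: row3P => //; apply: (mulfI v0); apply: (addIr (- v 0 1 ^+ 2)).
have w1 : w 0 1 = - v 0 1 by apply: (mulfI v0); rewrite mulrN -e1 mulNr opprK.
rewrite w1 sqrrN in e2; move/addIr: e2 => e2.
have w2 : w 0 2 = - v 0 2 by apply: (mulfI v0); rewrite mulrN -e2 mulNr opprK.
by apply: row3P; rewrite [RHS]mxE.
Qed.

Lemma G6_fib2 (s t : R) (w : 'rV[R]_3) : G6 w = G6 (row3 0 s t) ->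
  [/\ w 0 0 = 0, w 0 1 = s \/ w 0 1 = - s & w 0 2 = t \/ w 0 2 = - t].
Proof.
move=> /G6_eq; rewrite !mxE /= oppr0 => -[w0 w2 _].
have -> : w 0 0 = 0 by case: w0.
by rewrite !mul0r !sub0r => /oppr_inj/sqr_cases w1.
Qed.

Lemma G6_imm (v : 'rV[R]_3) : v 0 0 != 0 \/ (v 0 1 != 0 /\ v 0 2 != 0) ->
  immersive_at F (v *m K).
Proof.
have uM := unit_of_hat_free uK Qf hat_G6.
move=> H; apply: (sys_immersive uK uM hat_G6) => w; rewrite polar_G6 => /rowP E.
have := E 0; have := E 1; have := E 2; have := E 3; rewrite !mxE /= => E3 E2 E1 E0.
case: H => [v0|[v1 v2]].
  have w0 : w 0 0 = 0 by apply: (mulfI v0); rewrite mulr0; lra.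
  rewrite w0 !(mulr0, addr0) in E2 E3.
  have w1 : w 0 1 = 0 by apply: (mulfI v0); rewrite mulr0.
  rewrite w1 !(mulr0, subr0) in E3.
  by apply: row3P; rewrite [RHS]mxE //; apply: (mulfI v0); rewrite mulr0.
have w2 : w 0 2 = 0 by apply: (mulfI v2); rewrite mulr0; lra.
have [v0|v0] := eqVneq (v 0 0) 0.
  rewrite v0 !(mul0r, add0r) in E2 E3.
  have w0 : w 0 0 = 0 by apply: (mulfI v1); rewrite mulr0.
  rewrite w0 !(mulr0, sub0r) in E3.
  by apply: row3P; rewrite [RHS]mxE //; apply: (mulfI v1); rewrite mulr0; lra.
have w0 : w 0 0 = 0 by apply: (mulfI v0); rewrite mulr0; lra.
rewrite w0 !(mulr0, addr0) in E2.
by apply: row3P; rewrite [RHS]mxE //; apply: (mulfI v0); rewrite mulr0.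
Qed.

Lemma type6_end1 c u : c != 0 -> u = c *: row 1 K ->
  ~ finitely_determined_at F u /\ ~ cross_cap_at F u.
Proof.
move=> c0 uE; have uM := unit_of_hat_free uK Qf hat_G6.
have [r0 r1 r2] := rowsK K.
have [q0 q1 q2] := row_rows3 (row 1 K) (row 0 K) (row 2 K).
have uK' : rows3 (row 1 K) (row 0 K) (row 2 K) \in unitmx.
  apply: (rows3_unit uK (P := rows3 (row3 0 1 0) (row3 1 0 0) (row3 0 0 1))).
    by apply: unitmx_row3; rewrite !(mul0r, mulr0, mul1r, subr0, sub0r, addr0) oppr_eq0 oner_eq0.
  by split; rewrite [in RHS]rowK /=; [exact: r1|exact: r0|exact: r2].
have hA x : hat Q (aff (rows3 (row 1 K) (row 0 K) (row 2 K)) x) =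
    model6y x *m rows4 (hat Q (row 0 K)) (hat Q (row 2 K))
  (phat Q (row 0 K) (row 1 K)) (phat Q (row 0 K) (row 2 K)).
  have -> : aff (rows3 (row 1 K) (row 0 K) (row 2 K)) x = row3 (x 0 0) 1 (x 0 1) *m K.
    by rewrite /aff !row3_mul q0 q1 q2 [X in X + _ = _]addrC.
  rewrite hat_G6 /G6 /model6y; congr (_ *m _).
  by apply: row4P; rewrite !mxE //= ?mulr1 ?expr1n.
have uE' : u = c *: row 0 (rows3 (row 1 K) (row 0 K) (row 2 K)) by rewrite q0.
exact: (not_finitely_determined_at_model uK' uM c0 uE' hA smooth_model6y
  model6y_nontransversal model6y_perturbation).
Qed.

Lemma type6_end2 c u : c != 0 -> u = c *: row 2 K ->
  ~ finitely_determined_at F u /\ ~ cross_cap_at F u.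
Proof.
move=> c0 uE; have uM := unit_of_hat_free uK Qf hat_G6.
have [r0 r1 r2] := rowsK K.
have [q0 q1 q2] := row_rows3 (row 2 K) (row 0 K) (row 1 K).
have uK' : rows3 (row 2 K) (row 0 K) (row 1 K) \in unitmx.
  apply: (rows3_unit uK (P := rows3 (row3 0 0 1) (row3 1 0 0) (row3 0 1 0))).
    by apply: unitmx_row3; rewrite [X in X != 0](_ : _ = 1) ?oner_eq0 //; ring.
  by split; rewrite [in RHS]rowK /=; [exact: r2|exact: r0|exact: r1].
have hA x : hat Q (aff (rows3 (row 2 K) (row 0 K) (row 1 K)) x) =
    model6z x *m rows4 (hat Q (row 0 K)) (hat Q (row 2 K))
  (phat Q (row 0 K) (row 1 K)) (phat Q (row 0 K) (row 2 K)).
  have -> : aff (rows3 (row 2 K) (row 0 K) (row 1 K)) x = row3 (x 0 0) (x 0 1) 1 *m K.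
    by rewrite /aff !row3_mul q0 q1 q2 -addrA addrC.
  rewrite hat_G6 /G6 /model6z; congr (_ *m _).
  by apply: row4P; rewrite !mxE //= ?mulr1 ?expr1n.
have uE' : u = c *: row 0 (rows3 (row 2 K) (row 0 K) (row 1 K)) by rewrite q0.
exact: (not_finitely_determined_at_model uK' uM c0 uE' hA smooth_model6z
  model6z_nontransversal model6z_perturbation).
Qed.

(** Equal derivatives at [(0, s, t)] and [(0, s, - t)] force [b 0 0 = a 0 0], so the first
    coordinate of [G6 a - G6 b] vanishes; this vanishing is the equation of the common tangent image
    in four-space. *)
Lemma type6_tangent s t : s != 0 -> t != 0 -> sphere (row3 0 s t *m K) ->
  tangent_double_point F True (F (row3 0 s t *m K)).
Proof.
move=> s0 t0 ss; have uM := unit_of_hat_free uK Qf hat_G6.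
have GG : G6 (row3 0 s t) = G6 (row3 0 s (- t)).
  by apply: row4P; rewrite !mxE /= ?sqrrN ?mul0r.
exists (row3 0 s t *m K), (row3 0 s (- t) *m K); split.
- apply: (sys_preim2 uK uM hat_G6) => //.
  move=> w /G6_fib2[w0 w1 w2].
  by case: w1 w2 => w1 [] w2; [apply: Or41|apply: Or43|apply: Or44|apply: Or42];
    apply: row3P; rewrite ?w0 ?w1 ?w2 !mxE //= ?oppr0 ?opprK.
- apply: (sys_non_antipodal uK).
    by apply/eqP => /rowP/(_ 2)/eqP; rewrite !mxE /= (negbTE (neq_opp t0)).
  by apply/eqP => /rowP/(_ 1)/eqP; rewrite !mxE /= (negbTE (neq_opp s0)).
- by split; apply: G6_imm; right; rewrite !mxE /= ?oppr_eq0.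
- apply: (sys_tangent_image_eq uK hat_G6) => w; rewrite polar_G6.
    exists (row3 (w 0 0) (w 0 1 - t * w 0 0 / s) (- w 0 2)).
    by rewrite polar_G6; apply: row4P; rewrite !mxE /=; field.
  exists (row3 (w 0 0) (w 0 1 + t * w 0 0 / s) (- w 0 2)).
  by rewrite polar_G6; apply: row4P; rewrite !mxE /=; field.
- split; [move=> _|by []]; apply: (proj2 (sys_same_curvature uK uM hat_G6 ss GG)) => a b.
  rewrite !polar_G6 => /rowP E.
  have := E 1; have := E 2; rewrite !mxE /= !mul0r !add0r => E2 E1.
  have b0 : b 0 0 = a 0 0 by apply/esym/(mulfI s0).
  have b2 : b 0 2 = - a 0 2 by apply: (mulfI t0); lra.
  exists (row3 ((G6 a - G6 b) 0 2 / s)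
    ((t * ((G6 a - G6 b) 0 2 / s) - (G6 a - G6 b) 0 3) / (2 * s)) 0).
  by rewrite polar_G6; apply: row4P; rewrite !mxE /= ?b0 ?b2; field.
Qed.

Theorem type6_surface_of_basis : type6_surface F.
Proof.
have hE := hat_G6; have uM := unit_of_hat_free uK Qf hE.
have [r0 r1 r2] := rowsK K.
have e0 : row 1 K != 0 by rewrite r1 mulK_neq0 // row3_neq0 // oner_eq0 orbT.
have f0 : row 2 K != 0 by rewrite r2 mulK_neq0 // row3_neq0 // oner_eq0 !orbT.
have kE s t : s *: row 1 K + t *: row 2 K = row3 0 s t *m K.
  by rewrite row3_mul scale0r add0r.
have [c c0 nc] := normalizeE e0; have [d d0 nd] := normalizeE f0.
have ncE : normalize (row 1 K) = row3 0 c 0 *m K by rewrite nc r1 row3_mulZ mulr1 !mulr0.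
have ndE : normalize (row 2 K) = row3 0 0 d *m K by rewrite nd r2 row3_mulZ mulr1 !mulr0.
have sc := normalize_sphere e0; have sd := normalize_sphere f0.
exists (seg Q (row 1 K) (row 2 K)); rewrite seg0 seg1; split.
- apply: seg_arc; apply/eqP; rewrite ncE ndE in sc sd *.
  move/(sys_eq uM hE sc sd)/rowP/(_ 1); rewrite !mxE /= expr0n /=.
  by move/esym/eqP; rewrite sqrf_eq0 (negbTE d0).
- move=> u su; have [v uE] := coordsP uK u; subst u.
  have [v0|v0] := eqVneq (v 0 0) 0; last first.
    by move/(cross_cap_singular (smooth_net Q)); apply; apply: G6_imm; left.
  have [v1|v1] := eqVneq (v 0 1) 0.
    have [v2|v2] := eqVneq (v 0 2) 0.
      have := sphere_neq0 su; rewrite [v]row3_eta v0 v1 v2 row3_mul !scale0r !addr0.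
      by rewrite eqxx.
    apply: (type6_end2 v2 _).2.
    by rewrite {1}[v]row3_eta v0 v1 row3_mul !scale0r !add0r.
  have [v2|v2] := eqVneq (v 0 2) 0.
    apply: (type6_end1 v1 _).2.
    by rewrite {1}[v]row3_eta v0 v2 row3_mul !scale0r add0r addr0.
  by move/(cross_cap_singular (smooth_net Q)); apply; apply: G6_imm; right.
- split.
    exists (normalize (row 1 K)).
      rewrite ncE in sc *; apply: (sys_preim1 uK uM hE) => // w /G6_fib2[w0 w1 w2].
      have {}w2 : w 0 2 = 0 by move: w2; rewrite oppr0; case.
      by case: w1 => w1; [left|right]; apply: row3P; rewrite ?w0 ?w1 ?w2 !mxE //= oppr0.
    split; last exact: (type6_end1 c0 nc).1.
    rewrite ncE; apply: (sys_singular uK hE (w := row3 0 0 1)).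
      by rewrite row3_neq0 // oner_eq0 !orbT.
    by rewrite polar_G6; apply: row4P; rewrite !mxE /=; ring.
  exists (normalize (row 2 K)).
    rewrite ndE in sd *; apply: (sys_preim1 uK uM hE) => // w /G6_fib2[w0 w1 w2].
    have {}w1 : w 0 1 = 0 by move: w1; rewrite oppr0; case.
    by case: w2 => w2; [left|right]; apply: row3P; rewrite ?w0 ?w1 ?w2 !mxE //= oppr0.
  split; last exact: (type6_end2 d0 nd).1.
  rewrite ndE; apply: (sys_singular uK hE (w := row3 0 1 0)).
    by rewrite row3_neq0 // oner_eq0 !orbT.
  by rewrite polar_G6; apply: row4P; rewrite !mxE /=; ring.
- move=> y /(arc_int_segP e0 f0 p12)[s [t [ss -> s0 t0]]].
  by rewrite kE in ss *; apply: type6_tangent => //; exact: lt0r_neq0.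
- move=> _ [u su <-]; have [v uE] := coordsP uK u; subst u => Nkappa.
  have v0 : v 0 0 != 0.
    apply/eqP => v0; apply: Nkappa; move: su; rewrite [v]row3_eta v0 -kE.
    exact: arc_pts_seg.
  exists (v *m K); first by apply: (sys_preim1 uK uM hE) => // w; exact: G6_fib1.
  by apply: G6_imm; left.
Qed.

End Type6.

(** * Roman Steiner surface: one of its double point curves *)

Section RomanPair.
Context {R : realType}.
Variables (Q : @net R) (K : 'M[R]_3).
Hypotheses (uK : K \in unitmx) (Qf : hat_free Q).
Hypotheses (h01 : hat Q (row 1 K) = hat Q (row 0 K)) (h02 : hat Q (row 2 K) = hat Q (row 0 K)).
Local Notation F := (net_map Q).

(** Steiner's classical parametrisation, with the sum of squares as fourth homogeneous coordinate.
    The double point curve studied in this section comes from the plane of rows 0 and 1; the other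
    two follow by cyclic permutation of the rows. *)
Definition GR (v : 'rV[R]_3) : 'rV[R]_4 :=
  row4 (v 0 0 * v 0 1) (v 0 1 * v 0 2) (v 0 0 * v 0 2) (v 0 0 ^+ 2 + v 0 1 ^+ 2 + v 0 2 ^+ 2).

Lemma polar_GR v w : polar GR v w = row4 (v 0 0 * w 0 1 + v 0 1 * w 0 0)
  (v 0 1 * w 0 2 + v 0 2 * w 0 1) (v 0 0 * w 0 2 + v 0 2 * w 0 0)
  (2 * (v 0 0 * w 0 0 + v 0 1 * w 0 1 + v 0 2 * w 0 2)).
Proof. by apply: row4P; rewrite !mxE /=; ring. Qed.

Lemma hat_GR v : hat Q (v *m K) = GR v *m rows4 (phat Q (row 0 K) (row 1 K))
  (phat Q (row 1 K) (row 2 K)) (phat Q (row 0 K) (row 2 K)) (hat Q (row 0 K)).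
Proof.
rewrite {1}[v]row3_eta hat_row3 h01 h02 rows4_mul.
move: (hat Q (row 0 K)) (phat Q (row 0 K) (row 1 K)) (phat Q (row 0 K) (row 2 K)) (phat Q _ _).
by move=> p q r s; apply/rowP => j; rewrite !mxE; ring.
Qed.

Let hE := hat_GR.
Let uM := unit_of_hat_free uK Qf hE.

Lemma GR_eq (v w : 'rV[R]_3) : GR w = GR v -> [/\ w 0 0 * w 0 1 = v 0 0 * v 0 1,
  w 0 1 * w 0 2 = v 0 1 * v 0 2, w 0 0 * w 0 2 = v 0 0 * v 0 2 &
  w 0 0 ^+ 2 + w 0 1 ^+ 2 + w 0 2 ^+ 2 = v 0 0 ^+ 2 + v 0 1 ^+ 2 + v 0 2 ^+ 2].
Proof.
by move=> /rowP E; split; [have := E 0|have := E 1|have := E 2|have := E 3]; rewrite !mxE.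
Qed.

Lemma roman_rowE s t :
  s *: (row 0 K + row 1 K) + t *: (row 0 K - row 1 K) = row3 (s + t) (s - t) 0 *m K.
Proof.
rewrite row3_mul; move: (row 0 K) (row 1 K) (row 2 K) => a b c.
by apply/rowP => j; rewrite !mxE; ring.
Qed.

Lemma roman_phat01 : phat Q (row 0 K + row 1 K) (row 0 K - row 1 K) = 0.
Proof.
rewrite phatDl !phatDr -scaleN1r !phatZr !phat_diag h01 (phatC _ (row 1 K) (row 0 K)).
by move: (hat _ _) (phat _ _ _) => a b; apply/rowP => j; rewrite !mxE; ring.
Qed.

Lemma roman_neq0 (s t : R) : s != 0 -> s *: row 0 K + t *: row 1 K != 0.
Proof.
move=> s0; have -> : s *: row 0 K + t *: row 1 K = row3 s t 0 *m K.
  by rewrite row3_mul scale0r addr0.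
by rewrite mulK_neq0 // row3_neq0 // s0.
Qed.

(** The sign [e] treats both ends of the segment at once. As all rows have the same [hat], the
    vectors [row 0 K + e *: row 1 K] and [row 0 K - e *: row 1 K] are conjugate, and their [hat] add
    up to that of [2 *: row 2 K]: this is the relation with both parameters -1. *)
Lemma roman_pinch (e : R) : e ^+ 2 = 1 ->
  cross_cap_point F (F (normalize (row 0 K + e *: row 1 K))).
Proof.
move=> e1; have e0 : e != 0 by rewrite -sqrf_eq0 e1 oner_eq0.
have k0 : row 0 K + e *: row 1 K != 0.
  by have := roman_neq0 e (oner_neq0 R); rewrite scale1r.
have kE : row 0 K + e *: row 1 K = row3 1 e 0 *m K.
  by rewrite row3_mul scale1r scale0r addr0.
have [c c0 nc] := normalizeE k0.
have ncE : normalize (row 0 K + e *: row 1 K) = row3 c (c * e) 0 *m K.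
  by rewrite nc kE row3_mulZ mulr1 mulr0.
have sc := normalize_sphere k0.
exists (normalize (row 0 K + e *: row 1 K)).
  rewrite ncE in sc *; apply: (sys_preim1 uK uM hE) => // w /GR_eq.
  rewrite !mxE /= !mulr0 !expr0n /= !addr0 => -[E0 E1 _ E3].
  have w01 : w 0 0 * w 0 1 != 0 by rewrite E0 !mulf_neq0.
  have w1 : w 0 1 != 0 by apply: contra w01 => /eqP ->; rewrite mulr0.
  have w2 : w 0 2 = 0 by apply: (mulfI w1); rewrite E1 mulr0.
  have : (w 0 0 - e * w 0 1) ^+ 2 = 0.
    have -> : (w 0 0 - e * w 0 1) ^+ 2 = w 0 0 ^+ 2 + e ^+ 2 * w 0 1 ^+ 2
      - 2 * e * (w 0 0 * w 0 1) by ring.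
    move: E3; rewrite E0 w2 e1 expr0n mul1r addr0 => ->; rewrite exprMn e1.
    have -> : 2 * e * (c * (c * e)) = 2 * c ^+ 2 * e ^+ 2 by ring.
    by rewrite e1; ring.
  move/eqP; rewrite sqrf_eq0 subr_eq0 => /eqP w0.
  have w1E : w 0 1 = e * w 0 0 by rewrite w0 mulrA -expr2 e1 mul1r.
  have : w 0 0 ^+ 2 = c ^+ 2.
    apply: (mulIf e0); rewrite w1E in E0.
    by transitivity (w 0 0 * (e * w 0 0)); [ring|rewrite E0; ring].
  by move=> /sqr_cases[] w0E; rewrite w0E in w1E; [left|right];
    apply: row3P; rewrite ?w0E ?w1E ?w2 !mxE //= ?oppr0 ?mulrN // mulrC.
have [q0 q1 q2] := row_rows3 (row 0 K + e *: row 1 K) (row 0 K - e *: row 1 K) (2 *: row 2 K).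
rewrite -q0; apply: (@cross_cap_of_basis _ _
  (rows3 (row 0 K + e *: row 1 K) (row 0 K - e *: row 1 K) (2 *: row 2 K)) (-1) (-1)) => //.
- apply: (rows3_unit uK (P := rows3 (row3 1 e 0) (row3 1 (- e) 0) (row3 0 0 2))).
    apply: unitmx_row3; rewrite [X in X != 0](_ : _ = - (2 * 2 * e)); last by ring.
    by rewrite oppr_eq0 !mulf_neq0 // pnatr_eq0.
  split; rewrite [in RHS]rowK //= row3_mul ?scale1r !scale0r ?addr0 ?scaleNr //.
  by rewrite !add0r.
- rewrite q0 q1 phatDl !phatDr -scaleNr !phatZr !phatZl !phat_diag h01.
  rewrite (phatC _ (row 1 K) (row 0 K)).
  move: (hat _ _) (phat _ _ _) => a b; apply/rowP => j; rewrite !mxE.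
  have -> : 2 * a 0 j + - e * b 0 j + (e * b 0 j + - e * (e * (2 * a 0 j))) =
    2 * a 0 j * (1 - e ^+ 2) by ring.
  by rewrite e1 subrr mulr0.
- rewrite q0 q1 q2 -[- (e *: _)]scaleNr !hatD !phatZr !hatZ sqrrN e1 h01 h02.
  by move: (hat _ _) (phat _ _ _) => a b; apply/rowP => j; rewrite !mxE; ring.
Qed.

Lemma roman_double (a b : R) : sphere (row3 a b 0 *m K) -> a != 0 -> b != 0 -> a ^+ 2 != b ^+ 2 ->
  transversal_double_point F (F (row3 a b 0 *m K)).
Proof.
move=> ss a0 b0 ab.
have D : b ^+ 2 - a ^+ 2 != 0 by rewrite subr_eq0 eq_sym.
have D' : a ^+ 2 - b ^+ 2 != 0 by rewrite subr_eq0.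
have anb : a != b by apply: contra ab => /eqP ->.
have anNb : a != - b by apply: contra ab => /eqP ->; rewrite sqrrN.
have GG : GR (row3 b a 0) = GR (row3 a b 0).
  by apply: row4P; rewrite !mxE /= ?mulr0 1?mulrC // (addrC (a ^+ 2)).
have imm s t : t ^+ 2 - s ^+ 2 != 0 -> s != 0 -> immersive_at F (row3 s t 0 *m K).
  move=> st s0; apply: (sys_immersive uK uM hE) => w; rewrite polar_GR => /rowP E.
  have := E 0; have := E 2; have := E 3; rewrite !mxE /= !mul0r !addr0 => E3 E2 E0.
  have w2 : w 0 2 = 0 by apply: (mulfI s0); rewrite mulr0.
  by apply: row3P; rewrite [RHS]mxE //; apply: (mulfI st); rewrite mulr0;
    [transitivity (t * (s * w 0 1 + t * w 0 0) - s / 2 * (2 * (s * w 0 0 + t * w 0 1)))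
    |transitivity (t / 2 * (2 * (s * w 0 0 + t * w 0 1)) - s * (s * w 0 1 + t * w 0 0))];
    first [by rewrite E0 E3 !mulr0 subr0|by field].
exists (row3 a b 0 *m K), (row3 b a 0 *m K); split.
- apply: (sys_preim2 uK uM hE) => // w /GR_eq.
  rewrite !mxE /= !mulr0 !expr0n /= !addr0 => -[E0 E1 _ E3].
  have w01 : w 0 0 * w 0 1 != 0 by rewrite E0 mulf_neq0.
  have w1 : w 0 1 != 0 by apply: contra w01 => /eqP ->; rewrite mulr0.
  have w2 : w 0 2 = 0 by apply: (mulfI w1); rewrite E1 mulr0.
  have w0 : w 0 0 != 0 by apply: contra w01 => /eqP ->; rewrite mul0r.
  move: E3; rewrite w2 expr0n addr0 => E3.
  have sgn s t (s0 : s != 0) : w 0 0 ^+ 2 = s ^+ 2 -> s * t = a * b ->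
      w = row3 s t 0 \/ w = - row3 s t 0.
    move=> h1 h2; case: (sqr_cases h1) => w0E; rewrite w0E -h2 in E0; [left|right].
      by apply: row3P; rewrite !mxE //=; exact: (mulfI s0).
    apply: row3P; rewrite !mxE //= ?oppr0 //; apply: (mulfI s0).
    by rewrite mulrN -E0 mulNr opprK.
  have : (w 0 0 ^+ 2 - a ^+ 2) * (w 0 0 ^+ 2 - b ^+ 2) = 0.
    have e1 : w 0 1 ^+ 2 = a ^+ 2 + b ^+ 2 - w 0 0 ^+ 2 by rewrite -E3; ring.
    have : w 0 0 ^+ 2 * w 0 1 ^+ 2 = a ^+ 2 * b ^+ 2 by rewrite -!exprMn E0.
    by rewrite e1; move: (w 0 0 ^+ 2) (a ^+ 2) (b ^+ 2) => x y z h; lra.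
  move/eqP; rewrite mulf_eq0 !subr_eq0 => /orP[] /eqP h.
    by have [->|->] := sgn a b a0 h erefl; [apply: Or41|apply: Or42].
  by have [->|->] := sgn b a b0 h (mulrC b a); [apply: Or43|apply: Or44].
- apply: (sys_non_antipodal uK).
    by apply/eqP => /rowP/(_ 0)/eqP; rewrite !mxE /= (negbTE anb).
  by apply/eqP => /rowP/(_ 0)/eqP; rewrite !mxE /= (negbTE anNb).
- exact: imm.
- exact: imm.
- apply: (sys_transversal uM hE) => // A.
  exists (row3 ((b * A 0 0 - a * (A 0 3 / 2)) / (b ^+ 2 - a ^+ 2))
    ((b * (A 0 3 / 2) - a * A 0 0) / (b ^+ 2 - a ^+ 2))
    ((b * A 0 1 - a * A 0 2) / (b ^+ 2 - a ^+ 2))).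
  exists (row3 0 0 ((b * A 0 2 - a * A 0 1) / (b ^+ 2 - a ^+ 2))).
  by rewrite !polar_GR; apply: row4P; rewrite !mxE /=; field.
Qed.

Lemma roman_arc : Defs.arc (seg Q (row 0 K + row 1 K) (row 0 K - row 1 K)).
Proof.
have k0 := roman_neq0 1 (oner_neq0 R); have k1 := roman_neq0 (-1) (oner_neq0 R).
rewrite !scale1r ?scaleN1r in k0 k1.
have [c c0 nc] := normalizeE k0; have [d d0 nd] := normalizeE k1.
have sc := normalize_sphere k0; have sd := normalize_sphere k1.
have ncE : normalize (row 0 K + row 1 K) = row3 c c 0 *m K.
  by rewrite nc row3_mul scalerDr scale0r addr0.
have ndE : normalize (row 0 K - row 1 K) = row3 d (- d) 0 *m K.
  by rewrite nd row3_mul scalerBr scale0r addr0 scaleNr.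
apply: seg_arc; apply/eqP; rewrite ncE ndE in sc sd *.
move/(sys_eq uM hE sc sd)/rowP/(_ 0); rewrite !mxE /= mulrN -!expr2 => E.
have := sqr_ge0 d; have : 0 < c ^+ 2 by rewrite exprn_even_gt0.
lra.
Qed.

Lemma roman_triple_value v : sphere (v *m K) -> v 0 0 * v 0 1 = 0 -> v 0 1 * v 0 2 = 0 ->
  v 0 0 * v 0 2 = 0 -> F (v *m K) = F (normalize (row 0 K)).
Proof.
move=> sv E0 E1 E2.
have [r0 _ _] := rowsK K.
have k0 : row 0 K != 0 by rewrite r0 mulK_neq0 // row3_neq0 // oner_eq0.
have sc := normalize_sphere k0.
have hv : hat Q (v *m K) = (v 0 0 ^+ 2 + v 0 1 ^+ 2 + v 0 2 ^+ 2) *: hat Q (row 0 K).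
  by rewrite hE rows4_mul E0 E1 E2 !scale0r !add0r.
have [c c0 nc] := normalizeE k0.
rewrite (hat_eq Q sv sc) hv nc hatZ; congr (_ *: _).
have e1 := hat_max Q (v *m K); rewrite hv mxE hat_max sv in e1.
have e2 := hat_max Q (c *: row 0 K); rewrite hatZ mxE hat_max -nc sc in e2.
by apply: (mulIf (lt0r_neq0 (dot_gt0 k0))); rewrite e1 e2.
Qed.

Lemma roman_triple_point : transversal_triple_point F (F (normalize (row 0 K))).
Proof.
have [r0 _ _] := rowsK K.
have k0 : row 0 K != 0 by rewrite r0 mulK_neq0 // row3_neq0 // oner_eq0.
have [c c0 nc] := normalizeE k0; have sc := normalize_sphere k0.
have ncE : normalize (row 0 K) = row3 c 0 0 *m K by rewrite nc r0 row3_mulZ mulr1 !mulr0.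
rewrite ncE in sc *.
have G1 : GR (row3 0 c 0) = GR (row3 c 0 0) by apply: row4P; rewrite !mxE /=; ring.
have G2 : GR (row3 0 0 c) = GR (row3 c 0 0) by apply: row4P; rewrite !mxE /=; ring.
exists (row3 c 0 0 *m K), (row3 0 c 0 *m K), (row3 0 0 c *m K); split.
- apply: (sys_preim3 uK uM hE) => // w /GR_eq.
  rewrite !mxE /= !(mulr0, mul0r) !expr0n /= !addr0 => -[E0 E1 E2 E3].
  have [w0|w0] := eqVneq (w 0 0) 0; last first.
    have w1 : w 0 1 = 0 by apply: (mulfI w0); rewrite E0 mulr0.
    have w2 : w 0 2 = 0 by apply: (mulfI w0); rewrite E2 mulr0.
    move: E3; rewrite w1 w2 !expr0n /= !addr0 => /sqr_cases[] w0E; left; [left|right];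
      by apply: row3P; rewrite ?w0E ?w1 ?w2 !mxE //= oppr0.
  right; have [w1|w1] := eqVneq (w 0 1) 0.
    move: E3; rewrite w0 w1 !expr0n /= !add0r => /sqr_cases[] w2; [apply: Or43|apply: Or44];
      by apply: row3P; rewrite ?w0 ?w1 ?w2 !mxE //= oppr0.
  have w2 : w 0 2 = 0 by apply: (mulfI w1); rewrite E1 mulr0.
  move: E3; rewrite w0 w2 !expr0n /= add0r addr0 => /sqr_cases[] w1E; [apply: Or41|apply: Or42];
    by apply: row3P; rewrite ?w0 ?w1E ?w2 !mxE //= oppr0.
- apply/and3P; split; apply: (sys_non_antipodal uK); apply/eqP => /rowP E;
    first [by have := E 0; rewrite !mxE /= ?oppr0 => /eqP; rewrite (negbTE c0)
          |by have := E 1; rewrite !mxE /= ?oppr0 => /eqP; rewrite (negbTE c0)].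
- by split; apply: (sys_immersive uK uM hE) => w; rewrite polar_GR => /rowP E;
    have := E 0; have := E 1; have := E 2; have := E 3; rewrite !mxE /= => E3 E2 E1 E0;
    apply: row3P; rewrite [RHS]mxE; apply: (mulfI c0); lra.
- apply/seteqP; split=> A; last first.
    have tz u : tangent_image F u 0.
      exists 0; first by rewrite /tangent /= -[0](scale0r (0 : 'rV[R]_3)) dotZr mul0r.
      by rewrite derive_net -[X in pnet _ _ X](scale0r (0 : 'rV[R]_3)) pnetZr scale0r.
    by move=> ->; split; first split; exact: tz.
  move=> [[/tangent_imageP[w0 E0] /tangent_imageP[w1 E1]] /tangent_imageP[w2 E2]].
  have [v0 w0E] := coordsP uK w0; have [v1 w1E] := coordsP uK w1.
  have [v2 w2E] := coordsP uK w2; subst w0 w1 w2.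
  have E01 := etrans E0 (esym E1); have E02 := etrans E0 (esym E2).
  move: E0 E01 E02; rewrite !(sys_phat hE) => E0 /(mulM_inj uM) E01 /(mulM_inj uM) E02.
  (* A vector tangent to all three sheets is thus a multiple of [hat Q (row 0 K)], whose last
     coordinate is positive; for a tangent vector that coordinate is 0, so the multiple is zero. *)
  have P : polar GR (row3 c 0 0) v0 = row4 0 0 0 (2 * (c * v0 0 0)).
    apply: row4P.
    - by rewrite E02 polar_GR !mxE /=; ring.
    - by rewrite polar_GR !mxE /=; ring.
    - by rewrite E01 polar_GR !mxE /=; ring.
    - by rewrite polar_GR !mxE /=; ring.
  have T0 := congr1 (fun B : 'rV[R]_4 => B 0 ord_max) E0; rewrite P rows4_mul in E0.
  move: T0; rewrite P rows4_mul !scale0r !add0r [in LHS]mxE hat_max [in RHS]mxE unlift_none.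
  move/eqP; rewrite mulf_eq0 (gt_eqF (dot_gt0 k0)) orbF => /eqP X0.
  rewrite X0 !scale0r !addr0 in E0.
  by apply/rowP => k; move/rowP/(_ (lift ord_max k)): E0; rewrite !mxE liftK.
Qed.

End RomanPair.

(** * Roman Steiner surface: the three double point curves together *)

Section Roman.
Context {R : realType}.
Variables (Q : @net R) (K : 'M[R]_3).
Hypotheses (uK : K \in unitmx) (Qf : hat_free Q).
Hypotheses (hK : forall i j, hat Q (row i K) = hat Q (row j K)).
Local Notation F := (net_map Q).

(** Addition in ['I_3] is modulo 3, so each of the three pairs of rows occurs as the first two rows
    of some rotation. *)
Definition rotrows (i : 'I_3) : 'M[R]_3 := rows3 (row i K) (row (i + 1) K) (row (i + 1 + 1) K).
Definition rotrow (i : 'I_3) (v : 'rV[R]_3) : 'rV[R]_3 := row3 (v 0 i) (v 0 (i + 1)) (v 0 (i + 1 + 1)).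

Lemma ord3_01 : (0 : 'I_3) + 1 = 1. Proof. exact: val_inj. Qed.
Lemma ord3_12 : (1 : 'I_3) + 1 = 2. Proof. exact: val_inj. Qed.
Lemma ord3_20 : (2 : 'I_3) + 1 = 0. Proof. exact: val_inj. Qed.
Definition ord3_add := (ord3_01, ord3_12, ord3_20).

Lemma rotrow_mul i v : rotrow i v *m rotrows i = v *m K.
Proof.
rewrite [in RHS](row3_eta v) !row3_mul /rotrow /rotrows; have [-> -> ->] := row_rows3 (row i K) (row (i + 1) K) (row (i + 1 + 1) K).
elim/ord3E : i; rewrite !ord3_add //.
- by rewrite [LHS]addrC addrA.
- by rewrite -addrA addrC.
Qed.

Lemma rotrows_unit i : rotrows i \in unitmx.
Proof.
have [r0 r1 r2] := rowsK K.
pose e (j : 'I_3) : 'rV[R]_3 := delta_mx 0 j.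
apply: (rows3_unit uK (P := rows3 (e i) (e (i + 1)) (e (i + 1 + 1)))); last first.
  by split; rewrite [in RHS]rowK /= rowE.
apply: mulmx_inj_unitmx => v; apply: contra => /eqP vP.
have E (j : 'I_3) : (v *m rows3 (e i) (e (i + 1)) (e (i + 1 + 1))) 0 j = 0 by rewrite vP mxE.
rewrite [v]row3_eta; suff [-> -> ->] : [/\ v 0 0 = 0, v 0 1 = 0 & v 0 2 = 0].
  by apply/eqP/row3P; rewrite !mxE.
move: (E i) (E (i + 1)) (E (i + 1 + 1)); rewrite [v]row3_eta row3_mul.
have [-> -> ->] := row_rows3 (e i) (e (i + 1)) (e (i + 1 + 1)).
move: (v 0 0) (v 0 1) (v 0 2) => a b c; rewrite !mxE /= /e.
by elim/ord3E : i {E vP}; rewrite !ord3_add ?mxE /= !(mulr1, mulr0, addr0, add0r).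
Qed.

Lemma rotrows_hat i : hat Q (row 1 (rotrows i)) = hat Q (row 0 (rotrows i)) /\
  hat Q (row 2 (rotrows i)) = hat Q (row 0 (rotrows i)).
Proof. by split; rewrite !rowK /=; exact: hK. Qed.

Definition roman_gamma i := seg Q (row i K + row (i + 1) K) (row i K - row (i + 1) K).

Let k0 i : row i K + row (i + 1) K != 0.
Proof.
have := roman_neq0 (rotrows_unit i) 1 (oner_neq0 R); rewrite !scale1r.
by have [-> -> _] := row_rows3 (row i K) (row (i + 1) K) (row (i + 1 + 1) K).
Qed.

Let k1 i : row i K - row (i + 1) K != 0.
Proof.
have := roman_neq0 (rotrows_unit i) (-1) (oner_neq0 R); rewrite scale1r scaleN1r.
by have [-> -> _] := row_rows3 (row i K) (row (i + 1) K) (row (i + 1 + 1) K).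
Qed.

Let k01 i : phat Q (row i K + row (i + 1) K) (row i K - row (i + 1) K) = 0.
Proof.
have := roman_phat01 (rotrows_hat i).1.
by have [-> -> _] := row_rows3 (row i K) (row (i + 1) K) (row (i + 1 + 1) K).
Qed.

Let rotrowE i s t : s *: (row i K + row (i + 1) K) + t *: (row i K - row (i + 1) K) =
  row3 (s + t) (s - t) 0 *m rotrows i.
Proof.
have := roman_rowE (rotrows i) s t.
by have [-> -> _] := row_rows3 (row i K) (row (i + 1) K) (row (i + 1 + 1) K).
Qed.

Lemma rotK i (w : 'rV[R]_3) : exists v, row3 (w 0 0) (w 0 1) (w 0 2) = rotrow i v.
Proof.
elim/ord3E : i.
- by exists (row3 (w 0 0) (w 0 1) (w 0 2)); apply: row3P; rewrite ?ord3_add !mxE.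
- by exists (row3 (w 0 2) (w 0 0) (w 0 1)); apply: row3P; rewrite ?ord3_add !mxE.
- by exists (row3 (w 0 1) (w 0 2) (w 0 0)); apply: row3P; rewrite ?ord3_add !mxE.
Qed.

Lemma roman_arcP i y : arc_pts (roman_gamma i) y ->
  exists v, [/\ sphere (v *m K), y = F (v *m K) & v 0 (i + 1 + 1) = 0].
Proof.
move=> /(arc_pts_segP (k0 i) (k1 i) (k01 i))[s [t [ss ->]]]; rewrite rotrowE in ss *.
have [v E] := rotK i (row3 (s + t) (s - t) 0); rewrite !mxE /= in E.
rewrite E rotrow_mul in ss *; exists v; split => //.
by move/rowP/(_ 2): E; rewrite !mxE.
Qed.

Lemma arc_roman i v : sphere (v *m K) -> v 0 (i + 1 + 1) = 0 -> arc_pts (roman_gamma i) (F (v *m K)).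
Proof.
move=> ss v2; have E : v *m K = (v 0 i / 2 + v 0 (i + 1) / 2) *: (row i K + row (i + 1) K) +
    (v 0 i / 2 - v 0 (i + 1) / 2) *: (row i K - row (i + 1) K).
  by rewrite rotrowE -(rotrow_mul i) /rotrow v2; congr (row3 _ _ _ *m _); field.
by rewrite E in ss *; apply: (arc_pts_seg (k0 i) (k1 i) (k01 i)).
Qed.

Let y0 := F (normalize (row 0 K)).

Lemma row_neq0 i : row i K != 0.
Proof.
by rewrite rowE mulK_neq0 //; apply/eqP => /rowP/(_ i)/eqP; rewrite !mxE !eqxx oner_eq0.
Qed.

Lemma triple_row i : F (normalize (row i K)) = y0.
Proof.
have dE : dot (row i K) (row i K) = dot (row 0 K) (row 0 K) by rewrite -!(hat_max Q) (hK i 0).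
rewrite /y0 (hat_eq Q (normalize_sphere (row_neq0 i)) (normalize_sphere (row_neq0 0))).
by rewrite /normalize !hatZ (hK i 0) dE.
Qed.

Theorem roman_surface_of_basis : roman_steiner_surface F.
Proof.
have hE := hat_GR (rotrows_hat 0).1 (rotrows_hat 0).2.
have vK (v : 'rV[R]_3) : v *m rotrows 0 = v *m K.
  by rewrite -(rotrow_mul 0) /rotrow !ord3_add -row3_eta.
have uM := unit_of_hat_free (rotrows_unit 0) Qf hE.
exists roman_gamma, y0; split.
- split.
  + move=> i; have := roman_arc (rotrows_unit i) Qf (rotrows_hat i).1 (rotrows_hat i).2.
    by have [-> -> _] := row_rows3 (row i K) (row (i + 1) K) (row (i + 1 + 1) K).
  + move=> i; have [c c0 nc] := normalizeE (row_neq0 i).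
    rewrite -(triple_row i) nc.
    have E : c *: row i K = (c / 2) *: (row i K + row (i + 1) K) + (c / 2) *: (row i K - row (i + 1) K).
      by move: (row i K) (row _ K) => a b; apply/rowP => j; rewrite !mxE; field.
    rewrite E; apply: arc_int_seg; rewrite -?E -?nc ?mulf_neq0 ?invr_eq0 ?pnatr_eq0 //.
    exact: normalize_sphere (row_neq0 i).
  + move=> i j ij; apply/seteqP; split=> y; last first.
      move=> ->; split.
        have [c c0 nc] := normalizeE (row_neq0 i).
        rewrite -(triple_row i) nc rowE scalemxAl; apply: arc_roman.
          by rewrite -scalemxAl -rowE -nc; exact: normalize_sphere (row_neq0 i).
        by elim/ord3E : i {ij nc}; rewrite !ord3_add !mxE /= mulr0.
      have [c c0 nc] := normalizeE (row_neq0 j).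
      rewrite -(triple_row j) nc rowE scalemxAl; apply: arc_roman.
        by rewrite -scalemxAl -rowE -nc; exact: normalize_sphere (row_neq0 j).
      by elim/ord3E : j {ij nc}; rewrite !ord3_add !mxE /= mulr0.
    move=> [/roman_arcP[v [sv -> vi]] /roman_arcP[w [sw E wj]]].
    rewrite -vK in sv E *; rewrite -vK in sw E.
    move/(sys_eq uM hE sv sw)/GR_eq: E => [E0 E1 E2 _].
    have P a b : a != b -> v 0 a * v 0 b = w 0 a * w 0 b.
      by elim/ord3E: a; elim/ord3E: b => // _; rewrite 1?mulrC // 1?[RHS]mulrC.
    (* Two distinct indices out of three cannot avoid both [i + 1 + 1] and [j + 1 + 1], which are
       different; so each product vanishes at [v] or at [w]. *)
    have Z a b : a != b -> v 0 a * v 0 b = 0.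
      move=> ab; have [->|ai] := eqVneq a (i + 1 + 1); first by rewrite vi mul0r.
      have [->|bi] := eqVneq b (i + 1 + 1); first by rewrite vi mulr0.
      have [aj|aj] := eqVneq a (j + 1 + 1); first by rewrite (P _ _ ab) aj wj mul0r.
      have [bj|bj] := eqVneq b (j + 1 + 1); first by rewrite (P _ _ ab) bj wj mulr0.
      exfalso; move: ij ab ai bi aj bj.
      by elim/ord3E: i {vi}; elim/ord3E: j {wj} => // _; rewrite !ord3_add;
        elim/ord3E: a; elim/ord3E: b.
    have := roman_triple_value (rotrows_unit 0) (rotrows_hat 0).1 (rotrows_hat 0).2 sv (Z 0 1 isT) (Z 1 2 isT) (Z 0 2 isT).
    by have [-> _ _] := row_rows3 (row 0 K) (row (0 + 1) K) (row (0 + 1 + 1) K).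
- have := roman_triple_point (rotrows_unit 0) Qf (rotrows_hat 0).1 (rotrows_hat 0).2.
  by have [-> _ _] := row_rows3 (row 0 K) (row (0 + 1) K) (row (0 + 1 + 1) K).
- move=> i; rewrite /roman_gamma seg0 seg1.
  have [q0 q1 _] := row_rows3 (row i K) (row (i + 1) K) (row (i + 1 + 1) K).
  have H := roman_pinch (rotrows_unit i) Qf (rotrows_hat i).1 (rotrows_hat i).2.
  rewrite q0 q1 in H; split.
    by have := H 1 (expr1n _ _); rewrite scale1r.
  by have := H (-1); rewrite sqrrN expr1n scaleN1r; apply.
- move=> i y /(arc_int_segP (k0 i) (k1 i) (k01 i))[s [t [ss -> s0 t0]]] yt.
  rewrite rotrowE in ss yt *.
  have st : s - t != 0.
    apply: contra yt => /eqP st.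
    have ti := roman_triple_value (rotrows_unit i) (rotrows_hat i).1 (rotrows_hat i).2 ss.
    rewrite !mxE /= st !(mulr0, mul0r) in ti; rewrite st ti //.
    have [-> _ _] := row_rows3 (row i K) (row (i + 1) K) (row (i + 1 + 1) K).
    by rewrite triple_row.
  apply: (roman_double (rotrows_unit i) Qf (rotrows_hat i).1 (rotrows_hat i).2 ss) => //.
    by rewrite gt_eqF // addr_gt0.
  rewrite -subr_eq0 (_ : _ - _ = 4 * (s * t)); last by ring.
  by rewrite !mulf_neq0 ?pnatr_eq0 // lt0r_neq0.
- move=> _ [u su <-]; have [v uE] := coordsP uK u; subst u => Narc.
  have nz i : v 0 i != 0.
    apply/eqP => vi; apply: (Narc (i + 1)); apply: arc_roman => //.
    by rewrite -vi; congr (v 0 _); elim/ord3E: i {vi}; rewrite !ord3_add.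
  rewrite -vK in su *; exists (v *m rotrows 0).
    apply: (sys_preim1 (rotrows_unit 0) uM hE) => // w /GR_eq[E0 E1 E2 _].
    have e : w 0 0 ^+ 2 = v 0 0 ^+ 2.
      have w12 : w 0 1 * w 0 2 != 0 by rewrite E1 mulf_neq0.
      apply: (mulIf w12); transitivity ((w 0 0 * w 0 1) * (w 0 0 * w 0 2)); first by ring.
      by rewrite E0 E1 E2; ring.
    case: (sqr_cases e) => e0; rewrite e0 in E0 E2; [left|right].
      by apply: row3P => //; exact: (mulfI (nz 0)).
    by apply: row3P; rewrite [RHS]mxE //; apply: (mulfI (nz 0)); rewrite mulrN -?E0 -?E2 mulNr opprK.
  apply: (sys_immersive (rotrows_unit 0) uM hE) => w; rewrite polar_GR => /rowP E.
  have := E 0; have := E 1; have := E 2; rewrite !mxE /=.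
  move: (nz 0) (nz 1) (nz 2) (@row3P R w 0); rewrite !mxE.
  move: (v 0 0) (v 0 1) (v 0 2) (w 0 0) (w 0 1) (w 0 2) => x y z a b c x0 y0' z0 P e2 e1 e0.
  have a0 : a = 0.
    apply: (mulfI (mulf_neq0 (mulf_neq0 (lt0r_neq0 (ltr0Sn R 1)) y0') z0)).
    transitivity (z * (x * b + y * a) + y * (x * c + z * a) - x * (y * c + z * b)); first by ring.
    by rewrite e0 e1 e2; ring.
  rewrite a0 mulr0 addr0 in e0; rewrite a0 mulr0 addr0 in e2; apply: P => //.
    by apply: (mulfI x0); rewrite mulr0.
  by apply: (mulfI x0); rewrite mulr0.
Qed.

End Roman.

(** * Orthonormal frames and closed curves of the projective plane *)

Section ConeEllipsoid.
Context {R : realType}.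

Definition net_free (Q : @net R) := forall l : 'cV[R]_3, (forall u, net_map Q u *m l = 0) -> l = 0.

Lemma hat_freeP (Q : @net R) :
  (forall l : 'cV[R]_4, (forall u, hat Q u *m l = 0) -> l = 0) -> hat_free Q.
Proof. by move=> H l E; apply: H => u; rewrite /hat -mulmxA E mulmx0. Qed.

(** At a common zero of the net only the squared norm survives, so its coefficient in a linear
    relation is 0 and the relation is one among the forms of the net. *)
Lemma hat_free_of_zero Q (u : 'rV[R]_3) : net_free Q -> u != 0 -> net_map Q u = 0 -> hat_free Q.
Proof.
move=> fQ u0 Fu; apply: hat_freeP => l E.
have hE w : hat Q w *m l = (net_map Q w *m (\col_k l (lift ord_max k) 0)) + (dot w w * l ord_max 0)%:M.
  apply/rowP => j; rewrite !ord1 [LHS]mxE big_ord_recr hat_max [RHS]mxE [X in _ = X + _]mxE.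
  rewrite [X in _ = _ + X]mxE eqxx mulr1n; congr (_ + _); apply: eq_bigr => k _.
  rewrite -hat_lift [X in _ = _ * X]mxE.
  have -> : widen_ord (leqnSn 3) k = lift ord_max k by apply: ord_inj; rewrite lift_max.
  by [].
have l3 : l ord_max 0 = 0.
  have := E u; rewrite hE Fu mul0mx add0r => /rowP/(_ 0)/eqP.
  by rewrite !mxE eqxx mulr1n mulf_eq0 (gt_eqF (dot_gt0 u0)) => /eqP.
have l0 := fQ (\col_k l (lift ord_max k) 0).
have {}l0 : \col_k l (lift ord_max k) 0 = 0.
  by apply: l0 => w; have := E w; rewrite hE l3 mulr0 raddf0 addr0.
apply/colP => j; rewrite mxE; case: (unliftP ord_max j) => [k ->|-> //].
by move/colP/(_ k): l0; rewrite !mxE.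
Qed.

Lemma pnetC Q (u w : 'rV[R]_3) : pnet Q u w = pnet Q w u.
Proof. by rewrite /pnet pverC. Qed.

Lemma net_mapD Q (u w : 'rV[R]_3) : net_map Q (u + w) = net_map Q u + pnet Q u w + net_map Q w.
Proof. by rewrite /pnet !net_mapE verD !mulmxDl. Qed.

Lemma net_row3 Q (K : 'M[R]_3) x y z : net_map Q (row3 x y z *m K) =
  x ^+ 2 *: net_map Q (row 0 K) + y ^+ 2 *: net_map Q (row 1 K) + z ^+ 2 *: net_map Q (row 2 K) +
  (x * y) *: pnet Q (row 0 K) (row 1 K) + (x * z) *: pnet Q (row 0 K) (row 2 K) +
  (y * z) *: pnet Q (row 1 K) (row 2 K).
Proof.
have /rowP H := hat_row3 Q K x y z.
apply/rowP => k; have := H (lift ord_max k); rewrite hat_lift => ->.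
move: (hat_lift Q (row 0 K) k) (hat_lift Q (row 1 K) k) (hat_lift Q (row 2 K) k)
  (phat_lift Q (row 0 K) (row 1 K) k) (phat_lift Q (row 0 K) (row 2 K) k)
  (phat_lift Q (row 1 K) (row 2 K) k).
move: (hat Q _) (hat Q _) (hat Q _) (phat Q _ _) (phat Q _ _) (phat Q _ _) => a b c d e f.
move: (net_map Q _) (net_map Q _) (net_map Q _) (pnet Q _ _) (pnet Q _ _) (pnet Q _ _) => a' b' c' d' e' f'.
by move=> E0 E1 E2 E3 E4 E5; rewrite !mxE E0 E1 E2 E3 E4 E5.
Qed.

Lemma orthonormal_rows (K : 'M[R]_3) : K *m K^T = 1%:M -> K \in unitmx /\
  forall v w : 'rV[R]_3, dot (v *m K) (w *m K) = dot v w.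
Proof.
move=> KK; split; first by have [] := mulmx1_unit KK.
have dE (v w : 'rV[R]_3) : dot v w = (v *m w^T) 0 0.
  by rewrite mxE; apply: eq_bigr => i _; rewrite mxE.
by move=> v w; rewrite !dE trmx_mul mulmxA -(mulmxA v) KK mulmx1.
Qed.

Lemma orthonormal_extension (n : 'rV[R]_3) : n != 0 ->
  exists K : 'M[R]_3, [/\ K *m K^T = 1%:M, row 2 K = normalize n & dot (row 0 K) n = 0 /\ dot (row 1 K) n = 0].
Proof.
move=> n0; have [m m0 nm] := normalizeE n0; have := normalize_sphere n0.
move: nm; move: (normalize n) => r nm; rewrite /sphere /= dotE => r1.
have [p [p1 pr]] : exists p : 'rV[R]_3, dot p p = 1 /\ dot p r = 0.
  suff [w w0 wr] : exists2 w : 'rV[R]_3, w != 0 & dot w r = 0.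
    have [c c0 nc] := normalizeE w0; exists (normalize w); split; first exact: normalize_sphere.
    by rewrite nc dotZl wr mulr0.
  have [h|h] := boolP ((r 0 0 == 0) && (r 0 1 == 0)).
    exists (row3 1 0 0); first by rewrite row3_neq0 // oner_eq0.
    by move/andP: h => [/eqP h0 /eqP h1]; rewrite dotE !mxE /= h0; ring.
  exists (row3 (r 0 1) (- r 0 0) 0); last by rewrite dotE !mxE /=; ring.
  by rewrite row3_neq0 // oppr_eq0 eqxx orbF orbC -negb_and.
pose q := row3 (r 0 1 * p 0 2 - r 0 2 * p 0 1) (r 0 2 * p 0 0 - r 0 0 * p 0 2) (r 0 0 * p 0 1 - r 0 1 * p 0 0).
have qp : dot q p = 0 by rewrite dotE !mxE /=; ring.
have qr : dot q r = 0 by rewrite dotE !mxE /=; ring.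
have q1 : dot q q = 1.
  have -> : dot q q = dot p p * dot r r - dot p r ^+ 2 by rewrite !dotE !mxE /=; ring.
  by rewrite p1 pr expr0n subr0 mul1r dotE.
have [q0' q1' q2'] := row_rows3 p q r.
exists (rows3 p q r); rewrite q0' q1' q2'; split => //; last first.
  have -> : n = m^-1 *: r by rewrite nm scalerA mulVf // scale1r.
  by rewrite !dotZr pr qr !mulr0.
apply/matrixP => i j; have -> : (rows3 p q r *m (rows3 p q r)^T) i j =
    dot (row i (rows3 p q r)) (row j (rows3 p q r)).
  by rewrite mxE; apply: eq_bigr => k _; rewrite !mxE.
have r1' : dot r r = 1 by rewrite dotE.
rewrite mxE; move: i j; apply: ord3E; apply: ord3E; rewrite ?q0' ?q1' ?q2' //= ?(dotC r) ?(dotC p q) //.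
Qed.

(** Half of the great circle of rows 0 and 1, from row 0 to its antipode: a closed curve in the
    quotient. The square root replaces trigonometric functions. *)
Definition equator (K : 'M[R]_3) (t : R) : 'rV[R]_3 :=
  row3 (1 - 2 * t) (2 * Num.sqrt (t * (1 - t))) 0 *m K.

Lemma equator_pts (K : 'M[R]_3) : K *m K^T = 1%:M ->
  closed_curve (equator K) /\
  forall v, closed_curve_pts (equator K) (v *m K) <-> dot v v = 1 /\ v 0 2 = 0.
Proof.
move=> /orthonormal_rows[uK dK].
have sq (t : R) : t \in `[0, 1]%R -> Num.sqrt (t * (1 - t)) ^+ 2 = t * (1 - t).
  by rewrite in_itv /= => /andP[t0 t1]; rewrite sqr_sqrtr // mulr_ge0 // subr_ge0.
have sE (t : R) : t \in `[0, 1]%R -> sphere (equator K t).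
  by move=> t01; rewrite /sphere /= dK dotE !mxE /= -!expr2 exprMn sq //; ring.
split.
  split.
  - apply: continuous_subspaceT => t.
    have -> : equator K = fun t => (1 - 2 * t) *: row 0 K + (2 * Num.sqrt (t * (1 - t))) *: row 1 K.
      by apply/funext => x; rewrite /equator row3_mul scale0r addr0.
    apply: cvgD; apply: cvgZr_tmp.
      by apply: cvgB; [exact: cvg_cst|apply: cvgMr; exact: cvg_id].
    apply: cvgMr; apply: continuous_comp; last exact: sqrt_continuous.
    by apply: cvgM; [exact: cvg_id|apply: cvgB; [exact: cvg_cst|exact: cvg_id]].
  - exact: sE.
  - apply/orP; right; rewrite inE /equator -mulNmx; apply/eqP; congr (_ *m _).
    by apply: row3P; rewrite !mxE /= ?subrr ?mulr0 ?mul0r ?sqrtr0; ring.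
  - move=> s t; rewrite !in_itv /= => /andP[s0 s1] /andP[t0 t1].
    move=> /orP[]; rewrite inE /equator -?mulNmx => /eqP/(mulK_inj uK)/rowP E.
      by have := E 0; rewrite !mxE /=; lra.
    have := E 1; have := E 0; rewrite !mxE /= => E0 E1.
    have := sqrtr_ge0 (s * (1 - s)); have := sqrtr_ge0 (t * (1 - t)) => a b.
    have z : Num.sqrt (t * (1 - t)) = 0 by lra.
    have : t * (1 - t) = 0.
      by rewrite -(sq t) ?z ?expr0n // in_itv /= t0 ltW.
    by move/eqP; rewrite mulf_eq0 => /orP[] /eqP h; lra.
move=> v; split=> [[t t01] |[v1 v2]].
  have st := sE t t01; move=> /orP[]; rewrite inE /equator -?mulNmx => /eqP/(mulK_inj uK) E.
    by rewrite -dK E; split=> //; rewrite !mxE.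
  split; first by have := sphereN st; rewrite /sphere /= /equator -E mulNmx opprK dK.
  by move/rowP/(_ 2): E; rewrite !mxE /= => /eqP; rewrite oppr_eq0 => /eqP.
rewrite dotE v2 mulr0 addr0 -!expr2 in v1.
have s0 := sqr_ge0 (v 0 0); have s1 := sqr_ge0 (v 0 1).
have b : - 1 <= v 0 0 <= 1.
  by apply/andP; split; nra.
pose e : R := if 0 <= v 0 1 then 1 else -1.
have e1 : e ^+ 2 = 1 by rewrite /e; case: ifP; rewrite ?sqrrN expr1n.
have ev : 0 <= e * v 0 1.
  rewrite /e; case: ifP => h; first by rewrite mul1r.
  by rewrite mulN1r oppr_ge0; apply/ltW; rewrite ltNge h.
have eb : -1 <= e * v 0 0 <= 1.
  by rewrite /e; case: ifP => _; rewrite ?mul1r ?mulN1r //; lra.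
exists ((1 - e * v 0 0) / 2); first by rewrite in_itv /=; lra.
have E : equator K ((1 - e * v 0 0) / 2) = (e *: v) *m K.
  rewrite /equator; congr (_ *m _); apply: row3P; rewrite !mxE /= ?v2 ?mulr0 //; first by field.
  have -> : (1 - e * v 0 0) / 2 * (1 - (1 - e * v 0 0) / 2) = (e * v 0 1 / 2) ^+ 2.
    rewrite !exprMn e1 mul1r -(addrK (v 0 0 ^+ 2) (v 0 1 ^+ 2)) [_ + v 0 0 ^+ 2]addrC v1.
    transitivity ((1 - e ^+ 2 * v 0 0 ^+ 2) / 4); first by field.
    by rewrite e1; field.
  by rewrite sqrtr_sqr ger0_norm ?divr_ge0 //; field.
rewrite E /e; case: ifP => _; apply/orP.
  by left; rewrite inE scale1r.
by right; rewrite inE scaleN1r mulNmx.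
Qed.

End ConeEllipsoid.

(** * The cone *)

Section Cone.
Context {R : realType}.

Lemma unit_of_net_free Q (K A : 'M[R]_3) (c : 'rV[R]_3 -> 'rV[R]_3) : K \in unitmx ->
  net_free Q -> (exists y0, forall v, net_map Q (v *m K) = c v *m A + y0 *m A) -> A \in unitmx.
Proof.
move=> uK fQ [y0 cA]; rewrite -unitmx_tr; apply: mulmx_inj_unitmx => v; apply: contra => /eqP vA.
have Av : A *m v^T = 0 by rewrite -[LHS]trmxK trmx_mul trmxK vA trmx0.
rewrite -[v]trmxK (fQ v^T) ?trmx0 // => u.
by have [w ->] := coordsP uK u; rewrite cA -mulmxDl -mulmxA Av mulmx0.
Qed.

Lemma affine_polar Q (K A : 'M[R]_3) (c : 'rV[R]_3 -> 'rV[R]_3) (y0 : 'rV[R]_3) :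
  (forall v, net_map Q (v *m K) = c v *m A + y0 *m A) ->
  forall v w, pnet Q (v *m K) (w *m K) = (c (v + w) - c v - c w - y0) *m A.
Proof.
move=> cA v w; have := net_mapD Q (v *m K) (w *m K); rewrite -mulmxDl !cA !mulmxBl.
move: (pnet _ _ _) (c (v + w) *m A) (c v *m A) (c w *m A) (y0 *m A) => p a b d e /rowP E.
by apply/rowP => j; have := E j; rewrite !mxE => h; lra.
Qed.

Variables (Q : @net R) (K : 'M[R]_3).
Hypotheses (KK : K *m K^T = 1%:M) (fQ : net_free Q).
Hypotheses (h2 : net_map Q (row 2 K) = 0) (p02 : pnet Q (row 0 K) (row 2 K) = 0)
  (p12 : pnet Q (row 1 K) (row 2 K) = 0).
Local Notation F := (net_map Q).

(** The complex square of [x + i y], followed by its modulus. On the sphere the last entry is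
    [1 - z ^+ 2], so it runs from 1 on the equator, the base, to 0 at the poles, the vertex. *)
Definition cone_map (v : 'rV[R]_3) : 'rV[R]_3 :=
  row3 (v 0 0 ^+ 2 - v 0 1 ^+ 2) (2 * (v 0 0 * v 0 1)) (v 0 0 ^+ 2 + v 0 1 ^+ 2).

Definition cone_mx : 'M[R]_3 := rows3 (2^-1 *: (F (row 0 K) - F (row 1 K)))
  (2^-1 *: pnet Q (row 0 K) (row 1 K)) (2^-1 *: (F (row 0 K) + F (row 1 K))).

Lemma cone_mapE v : F (v *m K) = cone_map v *m cone_mx.
Proof.
rewrite {1}[v]row3_eta net_row3 h2 p02 p12 row3_mul.
have [-> -> ->] := row_rows3 (2^-1 *: (F (row 0 K) - F (row 1 K)))
  (2^-1 *: pnet Q (row 0 K) (row 1 K)) (2^-1 *: (F (row 0 K) + F (row 1 K))).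
move: (F _) (F _) (pnet _ _ _) => a b c.
by apply/rowP => j; rewrite !mxE; field.
Qed.

Theorem cone_surface_of_basis : cone_surface F.
Proof.
have [uK dK] := orthonormal_rows KK.
have cA v : F (v *m K) = cone_map v *m cone_mx + 0 *m cone_mx.
  by rewrite mul0mx addr0 cone_mapE.
have uA : cone_mx \in unitmx by apply: (unit_of_net_free uK fQ (c := cone_map)); exists 0.
have pE v w : pnet Q (v *m K) (w *m K) = row3 (2 * (v 0 0 * w 0 0 - v 0 1 * w 0 1))
    (2 * (v 0 0 * w 0 1 + v 0 1 * w 0 0)) (2 * (v 0 0 * w 0 0 + v 0 1 * w 0 1)) *m cone_mx.
  rewrite (affine_polar cA); congr (_ *m _); apply: row3P; rewrite !mxE /=; ring.
have [ccc cpts] := equator_pts KK.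
have sE v : sphere (v *m K) <-> v 0 0 ^+ 2 + v 0 1 ^+ 2 + v 0 2 ^+ 2 = 1.
  by rewrite /sphere /= dK dotE -!expr2.
have affK (y z : 'rV[R]_3) : y *m cone_mx + 0 = z *m cone_mx -> y = z.
  by rewrite addr0 => /(mulK_inj uA).
have baseE v : sphere (v *m K) -> [set y *m cone_mx + 0 | y in [set y : 'rV[R]_3 |
    y 0 0 ^+ 2 + y 0 1 ^+ 2 = 1 /\ y 0 2 = 1]] (F (v *m K)) <-> v 0 2 = 0.
  move=> /sE sv; rewrite cone_mapE; split=> [[y [_ y2] /affK E]|v2].
    move: y2; rewrite E !mxE /= => y2; apply/eqP; rewrite -sqrf_eq0; apply/eqP; lra.
  exists (cone_map v); last by rewrite addr0.
  rewrite v2 expr0n addr0 in sv; split; rewrite !mxE //=.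
  by transitivity ((v 0 0 ^+ 2 + v 0 1 ^+ 2) ^+ 2); [ring|rewrite sv expr1n].
exists cone_mx, 0; split => //.
- apply/seteqP; split=> y.
    move=> [u su <-]; have [v uE] := coordsP uK u; subst u; move/sE: su => sv.
    exists (cone_map v); last by rewrite addr0 cone_mapE.
    rewrite /= !mxE /=; split; first by ring.
    have := sqr_ge0 (v 0 0); have := sqr_ge0 (v 0 1); have := sqr_ge0 (v 0 2); lra.
  move=> [z [z01 /andP[z0 z2]] <-].
  have le0 : - z 0 2 <= z 0 0 <= z 0 2.
    by have := sqr_ge0 (z 0 1) => h; apply/andP; split; nra.
  (* Half-angle formulas; the sign [e] below takes care of the sign of [z 0 1]. *)
  pose a := Num.sqrt ((z 0 2 + z 0 0) / 2); pose b := Num.sqrt ((z 0 2 - z 0 0) / 2).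
  have aE : a ^+ 2 = (z 0 2 + z 0 0) / 2 by rewrite sqr_sqrtr //; lra.
  have bE : b ^+ 2 = (z 0 2 - z 0 0) / 2 by rewrite sqr_sqrtr //; lra.
  have [e [e1 eE]] : exists e : R, e ^+ 2 = 1 /\ z 0 1 = 2 * (a * (e * b)).
    have : z 0 1 ^+ 2 = (2 * (a * b)) ^+ 2.
      by rewrite !exprMn aE bE; transitivity (z 0 2 ^+ 2 - z 0 0 ^+ 2); [rewrite -z01; ring|field].
    case/sqr_cases => ->; [exists 1|exists (-1)]; rewrite ?sqrrN expr1n; split => //; ring.
  pose v := row3 a (e * b) (Num.sqrt (1 - z 0 2)).
  have sv : sphere (v *m K).
    by apply/sE; rewrite !mxE /= exprMn e1 aE bE sqr_sqrtr ?subr_ge0 //; field.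
  exists (v *m K) => //; rewrite cone_mapE addr0; congr (_ *m _).
  apply: row3P; rewrite !mxE /=.
  - by rewrite exprMn e1 aE bE; field.
  - by rewrite eE.
  - by rewrite exprMn e1 aE bE; field.
- exists (equator K) => //; apply/seteqP; split=> u; have [v uE] := coordsP uK u; subst u.
    by move=> [sv /(baseE v sv) v2]; apply/cpts; split=> //; rewrite -dK.
  move=> /cpts[v1 v2]; have sv : sphere (v *m K) by rewrite /sphere /= dK.
  by split=> //; apply/baseE.
- exists (row 2 K).
  have [_ _ r2] := rowsK K.
  have s2 : sphere (row 2 K) by rewrite r2; apply/sE; rewrite !mxE /=; ring.
  apply/seteqP; split=> u.
    move=> [su]; have [v uE] := coordsP uK u; subst u; rewrite cone_mapE -(mul0mx _ cone_mx).
    move=> /(mulK_inj uA)/rowP/(_ 2); rewrite !mxE /= => /eqP.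
    rewrite paddr_eq0 ?sqr_ge0 // !sqrf_eq0 => /andP[/eqP v0 /eqP v1].
    move/sE: su; rewrite v0 v1 expr0n !add0r -[X in _ = X](expr1n _ 2) => /sqr_cases v2.
    apply/pmP; rewrite !inE r2 -mulNmx [v]row3_eta v0 v1; case: v2 => ->; [left|right]; apply/eqP => //.
    by congr (_ *m _); apply: row3P; rewrite !mxE /= ?oppr0 ?opprK.
  move=> /pmP[]; rewrite inE => /eqP; first by move=> ->; split.
  move=> /(congr1 -%R); rewrite opprK => ->.
  by split; [exact: sphereN|rewrite net_mapN].
- move=> u; have [v uE] := coordsP uK u; subst u => sv; rewrite baseE //.
  have tE w : tangent (v *m K) (w *m K) <-> v 0 0 * w 0 0 + v 0 1 * w 0 1 + v 0 2 * w 0 2 = 0.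
    by rewrite /tangent /= dK dotE.
  have singE w : w != 0 -> tangent (v *m K) (w *m K) -> pnet Q (v *m K) (w *m K) = 0 ->
      singular_at F (v *m K).
    move=> w0 tw E; move=> /(_ _ tw (mulK_neq0 uK w0)); rewrite derive_net E eqxx //.
  split.
    move=> sing; apply: contrapT => /not_orP[v2 Fv]; apply: sing => w.
    have [w' ->] := coordsP uK w => /tE tw; apply: contra; rewrite derive_net pE => /eqP.
    rewrite -(mul0mx _ cone_mx) => /(mulK_inj uA)/rowP E.
    have := E 0; have := E 1; have := E 2; rewrite !mxE /= => E2 E1 E0.
    have r0 : 0 < v 0 0 ^+ 2 + v 0 1 ^+ 2.
      rewrite lt_neqAle addr_ge0 ?sqr_ge0 // andbT eq_sym; apply/eqP => h; apply: Fv.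
      rewrite cone_mapE -(mul0mx _ cone_mx); congr (_ *m _).
      move/eqP: h; rewrite paddr_eq0 ?sqr_ge0 // !sqrf_eq0 => /andP[/eqP v0 /eqP v1].
      by apply: row3P; rewrite !mxE /= v0 v1; ring.
    have A0 : v 0 0 * w' 0 0 = 0 by lra.
    have A1 : v 0 1 * w' 0 1 = 0 by lra.
    have w0 : w' 0 0 = 0.
      apply: (mulfI (lt0r_neq0 r0)); rewrite mulr0.
      transitivity (v 0 0 * (v 0 0 * w' 0 0) + v 0 1 * (v 0 0 * w' 0 1 + v 0 1 * w' 0 0)
        - v 0 0 * (v 0 1 * w' 0 1)); first by ring.
      have -> : v 0 0 * w' 0 1 + v 0 1 * w' 0 0 = 0 by lra.
      by rewrite A0 A1; ring.
    have w1 : w' 0 1 = 0.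
      apply: (mulfI (lt0r_neq0 r0)); rewrite mulr0.
      transitivity (v 0 1 * (v 0 1 * w' 0 1) + v 0 0 * (v 0 0 * w' 0 1 + v 0 1 * w' 0 0)
        - v 0 1 * (v 0 0 * w' 0 0)); first by ring.
      have -> : v 0 0 * w' 0 1 + v 0 1 * w' 0 0 = 0 by lra.
      by rewrite A0 A1; ring.
    have w2 : w' 0 2 = 0.
      by apply: (mulfI (negbT (introF eqP v2))); move: tw; rewrite w0 w1; lra.
    have -> : w' = 0 by apply: row3P; rewrite [RHS]mxE.
    by rewrite !mul0mx.
  case=> [v2|].
    apply: (singE (row3 0 0 1)); first by rewrite row3_neq0 // oner_eq0 !orbT.
      by apply/tE; rewrite !mxE /= v2; ring.
    by rewrite pE -(mul0mx _ cone_mx); congr (_ *m _); apply: row3P; rewrite !mxE /=; ring.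
  rewrite cone_mapE -(mul0mx _ cone_mx) => /(mulK_inj uA)/rowP/(_ 2); rewrite !mxE /= => /eqP.
  rewrite paddr_eq0 ?sqr_ge0 // !sqrf_eq0 => /andP[/eqP v0 /eqP v1].
  apply: (singE (row3 1 0 0)); first by rewrite row3_neq0 // oner_eq0.
    by apply/tE; rewrite !mxE /= v0; ring.
  by rewrite pE -(mul0mx _ cone_mx); congr (_ *m _); apply: row3P; rewrite !mxE /= v0 v1; ring.
Qed.

End Cone.

(** * The ellipsoid *)

Section Ellipsoid.
Context {R : realType}.
Variables (Q : @net R) (K : 'M[R]_3).
Hypotheses (KK : K *m K^T = 1%:M) (fQ : net_free Q).
Hypotheses (h0 : net_map Q (row 0 K) = 0) (h1 : net_map Q (row 1 K) = 0)
  (p01 : pnet Q (row 0 K) (row 1 K) = 0).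
Local Notation F := (net_map Q).

(** With [n] the third basis vector this is [u |-> 2 (u . n) u - n], which maps the unit sphere onto
    itself and collapses the equator to [- n]. *)
Definition ell_map (v : 'rV[R]_3) : 'rV[R]_3 :=
  row3 (2 * (v 0 0 * v 0 2)) (2 * (v 0 1 * v 0 2)) (2 * v 0 2 ^+ 2 - 1).

Definition ell_mx : 'M[R]_3 := rows3 (2^-1 *: pnet Q (row 0 K) (row 2 K))
  (2^-1 *: pnet Q (row 1 K) (row 2 K)) (2^-1 *: F (row 2 K)).

Lemma ell_mapE v : F (v *m K) = ell_map v *m ell_mx + row3 0 0 1 *m ell_mx.
Proof.
rewrite {1}[v]row3_eta net_row3 h0 h1 p01 !row3_mul.
have [-> -> ->] := row_rows3 (2^-1 *: pnet Q (row 0 K) (row 2 K))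
  (2^-1 *: pnet Q (row 1 K) (row 2 K)) (2^-1 *: F (row 2 K)).
move: (F _) (pnet _ _ _) (pnet _ _ _) => a b c.
by apply/rowP => j; rewrite !mxE; field.
Qed.

(** The net vanishes on the equatorial plane, so the frame can be rotated about its third vector
    until the given point becomes the first one; there the system is [modelI]. *)
Lemma ell_not_fd v : sphere (v *m K) -> v 0 2 = 0 -> ~ finitely_determined_at F (v *m K).
Proof.
have [uK dK] := orthonormal_rows KK.
move=> sv v2; have v1 : v 0 0 ^+ 2 + v 0 1 ^+ 2 = 1.
  by move: sv; rewrite /sphere /= dK dotE v2 mulr0 addr0 -!expr2.
pose P := rows3 (row3 (v 0 0) (v 0 1) 0) (row3 (- v 0 1) (v 0 0) 0) (row3 0 0 1).
have uP : P \in unitmx.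
  by apply: unitmx_row3; rewrite [X in X != 0](_ : _ = 1) ?oner_eq0 // -[RHS]v1; ring.
pose K' := P *m K; have uK' : K' \in unitmx by rewrite unitmx_mul uP.
have r2 : dot (row 2 K) (row 2 K) = 1 by have [_ _ ->] := rowsK K; rewrite dK dotE !mxE /=; ring.
have k0 : row 0 K != 0.
  by have [-> _ _] := rowsK K; rewrite mulK_neq0 // row3_neq0 // oner_eq0.
have Qf := hat_free_of_zero fQ k0 h0.
pose G (w : 'rV[R]_3) := row4 (w 0 0 * w 0 2) (w 0 1 * w 0 2) (w 0 2 ^+ 2)
  (w 0 0 ^+ 2 + w 0 1 ^+ 2 + w 0 2 ^+ 2).
have hE w : hat Q (w *m K') = G w *m rows4 (phat Q (row 0 K') (row 2 K'))
    (phat Q (row 1 K') (row 2 K')) (hat Q (row 2 K') - hat Q (row 0 K')) (hat Q (row 0 K')).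
  have kE i : row i K' = row i P *m K by rewrite row_mul.
  have [P0 P1 P2] := row_rows3 (row3 (v 0 0) (v 0 1) 0) (row3 (- v 0 1) (v 0 0) 0) (row3 0 0 1).
  have hz (u : 'rV[R]_3) : u 0 2 = 0 -> hat Q (u *m K) = row4 0 0 0 (dot u u).
    move=> u2; apply: rowmaxP => [k|]; last by rewrite hat_max dK mxE.
    rewrite hat_lift [u]row3_eta u2 net_row3 h0 h1 p01 expr0n !mulr0 !scale0r !scaler0 !addr0.
    by rewrite mxE; move: k; apply: ord3E; rewrite mxE.
  have e01 : hat Q (row 1 K') = hat Q (row 0 K').
    rewrite !kE P0 P1 !hz ?mxE //; congr row4; rewrite !dotE !mxE /=; ring.
  have f01 : phat Q (row 0 K') (row 1 K') = 0.
    have := hatD Q (row 0 K') (row 1 K'); rewrite e01 !kE P0 P1 -mulmxDl !hz ?mxE ?addr0 //.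
    have aux (p q s : 'rV[R]_4) : s = p + q + p -> q = s - p - p.
      by move=> ->; rewrite addrAC addrK [p + q]addrC addrK.
    move/aux => ->.
    apply: row4P; rewrite !mxE /= ?subr0 //; rewrite !dotE !mxE /=; ring.
  rewrite {1}[w]row3_eta hat_row3 e01 f01 rows4_mul.
  move: (hat Q (row 0 K')) (hat Q (row 2 K')) (phat Q (row 0 K') (row 2 K')) (phat Q _ _).
  by move=> p q r s; apply/rowP => j; rewrite !mxE; ring.
have uM := unit_of_hat_free uK' Qf hE.
have hA x : hat Q (aff K' x) = modelI x *m rows4 (phat Q (row 0 K') (row 2 K'))
    (phat Q (row 1 K') (row 2 K')) (hat Q (row 2 K') - hat Q (row 0 K')) (hat Q (row 0 K')).
  by rewrite /aff hE /G /modelI; congr (_ *m _); apply: row4P; rewrite !mxE //= ?mul1r ?expr1n.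
have uE : v *m K = 1 *: row 0 K'.
  by rewrite scale1r row_mul rowK /= [in LHS](row3_eta v) v2.
by have [] := not_finitely_determined_at_model uK' uM (oner_neq0 R) uE hA smooth_modelI
  modelI_nontransversal modelI_perturbation.
Qed.

Theorem ellipsoid_surface_of_basis : ellipsoid_surface F.
Proof.
have [uK dK] := orthonormal_rows KK.
have uA : ell_mx \in unitmx.
  by apply: (unit_of_net_free uK fQ (c := ell_map)); exists (row3 0 0 1) => v; exact: ell_mapE.
have pE v w : pnet Q (v *m K) (w *m K) = row3 (2 * (v 0 0 * w 0 2 + v 0 2 * w 0 0))
    (2 * (v 0 1 * w 0 2 + v 0 2 * w 0 1)) (4 * (v 0 2 * w 0 2)) *m ell_mx.
  rewrite (affine_polar ell_mapE); congr (_ *m _); apply: row3P; rewrite !mxE /=; ring.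
have [ccc cpts] := equator_pts KK.
have sE v : sphere (v *m K) <-> v 0 0 ^+ 2 + v 0 1 ^+ 2 + v 0 2 ^+ 2 = 1.
  by rewrite /sphere /= dK dotE -!expr2.
have sing v : sphere (v *m K) -> singular_at F (v *m K) <-> v 0 2 = 0.
  move=> /sE sv; have tE w : tangent (v *m K) (w *m K) <->
      v 0 0 * w 0 0 + v 0 1 * w 0 1 + v 0 2 * w 0 2 = 0 by rewrite /tangent /= dK dotE.
  split=> [sing|v2].
    apply/eqP/contraT => v2; exfalso; apply: sing => w.
    have [w' ->] := coordsP uK w => _; apply: contra; rewrite derive_net pE => /eqP.
    rewrite -(mul0mx _ ell_mx) => /(mulK_inj uA)/rowP E.
    have := E 0; have := E 1; have := E 2; rewrite !mxE /= => E2 E1 E0.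
    have w2 : w' 0 2 = 0 by apply: (mulfI v2); lra.
    rewrite w2 in E1 E0.
    have -> : w' = 0 by apply: row3P; rewrite [RHS]mxE //; apply: (mulfI v2); lra.
    by rewrite !mul0mx.
  rewrite v2 expr0n addr0 in sv.
  have w0 : row3 (- v 0 1) (v 0 0) 0 != 0.
    apply/eqP => /rowP E; have := E 0; have := E 1; rewrite !mxE /= => e0 e1.
    have e1' : v 0 1 = 0 by lra.
    by move/eqP: sv; rewrite e0 e1' expr0n addr0 eq_sym oner_eq0.
  have tw : tangent (v *m K) (row3 (- v 0 1) (v 0 0) 0 *m K).
    by apply/tE; rewrite !mxE /= v2; ring.
  move=> /(_ _ tw (mulK_neq0 uK w0)); rewrite derive_net pE.
  rewrite (_ : row3 _ _ _ = 0) ?mul0mx ?eqxx //.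
  by apply: row3P; rewrite !mxE /= v2; ring.
have ptsE u : closed_curve_pts (equator K) u <-> sphere u /\ singular_at F u.
  have [v ->] := coordsP uK u; rewrite cpts; split=> [[v1 v2]|[sv /sing v2]].
    have sv : sphere (v *m K) by rewrite /sphere /= dK.
    by split=> //; apply/sing.
  by split; [rewrite -dK|exact: v2].
exists ell_mx, (row3 0 0 1 *m ell_mx), (equator K); split => //.
- apply/seteqP; split=> y.
    move=> [u su <-]; have [v uE] := coordsP uK u; subst u; move/sE: su => sv.
    exists (ell_map v); last by rewrite ell_mapE.
    rewrite /sphere /= dotE !mxE /=.
    transitivity (4 * v 0 2 ^+ 2 * (v 0 0 ^+ 2 + v 0 1 ^+ 2 + v 0 2 ^+ 2 - 1) + 1); first by ring.
    by rewrite sv subrr mulr0 add0r.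
  move=> [z]; rewrite /sphere /= dotE -!expr2 => z1 <-.
  have s0 := sqr_ge0 (z 0 0); have s1 := sqr_ge0 (z 0 1).
  have z2 : - 1 <= z 0 2 by nra.
  have [z2'|z2'] := eqVneq (z 0 2) (- 1).
    rewrite z2' sqrrN expr1n in z1.
    have z00 : z 0 0 = 0 by apply/eqP; rewrite -sqrf_eq0; apply/eqP; lra.
    have z01 : z 0 1 = 0 by apply/eqP; rewrite -sqrf_eq0; apply/eqP; lra.
    exists (row3 1 0 0 *m K); first by apply/sE; rewrite !mxE /=; ring.
    rewrite ell_mapE; congr (_ *m _ + _).
    by apply: row3P; rewrite !mxE /= ?z2' ?z00 ?z01; ring.
  have c0 : 0 < (1 + z 0 2) / 2.
    by rewrite divr_gt0 // lt_neqAle eq_sym addrC addr_eq0 z2' -lerBlDr sub0r.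
  (* [c] is the cosine of half the angle between [z] and the third axis; this inverts [ell_map] away
     from the collapsed point. *)
  pose c := Num.sqrt ((1 + z 0 2) / 2).
  have c1 : c != 0 by rewrite lt0r_neq0 // sqrtr_gt0.
  have cE : c ^+ 2 = (1 + z 0 2) / 2 by rewrite sqr_sqrtr // ltW.
  exists (row3 (z 0 0 / (2 * c)) (z 0 1 / (2 * c)) c *m K).
    apply/sE; rewrite !mxE /=; apply: (mulIf (mulf_neq0 c1 c1)).
    transitivity ((z 0 0 ^+ 2 + z 0 1 ^+ 2) / 4 + (c ^+ 2) ^+ 2); first by field.
    rewrite mul1r -expr2 cE (_ : z 0 0 ^+ 2 + z 0 1 ^+ 2 = 1 - z 0 2 ^+ 2); last by lra.
    by field.
  rewrite ell_mapE; congr (_ *m _ + _).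
  by apply: row3P; rewrite !mxE /= ?cE; field.
- by apply/seteqP; split=> u /ptsE.
- move=> u uc; have /ptsE[su ss] := uc; split=> //.
  by move: uc; have [v ->] := coordsP uK u; move=> /cpts[v1 v2]; apply: ell_not_fd; rewrite // /sphere /= dK.
Qed.

End Ellipsoid.

(** * Symmetric matrices and the frame attached to a root *)

Section Pencil.
Context {R : realType}.

(** Rows of length six are regarded as dual to quadratic forms: [ver u] becomes the matrix
    [u^T *m u], and no factor 1/2 appears off the diagonal. *)
Definition symm (e : 'rV[R]_6) : 'M[R]_3 := rows3 (row3 (e 0 0) (e 0 5) (e 0 4))
  (row3 (e 0 5) (e 0 1) (e 0 3)) (row3 (e 0 4) (e 0 3) (e 0 2)).

Lemma ord6E (P : 'I_6 -> Prop) : P 0 -> P 1 -> P 2 -> P 3 -> P 4 -> P 5 -> forall j, P j.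
Proof.
move=> P0 P1 P2 P3 P4 P5 [[|[|[|[|[|[|//]]]]]] i].
- by have -> : Ordinal i = 0 by exact: val_inj.
- by have -> : Ordinal i = 1 by exact: val_inj.
- by have -> : Ordinal i = 2 by exact: val_inj.
- by have -> : Ordinal i = 3 by exact: val_inj.
- by have -> : Ordinal i = 4 by exact: val_inj.
- by have -> : Ordinal i = 5 by exact: val_inj.
Qed.

Lemma mx3P (A B : 'M[R]_3) : (forall i, [/\ A i 0 = B i 0, A i 1 = B i 1 & A i 2 = B i 2]) -> A = B.
Proof. by move=> H; apply/matrixP => i j; have [E0 E1 E2] := H i; move: j; apply: ord3E. Qed.

Lemma symm_inj (e f : 'rV[R]_6) : symm e = symm f -> e = f.
Proof.
move=> E; have H i j : symm e i j = symm f i j by rewrite E.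
apply/rowP; apply: ord6E.
- by have := H 0 0; rewrite !mxE.
- by have := H 1 1; rewrite !mxE.
- by have := H 2 2; rewrite !mxE.
- by have := H 1 2; rewrite !mxE.
- by have := H 0 2; rewrite !mxE.
- by have := H 0 1; rewrite !mxE.
Qed.

Definition row6 (a b c d e f : R) : 'rV[R]_6 := \row_(i < 6) [:: a; b; c; d; e; f]`_i.

Lemma symm_surj (A : 'M[R]_3) : A^T = A ->
  A = symm (row6 (A 0 0) (A 1 1) (A 2 2) (A 1 2) (A 0 2) (A 0 1)).
Proof.
move=> AT; have H i j : A i j = A j i by rewrite -{1}AT mxE.
by apply: mx3P; apply: ord3E; split; rewrite !mxE //= !mxE //=.
Qed.

Lemma symm_linear (s t : R) (e f : 'rV[R]_6) : symm (s *: e + t *: f) = s *: symm e + t *: symm f.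
Proof. by apply: mx3P; apply: ord3E; split; rewrite !mxE /= ?mxE /=. Qed.

Lemma det3 (A : 'M[R]_3) : \det A = A 0 0 * (A 1 1 * A 2 2 - A 1 2 * A 2 1)
  - A 0 1 * (A 1 0 * A 2 2 - A 1 2 * A 2 0) + A 0 2 * (A 1 0 * A 2 1 - A 1 1 * A 2 0).
Proof.
rewrite (expand_det_row _ 0) sum3E /cofactor !(expand_det_row _ 0) !big_ord_recl !big_ord0.
rewrite /cofactor !det_mx11 !mxE /=.
have e0 : lift (0 : 'I_3) (0 : 'I_2) = 1 by exact: val_inj.
have e1 : lift (0 : 'I_3) (1 : 'I_2) = 2 by exact: val_inj.
have e2 : lift (1 : 'I_3) (0 : 'I_2) = 0 by exact: val_inj.
have e3 : lift (1 : 'I_3) (1 : 'I_2) = 2 by exact: val_inj.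
have e4 : lift (2 : 'I_3) (0 : 'I_2) = 0 by exact: val_inj.
have e5 : lift (2 : 'I_3) (1 : 'I_2) = 1 by exact: val_inj.
have f0 : lift (0 : 'I_2) (0 : 'I_1) = 1 by exact: val_inj.
have f1 : lift (1 : 'I_2) (0 : 'I_1) = 0 by exact: val_inj.
rewrite !f0 !f1 !e0 !e1 !e2 !e3 !e4 !e5 /=; ring.
Qed.

Definition dets (e : 'rV[R]_6) : R := e 0 0 * e 0 1 * e 0 2 + 2 * (e 0 3 * e 0 4 * e 0 5)
  - e 0 0 * e 0 3 ^+ 2 - e 0 1 * e 0 4 ^+ 2 - e 0 2 * e 0 5 ^+ 2.

Lemma det_symm e : \det (symm e) = dets e.
Proof. by rewrite det3 !mxE /= ?mxE /= /dets; ring. Qed.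

(** The congruence by [K] in six coordinates, as [symm_act] shows: [x] holds the coordinates of
    [act K x] with respect to the products of the rows of [K]. *)
Definition act (K : 'M[R]_3) (x : 'rV[R]_6) : 'rV[R]_6 :=
  x 0 0 *: ver (row 0 K) + x 0 1 *: ver (row 1 K) + x 0 2 *: ver (row 2 K) +
  x 0 3 *: pver (row 1 K) (row 2 K) + x 0 4 *: pver (row 0 K) (row 2 K) +
  x 0 5 *: pver (row 0 K) (row 1 K).

Lemma symm_ver u i j : symm (ver u) i j = u 0 i * u 0 j.
Proof. by move: i j; apply: ord3E; apply: ord3E; rewrite !mxE /= ?mxE /=; ring. Qed.

Lemma symm_pver u w i j : symm (pver u w) i j = u 0 i * w 0 j + w 0 i * u 0 j.
Proof. by move: i j; apply: ord3E; apply: ord3E; rewrite !mxE /= ?mxE /=; ring. Qed.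

Lemma symmD e f i j : symm (e + f) i j = symm e i j + symm f i j.
Proof. by have := symm_linear 1 1 e f; rewrite !scale1r => ->; rewrite mxE. Qed.

Lemma symmZ s e i j : symm (s *: e) i j = s * symm e i j.
Proof. by have := symm_linear s 0 e 0; rewrite !scale0r !addr0 => ->; rewrite mxE. Qed.

Lemma symm_act K x : symm (act K x) = K^T *m symm x *m K.
Proof.
apply/matrixP => i j; rewrite /act !symmD !symmZ !symm_ver !symm_pver.
have -> : (K^T *m symm x *m K) i j = \sum_k (\sum_l K l i * symm x l k) * K k j.
  by rewrite mxE; apply: eq_bigr => k _; rewrite mxE; congr (_ * _); apply: eq_bigr => l _; rewrite mxE.
have rE k l : row k K 0 l = K k l by rewrite mxE.
rewrite !rE !sum3E !mxE /= ?mxE /=.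
move: (K 0 i) (K 1 i) (K 2 i) (K 0 j) (K 1 j) (K 2 j) => a b c a' b' c'.
by ring.
Qed.

Lemma act_hatm Q K x : act K x *m hatm Q =
  x 0 0 *: hat Q (row 0 K) + x 0 1 *: hat Q (row 1 K) + x 0 2 *: hat Q (row 2 K) +
  x 0 3 *: phat Q (row 1 K) (row 2 K) + x 0 4 *: phat Q (row 0 K) (row 2 K) +
  x 0 5 *: phat Q (row 0 K) (row 1 K).
Proof. by rewrite /act !mulmxDl -!scalemxAl. Qed.

Lemma det_act K x : \det (symm (act K x)) = \det K ^+ 2 * dets x.
Proof. by rewrite symm_act !det_mulmx det_tr det_symm; ring. Qed.

Lemma act_surj K e : K \in unitmx -> exists x, e = act K x.
Proof.
move=> uK; pose A := (invmx K)^T *m symm e *m invmx K.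
have sT f : (symm f)^T = symm f by apply: mx3P; apply: ord3E; split; rewrite !mxE /= ?mxE.
have AT : A^T = A by rewrite /A !trmx_mul trmxK sT mulmxA.
exists (row6 (A 0 0) (A 1 1) (A 2 2) (A 1 2) (A 0 2) (A 0 1)).
apply: symm_inj; rewrite symm_act -symm_surj // /A !mulmxA -trmx_mul.
by rewrite mulmxKV // mulVmx // trmx1 mul1mx.
Qed.

(** In an orthonormal basis whose last vector spans a direction of the kernel, only a block of size
    2 is left, and its trace is still 0. Such a block is indefinite, so it splits into a product of
    two real vectors. *)
Lemma root_frame (e : 'rV[R]_6) : e != 0 -> e 0 0 + e 0 1 + e 0 2 = 0 -> \det (symm e) = 0 ->
  exists2 K : 'M[R]_3, K \in unitmx & e = pver (row 0 K) (row 1 K).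
Proof.
move=> e0 tr /eqP/det0P[n n0 nE].
have [K [KK r2 _]] := orthonormal_extension n0; have [uK dK] := orthonormal_rows KK.
have [x xE] := act_surj e uK.
have [c c0 nc] := normalizeE n0.
have Kx : row 2 (symm x) = 0.
  have : n *m symm e *m K^T = 0 by rewrite nE mul0mx.
  rewrite xE symm_act mulmxA mulmxA -mulmxA KK mulmx1.
  have -> : n = c^-1 *: (row 2 1%:M *m K).
    by rewrite -row_mul mul1mx r2 nc scalerA mulVf // scale1r.
  rewrite -!scalemxAl -(mulmxA _ K) KK mulmx1 -row_mul mul1mx => /eqP.
  by rewrite scaler_eq0 invr_eq0 (negbTE c0) => /eqP.
have [x2 x3 x4] : [/\ x 0 2 = 0, x 0 3 = 0 & x 0 4 = 0].
  move/rowP: Kx => E; have := E 0; have := E 1; have := E 2; rewrite !mxE /= ?mxE /=.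
  by move=> -> -> ->.
have tE : e 0 0 + e 0 1 + e 0 2 = x 0 0 + x 0 1.
  have vt (u : 'rV[R]_3) : ver u 0 0 + ver u 0 1 + ver u 0 2 = dot u u by rewrite dotE !mxE /=; ring.
  have pt (u w : 'rV[R]_3) : pver u w 0 0 + pver u w 0 1 + pver u w 0 2 = 2 * dot u w.
    by rewrite dotE !mxE /=; ring.
  have [r0' r1' _] := rowsK K.
  have d0 : dot (row 0 K) (row 0 K) = 1 by rewrite r0' dK dotE !mxE /=; ring.
  have d1 : dot (row 1 K) (row 1 K) = 1 by rewrite r1' dK dotE !mxE /=; ring.
  have d01 : dot (row 0 K) (row 1 K) = 0 by rewrite r0' r1' dK dotE !mxE /=; ring.
  move: (vt (row 0 K)) (vt (row 1 K)) (pt (row 0 K) (row 1 K)); rewrite d0 d1 d01.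
  rewrite xE /act x2 x3 x4 !scale0r !addr0.
  move: (ver _) (ver _) (pver _ _) => q p r hp hq hr; rewrite !mxE.
  transitivity (x 0 0 * (p 0 0 + p 0 1 + p 0 2) + x 0 1 * (q 0 0 + q 0 1 + q 0 2) +
    x 0 5 * (r 0 0 + r 0 1 + r 0 2)); first by ring.
  by rewrite hp hq hr; ring.
rewrite tr in tE; pose p := x 0 0; pose q := x 0 5.
have x1 : x 0 1 = - p by rewrite /p; lra.
have eE : e = p *: ver (row 0 K) - p *: ver (row 1 K) + q *: pver (row 0 K) (row 1 K).
  by rewrite xE /act x1 x2 x3 x4 !scale0r !addr0 scaleNr.
have [p0|p0] := eqVneq p 0.
  have q0 : q != 0 by apply: contra e0 => /eqP q0; rewrite eE p0 q0 !scale0r subrr addr0.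
  have [q0' q1' q2'] := row_rows3 (q *: row 0 K) (row 1 K) (row 2 K).
  exists (rows3 (q *: row 0 K) (row 1 K) (row 2 K)); last first.
    by rewrite q0' q1' eE p0 !scale0r subrr add0r [in RHS]pverC pverZr pverC.
  apply: (rows3_unit uK (P := rows3 (row3 q 0 0) (row3 0 1 0) (row3 0 0 1))).
    by apply: unitmx_row3; rewrite [X in X != 0](_ : _ = q) //; ring.
  have [r0' r1' r2'] := rowsK K.
  by split; rewrite [in RHS]rowK //= r0' row3_mulZ mulr1 mulr0.
pose r := Num.sqrt (p ^+ 2 + q ^+ 2).
have pos : 0 < p ^+ 2 + q ^+ 2 by apply: ltr_pwDl; rewrite ?sqr_ge0 // exprn_even_gt0.
have r0 : r != 0 by rewrite lt0r_neq0 // sqrtr_gt0.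
have rE : r ^+ 2 = p ^+ 2 + q ^+ 2 by rewrite sqr_sqrtr // ltW.
(* Factorisation of the block with entries [p], [q], [- p]: the numbers [q + r] and [q - r] have
   product [- p ^+ 2] and sum [2 * q]. *)
pose a := p *: row 0 K + (q + r) *: row 1 K.
pose b := (2 * p)^-1 *: (p *: row 0 K + (q - r) *: row 1 K).
have [q0' q1' q2'] := row_rows3 a b (row 2 K).
exists (rows3 a b (row 2 K)).
  apply: (rows3_unit uK (P := rows3 (row3 p (q + r) 0)
    (row3 ((2 * p)^-1 * p) ((2 * p)^-1 * (q - r)) 0) (row3 0 0 1))).
    apply: unitmx_row3; rewrite [X in X != 0](_ : _ = - r); last by field.
    by rewrite oppr_eq0.
  split; rewrite [in RHS]rowK /= row3_mul ?scale0r ?scale1r ?add0r ?addr0 //.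
  by rewrite /b scalerDr !scalerA.
rewrite q0' q1' eE /a /b pverZr pverDr !pverZr ![pver (_ + _) _]pverC !pverDr !pverZr.
rewrite (pverC (row 1 K)) !pver_diag !scalerDr !scalerA.
move: (ver _) (ver _) (pver _ _) => B A C; apply/rowP => j; rewrite !mxE.
have E : (q + r) * (q - r) = - p ^+ 2.
  by transitivity (q ^+ 2 - r ^+ 2); [ring|rewrite rE; ring].
transitivity (p * A 0 j + (2 * p)^-1 * ((q + r) * (q - r)) * 2 * B 0 j + q * C 0 j); last by field.
by rewrite E; field.
Qed.

End Pencil.

(** * From the binary cubic to the type of surface *)

Section PencilSurfaces.
Context {R : realType}.

Definition pencil (Q : @net R) (e f : 'rV[R]_6) (c3 c2 c1 c0 : R) :=
  [/\ e *m hatm Q = 0, f *m hatm Q = 0,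
      forall s t : R, s *: e + t *: f = 0 -> s = 0 /\ t = 0 &
      forall s t, dets (s *: e + t *: f) =
        c3 * s ^+ 3 + c2 * s ^+ 2 * t + c1 * s * t ^+ 2 + c0 * t ^+ 3].

Definition disc (c3 c2 c1 c0 : R) := c2 ^+ 2 * c1 ^+ 2 - 4 * c3 * c1 ^+ 3 - 4 * c2 ^+ 3 * c0
  - 27 * c3 ^+ 2 * c0 ^+ 2 + 18 * c3 * c2 * c1 * c0.

(** Vanishing of the Hessian covariant, coefficient by coefficient: the cubic is a multiple of the
    cube of a linear form, possibly zero. *)
Definition hess0 (c3 c2 c1 c0 : R) :=
  [/\ c2 ^+ 2 - 3 * c3 * c1 = 0, c2 * c1 - 9 * c3 * c0 = 0 & c1 ^+ 2 - 3 * c2 * c0 = 0].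

(** A substitution of determinant 1, so that the discriminant is unchanged. The new leading
    coefficient is the value of the cubic at [r]; it vanishes when [r] is a root. *)
Lemma pencil_move Q e f c3 c2 c1 c0 r : pencil Q e f c3 c2 c1 c0 ->
  pencil Q (r *: e + f) (- e) (c3 * r ^+ 3 + c2 * r ^+ 2 + c1 * r + c0)
    (- (3 * c3 * r ^+ 2 + 2 * c2 * r + c1)) (3 * c3 * r + c2) (- c3).
Proof.
move=> [eh fh ind cE].
have E s t : s *: (r *: e + f) + t *: (- e) = (r * s - t) *: e + s *: f.
  by apply/rowP => j; rewrite !mxE; ring.
split.
- by rewrite mulmxDl -scalemxAl eh fh scaler0 addr0.
- by rewrite mulNmx eh oppr0.
- by move=> s t; rewrite E => /ind[h s0]; split=> //; move: h; rewrite s0; lra.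
- by move=> s t; rewrite E cE; ring.
Qed.

Lemma disc_move c3 c2 c1 c0 r :
  disc (c3 * r ^+ 3 + c2 * r ^+ 2 + c1 * r + c0)
    (- (3 * c3 * r ^+ 2 + 2 * c2 * r + c1)) (3 * c3 * r + c2) (- c3) = disc c3 c2 c1 c0.
Proof. by rewrite /disc; ring. Qed.

Lemma hess0_move c3 c2 c1 c0 r :
  hess0 (c3 * r ^+ 3 + c2 * r ^+ 2 + c1 * r + c0)
    (- (3 * c3 * r ^+ 2 + 2 * c2 * r + c1)) (3 * c3 * r + c2) (- c3) <-> hess0 c3 c2 c1 c0.
Proof.
have E1 : (- (3 * c3 * r ^+ 2 + 2 * c2 * r + c1)) ^+ 2 -
    3 * (c3 * r ^+ 3 + c2 * r ^+ 2 + c1 * r + c0) * (3 * c3 * r + c2) =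
    (c2 ^+ 2 - 3 * c3 * c1) * r ^+ 2 + (c2 * c1 - 9 * c3 * c0) * r + (c1 ^+ 2 - 3 * c2 * c0).
  by ring.
have E2 : - (3 * c3 * r ^+ 2 + 2 * c2 * r + c1) * (3 * c3 * r + c2) -
    9 * (c3 * r ^+ 3 + c2 * r ^+ 2 + c1 * r + c0) * - c3 =
    - (2 * (c2 ^+ 2 - 3 * c3 * c1) * r + (c2 * c1 - 9 * c3 * c0)) by ring.
have E3 : (3 * c3 * r + c2) ^+ 2 - 3 * - (3 * c3 * r ^+ 2 + 2 * c2 * r + c1) * - c3 =
    c2 ^+ 2 - 3 * c3 * c1 by ring.
rewrite /hess0 E1 E2 E3; move: (c2 ^+ 2 - 3 * c3 * c1) (c2 * c1 - _) (c1 ^+ 2 - _) => A B C.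
split=> -[]; last by move=> -> -> ->; split; ring.
move=> h1 h2 A0; have B0 : B = 0 by move: h2; rewrite A0; lra.
by split=> //; move: h1; rewrite A0 B0; lra.
Qed.

(** Intermediate value theorem on [[- M, M]], with [M] equal to 1 plus the absolute values of the
    normalised coefficients, so that the cubic term dominates at both ends. *)
Lemma real_cubic_root (c3 c2 c1 c0 : R) : c3 != 0 ->
  exists r, c3 * r ^+ 3 + c2 * r ^+ 2 + c1 * r + c0 = 0.
Proof.
move=> c30; pose b := c2 / c3; pose c := c1 / c3; pose d := c0 / c3.
pose p : {poly R} := 'X^3 + b *: 'X^2 + c *: 'X + d%:P.
have pE x : p.[x] = x ^+ 3 + b * x ^+ 2 + c * x + d by rewrite /p !hornerE.
pose M := 1 + `|b| + `|c| + `|d|.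
have [nb nc nd] : [/\ 0 <= `|b|, 0 <= `|c| & 0 <= `|d|] by split; exact: normr_ge0.
have M1 : 1 <= M by rewrite /M; lra.
have MM : M <= M ^+ 2 by rewrite expr2 ler_peMl //; lra.
have bd (x y z : R) : `|x| <= z -> - z <= x <= z by rewrite ler_norml.
have hb : `|b * M ^+ 2| <= `|b| * M ^+ 2 by rewrite normrM (ger0_norm (sqr_ge0 M)).
have hc : `|c * M| <= `|c| * M ^+ 2.
  by rewrite normrM ler_wpM2l // ger0_norm //; lra.
have hd : `|d| <= `|d| * M ^+ 2 by rewrite ler_peMr //; lra.
move: hb hc hd; rewrite !ler_norml => /andP[hb1 hb2] /andP[hc1 hc2] /andP[hd1 hd2].
have M3 : M ^+ 3 = M ^+ 2 + `|b| * M ^+ 2 + `|c| * M ^+ 2 + `|d| * M ^+ 2.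
  by rewrite exprS {1}/M; ring.
have [||x _ /rootP] := @poly_ivt R p (- M) M; first by lra.
  by rewrite !pE sqrrN; apply/andP; split; [rewrite exprNn -signr_odd /= mulN1r|]; lra.
rewrite pE => E; exists x.
have := congr1 ( *%R c3) E; rewrite mulr0 => <-; rewrite /b /c /d; field.
by [].
Qed.

(** One move makes the first form a root. If it is double but not triple, that is [d2 = 0] and
    [d1 != 0], a second move goes to the remaining root [- d0 / d1], which is simple. So [d2 = 0] is
    left only for a triple root or the zero cubic. *)
Lemma pencil_root Q e f c3 c2 c1 c0 : pencil Q e f c3 c2 c1 c0 ->
  exists e' f' d2 d1 d0, [/\ pencil Q e' f' 0 d2 d1 d0, disc 0 d2 d1 d0 = disc c3 c2 c1 c0,
    hess0 0 d2 d1 d0 <-> hess0 c3 c2 c1 c0 & d2 = 0 -> d1 = 0 /\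
      ([|| c3 != 0, c2 != 0, c1 != 0 | c0 != 0] -> d0 != 0)].
Proof.
move=> P; have [e' [f' [d2 [d1 [d0 [P' D H N]]]]]] : exists e' f' d2 d1 d0,
    [/\ pencil Q e' f' 0 d2 d1 d0, disc 0 d2 d1 d0 = disc c3 c2 c1 c0,
    hess0 0 d2 d1 d0 <-> hess0 c3 c2 c1 c0 &
    [|| c3 != 0, c2 != 0, c1 != 0 | c0 != 0] -> [|| d2 != 0, d1 != 0 | d0 != 0]].
  have [c30|c30] := eqVneq c3 0.
    by rewrite c30 in P *; exists e, f, c2, c1, c0.
  have [r rE] := real_cubic_root c2 c1 c0 c30.
  have := pencil_move r P; have := disc_move c3 c2 c1 c0 r; have := hess0_move c3 c2 c1 c0 r.
  rewrite rE => H D P'; exists (r *: e + f), (- e), (- (3 * c3 * r ^+ 2 + 2 * c2 * r + c1)),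
    (3 * c3 * r + c2), (- c3); split => //.
  by move=> _; rewrite [- c3 == 0]oppr_eq0 c30 !orbT.
have [d20|d20] := eqVneq d2 0; last first.
  by exists e', f', d2, d1, d0; split=> // d2'; rewrite d2' eqxx in d20.
have [d10|d10] := eqVneq d1 0.
  exists e', f', d2, d1, d0; split=> // _; split=> // /N.
  by rewrite d20 d10 eqxx.
have rE : 0 * (- d0 / d1) ^+ 3 + d2 * (- d0 / d1) ^+ 2 + d1 * (- d0 / d1) + d0 = 0.
  by rewrite d20; field.
have := pencil_move (- d0 / d1) P'; have := disc_move 0 d2 d1 d0 (- d0 / d1).
have := hess0_move 0 d2 d1 d0 (- d0 / d1); rewrite rE => H2 D2 P2.
exists ((- d0 / d1) *: e' + f'), (- e'),
  (- (3 * 0 * (- d0 / d1) ^+ 2 + 2 * d2 * (- d0 / d1) + d1)), (3 * 0 * (- d0 / d1) + d2), (- 0).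
split=> //.
- by rewrite D2.
- by rewrite H2.
- by rewrite d20 !(mul0r, mulr0, add0r) => /eqP; rewrite oppr_eq0 (negbTE d10).
Qed.

(** In the frame of the root, adding a multiple of [e] only shifts the coordinate [x 0 5], in which
    [dets] is quadratic; the coefficients of the cubic are read off from that. *)
Lemma pencil_frame Q e f c2 c1 c0 : pencil Q e f 0 c2 c1 c0 ->
  exists (K : 'M[R]_3) (x : 'rV[R]_6), [/\ K \in unitmx, phat Q (row 0 K) (row 1 K) = 0,
    f = act K x & [/\ c2 = - (\det K ^+ 2 * x 0 2),
    c1 = \det K ^+ 2 * (2 * (x 0 3 * x 0 4) - 2 * (x 0 2 * x 0 5)) &
    c0 = \det K ^+ 2 * dets x]].
Proof.
move=> [eh fh ind cE].
have e0 : e != 0.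
  apply/eqP => e0; have [] := ind 1 0; first by rewrite e0 scaler0 scale0r addr0.
  by move/eqP; rewrite oner_eq0.
have tr : e 0 0 + e 0 1 + e 0 2 = 0.
  by have := mul_hatm_max Q e; rewrite eh mxE.
have d0 : \det (symm e) = 0.
  have := cE 1 0; rewrite scale1r scale0r addr0 det_symm => ->; ring.
have [K uK eE] := root_frame e0 tr d0.
have [x fE] := act_surj f uK.
exists K, x; split => //; first by rewrite /phat -eE.
have E s t : dets (s *: e + t *: f) = \det K ^+ 2 * dets (row6 (t * x 0 0) (t * x 0 1)
    (t * x 0 2) (t * x 0 3) (t * x 0 4) (s + t * x 0 5)).
  rewrite -det_act -det_symm; congr (\det (symm _)).
  rewrite eE fE /act !mxE /=.
  move: (ver _) (ver _) (ver _) (pver _ _) (pver _ _) (pver _ _) => a1 a2 a3 a4 a5 a6.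
  by apply/rowP => j; rewrite !mxE; ring.
have := cE 1 1; have := cE 1 (- 1); have := cE 0 1; rewrite !E /dets !mxE /=.
move: (\det K) (x 0 0) (x 0 1) (x 0 2) (x 0 3) (x 0 4) (x 0 5) => k x0 x1 x2 x3 x4 x5 h1 h2 h3.
by split; lra.
Qed.

(** Simplicity of the root means [x 0 2 != 0], so the relation given by [f] can be solved for [hat]
    of row 2. Completing the square, with [c] in place of row 2, removes the mixed terms; [al] and
    [be] are principal minors of [symm x] divided by [x 0 2 ^+ 2]. *)
Lemma pencil_simple Q e f c2 c1 c0 : pencil Q e f 0 c2 c1 c0 -> c2 != 0 ->
  exists (K : 'M[R]_3) (al be mu : R), [/\ K \in unitmx, phat Q (row 0 K) (row 1 K) = 0,
    hat Q (row 2 K) = - al *: hat Q (row 0 K) - be *: hat Q (row 1 K), 0 < mu &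
    disc 0 c2 c1 c0 = mu * (al * be)].
Proof.
move=> P c20; have [K [x [uK p01 fE [c2E c1E c0E]]]] := pencil_frame P.
have [_ fh _ _] := P.
have x2 : x 0 2 != 0 by apply: contra c20 => /eqP h; rewrite c2E h mulr0 oppr0.
have k0 : \det K != 0 by rewrite -unitfE -unitmxE.
pose c := row 2 K + (x 0 4 / x 0 2) *: row 0 K + (x 0 3 / x 0 2) *: row 1 K.
exists (rows3 (row 0 K) (row 1 K) c), ((x 0 0 * x 0 2 - x 0 4 ^+ 2) / x 0 2 ^+ 2),
  ((x 0 1 * x 0 2 - x 0 3 ^+ 2) / x 0 2 ^+ 2), (4 * (\det K) ^+ 8 * x 0 2 ^+ 6).
have [-> -> ->] := row_rows3 (row 0 K) (row 1 K) c.
split=> //.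
- apply: (rows3_unit uK (P := rows3 (row3 1 0 0) (row3 0 1 0) (row3 (x 0 4 / x 0 2) (x 0 3 / x 0 2) 1))).
    by apply: unitmx_row3; rewrite [X in X != 0](_ : _ = 1) ?oner_eq0 //; ring.
  have [r0 r1 r2] := rowsK K.
  split; rewrite [in RHS]rowK //= row3_mul scale1r /c.
  by rewrite -addrA addrC.
- move: fh; rewrite fE act_hatm p01 scaler0 addr0 => /rowP E.
  rewrite /c hatD phatZr phatDl phatZl p01 scaler0 addr0 hatD phatZr !hatZ.
  rewrite (phatC _ (row 2 K) (row 0 K)) (phatC _ (row 2 K) (row 1 K)).
  apply/rowP => j; have := E j; move: (hat _ _) (hat _ _) (hat _ _) (phat _ _ _) (phat _ _ _).
  move=> a1 a2 a3 a4 a5 {E}; rewrite !mxE => E.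
  apply: (mulfI x2); apply/eqP; rewrite -subr_eq0; apply/eqP; rewrite -[RHS]E; field.
  by [].
- by apply: mulr_gt0; [apply: mulr_gt0; rewrite ?exprn_even_gt0|rewrite exprn_even_gt0].
- by rewrite /disc c2E c1E c0E /dets; field.
Qed.

Lemma norm_relation Q (a b c : 'rV[R]_3) al be :
  hat Q c = - al *: hat Q a - be *: hat Q b -> dot c c = - al * dot a a - be * dot b b.
Proof.
by move=> h; rewrite -!(hat_max Q) h; move: (hat Q a) (hat Q b) => p q; rewrite !mxE mulNr.
Qed.

(** The relation makes [- al] a quotient of squared norms, hence positive. With [r] its square root,
    [r *: row 0 K + row 2 K] and [r *: row 0 K - row 2 K] are conjugate, and [row 1 K] is conjugate
    to their sum. *)
Lemma simple_type5 Q (K : 'M[R]_3) al : hat_free Q -> K \in unitmx ->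
  phat Q (row 0 K) (row 1 K) = 0 -> hat Q (row 2 K) = - al *: hat Q (row 0 K) ->
  type5_surface (net_map Q).
Proof.
move=> Qf uK p01 h2.
have [r0 r1 r2] := rowsK K.
have k0 : row 0 K != 0 by rewrite r0 mulK_neq0 // row3_neq0 // oner_eq0.
have k2 : row 2 K != 0 by rewrite r2 mulK_neq0 // row3_neq0 // oner_eq0 !orbT.
have al0 : 0 < - al.
  have : dot (row 2 K) (row 2 K) = - al * dot (row 0 K) (row 0 K).
    by rewrite -!(hat_max Q) h2; move: (hat Q (row 0 K)) => p; rewrite !mxE.
  have := dot_gt0 k2 => + E; rewrite E pmulr_lgt0 //; exact: dot_gt0.
pose r := Num.sqrt (- al); have rE : r ^+ 2 = - al by rewrite sqr_sqrtr // ltW.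
have r_neq0 : r != 0 by rewrite lt0r_neq0 // sqrtr_gt0.
have [q0 q1 q2] := row_rows3 (r *: row 0 K + row 2 K) (r *: row 0 K - row 2 K) (row 1 K).
apply: (@type5_surface_of_basis _ _ (rows3 (r *: row 0 K + row 2 K) (r *: row 0 K - row 2 K) (row 1 K))) => //.
- apply: (rows3_unit uK (P := rows3 (row3 r 0 1) (row3 r 0 (-1)) (row3 0 1 0))).
    apply: unitmx_row3; rewrite [X in X != 0](_ : _ = 2 * r); last by ring.
    by rewrite mulf_neq0 // pnatr_eq0.
  by split; rewrite [in RHS]rowK //= row3_mul ?scale1r ?scale0r ?addr0 ?scaleN1r.
- rewrite q0 q1 phatDl !phatDr -scaleN1r !phatZr !phatZl ?phatZr !phat_diag h2.
  rewrite (phatC _ (row 2 K)) !scalerA -rE; move: (hat _ _) (phat _ _ _) => p q.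
  by apply/rowP => j; rewrite !mxE; ring.
- rewrite q0 q1 q2 !phatDl -scaleN1r !phatZl p01 scaler0 !add0r.
  by rewrite scaleN1r subrr.
Qed.

(** If [al] and [be] were both positive, [row 2 K] would have a negative squared norm; so
    [0 < al * be] forces both to be negative. Then [r *: row 0 K + s *: row 1 K], the same with
    [- s], and [row 2 K] have equal [hat], which is Steiner's normal form. *)
Lemma simple_surface Q (K : 'M[R]_3) al be : hat_free Q -> K \in unitmx ->
  phat Q (row 0 K) (row 1 K) = 0 ->
  hat Q (row 2 K) = - al *: hat Q (row 0 K) - be *: hat Q (row 1 K) ->
  [/\ al * be < 0 -> cross_cap_surface (net_map Q),
      0 < al * be -> roman_steiner_surface (net_map Q) &
      al * be = 0 -> type5_surface (net_map Q)].
Proof.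
move=> Qf uK p01 h2.
have [r0 r1 r2] := rowsK K.
have k0 : row 0 K != 0 by rewrite r0 mulK_neq0 // row3_neq0 // oner_eq0.
have k1 : row 1 K != 0 by rewrite r1 mulK_neq0 // row3_neq0 // oner_eq0 orbT.
have k2 : row 2 K != 0 by rewrite r2 mulK_neq0 // row3_neq0 // oner_eq0 !orbT.
have [q0 q1 q2] := row_rows3 (row 1 K) (row 0 K) (row 2 K).
have uK' : rows3 (row 1 K) (row 0 K) (row 2 K) \in unitmx.
  apply: (rows3_unit uK (P := rows3 (row3 0 1 0) (row3 1 0 0) (row3 0 0 1))).
    by apply: unitmx_row3; rewrite [X in X != 0](_ : _ = - 1) ?oppr_eq0 ?oner_eq0 //; ring.
  by split; rewrite [in RHS]rowK /=; [exact: r1|exact: r0|exact: r2].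
split.
- move=> ab; have [al0|al0] := ltP al 0.
    by apply: (cross_cap_surface_of_basis uK Qf p01 h2) => //; rewrite -(nmulr_llt0 _ al0) mulrC.
  have be0 : be < 0.
    by rewrite ltNge; apply/negP => be0; have := mulr_ge0 al0 be0; rewrite leNgt ab.
  apply: (@cross_cap_surface_of_basis _ _ (rows3 (row 1 K) (row 0 K) (row 2 K)) be al) => //.
  + by rewrite q0 q1 phatC.
  + by rewrite q0 q1 q2 h2 !scaleNr addrC.
  + by rewrite -(nmulr_llt0 _ be0).
- move=> ab.
  have [al0 be0] : al < 0 /\ be < 0.
    have [al0|al0] := ltP al 0; first by split=> //; rewrite -(nmulr_rgt0 _ al0).
    exfalso; have al0' : 0 < al.
      by rewrite lt_neqAle al0 andbT eq_sym; apply: contraTneq ab => ->; rewrite mul0r ltxx.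
    have be0 : 0 < be by rewrite -(pmulr_rgt0 _ al0').
    have := norm_relation h2; have := dot_gt0 k2.
    have := mulr_gt0 al0' (dot_gt0 k0); have := mulr_gt0 be0 (dot_gt0 k1); lra.
  pose r := Num.sqrt (- al); have rE : r ^+ 2 = - al by rewrite sqr_sqrtr // oppr_ge0 ltW.
  pose s := Num.sqrt (- be); have sE : s ^+ 2 = - be by rewrite sqr_sqrtr // oppr_ge0 ltW.
  have r_neq0 : r != 0 by rewrite lt0r_neq0 // sqrtr_gt0 oppr_gt0.
  have s_neq0 : s != 0 by rewrite lt0r_neq0 // sqrtr_gt0 oppr_gt0.
  pose a := r *: row 0 K + s *: row 1 K; pose b := r *: row 0 K + (- s) *: row 1 K.
  have [p0 p1 p2] := row_rows3 a b (row 2 K).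
  have H : forall i, hat Q (row i (rows3 a b (row 2 K))) = hat Q (row 2 K).
    apply: ord3E; rewrite ?p0 ?p1 ?p2 // /a /b hatD phatZl phatZr p01 !scaler0 addr0 !hatZ ?sqrrN;
    by rewrite rE sE h2 !scaleNr.
  apply: (@roman_surface_of_basis _ _ (rows3 a b (row 2 K))) => //.
    apply: (rows3_unit uK (P := rows3 (row3 r s 0) (row3 r (- s) 0) (row3 0 0 1))).
      apply: unitmx_row3; rewrite [X in X != 0](_ : _ = - (2 * (r * s))); last by ring.
      by rewrite oppr_eq0 !mulf_neq0 // pnatr_eq0.
    by split; rewrite [in RHS]rowK //= row3_mul ?scale1r ?scale0r ?addr0.
  by move=> i j; rewrite !H.
- move/eqP; rewrite mulf_eq0 => /orP[] /eqP h.
    apply: (@simple_type5 _ (rows3 (row 1 K) (row 0 K) (row 2 K)) be) => //.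
      by rewrite q0 q1 phatC.
    by rewrite q0 q2 h2 h oppr0 scale0r add0r scaleNr.
  by apply: (@simple_type5 _ K al) => //; rewrite h2 h scale0r subr0.
Qed.

Lemma type6_of_relation Q (K : 'M[R]_3) x0 x1 x4 : hat_free Q -> K \in unitmx ->
  phat Q (row 0 K) (row 1 K) = 0 -> x1 != 0 -> x4 != 0 ->
  x0 *: hat Q (row 0 K) + x1 *: hat Q (row 1 K) + x4 *: phat Q (row 0 K) (row 2 K) = 0 ->
  type6_surface (net_map Q).
Proof.
move=> Qf uK p01 x1_0 x4_0 E.
pose z := x1^-1 *: (x4 *: row 2 K + (x0 / 2) *: row 0 K).
have [q0 q1 q2] := row_rows3 z (row 1 K) (row 0 K).
apply: (@type6_surface_of_basis _ _ (rows3 z (row 1 K) (row 0 K))) => //.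
- apply: (rows3_unit uK (P := rows3 (row3 (x1^-1 * (x0 / 2)) 0 (x1^-1 * x4)) (row3 0 1 0) (row3 1 0 0))).
    apply: unitmx_row3; rewrite [X in X != 0](_ : _ = - (x1^-1 * x4)); last by ring.
    by rewrite oppr_eq0 mulf_neq0 // invr_eq0.
  split; rewrite [in RHS]rowK //= row3_mul ?scale1r ?scale0r ?addr0 ?add0r //.
  by rewrite /z scalerDr !scalerA addrC.
- by rewrite q1 q2 phatC.
- rewrite q0 q1 q2 /z phatZl phatDl !phatZl phat_diag (phatC _ (row 2 K)).
  move: E; move: (hat _ _) (hat _ _) (phat _ _ _) => a b c /rowP E.
  apply/rowP => j; have := E j; rewrite !mxE => h; apply: (mulfI x1_0).
  apply/eqP; rewrite -subr_eq0; apply/eqP; rewrite -[RHS]h; field.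
  by [].
Qed.

(** Here [x 0 2] and [x 0 3 * x 0 4] vanish, so up to exchange of rows 0 and 1 the relation contains
    one mixed term only; [c0 != 0] keeps its coefficient and that of the relevant square away from
    0. *)
Lemma pencil_triple Q e f c0 : hat_free Q -> pencil Q e f 0 0 0 c0 -> c0 != 0 ->
  type6_surface (net_map Q).
Proof.
move=> Qf P c0_0; have [K [x [uK p01 fE [c2E c1E c0E]]]] := pencil_frame P.
have [_ fh _ _] := P.
have k0 : \det K ^+ 2 != 0 by rewrite sqrf_eq0 -unitfE -unitmxE.
have x2 : x 0 2 = 0 by apply: (mulfI k0); rewrite mulr0; lra.
have x34 : x 0 3 * x 0 4 = 0.
  by apply: (mulfI k0); move: c1E; rewrite x2 mul0r !mulr0 subr0; lra.
move: fh; rewrite fE act_hatm p01 x2 scale0r scaler0 !addr0.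
move: c0_0; rewrite c0E mulf_eq0 (negbTE k0) /= /dets x2.
move/eqP: x34; rewrite mulf_eq0 => /orP[] /eqP h; rewrite h.
  move=> D E; apply: (@type6_of_relation _ K (x 0 0) (x 0 1) (x 0 4)) => //.
  - by apply: contraNneq D => ->; apply/eqP; ring.
  - by apply: contraNneq D => ->; apply/eqP; ring.
  - by rewrite scale0r addr0 in E.
have [q0 q1 q2] := row_rows3 (row 1 K) (row 0 K) (row 2 K).
have [r0 r1 r2] := rowsK K.
move=> D E; apply: (@type6_of_relation _ (rows3 (row 1 K) (row 0 K) (row 2 K)) (x 0 1) (x 0 0) (x 0 3)) => //.
- apply: (rows3_unit uK (P := rows3 (row3 0 1 0) (row3 1 0 0) (row3 0 0 1))).
    by apply: unitmx_row3; rewrite [X in X != 0](_ : _ = - 1) ?oppr_eq0 ?oner_eq0 //; ring.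
  by split; rewrite [in RHS]rowK /=; [exact: r1|exact: r0|exact: r2].
- by rewrite q0 q1 phatC.
- by apply: contraNneq D => ->; apply/eqP; ring.
- by apply: contraNneq D => ->; apply/eqP; ring.
- by rewrite q0 q1 q2; rewrite scale0r addr0 [X in X + _]addrC in E.
Qed.

Theorem surface_of_pencil Q e f c3 c2 c1 c0 : hat_free Q -> pencil Q e f c3 c2 c1 c0 ->
  [/\ disc c3 c2 c1 c0 < 0 -> cross_cap_surface (net_map Q),
      0 < disc c3 c2 c1 c0 -> roman_steiner_surface (net_map Q),
      disc c3 c2 c1 c0 = 0 -> ~ hess0 c3 c2 c1 c0 -> type5_surface (net_map Q) &
      hess0 c3 c2 c1 c0 -> [|| c3 != 0, c2 != 0, c1 != 0 | c0 != 0] ->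
        type6_surface (net_map Q)].
Proof.
move=> Qf P.
have [e' [f' [d2 [d1 [d0 [P' D H d21]]]]]] := pencil_root P; rewrite -D.
have [d20|d20] := eqVneq d2 0.
  have [d10 d00] := d21 d20; have Z : disc 0 d2 d1 d0 = 0 by rewrite /disc d20 d10; ring.
  have Hz : hess0 0 d2 d1 d0 by rewrite /hess0 d20 d10; split; ring.
  rewrite Z ltxx; split=> //; first by move=> _ []; apply/H.
  by move=> _ /d00 d0_0; rewrite d20 d10 in P'; exact: (pencil_triple Qf P').
have [K [al [be [mu [uK p01 h2 mu0 DE]]]]] := pencil_simple P' d20.
have [S1 S2 S3] := simple_surface Qf uK p01 h2.
rewrite DE; split.
- by rewrite pmulr_rlt0.
- by rewrite pmulr_rgt0.
- by move/eqP; rewrite mulf_eq0 (gt_eqF mu0) => /eqP/S3.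
- move/H => -[+ _ _]; rewrite mulr0 mul0r subr0 => /eqP.
  by rewrite sqrf_eq0 (negbTE d20).
Qed.

End PencilSurfaces.

(** * Classes of functions closed under ring operations *)

Section Closure.
Context {R : realType}.
Variables (X : Type) (C : (X -> R) -> Prop).
Hypotheses (Ccst : forall a, C (fun=> a)) (CD : forall f g, C f -> C g -> C (fun x => f x + g x))
  (CM : forall f g, C f -> C g -> C (fun x => f x * g x)).

Lemma closed_ext f g : f =1 g -> C f -> C g.
Proof. by move=> /funext ->. Qed.

Lemma closedN f : C f -> C (fun x => - f x).
Proof. by move=> Cf; apply: (closed_ext _ (CM (Ccst (-1)) Cf)) => x; rewrite mulN1r. Qed.

Lemma closedB f g : C f -> C g -> C (fun x => f x - g x).
Proof. by move=> Cf Cg; apply: CD => //; exact: closedN. Qed.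

Lemma closedX f n : C f -> C (fun x => f x ^+ n).
Proof.
move=> Cf; elim: n => [|n IH]; first exact: Ccst.
by apply: (closed_ext _ (CM Cf IH)) => x; rewrite exprS.
Qed.

Lemma closed_sum (I : Type) (s : seq I) (P : pred I) (f : I -> X -> R) :
  (forall i, C (f i)) -> C (fun x => \sum_(i <- s | P i) f i x).
Proof.
move=> Cf; elim: s => [|i s IH].
  by apply: (closed_ext _ (Ccst 0)) => x; rewrite big_nil.
case Pi: (P i).
  by apply: (closed_ext _ (CD (Cf i) IH)) => x; rewrite big_cons Pi.
by apply: (closed_ext _ IH) => x; rewrite big_cons Pi.
Qed.

Lemma closed_prod (I : Type) (s : seq I) (P : pred I) (f : I -> X -> R) :
  (forall i, C (f i)) -> C (fun x => \prod_(i <- s | P i) f i x).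
Proof.
move=> Cf; elim: s => [|i s IH].
  by apply: (closed_ext _ (Ccst 1)) => x; rewrite big_nil.
case Pi: (P i).
  by apply: (closed_ext _ (CM (Cf i) IH)) => x; rewrite big_cons Pi.
by apply: (closed_ext _ IH) => x; rewrite big_cons Pi.
Qed.

Definition mx_closed m n (A : X -> 'M[R]_(m, n)) := forall i j, C (fun x => A x i j).

Lemma closed_det n (A : X -> 'M[R]_n) : mx_closed A -> C (fun x => \det (A x)).
Proof.
move=> CA; rewrite /determinant; apply: closed_sum => s.
by apply: CM; [exact: Ccst|apply: closed_prod => i; exact: CA].
Qed.

(** The adjugate stands in for the inverse because its entries stay in the class. The two classes of
    interest are the functions continuous at a point and the polynomials in one variable. *)
Lemma closed_adj n (A : X -> 'M[R]_n) : mx_closed A -> mx_closed (fun x => \adj (A x)).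
Proof.
move=> CA i j; apply: (closed_ext (f := fun x => cofactor (A x) j i)).
  by move=> x; rewrite mxE.
apply: CM; first exact: Ccst.
apply: closed_det => k l; apply: (closed_ext (f := fun x => A x (lift j k) (lift i l))).
  by move=> x; rewrite !mxE.
exact: CA.
Qed.

Lemma closed_mulmx m n p (A : X -> 'M[R]_(m, n)) (B : X -> 'M[R]_(n, p)) :
  mx_closed A -> mx_closed B -> mx_closed (fun x => A x *m B x).
Proof.
move=> CA CB i j; apply: (closed_ext (f := fun x => \sum_k A x i k * B x k j)).
  by move=> x; rewrite mxE.
by apply: closed_sum => k; apply: CM; [exact: CA|exact: CB].
Qed.

Lemma closed_dets (e : X -> 'rV[R]_6) : mx_closed e -> C (fun x => dets (e x)).
Proof.
move=> Ce; rewrite /dets.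
by do !(apply: closedB || apply: CD || apply: CM || apply: closedX || exact: Ccst || exact: Ce).
Qed.

End Closure.

(** * Covariants of the cubic of two elements *)

Section Coefficients.
Context {R : realType}.

(** The middle coefficients by interpolation at [(1, 1)] and [(1, -1)]; they are polynomial in the
    entries of [x] and [y]. *)
Definition coef2 (x y : 'rV[R]_6) : R := (dets (x + y) - dets (x - y)) / 2 - dets y.
Definition coef1 (x y : 'rV[R]_6) : R := (dets (x + y) + dets (x - y)) / 2 - dets x.
Definition pdisc x y := disc (dets x) (coef2 x y) (coef1 x y) (dets y).
Definition phess0 x y := hess0 (dets x) (coef2 x y) (coef1 x y) (dets y).

Lemma dets_coefs (x y : 'rV[R]_6) s t : dets (s *: x + t *: y) =
  dets x * s ^+ 3 + coef2 x y * s ^+ 2 * t + coef1 x y * s * t ^+ 2 + dets y * t ^+ 3.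
Proof.
rewrite /coef2 /coef1 /dets !mxE.
move: (x 0 0) (x 0 1) (x 0 2) (x 0 3) (x 0 4) (x 0 5) => a b c d e f.
move: (y 0 0) (y 0 1) (y 0 2) (y 0 3) (y 0 4) (y 0 5) => a' b' c' d' e' f'.
by field.
Qed.

Lemma coefs_of_values (x y : 'rV[R]_6) c3 c2 c1 c0 :
  (forall s t, dets (s *: x + t *: y) =
    c3 * s ^+ 3 + c2 * s ^+ 2 * t + c1 * s * t ^+ 2 + c0 * t ^+ 3) ->
  [/\ dets x = c3, coef2 x y = c2, coef1 x y = c1 & dets y = c0].
Proof.
move=> E; have := E 1 0; have := E 0 1; have := E 1 1; have := E 1 (-1).
rewrite !scale1r !scaleN1r !scale0r addr0 add0r /coef2 /coef1 => h1 h2 h3 h4.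
by rewrite h1 h2 h3 h4; split; field.
Qed.

(** The discriminant of a linear times a quadratic form is that of the quadratic form times the
    square of their resultant. *)
Lemma disc_factor (l l' q2 q1 q0 : R) :
  disc (l * q2) (l * q1 + l' * q2) (l * q0 + l' * q1) (l' * q0) =
  (q1 ^+ 2 - 4 * q2 * q0) * (q2 * l' ^+ 2 - q1 * l * l' + q0 * l ^+ 2) ^+ 2.
Proof. by rewrite /disc; ring. Qed.

Lemma pdisc_factor (x y : 'rV[R]_6) l l' q2 q1 q0 :
  (forall s t, dets (s *: x + t *: y) = (l * s + l' * t) * (q2 * s ^+ 2 + q1 * s * t + q0 * t ^+ 2)) ->
  pdisc x y = (q1 ^+ 2 - 4 * q2 * q0) * (q2 * l' ^+ 2 - q1 * l * l' + q0 * l ^+ 2) ^+ 2.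
Proof.
move=> E; have [h3 h2 h1 h0] : [/\ dets x = l * q2, coef2 x y = l * q1 + l' * q2,
    coef1 x y = l * q0 + l' * q1 & dets y = l' * q0].
  by apply: coefs_of_values => s t; rewrite E; ring.
by rewrite /pdisc h3 h2 h1 h0 disc_factor.
Qed.

(** The discriminant of the Hessian is -3 times that of the cubic. *)
Lemma hess0_disc (c3 c2 c1 c0 : R) : hess0 c3 c2 c1 c0 -> disc c3 c2 c1 c0 = 0.
Proof.
move=> [A B D]; apply: (mulfI (_ : (-3 : R) != 0)); first by rewrite oppr_eq0 pnatr_eq0.
transitivity ((c2 * c1 - 9 * c3 * c0) ^+ 2 -
  4 * (c2 ^+ 2 - 3 * c3 * c1) * (c1 ^+ 2 - 3 * c2 * c0)); first by rewrite /disc; ring.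
by rewrite A B D; ring.
Qed.

(** For proportional elements the cubic is a multiple of a cube. Hence [~ phess0] also certifies
    that two elements are linearly independent, so one condition covers both in the openness and
    density arguments. *)
Lemma phess0_dependent (x y : 'rV[R]_6) s t : s *: x + t *: y = 0 -> (s != 0) || (t != 0) -> phess0 x y.
Proof.
have [s0|s0] := eqVneq s 0; last first.
  move=> E _; have xE : x = (- t / s) *: y.
    apply: (scalerI s0); rewrite scalerA mulrC divfK // scaleNr; apply/eqP.
    by rewrite -addr_eq0 E.
  have dZ a : dets (a *: y) = a ^+ 3 * dets y by rewrite /dets !mxE; ring.
  move: (- t / s) xE => a xE; rewrite /phess0.
  have [-> -> -> _] : [/\ dets x = a ^+ 3 * dets y, coef2 x y = 3 * a ^+ 2 * dets y,
      coef1 x y = 3 * a * dets y & dets y = dets y].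
    apply: coefs_of_values => u v; rewrite xE scalerA -scalerDl dZ; ring.
  by split; ring.
rewrite s0 scale0r add0r /= => /eqP; rewrite scaler_eq0 => /orP[/eqP ->|/eqP -> _]; first by rewrite eqxx.
have d0 : dets (0 : 'rV[R]_6) = 0 by rewrite /dets !mxE; ring.
by rewrite /phess0 /coef2 /coef1 addr0 subr0 d0; split; field.
Qed.

Lemma pencil_of_phess Q e f : e *m hatm Q = 0 -> f *m hatm Q = 0 -> ~ phess0 e f ->
  pencil Q e f (dets e) (coef2 e f) (coef1 e f) (dets f).
Proof.
move=> eh fh H; split=> // [s t E|s t]; last exact: dets_coefs.
apply: contrapT => st; apply: H; apply: (phess0_dependent E).
apply: contraT; rewrite negb_or !negbK => /andP[/eqP s0 /eqP t0]; case: st; by [].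
Qed.

Theorem surface_of_kernel Q e f : hat_free Q -> e *m hatm Q = 0 -> f *m hatm Q = 0 ->
  [/\ pdisc e f < 0 -> cross_cap_surface (net_map Q),
      0 < pdisc e f -> roman_steiner_surface (net_map Q) &
      ~ phess0 e f -> pdisc e f = 0 -> type5_surface (net_map Q)].
Proof.
move=> Qf eh fh; have [h|h] := pselect (phess0 e f).
  by rewrite /pdisc (hess0_disc h) ltxx; split.
have [S1 S2 S3 _] := surface_of_pencil Qf (pencil_of_phess eh fh h).
by split=> // _ D; exact: S3.
Qed.

Lemma scale_coefs (x y : 'rV[R]_6) (e f : 'rV[R]_6) k :
  (forall s t, dets (s *: e + t *: f) = k * dets (s *: x + t *: y)) ->
  pdisc e f = k ^+ 4 * pdisc x y /\ (k != 0 -> (phess0 e f <-> phess0 x y)).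
Proof.
move=> E; have [h3 h2 h1 h0] : [/\ dets e = k * dets x, coef2 e f = k * coef2 x y,
    coef1 e f = k * coef1 x y & dets f = k * dets y].
  by apply: coefs_of_values => s t; rewrite E dets_coefs; ring.
rewrite /pdisc /phess0 h3 h2 h1 h0; split; first by rewrite /disc; ring.
move: (dets x) (coef2 x y) (coef1 x y) (dets y) => a b c d k0.
have K (u v : R) : u = k ^+ 2 * v -> (u = 0 <-> v = 0).
  move=> ->; split=> [/eqP|->]; last by rewrite mulr0.
  by rewrite mulf_eq0 sqrf_eq0 (negbTE k0) => /eqP.
rewrite /hess0; have H1 := K ((k * b) ^+ 2 - 3 * (k * a) * (k * c)) (b ^+ 2 - 3 * a * c).
have H2 := K ((k * b) * (k * c) - 9 * (k * a) * (k * d)) (b * c - 9 * a * d).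
have H3 := K ((k * c) ^+ 2 - 3 * (k * b) * (k * d)) (c ^+ 2 - 3 * b * d).
have A := H1 ltac:(ring); have B := H2 ltac:(ring); have D := H3 ltac:(ring).
by split=> -[/A ? /B ? /D ?]; split.
Qed.

End Coefficients.

(** * Change of frame in six coordinates *)

Section Frames.
Context {R : realType}.

Lemma ver_act (K : 'M[R]_3) v : ver (v *m K) = act K (ver v).
Proof.
have sv (u : 'rV[R]_3) : symm (ver u) = u^T *m u.
  by apply/matrixP => i j; rewrite symm_ver mxE big_ord1 mxE.
by apply: symm_inj; rewrite symm_act !sv trmx_mul !mulmxA.
Qed.

Definition actm (K : 'M[R]_3) : 'M[R]_6 := \matrix_(i < 6) act K (delta_mx 0 i).

Lemma actD (K : 'M[R]_3) x y : act K (x + y) = act K x + act K y.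
Proof.
rewrite /act !mxE.
move: (ver _) (ver _) (ver _) (pver _ _) (pver _ _) (pver _ _) => a1 a2 a3 a4 a5 a6.
by apply/rowP => j; rewrite !mxE; ring.
Qed.

Lemma actZ (K : 'M[R]_3) s x : act K (s *: x) = s *: act K x.
Proof. by rewrite /act !mxE !scalerDr !scalerA. Qed.

Lemma act_mx (K : 'M[R]_3) x : act K x = x *m actm K.
Proof.
rewrite mulmx_sum_row {1}[x]row_sum_delta.
have act0 : act K 0 = 0 by rewrite /act !mxE !scale0r !addr0.
rewrite (big_morph (act K) (actD K) act0); apply: eq_bigr => i _.
by rewrite actZ rowK.
Qed.

Lemma ver_inj n (A B : 'M[R]_(6, n)) : (forall u, ver u *m A = ver u *m B) -> A = B.
Proof.
move=> H; apply/eqP; rewrite -subr_eq0; apply/eqP/matrixP => i j.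
have /colP/(_ i) : col j (A - B) = 0.
  by apply: ver_span => u; rewrite colE mulmxA mulmxBr H subrr mul0mx.
by rewrite !mxE.
Qed.

Definition tr6 (e : 'rV[R]_6) : R := e 0 0 + e 0 1 + e 0 2.

Lemma tr6D (e f : 'rV[R]_6) : tr6 (e + f) = tr6 e + tr6 f.
Proof. by rewrite /tr6 !mxE; ring. Qed.

Lemma tr6Z s (e : 'rV[R]_6) : tr6 (s *: e) = s * tr6 e.
Proof. by rewrite /tr6 !mxE; ring. Qed.

Lemma hatm_eq0 (Q : @net R) e : e *m hatm Q = 0 <-> e *m Q^T = 0 /\ tr6 e = 0.
Proof.
split=> [E|[E t]].
  split; last by have := mul_hatm_max Q e; rewrite E mxE.
  by apply/rowP => k; have := mul_hatm_lift Q e k; rewrite E mxE => <-; rewrite mxE.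
apply: rowmaxP => [k|]; first by rewrite mul_hatm_lift E !mxE.
by rewrite mul_hatm_max mxE; exact: t.
Qed.

Lemma tr6_act (K : 'M[R]_3) x : tr6 (act K x) = x 0 0 * dot (row 0 K) (row 0 K) + x 0 1 * dot (row 1 K) (row 1 K)
  + x 0 2 * dot (row 2 K) (row 2 K) + 2 * (x 0 3 * dot (row 1 K) (row 2 K)
  + x 0 4 * dot (row 0 K) (row 2 K) + x 0 5 * dot (row 0 K) (row 1 K)).
Proof.
have vt (u : 'rV[R]_3) : tr6 (ver u) = dot u u by rewrite /tr6 dotE !mxE /=; ring.
have pt (u w : 'rV[R]_3) : tr6 (pver u w) = 2 * dot u w by rewrite /tr6 dotE !mxE /=; ring.
by rewrite /act !tr6D !tr6Z !vt !pt; ring.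
Qed.

Definition cross (u v : 'rV[R]_3) : 'rV[R]_3 :=
  row3 (u 0 1 * v 0 2 - u 0 2 * v 0 1) (u 0 2 * v 0 0 - u 0 0 * v 0 2) (u 0 0 * v 0 1 - u 0 1 * v 0 0).

Lemma dot_cross (u v : 'rV[R]_3) : dot u (cross u v) = 0.
Proof. by rewrite dotE !mxE /=; ring. Qed.

End Frames.

(** * Normal forms and their annihilators *)

Section NormalForms.
Context {R : realType}.
Implicit Types (o : orbit_type) (g c : R).

Definition nflin o g c (x : 'rV[R]_6) : 'rV[R]_3 :=
  let xx := x 0 0 in let yy := x 0 1 in let zz := x 0 2 in
  let yz := x 0 3 in let xz := x 0 4 in let xy := x 0 5 in
  match o with
  | oAa | oAb | oAc | oAd | oBa | oBc | oBas | oBcs | oC =>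
      row3 (2 * xz + yy) (2 * yz) (- xx - 2 * g * yy + c * zz + 2 * g * xz)
  | oDa => row3 xx yy (zz + 2 * xy)
  | oDb => row3 (xx - yy) (2 * xy) (xx + zz)
  | oDc => row3 (xx - yy) (2 * xy) (xx - zz)
  | oDas => row3 (2 * xz) (2 * yz) (zz + 2 * xy)
  | oDbs => row3 (2 * xz) (2 * yz) (xx + yy - zz)
  | oDcs => row3 (2 * xz) (2 * yz) (xx + yy + zz)
  | oEa => row3 (xx + yy) (2 * xy) zz
  | oEb => row3 (xx - yy) (2 * xy) zz
  | oEas => row3 (xx - yy) (2 * xz) (2 * yz)
  | oEbs => row3 (xx + yy) (2 * xz) (2 * yz)
  | oFa => row3 (xx + yy) (2 * xy) (2 * yz)
  | oFb => row3 (xx - yy) (2 * xy) (2 * yz)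
  | oFas => row3 (xx - yy) (2 * xz) zz
  | oFbs => row3 (xx + yy) (2 * xz) zz
  | oG => row3 xx yy (2 * yz)
  | oGs => row3 (2 * xy) (2 * xz) zz
  | oH => row3 xx (2 * xy) (yy + 2 * xz)
  | oI => row3 xx (2 * xy) yy
  | oIs => row3 (2 * xz) (2 * yz) zz
  end.

Definition nfm o g c : 'M[R]_(6, 3) := \matrix_(i < 6) nflin o g c (delta_mx 0 i).

Lemma nflinE o g c u : normal_form o g c u = nflin o g c (ver u).
Proof. by case: o; apply: row3P; rewrite !mxE /= ?mxE /= ?mulrA. Qed.

Lemma nflinD o g c x y : nflin o g c (x + y) = nflin o g c x + nflin o g c y.
Proof.
rewrite /nflin !mxE; move: (x 0 0) (x 0 1) (x 0 2) (x 0 3) (x 0 4) (x 0 5) => a1 a2 a3 a4 a5 a6.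
move: (y 0 0) (y 0 1) (y 0 2) (y 0 3) (y 0 4) (y 0 5) => b1 b2 b3 b4 b5 b6.
by case: o; apply: row3P; rewrite !mxE /=; ring.
Qed.

Lemma nflinZ o g c s x : nflin o g c (s *: x) = s *: nflin o g c x.
Proof.
rewrite /nflin !mxE; move: (x 0 0) (x 0 1) (x 0 2) (x 0 3) (x 0 4) (x 0 5) => a1 a2 a3 a4 a5 a6.
by case: o; apply: row3P; rewrite !mxE /=; ring.
Qed.

Lemma mul_nfm o g c x : x *m nfm o g c = nflin o g c x.
Proof.
rewrite mulmx_sum_row {2}[x]row_sum_delta.
have n0 : nflin o g c 0 = 0.
  by have := nflinZ o g c 0 0; rewrite scale0r => ->; rewrite scale0r.
rewrite (big_morph (nflin o g c) (nflinD o g c) n0); apply: eq_bigr => i _.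
by rewrite nflinZ rowK.
Qed.

Lemma nf_ver o g c u : normal_form o g c u = ver u *m nfm o g c.
Proof. by rewrite mul_nfm nflinE. Qed.

(** The three-dimensional annihilator of the normal form, with [r] as parameter; by [dual_kills] and
    [dual_complete] it is exactly the kernel of [nflin]. *)
Definition dual o g c (r : 'rV[R]_3) : 'rV[R]_6 :=
  let a := r 0 0 in let b := r 0 1 in let d := r 0 2 in
  match o with
  | oAa | oAb | oAc | oAd | oBa | oBc | oBas | oBcs | oC =>
      row6 (6 * g * a + c * d) (- 2 * a) d 0 a b
  | oDa => row6 0 0 (- 2 * a) b d a
  | oDb => row6 a a (- a) b d 0
  | oDc => row6 a a a b d 0
  | oDas => row6 a b (- 2 * d) 0 0 d
  | oDbs => row6 a b (a + b) 0 0 d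
  | oDcs => row6 a b (- (a + b)) 0 0 d
  | oEa => row6 a (- a) 0 b d 0
  | oEb => row6 a a 0 b d 0
  | oEas => row6 a a b 0 0 d
  | oEbs => row6 a (- a) b 0 0 d
  | oFa => row6 a (- a) b 0 d 0
  | oFb => row6 a a b 0 d 0
  | oFas => row6 a a 0 b 0 d
  | oFbs => row6 a (- a) 0 b 0 d
  | oG => row6 0 0 a 0 b d
  | oGs => row6 a b 0 d 0 0
  | oH => row6 0 (- 2 * a) b d a 0
  | oI => row6 0 0 a b d 0
  | oIs => row6 a b 0 0 0 d
  end.

Lemma dual_linear o g c s t r r' :
  dual o g c (s *: r + t *: r') = s *: dual o g c r + t *: dual o g c r'.
Proof. rewrite /dual !mxE; move: (r 0 0) (r 0 1) (r 0 2) (r' 0 0) (r' 0 1) (r' 0 2) => a b d a' b' d'.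
by case: o; apply/rowP; apply: ord6E; rewrite !mxE /=; ring. Qed.

Lemma dual_kills o g c r : nflin o g c (dual o g c r) = 0.
Proof.
rewrite /dual; move: (r 0 0) (r 0 1) (r 0 2) => a b d.
by case: o => /=; apply: row3P; rewrite !mxE /= ?mxE /=; ring.
Qed.

Definition dual_coord o (x : 'rV[R]_6) : 'rV[R]_3 :=
  match o with
  | oAa | oAb | oAc | oAd | oBa | oBc | oBas | oBcs | oC => row3 (x 0 4) (x 0 5) (x 0 2)
  | oDa => row3 (x 0 5) (x 0 3) (x 0 4)
  | oDb | oDc | oEa | oEb => row3 (x 0 0) (x 0 3) (x 0 4)
  | oDas | oDbs | oDcs | oIs => row3 (x 0 0) (x 0 1) (x 0 5)
  | oEas | oEbs => row3 (x 0 0) (x 0 2) (x 0 5)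
  | oFa | oFb => row3 (x 0 0) (x 0 2) (x 0 4)
  | oFas | oFbs => row3 (x 0 0) (x 0 3) (x 0 5)
  | oG => row3 (x 0 2) (x 0 4) (x 0 5)
  | oGs => row3 (x 0 0) (x 0 1) (x 0 3)
  | oH => row3 (x 0 4) (x 0 2) (x 0 3)
  | oI => row3 (x 0 2) (x 0 3) (x 0 4)
  end.

Lemma dual_complete o g c x : nflin o g c x = 0 -> x = dual o g c (dual_coord o x).
Proof.
move=> /rowP E; have := E 0; have := E 1; have := E 2 => {E}.
by case: o; rewrite !mxE /= => E2 E1 E0; apply/rowP; apply: ord6E; rewrite !mxE /= ?mxE //=;
  first [lra|move: E2; rewrite (_ : x 0 1 = - 2 * x 0 4); lra].
Qed.

Lemma dot_row3 (x y z x' y' z' : R) :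
  dot (row3 x y z) (row3 x' y' z') = x * x' + y * y' + z * z'.
Proof. by rewrite dotE !mxE. Qed.

Lemma nf_free o g c (l : 'cV[R]_3) : (forall u, normal_form o g c u *m l = 0) -> l = 0.
Proof.
move=> H; have Nl : nfm o g c *m l = 0.
  by apply: ver_span => u; rewrite mulmxA -nf_ver.
have E x : dot (nflin o g c x) (row3 (l 0 0) (l 1 0) (l 2 0)) = 0.
  have : (nflin o g c x *m l) 0 0 = 0 by rewrite -mul_nfm -mulmxA Nl mulmx0 mxE.
  by rewrite mxE sum3E dotE !mxE.
suff [l0 l1 l2] : [/\ l 0 0 = 0, l 1 0 = 0 & l 2 0 = 0].
  by apply/colP; apply: ord3E; rewrite mxE.
move: (E (row6 1 0 0 0 0 0)) (E (row6 0 1 0 0 0 0)) (E (row6 0 0 1 0 0 0))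
  (E (row6 0 0 0 1 0 0)) (E (row6 0 0 0 0 1 0)) (E (row6 0 0 0 0 0 1)).
move: (l 0 0) (l 1 0) (l 2 0) => a b d {E Nl H l}.
rewrite /nflin !mxE /=; case: o; rewrite !dot_row3 => e1 e2 e3 e4 e5 e6;
  first [by split; lra |
         have d0 : d = 0 by lra; rewrite d0 ?mulr0 ?addr0 in e2 e5 *; by split; lra].
Qed.

End NormalForms.

(** * Nets of an orbit and their pencils *)

Section Orbits.
Context {R : realType}.
Implicit Types (o : orbit_type) (g c : R).

(** [K] is the inverse of the source matrix in the definition of [orbit]: the annihilator of the net
    is carried by [act K], so the rows of this inverse are the natural frame. *)
Definition framed (Q : @net R) o g c (K T : 'M[R]_3) :=
  forall v, net_map Q (v *m K) = normal_form o g c v *m T.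

Lemma framed_act Q o g c K T x : framed Q o g c K T -> act K x *m Q^T = nflin o g c x *m T.
Proof.
move=> QE; rewrite act_mx -mul_nfm -!mulmxA; congr (_ *m _); apply: ver_inj => u.
by rewrite !mulmxA -act_mx -ver_act -nf_ver -QE.
Qed.

Lemma framed_net_free Q o g c K T : framed Q o g c K T -> T \in unitmx -> net_free Q.
Proof.
move=> QE uT l H; have Tl : T *m l = 0.
  by apply: (nf_free (o := o) (g := g) (c := c)) => v; rewrite mulmxA -QE H.
by rewrite -(mulKmx uT l) Tl mulmx0.
Qed.

(** The form [x^2 + y^2 + z^2] restricted to the annihilator, in the coordinates of [dual]: the
    pencil is the plane orthogonal to this vector, and it depends on [K] through the scalar products
    of its rows. *)
Definition ell o g c (K : 'M[R]_3) : 'rV[R]_3 := \row_i tr6 (act K (dual o g c (delta_mx 0 i))).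

Lemma tr6_dual o g c K r : tr6 (act K (dual o g c r)) = dot (ell o g c K) r.
Proof.
have dD s t r1 r2 := dual_linear o g c s t r1 r2.
have d0 : dual o g c 0 = 0 by have := dD 0 0 0 0; rewrite !scale0r addr0 => ->; rewrite addr0.
have dDD r1 r2 : dual o g c (r1 + r2) = dual o g c r1 + dual o g c r2.
  by have := dD 1 1 r1 r2; rewrite !scale1r.
have dZ s r1 : dual o g c (s *: r1) = s *: dual o g c r1.
  by have := dD s 0 r1 0; rewrite !scale0r !addr0.
have F0 : tr6 (act K (dual o g c 0)) = 0.
  by rewrite d0 -[0](scale0r (0 : 'rV[R]_6)) actZ tr6Z mul0r.
have FD r1 r2 : tr6 (act K (dual o g c (r1 + r2))) =
    tr6 (act K (dual o g c r1)) + tr6 (act K (dual o g c r2)) by rewrite dDD actD tr6D.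
rewrite {1}[r]row_sum_delta (big_morph (fun r => tr6 (act K (dual o g c r))) FD F0).
by apply: eq_bigr => i _; rewrite dZ actZ tr6Z !mxE mulrC.
Qed.

Lemma framed_kernel Q o g c K T r : framed Q o g c K T -> dot (ell o g c K) r = 0 ->
  act K (dual o g c r) *m hatm Q = 0.
Proof.
move=> QE lr; apply/hatm_eq0; split; last by rewrite tr6_dual.
by rewrite (framed_act _ QE) dual_kills mul0mx.
Qed.

Lemma kernel_framed Q o g c K T e : framed Q o g c K T -> K \in unitmx -> T \in unitmx ->
  e *m hatm Q = 0 -> exists2 r, e = act K (dual o g c r) & dot (ell o g c K) r = 0.
Proof.
move=> QE uK uT /hatm_eq0[EQ Et]; have [x xE] := act_surj e uK.
have x0 : nflin o g c x = 0.
  by apply: (mulK_inj uT); rewrite -(framed_act _ QE) -xE EQ mul0mx.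
exists (dual_coord o x); first by rewrite -(dual_complete x0).
by rewrite -tr6_dual -(dual_complete x0) -xE.
Qed.

(** If [x^2 + y^2 + z^2] were a combination of the forms of the net, it would vanish on their
    annihilator; but at the element with parameter [ell] it takes the value [dot ell ell]. *)
Lemma framed_hat_free Q o g c K T : framed Q o g c K T -> T \in unitmx ->
  ell o g c K != 0 -> hat_free Q.
Proof.
move=> QE uT l0; apply: hat_freeP => l E.
have hE w : hat Q w *m l = net_map Q w *m (\col_k l (lift ord_max k) 0) + (tr6 (ver w) * l ord_max 0)%:M.
  have -> : tr6 (ver w) = dot w w by rewrite /tr6 dotE !mxE /=; ring.
  apply/rowP => j; rewrite !ord1 [LHS]mxE big_ord_recr hat_max [RHS]mxE [X in _ = X + _]mxE.
  rewrite [X in _ = _ + X]mxE eqxx mulr1n; congr (_ + _); apply: eq_bigr => k _.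
  rewrite -hat_lift [X in _ = _ * X]mxE.
  by have -> : widen_ord (leqnSn 3) k = lift ord_max k by apply: ord_inj; rewrite lift_max.
pose t6 : 'cV[R]_6 := col ord_max (hatm Q).
have t6E x : x *m t6 = (tr6 x)%:M.
  rewrite /t6 colE mulmxA -colE; apply/rowP => j.
  by rewrite !ord1 [LHS]mxE mul_hatm_max mxE eqxx mulr1n.
have Z : Q^T *m (\col_k l (lift ord_max k) 0) + l ord_max 0 *: t6 = 0.
  apply: ver_inj => u; rewrite mulmxDr mulmxA -net_mapE -scalemxAr t6E mulmx0 -[RHS](E u) hE.
  by congr (_ + _); rewrite mulrC scale_scalar_mx.
have l3 : l ord_max 0 = 0.
  have lr : dot (ell o g c K) (ell o g c K) * l ord_max 0 = 0.
    have := congr1 (mulmx (act K (dual o g c (ell o g c K)))) Z.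
    rewrite mulmxDr mulmxA (framed_act _ QE) dual_kills !mul0mx add0r -scalemxAr t6E tr6_dual mulmx0.
    by move/rowP/(_ 0); rewrite !mxE mulr1n mulrC.
  by move/eqP: lr; rewrite mulf_eq0 (gt_eqF (dot_gt0 l0)) => /eqP.
have l012 : \col_k l (lift ord_max k) 0 = 0.
  apply: (framed_net_free QE uT) => w; have := E w.
  by rewrite hE l3 mulr0 raddf0 addr0.
apply/colP => j; rewrite mxE; case: (unliftP ord_max j) => [k ->|-> //].
by move/colP/(_ k): l012; rewrite !mxE.
Qed.

(* By [framed_kernel], the pencil consists of the forms [act K (dual o g c r)] with
   [r] orthogonal to [ell o g c K]; the cross product makes its elements polynomial
   in [K]. *)
Definition px o g c K (p : 'rV[R]_3) := dual o g c (cross (ell o g c K) p).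

Lemma ell0_phess o g c K p q : ell o g c K = 0 -> phess0 (px o g c K p) (px o g c K q).
Proof.
move=> l0; apply: (phess0_dependent (s := 1) (t := 0)); last by rewrite oner_eq0.
rewrite scale1r scale0r addr0 /px l0.
have -> : cross 0 p = 0 :> 'rV[R]_3 by apply: row3P; rewrite !mxE /=; ring.
by have := dual_linear o g c 0 0 0 0; rewrite !scale0r addr0 => ->; rewrite addr0.
Qed.

Lemma dets_act K (x y : 'rV[R]_6) s t :
  dets (s *: act K x + t *: act K y) = \det K ^+ 2 * dets (s *: x + t *: y).
Proof. by rewrite -!actZ -actD -det_symm det_act. Qed.

Theorem framed_surface Q o g c K T p q : framed Q o g c K T -> K \in unitmx -> T \in unitmx ->
  ~ phess0 (px o g c K p) (px o g c K q) ->
  exists e f, [/\ hat_free Q, e *m hatm Q = 0, f *m hatm Q = 0, ~ phess0 e f &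
    exists2 k, 0 < k & pdisc e f = k * pdisc (px o g c K p) (px o g c K q)].
Proof.
move=> QE uK uT H; exists (act K (px o g c K p)), (act K (px o g c K q)).
have k0 : \det K != 0 by rewrite -unitfE -unitmxE.
have [D E] := scale_coefs (dets_act K (px o g c K p) (px o g c K q)).
have k2 : \det K ^+ 2 != 0 by rewrite sqrf_eq0.
split.
- by apply: (framed_hat_free QE uT); apply: contra_notN H => /eqP; exact: ell0_phess.
- by apply: (framed_kernel QE); exact: dot_cross.
- by apply: (framed_kernel QE); exact: dot_cross.
- by move=> /(E k2).
- by exists ((\det K ^+ 2) ^+ 4) => //; rewrite exprn_even_gt0.
Qed.

End Orbits.

(** * Examples of each sign of the discriminant *)

Section Examples.
Context {R : realType}.
Implicit Types (o : orbit_type) (g c : R).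

Lemma ellE o g c (K : 'M[R]_3) a b d :
  let D i := dual o g c (delta_mx 0 i) in
  let G i j := dot (row i K) (row j K) in
  let t i := D i 0 0 * G 0 0 + D i 0 1 * G 1 1 + D i 0 2 * G 2 2
    + 2 * (D i 0 3 * G 1 2 + D i 0 4 * G 0 2 + D i 0 5 * G 0 1) in
  t 0 = a -> t 1 = b -> t 2 = d -> ell o g c K = row3 a b d.
Proof. by move=> D G t ta tb td; apply: row3P; rewrite !mxE tr6_act. Qed.

Lemma cross_row3 (x y z x' y' z' : R) : cross (row3 x y z) (row3 x' y' z') =
  row3 (y * z' - z * y') (z * x' - x * z') (x * y' - y * x').
Proof. by apply: row3P; rewrite !mxE. Qed.

Lemma dets_row6 (a b d e f h : R) : dets (row6 a b d e f h) =
  a * b * d + 2 * (e * f * h) - a * e ^+ 2 - b * f ^+ 2 - d * h ^+ 2.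
Proof. by rewrite /dets !mxE. Qed.

Lemma row6D (a b d e f h a' b' d' e' f' h' : R) : row6 a b d e f h + row6 a' b' d' e' f' h' =
  row6 (a + a') (b + b') (d + d') (e + e') (f + f') (h + h').
Proof. by apply/rowP; apply: ord6E; rewrite !mxE. Qed.

Lemma row6B (a b d e f h a' b' d' e' f' h' : R) : row6 a b d e f h - row6 a' b' d' e' f' h' =
  row6 (a - a') (b - b') (d - d') (e - e') (f - f') (h - h').
Proof. by apply/rowP; apply: ord6E; rewrite !mxE. Qed.

Lemma unit_example (x0 x1 x2 y0 y1 y2 z0 z1 z2 : R) :
  0 < (x0 * (y1 * z2 - y2 * z1) - x1 * (y0 * z2 - y2 * z0) + x2 * (y0 * z1 - y1 * z0)) ^+ 2 ->
  rows3 (row3 x0 x1 x2) (row3 y0 y1 y2) (row3 z0 z1 z2) \in unitmx.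
Proof. by move=> D; apply: unitmx_row3; rewrite -sqrf_eq0 gt_eqF. Qed.

Definition e2 : 'rV[R]_3 := row3 0 0 1.
Definition e1 : 'rV[R]_3 := row3 0 1 0.
Definition e0 : 'rV[R]_3 := row3 1 0 0.

End Examples.

Ltac ell_tac := apply: ellE; rewrite /dual !mxE /= ?rowK /= ?dot_row3; ring.

Ltac pdisc_tac l p q := rewrite /px l /pdisc /phess0 /coef2 /coef1 /e0 /e1 /e2 !cross_row3 /dual !mxE /=
  ?row6D ?row6B !dets_row6 /disc /hess0.

Ltac example_tac k l p q :=
  exists k, p, q; split;
  [by apply: unit_example; lra
  |match goal with |- context [px ?o ?g ?c _] =>
     let L := fresh in have L : ell o g c k = l; [by ell_tac|pdisc_tac L p q; clear L]
   end].

Section Examples2.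
Context {R : realType}.
Implicit Types (o : orbit_type) (g c : R).

(** When the middle entry of [ell] is 0, the cubic is [s] times a quadratic form without mixed term.
    Once [lk] and the bracket are positive, the sign is that of [- le]. *)
Lemma abc_pdisc g c (K : 'M[R]_3) le lk : ell oC g c K = row3 le 0 lk ->
  pdisc (px oC g c K e1) (px oC g c K e0) =
  - 8 * (lk ^+ 3 * (lk ^+ 2 + 6 * g * lk * le - c * le ^+ 2) * le * (le * lk ^+ 2) ^+ 2).
Proof.
move=> l; rewrite (@pdisc_factor _ _ _ 1 0
  (- 2 * lk * (lk ^+ 2 + 6 * g * lk * le - c * le ^+ 2)) 0 (- le * lk ^+ 2)).
  by ring.
move=> s t; rewrite /px l /e1 /e0 !cross_row3 /dual /dets !mxE /=; ring.
Qed.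

(** The diagonal frame with entries [1], [b], [k] has [ell = (- m, 0, c + k ^+ 2)]; [b] makes [m]
    positive for any [g], and [k] is so large that the last entry dominates. The families A, B and C
    share the same [dual], so one frame serves all of them. *)
Lemma abc_roman g c : exists (K : 'M[R]_3) p q, K \in unitmx /\
  0 < pdisc (px oC g c K p) (px oC g c K q).
Proof.
have [g1 g2 c1 c2] : [/\ g <= `|g|, - g <= `|g|, c <= `|c| & - c <= `|c|].
  by split; rewrite ?ler_norm // -normrN ler_norm.
have g0 := normr_ge0 g; have c0 := normr_ge0 c.
pose b := 3 * `|g| + 1; pose m := 2 * b ^+ 2 - 6 * g.
have m0 : 0 < m.
  have -> : m = 18 * `|g| ^+ 2 + 2 + 12 * `|g| - 6 * g by rewrite /m /b; ring.
  have := sqr_ge0 `|g|; lra.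
pose B := 6 * `|g| * m + `|c| * m ^+ 2 + 1.
have gm : 0 <= `|g| * m by rewrite mulr_ge0 // ltW.
have cm : 0 <= `|c| * m ^+ 2 by rewrite mulr_ge0 ?sqr_ge0.
pose k := `|c| + B; pose lk := c + k ^+ 2.
have k1 : 1 <= k by rewrite /k /B; lra.
have lkB : B <= lk.
  have : k <= k ^+ 2 by rewrite expr2 ler_peMl //; lra.
  by rewrite /lk {1}/k; lra.
have B1 : 1 <= B by rewrite /B; lra.
exists (rows3 (row3 1 0 0) (row3 0 b 0) (row3 0 0 k)), e1, e0; split.
  have b0 : 0 < b by rewrite /b; lra.
  apply: unitmx_row3; rewrite [X in X != 0](_ : _ = b * k); last by ring.
  by rewrite mulf_neq0 // gt_eqF //; lra.
rewrite (@abc_pdisc g c _ (- m) lk); last by rewrite /m /lk; ell_tac.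
have lk0 : 0 < lk by lra.
have A0 : 0 < lk ^+ 2 + 6 * g * lk * - m - c * (- m) ^+ 2.
  have -> : lk ^+ 2 + 6 * g * lk * - m - c * (- m) ^+ 2 = lk * (lk - 6 * g * m) - c * m ^+ 2 by ring.
  have h1 : `|c| * m ^+ 2 + 1 <= lk - 6 * g * m.
    have : g * m <= `|g| * m by rewrite ler_pM2r.
    by move: lkB; rewrite /B; lra.
  have h2 : `|c| * m ^+ 2 + 1 <= lk * (lk - 6 * g * m).
    apply: (le_trans h1); rewrite ler_peMl //; lra.
  have : c * m ^+ 2 <= `|c| * m ^+ 2 by rewrite ler_wpM2r ?sqr_ge0.
  by lra.
have -> : - 8 * (lk ^+ 3 * (lk ^+ 2 + 6 * g * lk * - m - c * (- m) ^+ 2) * - m * (- m * lk ^+ 2) ^+ 2)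
  = 8 * (lk ^+ 3 * (lk ^+ 2 + 6 * g * lk * - m - c * (- m) ^+ 2) * m * (m * lk ^+ 2) ^+ 2) by ring.
by apply: mulr_gt0 => //; apply: mulr_gt0; [apply: mulr_gt0 => //; apply: mulr_gt0|]; rewrite ?exprn_gt0 // mulr_gt0 // exprn_gt0.
Qed.

(** [h] solves [6 * g - 2 + 2 * h = 1], which makes the first entry of [ell] equal to 1, and [k]
    makes the last one large. The parameters are arbitrary, so negative discriminants occur for
    [oBc], [oBcs] and [oC] too. *)
Lemma abc_cross_cap g c : exists (K : 'M[R]_3) p q, K \in unitmx /\
  pdisc (px oC g c K p) (px oC g c K q) < 0.
Proof.
have [g1 g2 c1 c2] : [/\ g <= `|g|, - g <= `|g|, c <= `|c| & - c <= `|c|].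
  by split; rewrite ?ler_norm // -normrN ler_norm.
have g0 := normr_ge0 g; have c0 := normr_ge0 c.
pose h := 3 / 2 - 3 * g; pose k := 6 * `|g| + 2 * `|c| + 1.
pose lk := c + h ^+ 2 + k ^+ 2.
have k1 : 1 <= k by rewrite /k; lra.
have lkB : 6 * `|g| + `|c| + 1 <= lk.
  have : k <= k ^+ 2 by rewrite expr2 ler_peMl //; lra.
  by have := sqr_ge0 h; rewrite /lk {1}/k; lra.
exists (rows3 (row3 1 0 0) (row3 0 1 0) (row3 h 0 k)), e1, e0; split.
  apply: unitmx_row3; rewrite [X in X != 0](_ : _ = k); last by ring.
  by rewrite gt_eqF //; lra.
rewrite (@abc_pdisc g c _ 1 lk); last first.
  have h1 : 6 * g - 2 + 2 * h = 1 by rewrite /h; field.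
  by apply: ellE; rewrite /dual !mxE /= ?rowK /= ?dot_row3;
    [rewrite -[RHS]h1; ring|ring|rewrite /lk; ring].
have lk0 : 0 < lk by lra.
have A0 : 0 < lk ^+ 2 + 6 * g * lk * 1 - c * 1 ^+ 2.
  have -> : lk ^+ 2 + 6 * g * lk * 1 - c * 1 ^+ 2 = lk * (lk + 6 * g) - c by ring.
  have h2 : lk + 6 * g <= lk * (lk + 6 * g) by rewrite ler_peMl //; lra.
  by lra.
rewrite mulNr oppr_lt0; apply: mulr_gt0 => //.
by apply: mulr_gt0; [apply: mulr_gt0 => //; apply: mulr_gt0|]; rewrite ?exprn_gt0 // mulr_gt0 // exprn_gt0.
Qed.

(** In each call of [example_tac] the row after the frame is its [ell]; it forms a basis together
    with the two unit vectors that follow, so their cross products with it span the pencil. *)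
Lemma example_roman o g c : table RomanSteiner o -> exists (K : 'M[R]_3) p q, K \in unitmx /\
  0 < pdisc (px o g c K p) (px o g c K q).
Proof.
case: o => // _.
1-9: exact: abc_roman.
- by example_tac (rows3 (row3 1 1 0) (row3 1 0 1) (row3 1 0 0) : 'M[R]_3) (row3 0 2 2 : 'rV[R]_3) (@e2 R) (@e0 R); lra.
- by example_tac (rows3 (row3 1 0 0) (row3 0 1 0) (row3 0 0 2) : 'M[R]_3) (row3 1 1 (- 8) : 'rV[R]_3) (@e1 R) (@e0 R); lra.
- by example_tac (rows3 (row3 1 0 0) (row3 0 3 0) (row3 0 0 2) : 'M[R]_3) (row3 (- 3) 5 0 : 'rV[R]_3) (@e2 R) (@e0 R); lra.
- by example_tac (rows3 (row3 1 0 0) (row3 0 2 0) (row3 1 0 1) : 'M[R]_3) (row3 (- 3) 0 2 : 'rV[R]_3) (@e1 R) (@e0 R); lra.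
- by example_tac (rows3 (row3 1 0 0) (row3 0 1 0) (row3 0 0 1) : 'M[R]_3) (row3 2 1 0 : 'rV[R]_3) (@e2 R) (@e0 R); lra.
- by example_tac (rows3 (row3 1 0 0) (row3 0 2 0) (row3 0 0 1) : 'M[R]_3) (row3 (- 3) 1 0 : 'rV[R]_3) (@e2 R) (@e0 R); lra.
Qed.

Lemma example_cross_cap o g c : table CrossCapSurface o -> exists (K : 'M[R]_3) p q, K \in unitmx /\
  pdisc (px o g c K p) (px o g c K q) < 0.
Proof.
case: o => // _.
1-6: exact: abc_cross_cap.
- by example_tac (rows3 (row3 1 1 0) (row3 (- 1) 2 1) (row3 1 0 0) : 'M[R]_3) (row3 0 (- 2) 2 : 'rV[R]_3) (@e2 R) (@e0 R); lra.
- by example_tac (rows3 (row3 1 0 0) (row3 0 1 0) (row3 0 1 1) : 'M[R]_3) (row3 0 2 0 : 'rV[R]_3) (@e2 R) (@e0 R); lra.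
- by example_tac (rows3 (row3 1 0 0) (row3 0 1 0) (row3 0 1 1) : 'M[R]_3) (row3 4 2 0 : 'rV[R]_3) (@e2 R) (@e0 R); lra.
- by example_tac (rows3 (row3 2 0 0) (row3 0 2 0) (row3 0 0 1) : 'M[R]_3) (row3 4 4 (- 2) : 'rV[R]_3) (@e1 R) (@e0 R); lra.
- by example_tac (rows3 (row3 1 0 0) (row3 0 2 0) (row3 0 0 1) : 'M[R]_3) (row3 2 5 0 : 'rV[R]_3) (@e2 R) (@e0 R); lra.
- by example_tac (rows3 (row3 2 0 0) (row3 0 3 0) (row3 0 0 1) : 'M[R]_3) (row3 3 8 0 : 'rV[R]_3) (@e2 R) (@e0 R); lra.
- by example_tac (rows3 (row3 1 0 0) (row3 0 1 0) (row3 1 0 1) : 'M[R]_3) (row3 2 0 2 : 'rV[R]_3) (@e1 R) (@e0 R); lra.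
- by example_tac (rows3 (row3 2 0 0) (row3 0 1 0) (row3 0 0 1) : 'M[R]_3) (row3 3 1 0 : 'rV[R]_3) (@e2 R) (@e0 R); lra.
- by example_tac (rows3 (row3 2 0 0) (row3 0 1 0) (row3 0 0 1) : 'M[R]_3) (row3 3 1 0 : 'rV[R]_3) (@e2 R) (@e0 R); lra.
- by example_tac (rows3 (row3 1 0 0) (row3 0 1 0) (row3 0 0 1) : 'M[R]_3) (row3 2 1 0 : 'rV[R]_3) (@e2 R) (@e0 R); lra.
Qed.

Lemma example_type5 o g c : table Type5 o -> exists (K : 'M[R]_3) p q, K \in unitmx /\
  ~ phess0 (px o g c K p) (px o g c K q).
Proof.
case: o => // _.
- by example_tac (rows3 (row3 1 0 0) (row3 1 1 0) (row3 0 0 1) : 'M[R]_3) (row3 3 0 2 : 'rV[R]_3) (@e1 R) (@e0 R); move=> [h1 h2 h3]; suff : (0 : R) < 0; [by rewrite ltxx|lra].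
- by example_tac (rows3 (row3 1 0 0) (row3 1 1 0) (row3 0 0 1) : 'M[R]_3) (row3 (- 1) 0 2 : 'rV[R]_3) (@e1 R) (@e0 R); move=> [h1 h2 h3]; suff : (0 : R) < 0; [by rewrite ltxx|lra].
- by example_tac (rows3 (row3 1 0 0) (row3 0 1 0) (row3 1 0 1) : 'M[R]_3) (row3 2 2 0 : 'rV[R]_3) (@e2 R) (@e0 R); move=> [h1 h2 h3]; suff : (0 : R) < 0; [by rewrite ltxx|lra].
- by example_tac (rows3 (row3 1 0 0) (row3 0 1 0) (row3 0 0 1) : 'M[R]_3) (row3 1 1 0 : 'rV[R]_3) (@e2 R) (@e0 R); move=> [h1 h2 h3]; suff : (0 : R) < 0; [by rewrite ltxx|lra].
Qed.

End Examples2.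

(** * Constraints on the discriminant along each orbit *)

Section Signs.
Context {R : realType}.
Implicit Types (o : orbit_type) (g c : R).

Lemma orbit_frame o (Q : @net R) : Defs.orbit o Q -> exists g c (K T : 'M[R]_3),
  [/\ parameters o g c, K \in unitmx, T \in unitmx & framed Q o g c K T].
Proof.
move=> [g [c [S [T [pgc uS uT QE]]]]]; exists g, c, (invmx S), T; split=> //.
  by rewrite unitmx_inv.
by move=> v; rewrite QE mulmxKV.
Qed.

Lemma framed_orbit o g c (Q : @net R) K T : parameters o g c -> K \in unitmx -> T \in unitmx ->
  framed Q o g c K T -> Defs.orbit o Q.
Proof.
move=> pgc uK uT QE; exists g, c, (invmx K), T; split=> //; first by rewrite unitmx_inv.
by move=> u; rewrite -QE mulmxKV.
Qed.

Lemma dot_cauchy (u v : 'rV[R]_3) : dot u v ^+ 2 <= dot u u * dot v v.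
Proof.
rewrite -subr_ge0; have -> : dot u u * dot v v - dot u v ^+ 2 = dot (cross u v) (cross u v).
  by rewrite !dotE !mxE /=; ring.
exact: dot_ge0.
Qed.

(** The quantity is the discriminant of [a * b - d ^+ 2] on a plane. Eliminating [a] gives, up to
    [la ^+ 2], the product of [ld ^+ 2 - 4 * la * lb] and a square: the plane meets the cone in at
    most a line. *)
Lemma quadratic_conic (la lb ld a b d a' b' d' : R) : 0 < la -> ld ^+ 2 <= 4 * la * lb ->
  la * a + lb * b + ld * d = 0 -> la * a' + lb * b' + ld * d' = 0 ->
  (a * b' + a' * b - 2 * d * d') ^+ 2 - 4 * (a * b - d ^+ 2) * (a' * b' - d' ^+ 2) <= 0.
Proof.
move=> la0 dl E E'; have la2 : 0 < la ^+ 2 by rewrite exprn_gt0.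
have Ea : la * a = - (lb * b + ld * d) by lra.
have Ea' : la * a' = - (lb * b' + ld * d') by lra.
rewrite -(pmulr_rle0 _ la2).
have -> : la ^+ 2 * ((a * b' + a' * b - 2 * d * d') ^+ 2 - 4 * (a * b - d ^+ 2) * (a' * b' - d' ^+ 2))
  = ((la * a) * b' + (la * a') * b - 2 * la * d * d') ^+ 2 -
    4 * ((la * a) * b - la * d ^+ 2) * ((la * a') * b' - la * d' ^+ 2) by ring.
rewrite Ea Ea'; set X := (X in X <= 0).
have -> : X = (ld ^+ 2 - 4 * la * lb) * (b * d' - b' * d) ^+ 2 by rewrite /X; ring.
by rewrite mulr_le0_ge0 ?sqr_ge0 // subr_le0.
Qed.

Lemma quadratic_cone (la lb ld a b d a' b' d' : R) : 0 < la -> lb ^+ 2 + ld ^+ 2 <= la ^+ 2 ->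
  la * a + lb * b + ld * d = 0 -> la * a' + lb * b' + ld * d' = 0 ->
  (2 * (a * a' - b * b' - d * d')) ^+ 2 -
  4 * (a ^+ 2 - b ^+ 2 - d ^+ 2) * (a' ^+ 2 - b' ^+ 2 - d' ^+ 2) <= 0.
Proof.
move=> la0 dl E E'; have la4 : 0 < la ^+ 4 by rewrite exprn_gt0.
have Ea : la * a = - (lb * b + ld * d) by lra.
have Ea' : la * a' = - (lb * b' + ld * d') by lra.
rewrite -(pmulr_rle0 _ la4).
have -> : la ^+ 4 * ((2 * (a * a' - b * b' - d * d')) ^+ 2 -
    4 * (a ^+ 2 - b ^+ 2 - d ^+ 2) * (a' ^+ 2 - b' ^+ 2 - d' ^+ 2)) =
    (2 * ((la * a) * (la * a') - la ^+ 2 * (b * b' + d * d'))) ^+ 2 -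
    4 * ((la * a) ^+ 2 - la ^+ 2 * (b ^+ 2 + d ^+ 2)) * ((la * a') ^+ 2 - la ^+ 2 * (b' ^+ 2 + d' ^+ 2)).
  by ring.
rewrite Ea Ea'; set X := (X in X <= 0).
have -> : X = 4 * (lb ^+ 2 + ld ^+ 2 - la ^+ 2) * (la ^+ 2 * (b * d' - b' * d) ^+ 2) by rewrite /X; ring.
by apply: mulr_le0_ge0; [apply: mulr_ge0_le0; rewrite ?subr_le0|apply: mulr_ge0; exact: sqr_ge0].
Qed.

Lemma dot_row3E (x y z : R) (r : 'rV[R]_3) : dot (row3 x y z) r = x * r 0 0 + y * r 0 1 + z * r 0 2.
Proof. by rewrite dotE !mxE. Qed.

Ltac factor_tac l l' q2 q1 q0 :=
  rewrite (@pdisc_factor _ _ _ l l' q2 q1 q0); [|by move=> s t; rewrite /dual /dets !mxE /=; ring].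

(** The cubic has a linear factor on the whole annihilator, so the quadratic factor decides the
    sign. For [oDb], [oEb] and [oEbs] it is, up to sign, a sum of squares; for the others the Cauchy
    inequality for the rows of [K] gives the hypothesis on [ell] in [quadratic_cone] or
    [quadratic_conic]. *)
Lemma dual_disc_le0 o g c (K : 'M[R]_3) (r r' : 'rV[R]_3) :
  match o with oDb | oDc | oDbs | oEb | oEbs | oFb => true | _ => false end ->
  K \in unitmx -> dot (ell o g c K) r = 0 -> dot (ell o g c K) r' = 0 ->
  pdisc (dual o g c r) (dual o g c r') <= 0.
Proof.
move=> ho uK; have kp i : 0 < dot (row i K) (row i K).
  by rewrite dot_gt0 // rowE mulK_neq0 //; apply/eqP => /rowP/(_ i)/eqP; rewrite !mxE !eqxx oner_eq0.
have k0 := kp 0; have k1 := kp 1; have k2 := kp 2.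
have c01 := dot_cauchy (row 0 K) (row 1 K); have c02 := dot_cauchy (row 0 K) (row 2 K).
have c12 := dot_cauchy (row 1 K) (row 2 K).
pose G i j := dot (row i K) (row j K).
have F (q W : R) : q <= 0 -> q * W ^+ 2 <= 0 by move=> q0; rewrite mulr_le0_ge0 ?sqr_ge0.
case: o ho => // _.
- move=> _ _.
  factor_tac (- r 0 0) (- r' 0 0) (r 0 0 ^+ 2 + r 0 1 ^+ 2 + r 0 2 ^+ 2)
    (2 * (r 0 0 * r' 0 0 + r 0 1 * r' 0 1 + r 0 2 * r' 0 2)) (r' 0 0 ^+ 2 + r' 0 1 ^+ 2 + r' 0 2 ^+ 2).
  apply: F; have := dot_cauchy r r'; rewrite !dotE => h; lra.
- rewrite (@ellE _ oDc g c K (G 0 0 + G 1 1 + G 2 2) (2 * G 1 2) (2 * G 0 2));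
    try by rewrite /dual !mxE /= /G; ring.
  rewrite !dot_row3E => E E'.
  factor_tac (r 0 0) (r' 0 0) (r 0 0 ^+ 2 - r 0 1 ^+ 2 - r 0 2 ^+ 2)
    (2 * (r 0 0 * r' 0 0 - r 0 1 * r' 0 1 - r 0 2 * r' 0 2)) (r' 0 0 ^+ 2 - r' 0 1 ^+ 2 - r' 0 2 ^+ 2).
  apply: F; apply: quadratic_cone E E'; first by rewrite !addr_gt0.
  have -> : (2 * G 1 2) ^+ 2 + (2 * G 0 2) ^+ 2 = 4 * (G 1 2 ^+ 2 + G 0 2 ^+ 2) by ring.
  apply: (@le_trans _ _ (4 * ((G 0 0 + G 1 1) * G 2 2))).
    by rewrite ler_pM2l ?ltr0n //; move: c02 c12; rewrite /G; lra.
  by rewrite -subr_ge0 (_ : _ - _ = (G 0 0 + G 1 1 - G 2 2) ^+ 2) ?sqr_ge0 //; ring.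
- rewrite (@ellE _ oDbs g c K (G 0 0 + G 2 2) (G 1 1 + G 2 2) (2 * G 0 1));
    try by rewrite /dual !mxE /= /G; ring.
  rewrite !dot_row3E => E E'.
  factor_tac (r 0 0 + r 0 1) (r' 0 0 + r' 0 1) (r 0 0 * r 0 1 - r 0 2 ^+ 2)
    (r 0 0 * r' 0 1 + r' 0 0 * r 0 1 - 2 * r 0 2 * r' 0 2) (r' 0 0 * r' 0 1 - r' 0 2 ^+ 2).
  apply: F; apply: quadratic_conic E E'; first by rewrite addr_gt0.
  have : 0 <= G 2 2 * (G 0 0 + G 1 1 + G 2 2) by rewrite mulr_ge0 ?addr_ge0 // ltW.
  by move: c01; rewrite /G; lra.
- move=> _ _.
  factor_tac (- r 0 0) (- r' 0 0) (r 0 1 ^+ 2 + r 0 2 ^+ 2)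
    (2 * (r 0 1 * r' 0 1 + r 0 2 * r' 0 2)) (r' 0 1 ^+ 2 + r' 0 2 ^+ 2).
  apply: F; have := sqr_ge0 (r 0 1 * r' 0 2 - r 0 2 * r' 0 1); lra.
- move=> _ _.
  factor_tac (- r 0 1) (- r' 0 1) (r 0 0 ^+ 2 + r 0 2 ^+ 2)
    (2 * (r 0 0 * r' 0 0 + r 0 2 * r' 0 2)) (r' 0 0 ^+ 2 + r' 0 2 ^+ 2).
  apply: F; have := sqr_ge0 (r 0 0 * r' 0 2 - r 0 2 * r' 0 0); lra.
- rewrite (@ellE _ oFb g c K (G 0 0 + G 1 1) (G 2 2) (2 * G 0 2));
    try by rewrite /dual !mxE /= /G; ring.
  rewrite !dot_row3E ![_ * r 0 0 + _]addrC ![_ * r' 0 0 + _]addrC => E E'.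
  factor_tac (r 0 0) (r' 0 0) (r 0 1 * r 0 0 - r 0 2 ^+ 2)
    (r 0 1 * r' 0 0 + r' 0 1 * r 0 0 - 2 * r 0 2 * r' 0 2) (r' 0 1 * r' 0 0 - r' 0 2 ^+ 2).
  apply: F; apply: quadratic_conic E E' => //.
  have : 0 <= G 2 2 * G 1 1 by rewrite mulr_ge0 // ltW.
  by move: c02; rewrite /G; lra.
Qed.

(** The quadratic factor is a difference of two squares, so it splits over the reals and its
    discriminant is a square. *)
Lemma dual_disc_ge0 o g c (r r' : 'rV[R]_3) :
  match o with oEa | oEas => true | _ => false end ->
  0 <= pdisc (dual o g c r) (dual o g c r').
Proof.
have F (q p W : R) : q = p ^+ 2 -> 0 <= q * W ^+ 2 by move=> ->; rewrite mulr_ge0 ?sqr_ge0.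
case: o => // _.
- factor_tac (r 0 0) (r' 0 0) (r 0 2 ^+ 2 - r 0 1 ^+ 2)
    (2 * (r 0 2 * r' 0 2 - r 0 1 * r' 0 1)) (r' 0 2 ^+ 2 - r' 0 1 ^+ 2).
  by apply: (F _ (2 * (r 0 1 * r' 0 2 - r 0 2 * r' 0 1))); ring.
- factor_tac (r 0 1) (r' 0 1) (r 0 0 ^+ 2 - r 0 2 ^+ 2)
    (2 * (r 0 0 * r' 0 0 - r 0 2 * r' 0 2)) (r' 0 0 ^+ 2 - r' 0 2 ^+ 2).
  by apply: (F _ (2 * (r 0 0 * r' 0 2 - r 0 2 * r' 0 0))); ring.
Qed.

(** On these annihilators the cubic contains the square of a linear form. *)
Lemma dual_disc_eq0 o g c (r r' : 'rV[R]_3) :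
  match o with oFas | oFbs | oG | oGs => true | _ => false end ->
  pdisc (dual o g c r) (dual o g c r') = 0.
Proof.
have F (a a' b b' : R) x y : (forall s t, dets (s *: x + t *: y) =
    - ((a * s + a' * t) * (b * s + b' * t) ^+ 2)) -> pdisc x y = 0.
  move=> E; rewrite (@pdisc_factor _ x y (- a) (- a') (b ^+ 2) (2 * b * b') (b' ^+ 2)); first by ring.
  by move=> s t; rewrite E; ring.
case: o => // _.
- by apply: (F (r 0 0) (r' 0 0) (r 0 1) (r' 0 1)) => s t; rewrite /dual /dets !mxE /=; ring.
- by apply: (F (r 0 0) (r' 0 0) (r 0 1) (r' 0 1)) => s t; rewrite /dual /dets !mxE /=; ring.
- by apply: (F (r 0 0) (r' 0 0) (r 0 2) (r' 0 2)) => s t; rewrite /dual /dets !mxE /=; ring.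
- by apply: (F (r 0 0) (r' 0 0) (r 0 2) (r' 0 2)) => s t; rewrite /dual /dets !mxE /=; ring.
Qed.

Lemma orbit_disc o (Q : @net R) e f : Defs.orbit o Q -> e *m hatm Q = 0 -> f *m hatm Q = 0 ->
  [/\ match o with oDb | oDc | oDbs | oEb | oEbs | oFb => true | _ => false end -> pdisc e f <= 0,
      match o with oEa | oEas => true | _ => false end -> 0 <= pdisc e f &
      match o with oFas | oFbs | oG | oGs => true | _ => false end -> pdisc e f = 0].
Proof.
move=> /orbit_frame[g [c [K [T [_ uK uT QE]]]]].
move=> /(kernel_framed QE uK uT)[r -> lr] /(kernel_framed QE uK uT)[r' -> lr'].
have [-> _] := scale_coefs (dets_act K (dual o g c r) (dual o g c r')).
have k4 : 0 <= (\det K ^+ 2) ^+ 4 by rewrite exprn_even_ge0.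
split=> ho.
- by rewrite mulr_ge0_le0 //; exact: (dual_disc_le0 ho uK lr lr').
- by rewrite mulr_ge0 //; exact: dual_disc_ge0.
- by rewrite dual_disc_eq0 // mulr0.
Qed.

Lemma type6_orbit (Q : @net R) : Defs.orbit oH Q -> type6_surface (net_map Q).
Proof.
move=> /orbit_frame[g [c [K [T [_ uK uT QE]]]]].
pose G i j := dot (row i K) (row j K).
have k2 : 0 < G 2 2.
  by rewrite dot_gt0 // rowE mulK_neq0 //; apply/eqP => /rowP/(_ 2)/eqP; rewrite !mxE !eqxx oner_eq0.
pose la := - 2 * G 1 1 + 2 * G 0 2.
have lE : ell oH g c K = row3 la (G 2 2) (2 * G 1 2).
  by apply: ellE; rewrite /dual !mxE /= /la /G; ring.
(* A basis of the plane orthogonal to [ell] in which only [r] involves the first parameter. As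
   [dets] on [dual oH] is twice the cube of that parameter, the cubic reduces to a constant times
   [s ^+ 3]. *)
pose r := row3 (G 2 2) (- la) 0; pose r' := row3 0 (2 * G 1 2) (- G 2 2).
have lr : dot (ell oH g c K) r = 0 by rewrite lE dot_row3E !mxE /=; ring.
have lr' : dot (ell oH g c K) r' = 0 by rewrite lE dot_row3E !mxE /=; ring.
have Qf : hat_free Q.
  apply: (framed_hat_free QE uT); rewrite lE row3_neq0 //.
  by rewrite (lt0r_neq0 k2) orbT.
have eh := framed_kernel QE lr; have fh := framed_kernel QE lr'.
have k0 : \det K != 0 by rewrite -unitfE -unitmxE.
have D s t : dets (s *: act K (dual oH g c r) + t *: act K (dual oH g c r')) =
    (\det K ^+ 2 * (2 * G 2 2 ^+ 3)) * s ^+ 3 + 0 * s ^+ 2 * t + 0 * s * t ^+ 2 + 0 * t ^+ 3.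
  by rewrite dets_act -dual_linear /dets /r /r' !mxE /=; ring.
have P : pencil Q (act K (dual oH g c r)) (act K (dual oH g c r'))
    (\det K ^+ 2 * (2 * G 2 2 ^+ 3)) 0 0 0.
  split=> // s t; rewrite -!actZ -actD -dual_linear => E.
  have : dual oH g c (s *: r + t *: r') = 0.
    have uA : symm (dual oH g c (s *: r + t *: r')) = 0.
      have S0 : symm (0 : 'rV[R]_6) = 0 by apply: mx3P; apply: ord3E; split; rewrite !mxE /= ?mxE.
      have := symm_act K (dual oH g c (s *: r + t *: r')); rewrite E S0 => /esym H.
      have := congr1 (fun A => invmx (K^T) *m A *m invmx K) H.
      by rewrite !mulmxA mulVmx ?unitmx_tr // mul1mx mulmxK // mulmx0 mul0mx.
    by apply: symm_inj; rewrite uA; apply: mx3P; apply: ord3E; split; rewrite !mxE /= ?mxE.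
  move=> /rowP Z; have := Z 3; have := Z 4; rewrite /r /r' !mxE /= => z4 z3.
  split; first by apply: (mulIf (lt0r_neq0 k2)); lra.
  by apply: (mulIf (lt0r_neq0 k2)); lra.
have [_ _ _ S] := surface_of_pencil Qf P; apply: S.
  by split; ring.
by rewrite !mulf_neq0 ?expf_neq0 ?pnatr_eq0 // lt0r_neq0.
Qed.

(** The normal form ignores its third variable. The corresponding direction in the source is the
    third row of [invmx S], taken as last vector of an orthonormal basis. *)
Lemma cone_orbit (Q : @net R) : Defs.orbit oI Q -> cone_surface (net_map Q).
Proof.
move=> [g [c [S [T [_ uS uT QE]]]]].
have uV : invmx S \in unitmx by rewrite unitmx_inv.
have n0 : row 2 (invmx S) != 0.
  by rewrite rowE mulK_neq0 //; apply/eqP => /rowP/(_ 2)/eqP; rewrite !mxE !eqxx oner_eq0.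
have QF : framed Q oI g c (invmx S) T by move=> v; rewrite QE mulmxKV.
have [K [KK r2 _]] := orthonormal_extension n0.
have [a _ aE] := normalizeE n0.
have nS : row 2 K *m S = row3 0 0 a.
  rewrite r2 aE -scalemxAl -row_mul mulVmx //; apply: row3P; rewrite !mxE /=; ring.
have nf2 (u : 'rV[R]_3) : net_map Q (u + row 2 K) = net_map Q u.
  rewrite !QE mulmxDl nS; move: (u *m S) => w.
  by congr (_ *m _); apply: row3P; rewrite !mxE /= ?mxE /=; ring.
have h2 : net_map Q (row 2 K) = 0.
  by rewrite QE nS -(mul0mx _ T); congr (_ *m _); apply: row3P; rewrite !mxE /= ?mxE /=; ring.
have p2 u : pnet Q u (row 2 K) = 0.
  have := net_mapD Q u (row 2 K); rewrite nf2 h2 addr0 => /esym/eqP.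
  by rewrite addrC -subr_eq0 addrK => /eqP.
by apply: (cone_surface_of_basis KK (framed_net_free QF uT)).
Qed.

(** The normal form vanishes together with its third variable; in the source this is the plane with
    normal vector the third column of [S]. *)
Lemma ellipsoid_orbit (Q : @net R) : Defs.orbit oIs Q -> ellipsoid_surface (net_map Q).
Proof.
move=> [g [c [S [T [_ uS uT QE]]]]].
have uV : invmx S \in unitmx by rewrite unitmx_inv.
have QF : framed Q oIs g c (invmx S) T by move=> v; rewrite QE mulmxKV.
pose n : 'rV[R]_3 := (col 2 S)^T.
have nE (u : 'rV[R]_3) : dot u n = (u *m S) 0 2.
  by rewrite mxE; apply: eq_bigr => i _; rewrite !mxE.
have n0 : n != 0.
  apply/eqP => n0; have := nE (row 2 (invmx S)); rewrite n0 -row_mul mulVmx // !mxE /=.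
  rewrite (_ : dot _ 0 = 0); first by move/esym/eqP; rewrite oner_eq0.
  by rewrite dotE !mxE; ring.
have [K [KK _ [d0 d1]]] := orthonormal_extension n0; rewrite !nE in d0 d1.
have nf0 (u : 'rV[R]_3) : (u *m S) 0 2 = 0 -> net_map Q u = 0.
  rewrite QE -(mul0mx _ T); move: (u *m S) => w w2.
  by congr (_ *m _); apply: row3P; rewrite !mxE /= w2; ring.
apply: (ellipsoid_surface_of_basis KK (framed_net_free QF uT)); try exact: nf0.
have := net_mapD Q (row 0 K) (row 1 K); rewrite !nf0 ?add0r ?addr0 //.
by rewrite mulmxDl mxE d0 d1 addr0.
Qed.

End Signs.

(** * Openness: the pencil as a continuous function of the net *)

Section Openness.
Context {R : realType}.

Definition cont_at (X : topologicalType) (x : X) (f : X -> R) := f @ x --> f x.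

Lemma cont_cst (X : topologicalType) (x : X) a : cont_at x (fun=> a).
Proof. exact: cvg_cst. Qed.
Lemma contD (X : topologicalType) (x : X) (f g : X -> R) :
  cont_at x f -> cont_at x g -> cont_at x (fun y => f y + g y).
Proof. exact: cvgD. Qed.
Lemma contM (X : topologicalType) (x : X) (f g : X -> R) :
  cont_at x f -> cont_at x g -> cont_at x (fun y => f y * g y).
Proof. exact: cvgM. Qed.

Lemma cont_neq0 (X : topologicalType) (x : X) f : cont_at x f -> f x != 0 -> \forall y \near x, f y != 0.
Proof. by move=> cf f0; apply: cvgr_neq0 cf f0. Qed.
Lemma cont_lt0 (X : topologicalType) (x : X) f : cont_at x f -> f x < 0 -> \forall y \near x, f y < 0.
Proof. by move=> cf f0; apply: cvgr_lt cf _ f0. Qed.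
Lemma cont_gt0 (X : topologicalType) (x : X) f : cont_at x f -> 0 < f x -> \forall y \near x, 0 < f y.
Proof. by move=> cf f0; apply: cvgr_gt cf _ f0. Qed.

(** Fixing one coefficient of the Hessian that is nonzero gives a single function to which
    continuity or polynomiality can be applied. *)
Definition hess_part (i : 'I_3) (x y : 'rV[R]_6) : R :=
  [:: coef2 x y ^+ 2 - 3 * dets x * coef1 x y; coef2 x y * coef1 x y - 9 * dets x * dets y;
      coef1 x y ^+ 2 - 3 * coef2 x y * dets y]`_i.

Lemma phess0P x y : phess0 x y <-> forall i, hess_part i x y = 0.
Proof.
split=> [[h0 h1 h2]|H]; first by apply: ord3E.
by split; [exact: (H 0)|exact: (H 1)|exact: (H 2)].
Qed.

Lemma phess_part x y : ~ phess0 x y -> exists i, hess_part i x y != 0.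
Proof.
move=> H; apply: contrapT => /forallNP E; apply: H; apply/phess0P => i.
by apply/eqP/negPn/negP; exact: E.
Qed.

Section ClosedCovariants.
Variables (X : Type) (C : (X -> R) -> Prop).
Hypotheses (Ccst : forall a, C (fun=> a)) (CD : forall f g, C f -> C g -> C (fun x => f x + g x))
  (CM : forall f g, C f -> C g -> C (fun x => f x * g x)).
Variables (x y : X -> 'rV[R]_6).
Hypotheses (Cx : mx_closed C x) (Cy : mx_closed C y).

Let CB := closedB Ccst CD CM.
Let CX := closedX Ccst CM.
Let Cd := closed_dets Ccst CD CM.

Lemma closed_addmx m n (A B : X -> 'M[R]_(m, n)) : mx_closed C A -> mx_closed C B ->
  mx_closed C (fun x => A x + B x).
Proof. by move=> CA CB' i j; apply: (closed_ext _ (CD (CA i j) (CB' i j))) => z; rewrite mxE. Qed.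

Lemma closed_oppmx m n (A : X -> 'M[R]_(m, n)) : mx_closed C A -> mx_closed C (fun x => - A x).
Proof. by move=> CA i j; apply: (closed_ext _ (closedN Ccst CM (CA i j))) => z; rewrite mxE. Qed.

Let Cp := Cd (closed_addmx Cx Cy).
Let Cm := Cd (closed_addmx Cx (closed_oppmx Cy)).

Lemma closed_coef2 : C (fun z => coef2 (x z) (y z)).
Proof. by apply: CB; [apply: CM; [apply: CB; [exact: Cp|exact: Cm]|exact: Ccst]|exact: Cd]. Qed.

Lemma closed_coef1 : C (fun z => coef1 (x z) (y z)).
Proof. by apply: CB; [apply: CM; [apply: CD; [exact: Cp|exact: Cm]|exact: Ccst]|exact: Cd]. Qed.

Lemma closed_pdisc : C (fun z => pdisc (x z) (y z)).
Proof.
have c2 := closed_coef2; have c1 := closed_coef1; have dx := Cd Cx; have dy := Cd Cy.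
rewrite /pdisc /disc.
by do !(exact: dx || exact: dy || exact: c1 || exact: c2 || exact: Ccst ||
    apply: CB || apply: CD || apply: CX || apply: CM).
Qed.

Lemma closed_hess_part i : C (fun z => hess_part i (x z) (y z)).
Proof.
have c2 := closed_coef2; have c1 := closed_coef1; have dx := Cd Cx; have dy := Cd Cy.
by rewrite /hess_part; elim/ord3E : i => /=;
  do !(exact: dx || exact: dy || exact: c1 || exact: c2 || exact: Ccst ||
    apply: CB || apply: CD || apply: CX || apply: CM).
Qed.

End ClosedCovariants.

Definition rows2 n (e f : 'rV[R]_n) : 'M[R]_(2, n) := \matrix_(i < 2) [:: e; f]`_i.

Lemma rows2_mul n (v : 'rV[R]_2) (e f : 'rV[R]_n) : v *m rows2 e f = v 0 0 *: e + v 0 1 *: f.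
Proof. by rewrite mulmx_sum_row sum2E !rowK. Qed.

Lemma row_free_pencil (e f : 'rV[R]_6) : ~ phess0 e f -> row_free (rows2 e f).
Proof.
move=> H; apply: inj_row_free => v; rewrite rows2_mul.
move=> E; apply: contrapT => v0; apply: H; apply: (phess0_dependent E).
apply: contraT; rewrite negb_or !negbK => /andP[/eqP h0 /eqP h1]; case: v0.
by apply: row2P; rewrite mxE.
Qed.

Lemma row_mx0_inj (A : 'rV[R]_4) (B : 'rV[R]_2) : row_mx A B = 0 -> A = 0 /\ B = 0.
Proof. by move/eqP; rewrite row_mx_eq0 => /andP[/eqP -> /eqP ->]. Qed.

(** [hatm Q] has rank 4 and its left kernel is spanned by [e] and [f], so two columns dual to [e]
    and [f] complete it to an invertible matrix. *)
Lemma kernel_annihilator (Q : @net R) e f : hat_free Q -> e *m hatm Q = 0 -> f *m hatm Q = 0 ->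
  ~ phess0 e f -> exists B : 'M[R]_(6, 2), [/\ row_mx (hatm Q) B \in unitmx,
    e *m B = delta_mx 0 0 & f *m B = delta_mx 0 1].
Proof.
move=> Qf eh fh H; have fr := row_free_pencil H.
have /row_freeP[B WB] := fr.
exists B; split.
- apply: mulmx_inj_unitmx => v; apply: contra => /eqP.
  rewrite (mul_mx_row v (hatm Q) B : @mulmx R 1 6 6 v (row_mx (hatm Q) B) = _) => vN.
  have [vh vB] : v *m hatm Q = 0 /\ v *m B = 0 by apply: row_mx0_inj.
  have rk : \rank (hatm Q) = 4%N.
    apply/eqP; rewrite -mxrank_tr -/(row_free (hatm Q)^T); apply: inj_row_free => l lh.
    rewrite -[l]trmxK (Qf l^T) ?trmx0 //.
    by rewrite -[LHS]trmxK trmx_mul trmxK lh trmx0.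
  have WK : (rows2 e f <= kermx (hatm Q))%MS.
    apply/sub_kermxP/row_matrixP; apply: ord2E; rewrite row_mul rowK /= ?eh ?fh;
    by apply/rowP => j; rewrite !mxE.
  have KW : (kermx (hatm Q) <= rows2 e f)%MS.
    by rewrite -(mxrank_leqif_sup WK) mxrank_ker rk; move/eqP: fr => ->.
  have /submxP[D vE] : (v <= rows2 e f)%MS.
    by apply: submx_trans KW; apply/sub_kermxP.
  by apply/eqP; move: vB; rewrite vE -mulmxA WB mulmx1 => ->; rewrite mul0mx.
- by have := congr1 (row 0) WB; rewrite row1 row_mul rowK.
- by have := congr1 (row 1) WB; rewrite row1 row_mul rowK.
Qed.

Lemma mx_entry_cont m n (A : 'M[R]_(m.+1, n.+1)) i j : cont_at A (fun B : 'M[R]_(m.+1, n.+1) => B i j).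
Proof. exact: coord_continuous. Qed.

Lemma row_mx_l m (A : 'M[R]_(m, 4)) (B : 'M[R]_(m, 2)) i (j : 'I_6) (k : 'I_4) : j = k :> nat ->
  (row_mx A B : 'M[R]_(m, 6)) i j = A i k.
Proof.
move=> jk; have -> : j = (lshift 2 k : 'I_6) by apply: ord_inj; rewrite jk.
exact: row_mxEl.
Qed.

Lemma row_mx_r m (A : 'M[R]_(m, 4)) (B : 'M[R]_(m, 2)) i (j : 'I_6) (k : 'I_2) : j = (4 + k)%N :> nat ->
  (row_mx A B : 'M[R]_(m, 6)) i j = B i k.
Proof.
move=> jk; have -> : j = (rshift 4 k : 'I_6) by apply: ord_inj; rewrite jk.
exact: row_mxEr.
Qed.

(** The complement [B] stays fixed while [Q] varies. The last two rows of the adjugate of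
    [row_mx (hatm Q) B] annihilate [hatm Q] and are continuous in [Q]; at [Q0] they are [e0] and
    [f0] times the determinant. Near [Q0] the matrix stays invertible, which yields [hat_free]. *)
Lemma open_pencil (Q0 : @net R) e0 f0 : hat_free Q0 -> e0 *m hatm Q0 = 0 -> f0 *m hatm Q0 = 0 ->
  ~ phess0 e0 f0 -> exists (E F : @net R -> 'rV[R]_6) (k : R),
  [/\ mx_closed (cont_at Q0) E /\ mx_closed (cont_at Q0) F, k != 0,
      E Q0 = k *: e0 /\ F Q0 = k *: f0 &
      \forall Q \near Q0, [/\ hat_free Q, E Q *m hatm Q = 0 & F Q *m hatm Q = 0]].
Proof.
move=> Qf eh fh H; have [B [uN eB fB]] := kernel_annihilator Qf eh fh H.
pose N (Q : @net R) : 'M[R]_6 := row_mx (hatm Q) B.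
have cN : mx_closed (cont_at Q0) N.
  move=> i j; case: (splitP (j : 'I_(4 + 2))) => k jk.
    apply: (@closed_ext _ _ (cont_at Q0) (fun Q => hatm Q i k)).
      by move=> Q; rewrite /N (row_mx_l _ _ _ jk).
    case: (unliftP ord_max k) => [l ->|->].
      apply: (@closed_ext _ _ (cont_at Q0) (fun Q : @net R => Q l i)); first by move=> Q; rewrite hatm_lift.
      exact: mx_entry_cont.
    apply: (@closed_ext _ _ (cont_at Q0) (fun=> (i < 3)%:R)); first by move=> Q; rewrite hatm_max.
    exact: cont_cst.
  apply: (@closed_ext _ _ (cont_at Q0) (fun=> B i k)).
    by move=> Q; rewrite /N (row_mx_r _ _ _ jk).
  exact: cont_cst.
have cadj := closed_adj (@cont_cst _ Q0) (@contD _ Q0) (@contM _ Q0) cN.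
pose r4 : 'I_6 := rshift 4 (0 : 'I_2); pose r5 : 'I_6 := rshift 4 (1 : 'I_2).
have adjN Q (i : 'I_2) : row (rshift 4 i : 'I_6) (\adj (N Q)) *m hatm Q = 0.
  have := congr1 (row (rshift 4 i : 'I_6)) (mul_adj_mx (N Q)); rewrite row_mul {2}/N.
  move: (row _ (\adj _)) => w.
  rewrite (mul_mx_row w (hatm Q) B : @mulmx R 1 6 6 w (row_mx (hatm Q) B) = _) => E.
  apply/rowP => j; have jl : (lshift 2 j : 'I_6) = j :> nat by [].
  have := congr1 (fun A : 'rV[R]_6 => A 0 (lshift 2 j)) E; rewrite (row_mx_l _ _ _ jl) => ->.
  rewrite !mxE; have -> : (rshift 4 i == lshift 2 j :> 'I_6) = false.
    by apply/negP => /eqP/(congr1 val) /= h; have := ltn_ord j; rewrite -h.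
  by [].
have r_mul (e : 'rV[R]_6) (i : 'I_2) : e *m hatm Q0 = 0 -> e *m B = delta_mx 0 i ->
    row (rshift 4 i : 'I_6) (\adj (N Q0)) = \det (N Q0) *: e.
  move=> eh' eB'; rewrite -mul_mx_scalar -mul_mx_adj mulmxA {1}/N rowE.
  rewrite (mul_mx_row e (hatm Q0) B : @mulmx R 1 6 6 e (row_mx (hatm Q0) B) = _) eh' eB'.
  congr (_ *m _); apply/rowP => j; case: (splitP (j : 'I_(4 + 2))) => k jk.
    rewrite (row_mx_l _ _ _ jk) !mxE eqxx /=; case: eqP => // /(congr1 val) /= h.
    by have := ltn_ord k; rewrite -jk h.
  rewrite (row_mx_r _ _ _ jk) !mxE /=; congr (_ %:R); congr nat_of_bool.
  rewrite ?eqxx /=; apply/eqP/eqP => [/(congr1 val) /=|ki].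
    by rewrite jk => /addnI/ord_inj.
  by apply: ord_inj; rewrite jk ki.
exists (fun Q => row r4 (\adj (N Q))), (fun Q => row r5 (\adj (N Q))), (\det (N Q0)); split.
- by split=> i j; [apply: (@closed_ext _ _ (cont_at Q0) _ _ _ (cadj r4 j))
    |apply: (@closed_ext _ _ (cont_at Q0) _ _ _ (cadj r5 j))] => Q; rewrite [RHS]mxE.
- by rewrite -unitfE -unitmxE.
- by split; apply: r_mul.
have cdet : \forall Q \near Q0, \det (N Q) != 0.
  have cd := closed_det (@cont_cst _ Q0) (@contD _ Q0) (@contM _ Q0) cN.
  have d0 : \det (N Q0) != 0 by rewrite -unitfE -unitmxE.
  exact: (cont_neq0 cd d0).
near=> Q; split; [|exact: adjN|exact: adjN].
have uNQ : N Q \in unitmx by rewrite unitmxE unitfE; near: Q.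
move=> l Ql; have : N Q *m (col_mx l 0 : 'M_(4 + 2, 1)) = 0.
  rewrite (mul_row_col (hatm Q) B l 0 : @mulmx R 6 6 1 (row_mx (hatm Q) B) (col_mx l 0) = _).
  by rewrite Ql mulmx0 addr0.
move/(congr1 (mulmx (invmx (N Q)))); rewrite mulKmx // mulmx0 => /eqP.
by rewrite (col_mx_eq0 l (0 : 'M_(2, 1)) : (_ == 0 :> 'cV[R]_6) = _) => /andP[/eqP].
Unshelve. all: by end_near. Qed.

Lemma scale_pair (x y : 'rV[R]_6) k : k != 0 ->
  pdisc (k *: x) (k *: y) = (k ^+ 3) ^+ 4 * pdisc x y /\ (phess0 (k *: x) (k *: y) <-> phess0 x y).
Proof.
move=> k0; have E s t : dets (s *: (k *: x) + t *: (k *: y)) = k ^+ 3 * dets (s *: x + t *: y).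
  by rewrite /dets !mxE; ring.
by have [D H] := scale_coefs E; split=> //; apply: H; rewrite expf_neq0.
Qed.

(** The third clause stops at the Hessian: for type 5 the vanishing of the discriminant is not an
    open condition and has to come from the orbit. *)
Theorem near_surface (Q0 : @net R) e0 f0 : hat_free Q0 -> e0 *m hatm Q0 = 0 -> f0 *m hatm Q0 = 0 ->
  [/\ pdisc e0 f0 < 0 -> \forall Q \near Q0, cross_cap_surface (net_map Q),
      0 < pdisc e0 f0 -> \forall Q \near Q0, roman_steiner_surface (net_map Q) &
      ~ phess0 e0 f0 -> \forall Q \near Q0, exists e f, [/\ hat_free Q, e *m hatm Q = 0,
        f *m hatm Q = 0 & ~ phess0 e f]].
Proof.
move=> Qf eh fh; have [h|h] := pselect (phess0 e0 f0).
  by rewrite /pdisc (hess0_disc h) ltxx; split.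
have [E [F [k [[cE cF] k0 [EQ FQ] nQ]]]] := open_pencil Qf eh fh h.
have [Dk Hk] := scale_pair e0 f0 k0; rewrite -EQ -FQ in Dk Hk.
have k12 : 0 < (k ^+ 3) ^+ 4 by rewrite exprn_even_gt0 //= expf_neq0.
have cD : cont_at Q0 (fun Q => pdisc (E Q) (F Q)).
  exact: (closed_pdisc (@cont_cst _ Q0) (@contD _ Q0) (@contM _ Q0) cE cF).
split.
- move=> d0; have D0 : pdisc (E Q0) (F Q0) < 0 by rewrite Dk pmulr_rlt0.
  have nD : \forall Q \near Q0, pdisc (E Q) (F Q) < 0 by exact: (cont_lt0 cD D0).
  near=> Q; have [//|Qf' E0 F0] := near nQ Q.
  by have [S _ _] := surface_of_kernel Qf' E0 F0; apply: S; near: Q.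
- move=> d0; have D0 : 0 < pdisc (E Q0) (F Q0) by rewrite Dk pmulr_rgt0.
  have nD : \forall Q \near Q0, 0 < pdisc (E Q) (F Q) by exact: (cont_gt0 cD D0).
  near=> Q; have [//|Qf' E0 F0] := near nQ Q.
  by have [_ S _] := surface_of_kernel Qf' E0 F0; apply: S; near: Q.
- move=> _; have [i hi] : exists i, hess_part i (E Q0) (F Q0) != 0 by apply: phess_part => /Hk.
  have cH := closed_hess_part (@cont_cst _ Q0) (@contD _ Q0) (@contM _ Q0) cE cF i.
  have nH : \forall Q \near Q0, hess_part i (E Q) (F Q) != 0 by exact: (cont_neq0 cH hi).
  near=> Q; exists (E Q), (F Q); have [//|Qf' E0 F0] := near nQ Q; split=> //.
  by move/phess0P/(_ i)/eqP; apply/negP; near: Q.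
Unshelve. all: by end_near. Qed.

End Openness.

(** * Density: polynomial paths inside an orbit *)

Section Density.
Context {R : realType}.

Definition polyfun (f : R -> R) := exists p : {poly R}, forall t, f t = p.[t].

Lemma polyfun_cst a : polyfun (fun=> a).
Proof. by exists a%:P => t; rewrite hornerC. Qed.
Lemma polyfunD f g : polyfun f -> polyfun g -> polyfun (fun t => f t + g t).
Proof. by move=> [p pE] [q qE]; exists (p + q) => t; rewrite hornerD pE qE. Qed.
Lemma polyfunM f g : polyfun f -> polyfun g -> polyfun (fun t => f t * g t).
Proof. by move=> [p pE] [q qE]; exists (p * q) => t; rewrite hornerM pE qE. Qed.

Lemma polyfun_cont f x : polyfun f -> cont_at x f.
Proof. by move=> [p pE]; rewrite /cont_at (_ : f = horner p); [exact: continuous_horner|apply/funext]. Qed.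

(** A polynomial vanishing on the whole interval would have the roots [d / i.+2], more of them than
    its size allows. *)
Lemma polyfun_small f (d : R) : polyfun f -> f 1 != 0 -> 0 < d -> exists t, 0 < t < d /\ f t != 0.
Proof.
move=> [p pE] f1 d0; apply: contrapT => H.
have pt t : 0 < t < d -> p.[t] = 0.
  by move=> td; apply/eqP; rewrite -pE; apply: contrapT => /negP ft; apply: H; exists t.
have p0 : p != 0 by apply: contra f1 => /eqP p0; rewrite pE p0 horner0.
pose rs := [seq d / (i.+2)%:R | i <- iota 0 (size p)].
have urs : uniq rs.
  rewrite map_inj_uniq ?iota_uniq // => i j /(mulfI (lt0r_neq0 d0))/invr_inj/eqP.
  by rewrite eqr_nat => /eqP[].
have ars : all (root p) rs.
  apply/allP => _ /mapP[i _ ->]; rewrite rootE pt //.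
  by rewrite divr_gt0 ?ltr0n //= ltr_pdivrMr ?ltr0n // ltr_pMr // ltr1n.
by have := max_poly_roots p0 ars urs; rewrite size_map size_iota ltnn.
Qed.

Definition net_of o g c (S T : 'M[R]_3) : @net R := (actm S *m nfm o g c *m T)^T.

Lemma net_ofE o g c S T u : net_map (net_of o g c S T) u = normal_form o g c (u *m S) *m T.
Proof. by rewrite net_mapE trmxK !mulmxA -act_mx -ver_act -nf_ver. Qed.

Lemma net_of_eq o g c S T (Q : @net R) :
  (forall u, net_map Q u = normal_form o g c (u *m S) *m T) -> Q = net_of o g c S T.
Proof.
move=> H; apply: trmx_inj; apply: ver_inj => u.
by rewrite -[LHS]net_mapE -[RHS]net_mapE H net_ofE.
Qed.

Lemma net_of_framed o g c (K T : 'M[R]_3) : K \in unitmx ->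
  framed (net_of o g c (invmx K) T) o g c K T.
Proof. by move=> uK v; rewrite net_ofE mulmxK. Qed.

Lemma dualZ o g c s (r : 'rV[R]_3) : dual o g c (s *: r) = s *: dual o g c r.
Proof. by have := dual_linear o g c s 0 r 0; rewrite !scale0r !addr0. Qed.

Lemma nfZ o g c s (u : 'rV[R]_3) : normal_form o g c (s *: u) = s ^+ 2 *: normal_form o g c u.
Proof. by rewrite !nf_ver verZ scalemxAl. Qed.

(** The adjugate replaces the inverse of [S] so that the frame is polynomial in [S]; since normal
    forms are quadratic, the factor [\det S] comes out squared and is absorbed by the target. *)
Lemma framed_adj Q o g c (S T : 'M[R]_3) : (forall u, net_map Q u = normal_form o g c (u *m S) *m T) ->
  framed Q o g c (\adj S) (\det S ^+ 2 *: T).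
Proof.
by move=> QE v; rewrite QE -mulmxA mul_adj_mx mul_mx_scalar nfZ -scalemxAl scalemxAr.
Qed.

Lemma px_scale o g c d (K : 'M[R]_3) p : px o g c (d *: K) p = d ^+ 2 *: px o g c K p.
Proof.
rewrite /px -dualZ; congr (dual _ _ _ _).
have -> : ell o g c (d *: K) = d ^+ 2 *: ell o g c K.
  apply/rowP => i; have lE (K' : 'M[R]_3) : ell o g c K' 0 i = tr6 (act K' (dual o g c (delta_mx 0 i))).
    by rewrite mxE.
  rewrite [RHS]mxE !lE !tr6_act.
  have rZ j : row j (d *: K) = d *: row j K by apply/rowP => k; rewrite !mxE.
  by rewrite !rZ !dotZl !dotZr; ring.
by move: (ell o g c K) => l; apply: row3P; rewrite !mxE /=; ring.
Qed.

Lemma hess_part_scale i k (x y : 'rV[R]_6) : hess_part i (k *: x) (k *: y) = (k ^+ 3) ^+ 2 * hess_part i x y.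
Proof.
have dZ a (z : 'rV[R]_6) : dets (a *: z) = a ^+ 3 * dets z by rewrite /dets !mxE; ring.
rewrite /hess_part /coef2 /coef1 -scalerDr -scalerBr !dZ.
move: (dets x) (dets y) (dets (x + y)) (dets (x - y)) => a b m n.
by elim/ord3E : i => /=; field.
Qed.

Section ClosedFrames.
Variables (X : Type) (C : (X -> R) -> Prop).
Hypotheses (Ccst : forall a, C (fun=> a)) (CD : forall f g, C f -> C g -> C (fun x => f x + g x))
  (CM : forall f g, C f -> C g -> C (fun x => f x * g x)).
Variable (K : X -> 'M[R]_3).
Hypothesis CK : mx_closed C K.

Let CB := closedB Ccst CD CM.
Let CX := closedX Ccst CM.
Let Csum := closed_sum Ccst CD.

Lemma closed_row3 (a b d : X -> R) : C a -> C b -> C d ->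
  mx_closed C (fun x => row3 (a x) (b x) (d x)).
Proof.
move=> Ca Cb Cd' i; apply: ord3E.
- by apply: (@closed_ext _ _ C a) => // x; rewrite mxE.
- by apply: (@closed_ext _ _ C b) => // x; rewrite mxE.
- by apply: (@closed_ext _ _ C d) => // x; rewrite mxE.
Qed.

Lemma closed_row6 (a b d e f h : X -> R) : C a -> C b -> C d -> C e -> C f -> C h ->
  mx_closed C (fun x => row6 (a x) (b x) (d x) (e x) (f x) (h x)).
Proof.
move=> Ca Cb Cd' Ce Cf Ch i; apply: ord6E.
- by apply: (@closed_ext _ _ C a) => // x; rewrite mxE.
- by apply: (@closed_ext _ _ C b) => // x; rewrite mxE.
- by apply: (@closed_ext _ _ C d) => // x; rewrite mxE.
- by apply: (@closed_ext _ _ C e) => // x; rewrite mxE.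
- by apply: (@closed_ext _ _ C f) => // x; rewrite mxE.
- by apply: (@closed_ext _ _ C h) => // x; rewrite mxE.
Qed.

Lemma closed_dot_rows i j : C (fun x => dot (row i (K x)) (row j (K x))).
Proof.
apply: (@closed_ext _ _ C (fun x => \sum_k K x i k * K x j k)); last first.
  by apply: Csum => k; apply: CM; exact: CK.
by move=> x; apply: eq_bigr => k _; rewrite !mxE.
Qed.

Lemma closed_ell o g c : mx_closed C (fun x => ell o g c (K x)).
Proof.
move=> a i; pose D := dual o g c (delta_mx 0 i).
apply: (@closed_ext _ _ C (fun x => tr6 (act (K x) D))); first by move=> x; rewrite mxE.
have dC i' j' := closed_dot_rows i' j'.
apply: (@closed_ext _ _ C _ _ (fun x => esym (tr6_act (K x) D))).
by do !(exact: dC || exact: Ccst || apply: CD || apply: CM).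
Qed.

Lemma closed_px o g c p : mx_closed C (fun x => px o g c (K x) p).
Proof.
move=> a j; have cl := closed_ell o g c; rewrite ord1.
have cc : mx_closed C (fun x => cross (ell o g c (K x)) p).
  by apply: closed_row3; apply: CB; apply: CM; first [exact: cl|exact: Ccst].
apply: (@closed_ext _ _ C (fun x => \sum_i cross (ell o g c (K x)) p 0 i * dual o g c (delta_mx 0 i) 0 j)).
  move=> x; rewrite /px; move: (cross _ _) => r.
  have dDD r1 r2 : dual o g c (r1 + r2) = dual o g c r1 + dual o g c r2.
    by have := dual_linear o g c 1 1 r1 r2; rewrite !scale1r.
  have d0 : dual o g c 0 = 0 by have := dualZ o g c 0 0; rewrite !scale0r.
  rewrite [in RHS](row_sum_delta r) (big_morph (dual o g c) dDD d0) summxE.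
  by apply: eq_bigr => i _; rewrite dualZ mxE.
by apply: Csum => i; apply: CM; [exact: cc|exact: Ccst].
Qed.

Lemma closed_net_of o g c T : mx_closed C (fun x => net_of o g c (K x) T).
Proof.
have CA : mx_closed C (fun x => actm (K x)).
  move=> i j; apply: (@closed_ext _ _ C (fun x => act (K x) (delta_mx 0 i) 0 j)).
    by move=> x; rewrite [RHS]mxE.
  have cr k l : C (fun x => row k (K x) 0 l).
    by apply: (@closed_ext _ _ C (fun x => K x k l)) (CK k l) => x; rewrite mxE.
  have cv k : C (fun x => ver (row k (K x)) 0 j).
    apply: (closed_row6 (a := fun x => row k (K x) 0 0 ^+ 2) (b := fun x => row k (K x) 0 1 ^+ 2)
      (d := fun x => row k (K x) 0 2 ^+ 2) (e := fun x => row k (K x) 0 1 * row k (K x) 0 2)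
      (f := fun x => row k (K x) 0 0 * row k (K x) 0 2) (h := fun x => row k (K x) 0 0 * row k (K x) 0 1));
      (apply: CX || apply: CM); exact: cr.
  have cp k l : C (fun x => pver (row k (K x)) (row l (K x)) 0 j).
    apply: (closed_row6 (a := fun x => 2 * (row k (K x) 0 0 * row l (K x) 0 0))
      (b := fun x => 2 * (row k (K x) 0 1 * row l (K x) 0 1)) (d := fun x => 2 * (row k (K x) 0 2 * row l (K x) 0 2))
      (e := fun x => row k (K x) 0 1 * row l (K x) 0 2 + row k (K x) 0 2 * row l (K x) 0 1)
      (f := fun x => row k (K x) 0 0 * row l (K x) 0 2 + row k (K x) 0 2 * row l (K x) 0 0)
      (h := fun x => row k (K x) 0 0 * row l (K x) 0 1 + row k (K x) 0 1 * row l (K x) 0 0));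
      by do !(exact: cr || exact: Ccst || apply: CD || apply: CM).
  have E x : act (K x) (delta_mx 0 i) 0 j = (delta_mx 0 i : 'rV[R]_6) 0 0 * ver (row 0 (K x)) 0 j +
      (delta_mx 0 i : 'rV[R]_6) 0 1 * ver (row 1 (K x)) 0 j + (delta_mx 0 i : 'rV[R]_6) 0 2 * ver (row 2 (K x)) 0 j +
      (delta_mx 0 i : 'rV[R]_6) 0 3 * pver (row 1 (K x)) (row 2 (K x)) 0 j +
      (delta_mx 0 i : 'rV[R]_6) 0 4 * pver (row 0 (K x)) (row 2 (K x)) 0 j +
      (delta_mx 0 i : 'rV[R]_6) 0 5 * pver (row 0 (K x)) (row 1 (K x)) 0 j.
    rewrite /act; move: (delta_mx 0 i) => d.
    move: (ver _) (ver _) (ver _) (pver _ _) (pver _ _) (pver _ _) => a1 a2 a3 a4 a5 a6.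
    by rewrite !mxE.
  apply: (@closed_ext _ _ C _ _ (fun x => esym (E x))).
  by do !(exact: cv || exact: cp || exact: Ccst || apply: CD || apply: CM).
have Ccm m n (A : 'M[R]_(m, n)) : mx_closed C (fun=> A) by move=> i j; exact: Ccst.
have CN := closed_mulmx Ccst CD CM (closed_mulmx Ccst CD CM CA (Ccm _ _ (nfm o g c))) (Ccm _ _ T).
by move=> i j; apply: (@closed_ext _ _ C _ _ _ (CN j i)) => x; rewrite [RHS]mxE.
Qed.

End ClosedFrames.

(* The path joins the given frame to a good one; the covariant [Phi] is polynomial along it. *)
Lemma dense_frame o g c (S1 T1 K0 : 'M[R]_3) p q (Phi : 'rV[R]_6 -> 'rV[R]_6 -> R) (U : set (@net R)) :
  S1 \in unitmx -> T1 \in unitmx -> K0 \in unitmx -> nbhs (net_of o g c S1 T1) U ->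
  (forall x y : R -> 'rV[R]_6, mx_closed polyfun x -> mx_closed polyfun y -> polyfun (fun t => Phi (x t) (y t))) ->
  (forall k x y, k != 0 -> Phi x y != 0 -> Phi (k *: x) (k *: y) != 0) ->
  Phi (px o g c K0 p) (px o g c K0 q) != 0 ->
  exists Q (K T : 'M[R]_3), [/\ U Q, K \in unitmx, T \in unitmx, framed Q o g c K T &
    Phi (px o g c K p) (px o g c K q) != 0].
Proof.
move=> uS1 uT1 uK0 /nbhs_ballP[eps eps0 ballU] cPhi sPhi Phi0.
pose S0 := invmx K0; have uS0 : S0 \in unitmx by rewrite unitmx_inv.
pose S (t : R) := S1 + t *: (S0 - S1).
have cS : mx_closed polyfun S.
  move=> i j; exists ((S1 i j)%:P + (S0 i j - S1 i j)%:P * 'X) => t.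
  by rewrite !hornerE !mxE mulrC.
have cK := closed_adj polyfun_cst polyfunD polyfunM cS.
have cQ := closed_net_of polyfun_cst polyfunD polyfunM cS o g c T1.
have cdet := closed_det polyfun_cst polyfunD polyfunM cS.
(* The factor [\det (S t)] merges two requirements into one: that [S t] be invertible and that [Phi]
   not vanish. *)
have cF : polyfun (fun t => \det (S t) * Phi (px o g c (\adj (S t)) p) (px o g c (\adj (S t)) q)).
  apply: polyfunM => //; apply: cPhi; exact: (closed_px polyfun_cst polyfunD polyfunM cK).
have S00 : S 0 = S1 by rewrite /S scale0r addr0.
have S11 : S 1 = S0 by rewrite /S scale1r addrC subrK.
have F1 : \det (S 1) * Phi (px o g c (\adj (S 1)) p) (px o g c (\adj (S 1)) q) != 0.
  have d0 : \det S0 != 0 by rewrite -unitfE -unitmxE.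
  have -> : \adj (S 1) = \det S0 *: K0.
    by rewrite S11 -mul_scalar_mx -mul_adj_mx -mulmxA mulVmx // mulmx1.
  by rewrite S11 mulf_neq0 // !px_scale; apply: sPhi => //; rewrite sqrf_eq0.
have near0 : \forall t \near (0 : R), forall i j,
    ball (net_of o g c S1 T1 i j) eps (net_of o g c (S t) T1 i j).
  have Hij (i : 'I_3) (j : 'I_6) : \forall t \near (0 : R), ball (net_of o g c S1 T1 i j) eps (net_of o g c (S t) T1 i j).
    have H : (fun t => net_of o g c (S t) T1 i j) @ (0 : R) --> net_of o g c (S 0) T1 i j.
      exact: (@polyfun_cont _ 0 (cQ i j)).
    rewrite S00 in H; exact: (cvg_ball H eps0).
  exact: (filter_forall (nbhs_filter (0 : R)) (fun i => filter_forall (nbhs_filter (0 : R)) (Hij i))).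
have /nbhs_ballP[d d0 dP] := near0.
have [t [/andP[t0 td] Ft]] := polyfun_small cF F1 d0.
have [dt Pt] : \det (S t) != 0 /\ Phi (px o g c (\adj (S t)) p) (px o g c (\adj (S t)) q) != 0.
  by apply/andP; rewrite -negb_or -mulf_eq0.
exists (net_of o g c (S t) T1), (\adj (S t)), (\det (S t) ^+ 2 *: T1); split=> //.
- apply: ballU; have H : forall i j, ball (net_of o g c S1 T1 i j) eps (net_of o g c (S t) T1 i j).
    by apply: dP; rewrite /ball /= sub0r normrN gtr0_norm.
  exact: (conj eps0 H).
- have uSt : S t \in unitmx by rewrite unitmxE unitfE.
  have := mul_adj_mx (S t) => /(congr1 (mulmx^~ (invmx (S t)))); rewrite mulmxK // => ->.
  by rewrite mul_scalar_mx unitmxZ ?unitmx_inv // unitfE.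
- by rewrite unitmxZ // unitfE sqrf_eq0.
- by apply: framed_adj => u; rewrite net_ofE.
Qed.

End Density.

(** * Monge forms with prescribed second fundamental form *)

Section MongeForms.
Context {R : realType}.

Lemma pver_mx (x v : 'rV[R]_3) : pver x v = x *m \matrix_(i < 3) pver (delta_mx 0 i) v.
Proof.
rewrite mulmx_sum_row sum3E !rowK {1}[x]row_sum_delta sum3E pverC !pverDr !pverZr.
by rewrite ![pver v (delta_mx _ _)]pverC.
Qed.

Variables (p : nat) (A : 'M[R]_(3, p.+1)) (B : 'M[R]_(6, p.+1)).

Lemma smooth_quadratic x : smooth_at (fun u : 'rV[R]_3 => u *m A + ver u *m B) x.
Proof.
apply/smooth_row => j.
apply: (@smooth_at_eq _ _ _ (fun u : 'rV[R]_3 => (u *m A) 0 j + (ver u *m B) 0 j)).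
  by move=> u; rewrite [RHS]mxE.
apply: smoothD.
- by apply: ((smooth_row (fun u : 'rV[R]_3 => u *m A) x).2 (linear_row_smooth (mulmxr A) x) j).
- by apply: ((smooth_row (fun u : 'rV[R]_3 => ver u *m B) x).2 (smooth_mulmx B (smooth_ver x)) j).
Qed.

Lemma derive_affine (c : 'rV[R]_p.+1) x w : 'D_w (fun u : 'rV[R]_3 => c + u *m A) x = w *m A.
Proof.
have sA := linear_row_smooth (mulmxr A).
rewrite (_ : (fun u : 'rV[R]_3 => c + u *m A) = cst c + (mulmxr A : 'rV[R]_3 -> 'rV[R]_p.+1)) //.
rewrite deriveD ?derive_cst ?add0r; last 2 first.
- by [].
- exact/diff_derivable/smooth_at_differentiable.
by rewrite derive_linear // => y; exact: smooth_at_continuous.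
Qed.

Lemma derive_quadratic x w :
  'D_w (fun u : 'rV[R]_3 => u *m A + ver u *m B) x = w *m A + pver x w *m B.
Proof.
have sA := linear_row_smooth (mulmxr A).
rewrite (_ : (fun u : 'rV[R]_3 => u *m A + ver u *m B) =
  (mulmxr A : 'rV[R]_3 -> 'rV[R]_p.+1) + (fun u => ver u *m B)) //.
rewrite deriveD ?derive_ver_mul ?derive_linear //.
- by move=> y; exact: smooth_at_continuous.
- exact/diff_derivable/smooth_at_differentiable.
- exact/diff_derivable/smooth_at_differentiable/(smooth_mulmx B (smooth_ver x)).
Qed.

End MongeForms.

Section Monge.
Context {R : realType}.

Lemma derive2_quadratic p (A : 'M[R]_(3, p.+1)) (B : 'M[R]_(6, p.+1)) x w :
  'D_w ('D_w (fun u : 'rV[R]_3 => u *m A + ver u *m B)) x = 2 *: (ver w *m B).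
Proof.
have -> : 'D_w (fun u : 'rV[R]_3 => u *m A + ver u *m B) =
    (fun x : 'rV[R]_3 => w *m A + x *m (\matrix_(i < 3) pver (delta_mx 0 i) w *m B)).
  by apply/funext => y; rewrite derive_quadratic pver_mx mulmxA.
by rewrite derive_affine mulmxA -pver_mx pver_diag scalemxAl.
Qed.

(** The factor 1/2 compensates for the second derivative along [u] of a quadratic map, which is
    twice its value at [u]. *)
Definition monge (Q : @net R) (u : 'rV[R]_3) : 'rV[R]_(3 + 3) := row_mx u (2^-1 *: net_map Q u).

Lemma monge_quadratic Q : monge Q =
  fun u => u *m row_mx 1%:M 0 + ver u *m row_mx 0 (2^-1 *: Q^T).
Proof.
apply/funext => u; rewrite !mul_mx_row mulmx1 !mulmx0 add_row_mx addr0 add0r -scalemxAr.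
by rewrite -net_mapE.
Qed.

Lemma monge_formP Q : monge_form (monge Q) /\ second_fundamental_form (monge Q) = net_map Q.
Proof.
pose A : 'M[R]_(3, 3 + 3) := row_mx 1%:M 0.
pose B : 'M[R]_(6, 3 + 3) := row_mx 0 (2^-1 *: Q^T).
split; last first.
  apply/funext => u; rewrite /second_fundamental_form monge_quadratic.
  have E : 'D_u ('D_u (fun u : 'rV[R]_3 => u *m A + ver u *m B)) 0 = 2 *: (ver u *m B).
    exact: (derive2_quadratic (A : 'M[R]_(3, 6)) (B : 'M[R]_(6, 6)) 0 u).
  rewrite E /B mul_mx_row mulmx0 scale_row_mx row_mxKr -scalemxAr scalerA divff ?pnatr_eq0 //.
  by rewrite scale1r -net_mapE.
split.
- by rewrite monge_quadratic; apply/smooth_nearP; exact: (smooth_quadratic (A : 'M[R]_(3, 6)) (B : 'M[R]_(6, 6)) 0).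
- by apply: near_all_pts => u; rewrite row_mxKl.
- rewrite row_mxKr -[X in net_map Q X](scale0r (0 : 'rV[R]_3)) net_mapZ.
  by rewrite expr0n scale0r scaler0.
- move=> v; rewrite monge_quadratic.
  have E : 'D_v (fun u : 'rV[R]_3 => u *m A + ver u *m B) 0 = v *m A + pver 0 v *m B.
    exact: (derive_quadratic (A : 'M[R]_(3, 6)) (B : 'M[R]_(6, 6)) 0 v).
  have p0 : pver 0 v = 0 by rewrite pver_mx mul0mx.
  by rewrite E p0 mul0mx addr0 mul_mx_row mulmx1 mulmx0 row_mxKr.
Qed.

End Monge.

(** * The types of surfaces exclude each other *)

Section Exclusivity.
Context {R : realType} (Q : @net R).
Local Notation F := (net_map Q).

Lemma immersive_opp u : immersive_at F u -> immersive_at F (- u).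
Proof.
move=> imm w tw w0.
have tw' : tangent u w by move: tw; rewrite /tangent /= -scaleN1r dotZl mulN1r => /eqP; rewrite oppr_eq0 => /eqP.
have E : pnet Q (- u) w = - pnet Q u w by rewrite pnetC -scaleN1r pnetZr scaleN1r pnetC.
by have := imm w tw' w0; rewrite !derive_net E oppr_eq0.
Qed.

Lemma immersive_pm s u : (forall v, v \in s -> immersive_at F v) -> pm s u -> immersive_at F u.
Proof.
by move=> H /orP[/H //|/H]; rewrite -{2}[u]opprK => /immersive_opp.
Qed.

Lemma pm_self s (u : 'rV[R]_3) : u \in s -> pm s u.
Proof. by rewrite /pm /= => ->. Qed.

(* Separates the types of surfaces: cross-cap and type 6 surfaces are [tame 2 1],
   type 5 surfaces [tame 2 2], Roman ones [tame 3 1]. [Y] is to contain the images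
   of the singular points. *)
Definition tame (k m : nat) := exists Y : seq 'rV[R]_3, forall y, locus F y -> exists s,
  [/\ Defs.preim F y = pm s, (size s <= k)%N &
      (y \in Y /\ (size s <= m)%N) \/ forall v, v \in s -> immersive_at F v].

Lemma regular_tame k m (Y : seq 'rV[R]_3) y : (0 < k)%N -> regular_point F y -> exists s,
  [/\ Defs.preim F y = pm s, (size s <= k)%N &
      (y \in Y /\ (size s <= m)%N) \/ forall v, v \in s -> immersive_at F v].
Proof.
move=> k0 [u E i]; exists [:: u]; split=> //; right=> v.
by rewrite inE => /eqP ->.
Qed.

Lemma transversal_tame (Y : seq 'rV[R]_3) m y : transversal_double_point F y -> exists s,
  [/\ Defs.preim F y = pm s, (size s <= 2)%N &
      (y \in Y /\ (size s <= m)%N) \/ forall v, v \in s -> immersive_at F v].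
Proof.
move=> [u [v [E _ iu iv _]]]; exists [:: u; v]; split=> //; right=> w.
by rewrite !inE => /orP[] /eqP ->.
Qed.

Lemma tangent_tame (Y : seq 'rV[R]_3) m D y : tangent_double_point F D y -> exists s,
  [/\ Defs.preim F y = pm s, (size s <= 2)%N &
      (y \in Y /\ (size s <= m)%N) \/ forall v, v \in s -> immersive_at F v].
Proof.
move=> [u [v [E _ [iu iv] _ _]]]; exists [:: u; v]; split=> //; right=> w.
by rewrite !inE => /orP[] /eqP ->.
Qed.

Lemma arc_cases (gamma : R -> 'rV[R]_3) y : arc_pts gamma y ->
  [\/ y = gamma 0, y = gamma 1 | arc_int gamma y].
Proof.
move=> [t]; rewrite /= in_itv /= => /andP[t0 t1] <-.
have [->|n0] := eqVneq t 0; first by constructor 1.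
have [->|n1] := eqVneq t 1; first by constructor 2.
by constructor 3; exists t => //; rewrite /= in_itv /= !lt_neqAle t0 t1 eq_sym n0 n1.
Qed.

Lemma cross_cap_tame : cross_cap_surface F -> tame 2 1.
Proof.
move=> [ga [_ [u0 E0 _] [u1 E1 _] H reg]]; exists [:: ga 0; ga 1] => y Ly.
have [/arc_cases[->|->|/H]|/(reg y Ly)] := pselect (arc_pts ga y).
- by exists [:: u0]; split=> //; left; rewrite !inE eqxx.
- by exists [:: u1]; split=> //; left; rewrite !inE eqxx orbT.
- exact: transversal_tame.
- exact: regular_tame.
Qed.

(** The second bound is 2 on account of [ta 0], the cross-cap that lies on another sheet: a singular
    value with two preimages up to sign. *)
Lemma type5_tame : type5_surface F -> tame 2 2.
Proof.
move=> [ta [ka [_ [[u [v [E0 _ _ _]]] [u1 E1 _]] H [[k0 K0 _] [k1 K1 _] Hk] reg]]].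
exists [:: ta 0; ta 1; ka 0; ka 1] => y Ly.
have [/arc_cases[->|->|/H]|nt] := pselect (arc_pts ta y).
- by exists [:: u; v]; split=> //; left; rewrite !inE eqxx.
- by exists [:: u1]; split=> //; left; rewrite !inE eqxx !orbT.
- exact: transversal_tame.
have [/arc_cases[->|->|yk]|/(reg y Ly nt)] := pselect (arc_pts ka y).
- by exists [:: k0]; split=> //; left; rewrite !inE eqxx !orbT.
- by exists [:: k1]; split=> //; left; rewrite !inE eqxx !orbT.
- have [yt|/eqP yt] := eqVneq y (ta 0); last exact: (tangent_tame _ _ (Hk y yk (introN eqP yt))).
  by exists [:: u; v]; split; rewrite ?yt //; left; rewrite !inE eqxx.
- exact: regular_tame.
Qed.

Lemma type6_tame : type6_surface F -> tame 2 1.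
Proof.
move=> [ka [_ _ [[u0 E0 _] [u1 E1 _]] H reg]]; exists [:: ka 0; ka 1] => y Ly.
have [/arc_cases[->|->|/H]|/(reg y Ly)] := pselect (arc_pts ka y).
- by exists [:: u0]; split=> //; left; rewrite !inE eqxx.
- by exists [:: u1]; split=> //; left; rewrite !inE eqxx orbT.
- exact: tangent_tame.
- exact: regular_tame.
Qed.

Lemma roman_tame : roman_steiner_surface F -> tame 3 1.
Proof.
move=> [ga [y0 [_ T H D reg]]].
exists (flatten [seq [:: ga i 0; ga i 1] | i <- enum 'I_3]) => y Ly.
have mem i t : t \in [:: ga i 0; ga i 1] -> t \in flatten [seq [:: ga i 0; ga i 1] | i <- enum 'I_3].
  by move=> h; apply/flattenP; exists [:: ga i 0; ga i 1] => //; apply: map_f; rewrite mem_enum.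
have [[i]|n] := pselect (exists i, arc_pts (ga i) y); last first.
  by apply: regular_tame => //; apply: reg => // i yi; apply: n; exists i.
have [[u0 E0 _] [u1 E1 _]] := H i => /arc_cases[->|->|yi].
- by exists [:: u0]; split=> //; left; split=> //; apply: (mem i); rewrite !inE eqxx.
- by exists [:: u1]; split=> //; left; split=> //; apply: (mem i); rewrite !inE eqxx orbT.
have [yE|/eqP ny] := eqVneq y y0; last first.
  have [s [E s2 h]] := transversal_tame (flatten [seq [:: ga i 0; ga i 1] | i <- enum 'I_3]) 1
    (D i y yi (introN eqP ny)).
  by exists s; split=> //; exact: leq_trans s2 _.
have [u [v [w [E _ [iu iv iw] _]]]] := T; exists [:: u; v; w]; split; rewrite ?yE //; right=> x.
by rewrite !inE => /or3P[] /eqP ->.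
Qed.

(** Singular points lie over the finitely many values in [Y], each with finitely many preimages. *)
Lemma tame_finite k m : tame k m -> exists L : seq 'rV[R]_3,
  forall u, sphere u -> singular_at F u -> u \in L.
Proof.
move=> [Y H]; have /choice[S HS] : forall y, exists s, locus F y ->
    [/\ Defs.preim F y = pm s, (size s <= k)%N &
      (y \in Y /\ (size s <= m)%N) \/ forall v, v \in s -> immersive_at F v].
  by move=> y; have [/H[s hs]|h] := pselect (locus F y); [exists s|exists [::]].
exists (flatten [seq S y ++ map -%R (S y) | y <- Y]) => u su sing.
have Lu : locus F (F u) by exists u.
have [E _ h] := HS _ Lu.
have pu : pm (S (F u)) u by rewrite -E.
case: h => [[yY _]|imm]; last by case: sing; exact: immersive_pm pu.
apply/flattenP; exists (S (F u) ++ map -%R (S (F u))); first exact: map_f.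
rewrite mem_cat; case/orP: pu => [-> //|h].
by rewrite -{3}[u]opprK map_f ?orbT.
Qed.

(** The points of the curve at the parameters [1 / i.+2] are pairwise distinct, too many for a
    finite list. This separates the cone and the ellipsoid from the other four types. *)
Lemma tame_no_singular_curve k m gamma : tame k m -> closed_curve gamma ->
  (forall u, closed_curve_pts gamma u -> sphere u /\ singular_at F u) -> False.
Proof.
move=> /tame_finite[L HL] [_ _ _ inj] sing.
pose x (i : nat) : R := (i.+2)%:R^-1.
have x01 i : x i \in `[0, 1[.
  by rewrite in_itv /= invr_ge0 ler0n invf_lt1 ?ltr0n // ltr1n.
pose s := [seq gamma (x i) | i <- iota 0 (size L).+1].
have us : uniq s.
  rewrite map_inj_in_uniq ?iota_uniq // => i j _ _ E.
  have /invr_inj/eqP : x i = x j.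
    by apply: inj => //; apply: pm_self; rewrite E inE.
  by rewrite eqr_nat => /eqP [].
have /(uniq_leq_size us) : {subset s <= L}.
  move=> u /mapP[i _ ->]; have [] : sphere (gamma (x i)) /\ singular_at F (gamma (x i)).
    apply: sing; exists (x i); last by apply: pm_self; rewrite inE.
    by have := x01 i; rewrite !in_itv /= => /andP[-> /ltW ->].
  exact: HL.
by rewrite size_map size_iota ltnn.
Qed.

Lemma cone_singular_curve : cone_surface F -> exists2 gamma, closed_curve gamma &
  forall u, closed_curve_pts gamma u -> sphere u /\ singular_at F u.
Proof.
move=> [A [y0 [_ _ [gamma cg E] _ H]]]; exists gamma => // u; rewrite -E => -[su b].
by split=> //; apply/(H u su); left.
Qed.

Lemma ellipsoid_singular_curve : ellipsoid_surface F -> exists2 gamma, closed_curve gamma &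
  forall u, closed_curve_pts gamma u -> sphere u /\ singular_at F u.
Proof. by move=> [A [y0 [gamma [_ _ cg E _]]]]; exists gamma => // u; rewrite -E. Qed.

Definition sim (a x : 'rV[R]_3) := (x == a) || (x == - a).

Lemma sim_non_antipodal a x y : non_antipodal x y -> sim a x -> sim a y -> False.
Proof.
by move=> /andP[/eqP n1 /eqP n2] /orP[]/eqP xE /orP[]/eqP yE; subst;
  move: n1 n2; rewrite ?opprK => n1 n2; (apply: n1; reflexivity) || (apply: n2; reflexivity).
Qed.

Lemma pm_sim s (x : 'rV[R]_3) : pm s x -> exists2 a, a \in s & sim a x.
Proof.
by move=> /orP[xs|xs]; [exists x|exists (- x)] => //; rewrite /sim ?opprK eqxx ?orbT.
Qed.

Lemma tame_no_triple m : tame 2 m -> roman_steiner_surface F -> False.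
Proof.
move=> [Y H] [ga [y0 [_ [u [v [w [E /and3P[uv uw vw] _ _]]]] _ _ _]]].
have mem x : x \in [:: u; v; w] -> sphere x /\ F x = y0.
  by move=> /pm_self xs; have : Defs.preim F y0 x by rewrite E.
have [su Fu] := mem u (mem_head _ _).
have [s [Es s2 _]] := H y0 (ex_intro2 _ _ u su Fu).
have sm x : x \in [:: u; v; w] -> exists2 a, a \in s & sim a x.
  by move=> /mem xs; apply: pm_sim; rewrite -Es.
have [a aS ua] := sm u (mem_head _ _).
have [b bS vb] : exists2 a, a \in s & sim a v by apply: sm; rewrite !inE eqxx !orbT.
have [d dS wd] : exists2 a, a \in s & sim a w by apply: sm; rewrite !inE eqxx !orbT.
have nab : a != b by apply/eqP => ab; subst; exact: (sim_non_antipodal uv ua vb).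
have nad : a != d by apply/eqP => ab; subst; exact: (sim_non_antipodal uw ua wd).
have nbd : b != d by apply/eqP => ab; subst; exact: (sim_non_antipodal vw vb wd).
have U : uniq [:: a; b; d] by rewrite /= !inE negb_or nab nad nbd.
have : {subset [:: a; b; d] <= s}.
  by move=> x; rewrite !inE => /or3P[]/eqP ->.
by move=> /(uniq_leq_size U) /= h; have := leq_trans h s2.
Qed.

(** Over [ta 0] a type 5 surface has two preimages up to sign, one of them singular, whereas
    [tame k 1] grants a singular value only one. *)
Lemma tame_no_sheet k : tame k 1 -> type5_surface F -> False.
Proof.
move=> [Y H] [ta [ka [_ [[u [v [E uv cu _]]] _] _ _ _]]].
have pu : Defs.preim F (ta 0) u by rewrite E; apply: pm_self; rewrite inE eqxx.
have pv : Defs.preim F (ta 0) v by rewrite E; apply: pm_self; rewrite !inE eqxx orbT.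
have [s [Es _ h]] := H (ta 0) (ex_intro2 _ _ u pu.1 pu.2).
rewrite Es in pu pv; case: h => [[_ s1]|imm]; last first.
  by apply: (cross_cap_singular (smooth_net Q) cu); exact: immersive_pm pu.
have [a aS ua] := pm_sim pu; have [b bS vb] := pm_sim pv.
have nab : a != b by apply/eqP => ab; subst; exact: (sim_non_antipodal uv ua vb).
have U : uniq [:: a; b] by rewrite /= !inE nab.
have : {subset [:: a; b] <= s} by move=> x; rewrite !inE => /orP[]/eqP ->.
by move=> /(uniq_leq_size U) /= h; have := leq_trans h s1.
Qed.

Lemma cross_cap_not_type6 : cross_cap_surface F -> type6_surface F -> False.
Proof.
move=> [ga [_ [u E cu] _ _ _]] [ka [_ no _ _ _]].
have [su _] : Defs.preim F (ga 0) u by rewrite E; apply: pm_self; rewrite inE.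
exact: no su cu.
Qed.

(** A ruling of the cone is a segment in the locus. Its ends and its midpoint would be affine images
    of three points of a sphere, which contains no segment. *)
Lemma cone_not_ellipsoid : cone_surface F -> ellipsoid_surface F -> False.
Proof.
move=> [A [y0 [uA LA _ _ _]]] [B [y1 [ga [uB LB _ _ _]]]].
have pt (t : R) : 0 <= t <= 1 -> exists2 s : 'rV[R]_3, sphere s & s *m B + y1 = row3 t 0 t *m A + y0.
  move=> t01; have : locus F (row3 t 0 t *m A + y0).
    rewrite LA; exists (row3 t 0 t) => //=; rewrite !mxE /=; split => //.
    by rewrite [0 ^+ 2]expr0n addr0.
  by rewrite LB => -[s ss E]; exists s.
have [s0 d0 E0] := pt 0 ltac:(by rewrite lexx ler01).
have [s1 d1 E1] := pt 1 ltac:(by rewrite lexx ler01).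
have [s d E] := pt 2^-1 ltac:(by rewrite invr_ge0 ler0n invf_le1 ?ltr0n // ler1n).
have sE : s = 2^-1 *: (s0 + s1).
  apply: (mulK_inj uB); apply: (addIr y1); rewrite E -scalemxAl mulmxDl.
  have -> : s0 *m B = row3 0 0 0 *m A + y0 - y1 by rewrite -E0 addrK.
  have -> : s1 *m B = row3 1 0 1 *m A + y0 - y1 by rewrite -E1 addrK.
  rewrite !row3_mul !scale0r !scale1r !add0r.
  move: (row 0 A) (row 2 A) => a b; apply/rowP => i; rewrite !mxE.
  by move: (a 0 i) (b 0 i) (y0 0 i) (y1 0 i) => *; field.
have e0 : s1 = s0.
  apply/eqP; rewrite -subr_eq0; apply/eqP/dot_eq0.
  move: d d0 d1; rewrite sE /sphere /= !dotE !mxE => h h0 h1; nra.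
have : row3 1 0 1 *m A = 0.
  apply: (addIr y0); rewrite -E1 e0 E0 row3_mul !scale0r !add0r; by rewrite ?addr0.
apply/eqP; apply: mulK_neq0 => //; apply/eqP => /rowP/(_ 0)/eqP.
by rewrite !mxE /= oner_eq0.
Qed.

Theorem surface_type_unique s s' : of_surface_type s F -> of_surface_type s' F -> s = s'.
Proof.
have curve k m : tame k m -> cone_surface F \/ ellipsoid_surface F -> False.
  move=> T [/cone_singular_curve|/ellipsoid_singular_curve] [ga cg E];
  exact: (tame_no_singular_curve T cg E).
have C12 h h' : False := tame_no_triple (cross_cap_tame h) h'.
have C13 h h' : False := tame_no_triple (type5_tame h) h'.
have C14 h h' : False := tame_no_triple (type6_tame h) h'.
have C23 h h' : False := tame_no_sheet (cross_cap_tame h) h'.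
have C43 h h' : False := tame_no_sheet (type6_tame h) h'.
have C24 := cross_cap_not_type6.
have C15 h h' : False := curve _ _ (roman_tame h) (or_introl h').
have C16 h h' : False := curve _ _ (roman_tame h) (or_intror h').
have C25 h h' : False := curve _ _ (cross_cap_tame h) (or_introl h').
have C26 h h' : False := curve _ _ (cross_cap_tame h) (or_intror h').
have C35 h h' : False := curve _ _ (type5_tame h) (or_introl h').
have C36 h h' : False := curve _ _ (type5_tame h) (or_intror h').
have C45 h h' : False := curve _ _ (type6_tame h) (or_introl h').
have C46 h h' : False := curve _ _ (type6_tame h) (or_intror h').
have C56 := cone_not_ellipsoid.
by case: s; case: s' => //= h h'; exfalso; eauto.
Qed.

End Exclusivity.

(** * Generic loci of the orbits *)

Section Generic.
Context {R : realType}.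

Lemma parameters_inhabited o : exists g c : R, parameters o g c.
Proof.
case: o => /=; try by exists 0, 0.
- by exists (-1), (-1); split; [apply/andP; split|]; lra.
- by exists 0, (-1); rewrite expr0n mulr0; lra.
- by exists 1, (-1); split; [apply/andP; split|]; lra.
- by exists 0, 1.
- by exists (-1), (- 9 * (-1) ^+ 2); split=> //; lra.
- by exists 1, (- 9 * 1 ^+ 2).
- by exists 1, 0.
- by exists (-1), 0; split=> //; lra.
Qed.

Lemma net_of_orbit o g c (S T : 'M[R]_3) : parameters o g c -> S \in unitmx -> T \in unitmx ->
  Defs.orbit o (net_of o g c S T).
Proof. by move=> h uS uT; exists g, c, S, T; split=> // u; rewrite net_ofE. Qed.

Lemma orbit_net_of o (Q : @net R) : Defs.orbit o Q -> exists g c (S T : 'M[R]_3),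
  [/\ parameters o g c, S \in unitmx, T \in unitmx & Q = net_of o g c S T].
Proof.
by move=> [g [c [S [T [h uS uT E]]]]]; exists g, c, S, T; split=> //; exact: net_of_eq.
Qed.

Lemma generic_of_near o s (Q0 : @net R) (U : set (@net R)) : Defs.orbit o Q0 -> nbhs Q0 U ->
  (forall Q, U Q -> Defs.orbit o Q -> of_surface_type s (net_map Q)) ->
  generic_curvature_locus R o s.
Proof.
move=> oQ; rewrite nbhsE => -[V [oV VQ] VU] H.
exists V; split=> //; first by exists Q0.
move=> Q f VQ' oQ' _ E; rewrite (_ : second_fundamental_form f = net_map Q); last exact/funext.
by apply: H => //; exact: VU.
Qed.

Lemma generic_of_orbit o s : (forall Q, Defs.orbit o Q -> of_surface_type s (@net_map R Q)) ->
  generic_curvature_locus R o s.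
Proof.
move=> H; have [g [c h]] := parameters_inhabited o.
apply: (generic_of_near (U := setT) (net_of_orbit h (unitmx1 _ _) (unitmx1 _ _))).
  exact: filterT.
by move=> Q _ /H.
Qed.

Lemma pdisc_phess (x y : 'rV[R]_6) : pdisc x y != 0 -> ~ phess0 x y.
Proof. by move=> /eqP h H; apply: h; exact: hess0_disc H. Qed.

Lemma frame_net o (K : R -> R -> 'M[R]_3 -> Prop) :
  (forall g c, exists K0 : 'M[R]_3, K0 \in unitmx /\ K g c K0) ->
  exists (Q0 : @net R) g c K0 T, [/\ Defs.orbit o Q0, K0 \in unitmx, T \in unitmx,
    framed Q0 o g c K0 T & K g c K0].
Proof.
move=> H; have [g [c h]] := parameters_inhabited o; have [K0 [uK HK]] := H g c.
exists (net_of o g c (invmx K0) 1%:M), g, c, K0, 1%:M; split=> //.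
- by apply: net_of_orbit => //; rewrite ?unitmx_inv ?unitmx1.
- exact: unitmx1.
- exact: net_of_framed.
Qed.

Theorem table_generic o s : table s o -> generic_curvature_locus R o s.
Proof.
case: s => tso.
- have [Q0 [g [c [K [T [oQ uK uT QE [p [q D]]]]]]]] := @frame_net o
    (fun g c K => exists p q, 0 < pdisc (px o g c K p) (px o g c K q))
    ltac:(by move=> g c; have [K [p [q [uK D]]]] := example_roman g c tso; exists K; split=> //; exists p, q).
  have [e [f [hf eh fh _ [k k0 E]]]] := framed_surface QE uK uT (pdisc_phess (lt0r_neq0 D)).
  have [_ N _] := near_surface hf eh fh.
  by apply: (generic_of_near oQ (N _)); rewrite ?E ?mulr_gt0.
- have [Q0 [g [c [K [T [oQ uK uT QE [p [q D]]]]]]]] := @frame_net o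
    (fun g c K => exists p q, pdisc (px o g c K p) (px o g c K q) < 0)
    ltac:(by move=> g c; have [K [p [q [uK D]]]] := example_cross_cap g c tso; exists K; split=> //; exists p, q).
  have [e [f [hf eh fh _ [k k0 E]]]] := framed_surface QE uK uT (pdisc_phess (ltr0_neq0 D)).
  have [N _ _] := near_surface hf eh fh.
  by apply: (generic_of_near oQ (N _)); rewrite ?E ?pmulr_rlt0.
- have [Q0 [g [c [K [T [oQ uK uT QE [p [q D]]]]]]]] := @frame_net o
    (fun g c K => exists p q, ~ phess0 (px o g c K p) (px o g c K q))
    ltac:(by move=> g c; have [K [p [q [uK D]]]] := example_type5 g c tso; exists K; split=> //; exists p, q).
  have [e [f [hf eh fh nh _]]] := framed_surface QE uK uT D.
  have [_ _ N] := near_surface hf eh fh.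
  (* Openness provides the nonzero Hessian at nearby nets; on the orbit the discriminant is
     identically zero by [orbit_disc]. *)
  apply: (generic_of_near oQ (N nh)) => Q [e' [f' [hf' eh' fh' nh']]] oQ'.
  have [_ _ D0] := orbit_disc oQ' eh' fh'; have [_ _ T5] := surface_of_kernel hf' eh' fh'.
  by apply: T5 => //; apply: D0; case: (o) tso.
- by case: o tso => // _; apply: generic_of_orbit => Q; exact: type6_orbit.
- by case: o tso => // _; apply: generic_of_orbit => Q; exact: cone_orbit.
- by case: o tso => // _; apply: generic_of_orbit => Q; exact: ellipsoid_orbit.
Qed.

(* [Phi] may depend on the parameters [g] and [c]: [Q] keeps those of [Q1]. *)
Lemma dense_pencil o (Phi : R -> R -> 'rV[R]_6 -> 'rV[R]_6 -> R) (U : set (@net R)) Q1 :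
  (forall g c x y, mx_closed polyfun x -> mx_closed polyfun y -> polyfun (fun t => Phi g c (x t) (y t))) ->
  (forall g c k x y, k != 0 -> Phi g c x y != 0 -> Phi g c (k *: x) (k *: y) != 0) ->
  (forall g c x y, Phi g c x y != 0 -> ~ phess0 x y) ->
  open U -> U Q1 -> Defs.orbit o Q1 ->
  (forall g c, exists (K0 : 'M[R]_3) p q, K0 \in unitmx /\
    Phi g c (px o g c K0 p) (px o g c K0 q) != 0) ->
  exists (Q : @net R) g c (x y e f : 'rV[R]_6), [/\ U Q /\ Defs.orbit o Q,
    Phi g c x y != 0, hat_free Q, e *m hatm Q = 0 /\ f *m hatm Q = 0 &
    ~ phess0 e f /\ exists2 k, 0 < k & pdisc e f = k * pdisc x y].
Proof.
move=> cP sP hP oU UQ /orbit_net_of[g [c [S [T [h uS uT QE]]]]] H.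
have [K0 [p [q [uK0 P0]]]] := H g c.
have nU : nbhs (net_of o g c S T) U by rewrite -QE; exact: open_nbhs_nbhs.
have [Q [K [T' [UQ' uK uT' fQ PQ]]]] := dense_frame uS uT uK0 nU (cP g c) (sP g c) P0.
have [e [f [hf eh fh nh E]]] := framed_surface fQ uK uT' (hP _ _ _ _ PQ).
exists Q, g, c, (px o g c K p), (px o g c K q), e, f; split=> //; split=> //.
exact: (framed_orbit h uK uT' fQ).
Qed.

Lemma dense_disc o (U : set (@net R)) Q1 : open U -> U Q1 -> Defs.orbit o Q1 ->
  table RomanSteiner o || table CrossCapSurface o ->
  exists Q (e f : 'rV[R]_6), [/\ U Q /\ Defs.orbit o Q, hat_free Q,
    e *m hatm Q = 0 /\ f *m hatm Q = 0 & pdisc e f != 0].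
Proof.
move=> oU UQ oQ t.
have [||||Q [g [c [x [y [e [f [UoQ P hf ker [_ [k k0 E]]]]]]]]]] :=
  @dense_pencil o (fun _ _ => pdisc) U Q1 _ _ _ oU UQ oQ _.
- by move=> _ _ x y cx cy; exact: (closed_pdisc polyfun_cst polyfunD polyfunM cx cy).
- by move=> _ _ k x y k0 D; have [-> _] := scale_pair x y k0; rewrite mulf_neq0 ?expf_neq0.
- by move=> _ _; exact: pdisc_phess.
- move=> g c; have [tR|ntR] := boolP (table RomanSteiner o).
    have [K [p [q [uK D]]]] := example_roman g c tR.
    by exists K, p, q; split=> //; exact: lt0r_neq0.
  rewrite (negPf ntR) /= in t; have [K [p [q [uK D]]]] := example_cross_cap g c t.
  by exists K, p, q; split=> //; exact: ltr0_neq0.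
by exists Q, e, f; split=> //; rewrite E mulf_neq0 // lt0r_neq0.
Qed.

Lemma dense_hess o (U : set (@net R)) Q1 : open U -> U Q1 -> Defs.orbit o Q1 -> table Type5 o ->
  exists Q (e f : 'rV[R]_6), [/\ U Q /\ Defs.orbit o Q, hat_free Q,
    e *m hatm Q = 0 /\ f *m hatm Q = 0 & ~ phess0 e f].
Proof.
move=> oU UQ oQ t.
(* Which coefficient of the Hessian is nonzero may depend on the parameters, so its index is chosen
   as a function of them. *)
have /choice[i Hi] : forall gc : R * R, exists i, exists (K : 'M[R]_3) p q, K \in unitmx /\
    hess_part i (px o gc.1 gc.2 K p) (px o gc.1 gc.2 K q) != 0.
  move=> [g c]; have [K [p [q [uK /phess_part[i P]]]]] := example_type5 g c t.
  by exists i, K, p, q.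
have [||||Q [g [c [x [y [e [f [UoQ P hf ker [nh _]]]]]]]]] :=
  @dense_pencil o (fun g c => hess_part (i (g, c))) U Q1 _ _ _ oU UQ oQ _.
- by move=> g c x y cx cy; exact: (closed_hess_part polyfun_cst polyfunD polyfunM cx cy).
- by move=> g c k x y k0 D; rewrite hess_part_scale mulf_neq0 ?expf_neq0.
- by move=> g c x y D /phess0P/(_ (i (g, c))) E; move: D; rewrite E eqxx.
- by move=> g c; exact: (Hi (g, c)).
by exists Q, e, f.
Qed.

(** The open set contains a net of the orbit whose type is settled by a nonzero discriminant or
    Hessian, or by the orbit itself; uniqueness of the type identifies it with [s]. Signs excluded
    by [orbit_disc] cannot occur. For [oBc], [oBcs] and [oC] it excludes none, and [abc_cross_cap]
    realises the negative sign, whence the exception. *)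
Theorem generic_table o s : generic_curvature_locus R o s ->
  table s o \/ (s = CrossCapSurface /\ (o = oBc \/ o = oBcs \/ o = oC)).
Proof.
move=> [U [oU [Q1 [UQ1 oQ1]] H]].
have det Q s' : U Q -> Defs.orbit o Q -> of_surface_type s' (net_map Q) -> s = s'.
  (* The hypothesis is about manifolds with second fundamental form [Q]; [monge Q] is one, so it
     says something for every net of the open set. *)
  move=> UQ oQ h'; have [mf E] := monge_formP Q.
  have := H Q (monge Q) UQ oQ mf (fun u => congr1 (@^~ u) E); rewrite E => h.
  exact: (surface_type_unique h h').
have [t|nt] := boolP (table RomanSteiner o || table CrossCapSurface o).
  have [Q [e [f [[UQ oQ] hf [eh fh] D]]]] := dense_disc oU UQ1 oQ1 t.
  have [D1 D2 _] := orbit_disc oQ eh fh; have [C M _] := surface_of_kernel hf eh fh.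
  have [lt|gt|E] := ltgtP (pdisc e f) 0; last by rewrite E eqxx in D.
  - rewrite (det Q CrossCapSurface UQ oQ (C lt)).
    have ge : match o with oEa | oEas => true | _ => false end -> False.
      by move=> /D2 /le_lt_trans/(_ lt); rewrite ltxx.
    case: (o) t ge => //= _ ge; first [by left | by case: (ge isT) | by right; tauto].
  - rewrite (det Q RomanSteiner UQ oQ (M gt)).
    have le : match o with oDb | oDc | oDbs | oEb | oEbs | oFb => true | _ => false end -> False.
      by move=> /D1 /(lt_le_trans gt); rewrite ltxx.
    by left; case: (o) t le => //= _ le; case: (le isT).
have [t5|nt5] := boolP (table Type5 o).
  have [Q [e [f [[UQ oQ] hf [eh fh] nh]]]] := dense_hess oU UQ1 oQ1 t5.
  have [_ _ D0] := orbit_disc oQ eh fh; have [_ _ T5] := surface_of_kernel hf eh fh.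
  have -> : s = Type5; last by left.
  by apply: (det Q) => //; apply: T5 => //; apply: D0; case: (o) t5.
left; case: o oQ1 nt nt5 det {H} => // oQ1 _ _ det.
- by rewrite (det Q1 Type6 UQ1 oQ1 (type6_orbit oQ1)).
- by rewrite (det Q1 Cone UQ1 oQ1 (cone_orbit oQ1)).
- by rewrite (det Q1 Ellipsoid UQ1 oQ1 (ellipsoid_orbit oQ1)).
Qed.

End Generic.

Theorem theorem5p2 (R : realType) (o : orbit_type) (s : surface_type) :
  (table s o -> generic_curvature_locus R o s) /\
  (generic_curvature_locus R o s ->
     table s o \/ (s = CrossCapSurface /\ (o = oBc \/ o = oBcs \/ o = oC))).
Proof. by split; [exact: table_generic | exact: generic_table]. Qed.
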